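(* Let $\gamma\in(0,1)$, $\alpha_1,\alpha_2>0$ and $t_1,t_2\in\mathbb{R}$ with $\gamma t_1^2+(1-\gamma)t_2^2=1$ be fixed ($N$-independent) constants, and let $\lambda\ge 0$ be a fixed constant. For each $N$, let $M=H+\lambda uu^T$ be a generalized stochastic block model (as defined in the context) with community $S\subset[N]$ of size $|S|=N_1=\gamma N$, variance parameters $\alpha_1,\alpha_2$, and $u_i=\theta_1=t_1/\sqrt N$ for $i\in S$, $u_i=\theta_2=t_2/\sqrt N$ for $i\notin S$. Denote by $\lambda_1\ge\lambda_2$ the two largest eigenvalues of $M$. Then there exists a constant $\lambda_c$, depending only on $t_1,t_2,\alpha_1,\alpha_2,\gamma$, such that: (i) (subcritical case) if $\lambda<\lambda_c$, then $\lambda_1-\lambda_2\to 0$ almost surely as $N\to\infty$; (ii) (supercritical case) if $\lambda>\lambda_c$, then $\lambda_1-\lambda_2\to g$ almost surely as $N\to\infty$, for some $N$-independent constant $g>0$ (depending only on $\lambda,t_1,t_2,\alpha_1,\alpha_2,\gamma$).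
   Context: Generalized stochastic block model (GSBM): an $N\times N$ matrix $M=H+\lambda uu^T$, where $\lambda\ge0$ is a constant, $u\in\mathbb{R}^N$ with $\|u\|=1$, and $H=[H_{ij}]$ is a real symmetric random matrix, such that: (1) there exist $S\subset[N]=\{1,\dots,N\}$ and constants $\theta_1,\theta_2$ with $u_i=\theta_1$ for $i\in S$ and $u_i=\theta_2$ for $i\notin S$, and $|S|/N,\ 1-|S|/N>c>0$ for an $N$-independent constant $c$; (2) the entries $H_{ij}$, $i\le j$, are independent centered random variables with $\mathbb{E}[H_{ij}^2]=\alpha_1N^{-1}$ if $i,j\in S$, $\alpha_2N^{-1}$ if $i,j\notin S$, and $N^{-1}$ otherwise, for $N$-independent constants $\alpha_1,\alpha_2$; and (3) for every $D>0$ there is a constant $C_D$ with $\mathbb{E}[|H_{ij}|^D]\le C_DN^{-D/2}$ for all $i\le j$. *)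

(* Defs.v *)
From HB Require Import structures.
From mathcomp Require Import all_boot all_order all_algebra.
From mathcomp Require Import all_classical all_reals all_analysis.
Set Implicit Arguments. Unset Strict Implicit. Unset Printing Implicit Defensive.
Import Order.TTheory GRing.Theory Num.Theory.
Local Open Scope ring_scope.
Local Open Scope classical_set_scope.

Section Defs.
Variable R : realType.

(* Eigenvalues (with algebraic multiplicity) of a square real matrix, sorted
   in non-increasing order: the roots of the characteristic polynomial when it
   splits over R (always the case for symmetric matrices). *)
Definition eigseq (n : nat) (A : 'M[R]_n) : seq R :=
  sort (fun x y : R => y <= x)
    (if pselect (exists s : seq R, char_poly A = \prod_(x <- s) ('X - x%:P))
     is left h then proj1_sig (cid h) else [::]).

(* k-th largest eigenvalue, k = 0 is the largest (lambda_1). *)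
Definition eigval (n : nat) (A : 'M[R]_n) (k : nat) : R := nth 0 (eigseq A) k.

Definition spike (N : nat) (S : {set 'I_N}) (t1 t2 : R) : 'cV[R]_N :=
  \col_i ((if i \in S then t1 else t2) / Num.sqrt N%:R).

Definition gsbm_matrix (N : nat) (S : {set 'I_N}) (t1 t2 lam : R)
  (Hm : 'M[R]_N) : 'M[R]_N :=
  Hm + lam *: (spike S t1 t2 *m (spike S t1 t2)^T).

Definition top_gap (n : nat) (A : 'M[R]_n) : R := eigval A 0 - eigval A 1.

Definition gsbm_var (N : nat) (S : {set 'I_N}) (a1 a2 : R) (i j : 'I_N) : R :=
  if (i \in S) && (j \in S) then a1
  else if (i \notin S) && (j \notin S) then a2 else 1.

(* mutual independence of a finite family of real random variables X_k, k in D: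
   product rule for every choice of Borel sets (taking B_k = setT recovers the
   product rule for every subfamily). *)
Definition mutually_independent {d} {T : measurableType d} {I : finType}
  (P : probability T R) (D : {set I}) (X : I -> T -> R) : Prop :=
  forall B : I -> set R, (forall k, measurable (B k)) ->
    P (\bigcap_(k in [set k | k \in D]) (X k @^-1` B k)) =
    (\prod_(k in D) P (X k @^-1` B k))%E.

Definition gsbm_noise {d} {T : measurableType d} (P : probability T R)
  (S : forall N, {set 'I_N}) (a1 a2 : R) (H : forall N, T -> 'M[R]_N) : Prop :=
  [/\ (forall N (i j : 'I_N), measurable_fun setT (fun w => H N w i j)),
      (forall N w, (H N w)^T = H N w),
      (forall N, mutually_independent P [set p : 'I_N * 'I_N | (p.1 <= p.2)%N]
                   (fun p w => H N w p.1 p.2)),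
      (forall N (i j : 'I_N), (i <= j)%N ->
         (\int[P]_w (H N w i j)%:E = 0)%E /\
         (\int[P]_w ((H N w i j) ^+ 2)%:E = (gsbm_var (S N) a1 a2 i j / N%:R)%:E)%E)
    & (forall D : R, 0 < D -> exists C : R, forall N (i j : 'I_N), (i <= j)%N ->
         (\int[P]_w (`|H N w i j| `^ D)%:E <= (C * (N%:R `^ (- (D / 2))))%:E)%E)].

End Defs.

(* Main.v *)
Require Import Defs.
From HB Require Import structures.
From mathcomp Require Import all_boot all_order all_algebra.
From mathcomp Require Import all_classical all_reals all_analysis measurable_realfun.
From mathcomp Require Import spectral complex perm ring lra.
Import Order.TTheory GRing.Theory Num.Theory numFieldNormedType.Exports.
Local Open Scope ring_scope.
Local Open Scope classical_set_scope.
Set Implicit Arguments. Unset Strict Implicit. Unset Printing Implicit Defensive.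

(** Everything happens at real spectral parameters [x] above the edge.  Let
    [S_ij = E H_ij^2], let [s] be its two-block limit, and call [M > 0] a
    supersolution at [x] if [1/M_a + (s M)_a <= x].  The edge [L] is the infimum
    of the [x] admitting a supersolution; for [x > L] the least supersolution
    [m(x)] solves [1/m_a + (s m)_a = x].

    For [x > L], [x - H] is positive definite: the rows of [H] are revealed one at
    a time, the diagonal being shifted so that [1/m_i] always is a supersolution
    of the equation for the revealed part.  Klein's inequality and a rank-one
    update show that [E Tr G^64] grows by at most a constant per row, so Markov's
    inequality bounds the norm of every intermediate resolvent by [N^(1/16)];
    with such a bound, leave-one-out identities and concentration of quadratic
    forms keep the next Schur complement positive.  A second pass at a slightly
    larger [x], where the resolvent is bounded, gives [G_jj ~ m_j], and makes the
    increments of [u^T G u] a deterministic main term plus a martingale, so that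
    [u^T G u] tends to [F(x) = sum_b gamma_b t_b^2 m_b(x)].

    If the second eigenvalue of [H] stayed below [x0 < L], the difference
    quotients of [m] above [L] would be at most [(L - x0)^-2]; but a bounded
    difference quotient [zeta] makes [m + eps zeta] a supersolution below [L].
    Hence the second eigenvalue of [H + lam u u^T] tends to [L] by interlacing,
    and the top one exceeds [x > L] exactly when [lam u^T G(x) u >= 1]. *)

(** * Decoupling of independent families *)

(** The obstacle is circular: concentration of the quadratic forms of the rows needs a bound on the
    norm of the resolvent, and that bound needs concentration; no a priori bound on $\|H\|$ is at
    hand. Revealing rows breaks the circle, since each form meets a resolvent that does not involve
    its row. The diagonal shift compensates in the mean for the rows still hidden, multiplied by
    [kap > 1]: the trace lost by raising the diagonal is then [kap] times $\sum_k
    S_{nk}(G^{q+2})_{kk}$, which beats the mean gain from the new row, of the same leading order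
    without [kap], up to a constant. The exponents serve Borel-Cantelli: with $b=N^{1/16}$ one has
    $b^{64}=N^4$, so Markov's inequality costs $N\cdot N^{-4}$ per row and $N^{-2}$ in all, while
    16th moments make a concentration condition fail with probability $O(b^{32}N^{-8})=O(N^{-6})$.
    Stability of the limit equation is never assumed: the first comparison weighs errors by the
    squared rows $\sum_k G_{jk}^2$, which satisfy the linearised equation with a positive source. *)

Section IndepSigma.
Context {d} {T : measurableType d} {R : realType} (P : probability T R).
Variables G1 G2 : set (set T).
Hypothesis G1m : G1 `<=` measurable.
Hypothesis G2m : G2 `<=` measurable.
Hypothesis G1I : setI_closed G1.
Hypothesis G2I : setI_closed G2.
Hypothesis G1T : G1 setT.
Hypothesis G2T : G2 setT.
Hypothesis indep : forall A B, G1 A -> G2 B -> P (A `&` B) = (P A * P B)%E.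

Let gsub (G : set (set T)) : G `<=` measurable -> <<s G >> `<=` measurable.
Proof. by move=> Gm; apply: smallest_sub => //; exact: sigma_algebra_measurable. Qed.

(** For a fixed [A] both sides are finite measures in [B]; they agree on a generating pi-system
    containing the whole space, hence everywhere. *)
Let pi_ext (G : set (set T)) (A : set T) :
  G `<=` measurable -> setI_closed G -> G setT -> measurable A ->
  (forall B, G B -> P (A `&` B) = (P A * P B)%E) ->
  forall B, <<s G >> B -> P (A `&` B) = (P A * P B)%E.
Proof.
move=> Gm GI GT mA AG B sB.
have PA0 : 0 <= fine (P A) by rewrite fine_ge0.
pose m1 := mrestr P mA.
pose m2 := mscale (NngNum PA0) P.
have m1E C : m1 C = P (A `&` C) by rewrite /m1 /mrestr setIC.
have m2E C : m2 C = (P A * P C)%E.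
  by rewrite /m2 /mscale /= fineK// fin_num_measure.
rewrite -m1E -m2E.
apply: (g_sigma_algebra_measure_unique G Gm (fun=> setT)) => //.
- by rewrite bigcup_const//; exists 0%N.
- by move=> C GC; exact: etrans (m1E C) (etrans (AG _ GC) (esym (m2E C))).
- move=> k; rewrite [X in (X < _)%E]m1E setIT.
  by apply: (le_lt_trans (probability_le1 _ _)) => //; exact: ltry.
Qed.

(** The two factors are enlarged from generators to generated sigma-algebras one at a time. *)
Lemma indep_sigma A B : <<s G1 >> A -> <<s G2 >> B -> P (A `&` B) = (P A * P B)%E.
Proof.
move=> sA sB; rewrite setIC muleC; apply: (pi_ext (G := G1)) => //.
  exact: (gsub G2m).
move=> C GC; rewrite setIC muleC; apply: (pi_ext (G := G2)) => //.
  exact: G1m.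
by move=> D GD; exact: indep.
Qed.

End IndepSigma.

Section Decoupling.
Context {d d1 d2} {T : measurableType d} {T1 : measurableType d1}
  {T2 : measurableType d2} {R : realType} (P : probability T R).
Variables (i1 : {mfun T >-> T1}) (i2 : {mfun T >-> T2}).
Hypothesis indep : forall A B, measurable A -> measurable B ->
  P (i1 @^-1` A `&` i2 @^-1` B) = (P (i1 @^-1` A) * P (i2 @^-1` B))%E.

Let diag (w : T) := (i1 w, i2 w).
Let mdiag : measurable_fun setT diag.
Proof. exact: measurable_fun_pair. Qed.
HB.instance Definition _ := isMeasurableFun.Build _ _ _ _ diag mdiag.

(** Independence says that the joint law is the product of the laws, so this is Tonelli's theorem.
    The inner integral over an independent copy replaces the conditional expectation given [i1]. *)
Lemma decoupling (F : T1 * T2 -> \bar R) :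
  measurable_fun setT F -> (forall x, (0 <= F x)%E) ->
  (\int[P]_w F (i1 w, i2 w) = \int[P]_w \int[P]_v F (i1 w, i2 v))%E.
Proof.
move=> mF F0.
have -> : (\int[P]_w F (i1 w, i2 w) = \int[distribution P diag]_z F z)%E.
  by rewrite ge0_integral_pushforward.
rewrite (eq_measure_integral (distribution P i1 \x distribution P i2)%E); last first.
  move=> A mA _; exact/esym/product_measure_unique.
rewrite [LHS](fubini_tonelli1 F)//.
have mG : measurable_fun setT (fubini_F (distribution P i2) F).
  exact: measurable_fun_fubini_tonelli_F.
rewrite [LHS](ge0_integral_pushforward (measurable_funPT i1))//; last first.
  by move=> x _; apply: integral_ge0.
rewrite preimage_setT; apply: eq_integral => w _ /=.
rewrite /fubini_F [LHS](ge0_integral_pushforward (measurable_funPT i2)) ?preimage_setT//.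
exact: measurableT_comp.
Qed.

End Decoupling.

(** * Functions of disjoint subfamilies of independent variables *)

Section Family.
Context {d} {T : measurableType d} {R : realType} (P : probability T R).
Context {I : finType} (D : {set I}) (X : I -> T -> R).
Hypothesis mX : forall k, measurable_fun setT (X k).
Hypothesis indX : mutually_independent P D X.

(** The pi-system of cylinder events that generates the sigma-algebra of the [X k], [k] in [K]. *)
Definition rects (K : {set I}) : set (set T) :=
  [set A | exists B : I -> set R, (forall k, measurable (B k)) /\
     A = \bigcap_(k in [set k | k \in K]) (X k @^-1` B k)].

Lemma rects_measurable K : rects K `<=` measurable.
Proof.
move=> _ [B [mB ->]]; apply: fin_bigcap_measurable => [|k _].
  exact: finite_finset.
by rewrite -[X in measurable X]setTI; exact: mX.
Qed.

Lemma rectsI K : setI_closed (rects K).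
Proof.
move=> _ _ [B [mB ->]] [C [mC ->]]; exists (fun k => B k `&` C k).
split; first by move=> k; exact: measurableI.
by rewrite -bigcapI; apply: eq_bigcapr => k _; rewrite preimage_setI.
Qed.

Lemma rectsT K : rects K setT.
Proof.
exists (fun=> setT); split => //.
by rewrite bigcapT// => k _; rewrite preimage_setT.
Qed.

Lemma rects_prob (K : {set I}) (B : I -> set R) :
  K \subset D -> (forall k, measurable (B k)) ->
  P (\bigcap_(k in [set k | k \in K]) (X k @^-1` B k)) =
  (\prod_(k in K) P (X k @^-1` B k))%E.
Proof.
move=> sK mB.
pose C k := if k \in K then B k else setT.
transitivity (P (\bigcap_(k in [set k | k \in D]) (X k @^-1` C k))).
  congr (P _); apply/seteqP; split => [w h k /= kD|w h k /= kK].
    by rewrite /C; case: ifP => // kK; exact: h.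
  by have := h k; rewrite /C /= kK; apply; apply: (fintype.subsetP sK).
rewrite indX; last by move=> k; rewrite /C; case: ifP.
rewrite (big_setID K)/= [X in (_ * X)%E]big1 ?mule1.
  rewrite (finset.setIidPr sK); apply: eq_bigr => k kK.
  by rewrite /C kK.
move=> k; rewrite inE => /andP[kK _].
by rewrite /C (negbTE kK) preimage_setT probability_setT.
Qed.

Lemma rects_indep (K1 K2 : {set I}) A1 A2 :
  K1 \subset D -> K2 \subset D -> (forall k, k \in K1 -> k \notin K2) ->
  rects K1 A1 -> rects K2 A2 -> P (A1 `&` A2) = (P A1 * P A2)%E.
Proof.
move=> s1 s2 dis [B1 [mB1 ->]] [B2 [mB2 ->]].
rewrite !rects_prob//.
pose B k := if k \in K1 then B1 k else B2 k.
have -> : (\bigcap_(k in [set k | k \in K1]) (X k @^-1` B1 k)) `&`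
   (\bigcap_(k in [set k | k \in K2]) (X k @^-1` B2 k)) =
   \bigcap_(k in [set k | k \in (K1 :|: K2)%SET]) (X k @^-1` B k).
  apply/seteqP; split => [w [h1 h2] k /=|w h].
    rewrite inE /B; case: ifP => [k1 _|k1 /= k2]; first exact: h1.
    exact: h2.
  split => k /= kK.
    by have := h k; rewrite /B /= inE kK; apply.
  have := h k; rewrite /B /= inE kK orbT; case: ifP => [/dis|_]; last exact.
  by rewrite kK.
rewrite rects_prob ?finset.subUset ?s1//; last by move=> k; rewrite /B; case: ifP.
rewrite (big_setID K1)/= finset.setUK; congr (_ * _)%E.
  by apply: eq_bigr => k kK; rewrite /B kK.
apply: eq_big => k; last by rewrite !inE /B => /andP[/negbTE ->].
rewrite !inE; case: (boolP (k \in K1)) => //= k1.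
by rewrite (negbTE (dis _ k1)).
Qed.

Lemma rects_in (K : {set I}) k B : k \in K -> measurable B -> rects K (X k @^-1` B).
Proof.
move=> kK mB; exists (fun l => if l == k then B else setT); split.
  by move=> l; case: ifP.
apply/seteqP; split => [w h l /= lK|w /(_ k)/=].
  by case: ifP => // /eqP ->.
by rewrite eqxx; apply.
Qed.

(** The space [T] with the sigma-algebra of the [X k], [k] in [K]. Measurability of a function on
    [subT K] says that it depends on these variables only, so dependence is checked by ordinary
    measurability proofs. *)
Definition subT (K : {set I}) : measurableType _ := g_sigma_algebraType (rects K).

Lemma measurable_subT (K : {set I}) k : k \in K ->
  measurable_fun setT (X k : subT K -> R).
Proof.
move=> kK _ B mB; rewrite setTI; apply: sub_sigma_algebra.
exact: rects_in.
Qed.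

Definition toS (K : {set I}) : T -> subT K := id.
Let mtoS (K : {set I}) : measurable_fun setT (toS K).
Proof.
move=> _ B; rewrite setTI => mB; rewrite /toS preimage_id.
apply: (smallest_sub _ (@rects_measurable K)) mB.
exact: sigma_algebra_measurable.
Qed.
HB.instance Definition _ K := isMeasurableFun.Build _ _ _ _ (toS K) (@mtoS K).

Lemma measurable_of_subT K d' (U : measurableType d') (f : subT K -> U) :
  measurable_fun setT f -> measurable_fun setT (f : T -> U).
Proof. by move=> mf; exact: (measurableT_comp mf (measurable_funPT (toS K))). Qed.

Lemma measurable_of_subT2 K1 K2 d' (U : measurableType d') (F : subT K1 * subT K2 -> U) :
  measurable_fun setT F -> measurable_fun setT (F : T * T -> U).
Proof.
move=> mF.
pose phi (z : T * T) : subT K1 * subT K2 := (toS K1 z.1, toS K2 z.2).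
have mphi : measurable_fun setT phi.
  apply: measurable_fun_pair.
    exact: (measurableT_comp (measurable_funPT (toS K1)) measurable_fst).
  exact: (measurableT_comp (measurable_funPT (toS K2)) measurable_snd).
have -> : (F : T * T -> U) = F \o phi by apply/funext => -[].
exact: (measurableT_comp mF mphi).
Qed.

Lemma family_fubini K1 K2 (F : subT K1 * subT K2 -> \bar R) :
  measurable_fun setT F -> (forall x, (0 <= F x)%E) ->
  measurable_fun setT ((fun w => \int[P]_u F (w, u))%E : T -> \bar R).
Proof.
move=> mF F0.
exact: (measurable_fun_fubini_tonelli_F (m2 := P) (F : T * T -> \bar R) (measurable_of_subT2 mF) F0).
Qed.

(** Used with [K1] the past and [K2] the newly revealed variables: a function of both is integrated
    with the past frozen. *)
Lemma family_decoupling (K1 K2 : {set I}) (F : subT K1 * subT K2 -> \bar R) :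
  K1 \subset D -> K2 \subset D -> (forall k, k \in K1 -> k \notin K2) ->
  measurable_fun setT F -> (forall x, (0 <= F x)%E) ->
  (\int[P]_w F (w, w) = \int[P]_w \int[P]_v F (w, v))%E.
Proof.
move=> s1 s2 dis mF F0.
apply: (@decoupling _ _ _ _ _ _ _ P (toS K1) (toS K2)) => // A B mA mB.
rewrite /toS !preimage_id.
apply: (@indep_sigma _ _ _ P (rects K1) (rects K2)) => //; try exact: rects_measurable;
 try exact: rectsI; try exact: rectsT.
by move=> A' B'; exact: rects_indep.
Qed.

End Family.

(** * Moments of martingales, linear and quadratic forms *)

Section PowerInequality.
Variable R : realType.
Implicit Types S y p C : R.

Definition pw (r : nat) (x : R) : R := (x ^+ 2) ^+ r.+1.

Lemma pw_ge0 r x : 0 <= pw r x.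
Proof. by rewrite /pw exprn_ge0// ?sqr_ge0. Qed.

Lemma pwM r x y : pw r (x * y) = pw r x * pw r y.
Proof. by rewrite /pw [(x * y) ^+ 2]exprMn exprMn. Qed.

(** If [Y <= X], all but one power of [Y] are traded for [X]; otherwise all powers of [X] are traded
    for [Y]. *)
Let mix (X Y : R) (i j : nat) : 0 <= X -> 0 <= Y ->
  X ^+ i.+1 * Y ^+ j.+1 <= X ^+ (i + j).+1 * Y + Y ^+ (i + j).+2.
Proof.
move=> X0 Y0; have [XY|/ltW XY] := leP Y X.
  apply: (@le_trans _ _ (X ^+ (i + j).+1 * Y)); last first.
    by rewrite lerDl exprn_ge0.
  rewrite -addSn exprD -mulrA ler_wpM2l ?exprn_ge0//.
  by rewrite exprSr ler_wpM2r// lerXn2r.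
apply: (@le_trans _ _ (Y ^+ (i + j).+2)); last first.
  by rewrite lerDr mulr_ge0 ?exprn_ge0.
have -> : (i + j).+2 = (i.+1 + j.+1)%N by rewrite addSn addnS.
rewrite exprD.
by rewrite ler_wpM2r ?exprn_ge0// lerXn2r.
Qed.

(** Induction on [r], multiplying by [(S + y) ^+ 2]. The linear term is kept exact because it
    integrates to zero for a centred [y]; every other cross term is absorbed by [mix] into the two
    extreme ones. *)
Let taylor_pw r : exists2 C, 0 <= C & forall S y, pw r (S + y) <=
  pw r S + (2 * r.+1%:R) * (S ^+ 2) ^+ r * S * y + C * ((S ^+ 2) ^+ r * y ^+ 2 + pw r y).
Proof.
elim: r => [|r [C C0 IH]].
  exists 1 => // S y; rewrite /pw !expr1 !expr0; have := sqr_ge0 y; lra.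
exists ((6 * r.+1%:R + 8) * (1 + C)).
  by rewrite mulr_ge0// addr_ge0// mulr_ge0.
move=> S y; rewrite {1}/pw exprS.
have S2 := sqr_ge0 S; have y2 := sqr_ge0 y.
have := ler_wpM2l (sqr_ge0 (S + y)) (IH S y).
rewrite -/(pw r (S + y)) => /le_trans; apply.
rewrite /pw in IH *.
have h1 := mix r 0 S2 y2; have h2 := mix 0 r S2 y2.
rewrite addn0 expr1 in h1; rewrite add0n expr1 in h2.
have h3 : S ^+ 2 ^+ r * (y ^+ 2) ^+ 2 <= (S ^+ 2) ^+ r.+1 * y ^+ 2 + (y ^+ 2) ^+ r.+2.
  case: (r) => [|k]; last by have := mix k 1 S2 y2; rewrite addn1.
  by rewrite expr0 mul1r lerDr mulr_ge0.
set E := (S ^+ 2) ^+ r in h1 h2 h3 *.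
have E0 : 0 <= E by rewrite exprn_ge0.
set W := (y ^+ 2) ^+ r.+1 in h1 h2 h3 *.
have W0 : 0 <= W by rewrite exprn_ge0.
have eS : (S ^+ 2) ^+ r.+1 = S ^+ 2 * E by rewrite exprS.
have eS2 : (S ^+ 2) ^+ r.+2 = S ^+ 2 * (S ^+ 2 * E) by rewrite exprS eS.
have eW : (y ^+ 2) ^+ r.+2 = y ^+ 2 * W by rewrite exprS.
rewrite !eS ?eS2 ?eW in h1 h2 h3 *.
have n1 : (1 : R) <= r.+1%:R by rewrite ler1n.
have -> : (r.+2%:R = r.+1%:R + 1 :> R) by rewrite -natr1.
set n := r.+1%:R in n1 *.
set A := S ^+ 2 * E * y ^+ 2 in h1 h2 h3 *.
set B := y ^+ 2 * W in h1 h2 h3 *.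
have A0 : 0 <= A by exact: mulr_ge0 (mulr_ge0 S2 E0) y2.
have B0 : 0 <= B by exact: mulr_ge0.
have c1 : (S + y) ^+ 2 <= 2 * S ^+ 2 + 2 * y ^+ 2 by have := sqr_ge0 (S - y); nra.
have c2 : (S + y) ^+ 2 * (E * y ^+ 2 + W) <= 8 * (A + B).
  apply: (@le_trans _ _ ((2 * S ^+ 2 + 2 * y ^+ 2) * (E * y ^+ 2 + W))).
    by apply: ler_wpM2r => //; exact: addr_ge0 (mulr_ge0 E0 y2) W0.
  rewrite (_ : _ * _ = 2 * A + 2 * (S ^+ 2 * W) + 2 * (E * (y ^+ 2) ^+ 2) + 2 * B); last first.
    by rewrite /A /B; ring.
  lra.
have c3 : E * (S * y ^+ 3) <= A + B.
  apply: (@le_trans _ _ (E * ((S ^+ 2 * y ^+ 2 + (y ^+ 2) ^+ 2) / 2))).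
    rewrite ler_wpM2l//; have := sqr_ge0 (S * y - y ^+ 2); nra.
  rewrite (_ : E * _ = (A + E * (y ^+ 2) ^+ 2) / 2); last by rewrite /A; ring.
  lra.
have -> : (S + y) ^+ 2 * (S ^+ 2 * E + 2 * n * E * S * y + C * (E * y ^+ 2 + W)) =
  S ^+ 2 * (S ^+ 2 * E) + 2 * (n + 1) * (S ^+ 2 * E) * S * y +
  ((4 * n + 1) * A + 2 * n * (E * (S * y ^+ 3))) + C * ((S + y) ^+ 2 * (E * y ^+ 2 + W)).
  by rewrite /A; ring.
rewrite -[leLHS]addrA lerD2l.
apply: (@le_trans _ _ (((4 * n + 1) * A + 2 * n * (A + B)) + C * (8 * (A + B)))).
  apply: lerD; last exact: ler_wpM2l.
  by apply: lerD => //; apply: ler_wpM2l => //; lra.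
have n0 : 0 <= n by lra.
have : 0 <= n * C * (A + B) by exact: mulr_ge0 (mulr_ge0 n0 C0) (addr_ge0 A0 B0).
have : 0 <= n * B by exact: mulr_ge0.
have : A <= n * A by rewrite ler_peMl.
move=> a1 a2 a3; nra.
Qed.

(** The middle term is split according to whether [y ^+ 2 <= p * S ^+ 2]. Here [p] is the fraction
    of the total variance carried by the increment: the factors [1 + C * p] then have a bounded
    product along the martingale. *)
Lemma pw_taylor r : exists2 C, 0 <= C & forall S y p, 0 < p -> p <= 1 ->
  pw r (S + y) <= (1 + C * p) * pw r S + (2 * r.+1%:R) * (S ^+ 2) ^+ r * S * y +
     C * (p ^- r) * pw r y.
Proof.
have [C C0 HC] := taylor_pw r; exists (C + C) => [|S y p p0 p1]; first exact: addr_ge0.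
apply: (le_trans (HC S y)).
have ip : 1 <= p ^- r by rewrite invf_ge1 ?exprn_gt0// exprn_ile1// ltW.
have : (S ^+ 2) ^+ r * y ^+ 2 <= p * pw r S + p ^- r * pw r y.
  have [h|/ltW h] := leP (y ^+ 2) (p * S ^+ 2).
    apply: (@le_trans _ _ (p * pw r S)).
      have -> : p * pw r S = (S ^+ 2) ^+ r * (p * S ^+ 2).
        by rewrite /pw [_ ^+ r.+1]exprSr mulrCA.
      by apply: ler_wpM2l => //; rewrite exprn_ge0// sqr_ge0.
    by rewrite lerDl mulr_ge0 ?pw_ge0// invr_ge0 exprn_ge0// ltW.
  apply: (@le_trans _ _ (p ^- r * pw r y)).
    have -> : p ^- r * pw r y = (p ^- r * (y ^+ 2) ^+ r) * y ^+ 2.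
      by rewrite /pw [_ ^+ r.+1]exprSr mulrA.
    apply: ler_wpM2r; first exact: sqr_ge0.
    rewrite ler_pdivlMl ?exprn_gt0// -exprMn.
    by apply: lerXn2r => //; rewrite nnegrE; [exact: mulr_ge0 (ltW p0) (sqr_ge0 S)|exact: sqr_ge0].
  by rewrite lerDr mulr_ge0 ?pw_ge0// ltW.
have := pw_ge0 r y; have := pw_ge0 r S.
set X := (S ^+ 2) ^+ r * y ^+ 2; set A := pw r S; set B := pw r y; set Q := p ^- r.
set L := 2 * _ * _ * _ * _ => A0 B0 hX.
have hB : B <= Q * B by rewrite ler_peMl.
have : C * (X + B) <= C * (p * A + Q * B + Q * B) by rewrite ler_wpM2l// lerD.
have : 0 <= C * p * A by rewrite !mulr_ge0// ltW.
nra.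
Qed.

End PowerInequality.

Section StepIntegral.
Context {d} {T : measurableType d} {R : realType} (P : probability T R).
Local Open Scope ereal_scope.

Lemma pw_dominates (r : nat) (y : R) : (`|y| <= 1 + pw r y)%R.
Proof.
have h0 := pw_ge0 r y.
have [y1|/ltW y1] := leP `|y|%R 1%R; first by lra.
have y2 : (1 <= y ^+ 2)%R by rewrite -(real_normK (num_real y)) exprn_ege1.
have : (`|y| <= y ^+ 2)%R by rewrite -real_normK ?num_real// expr2 ler_peMl.
have : (y ^+ 2 <= pw r y)%R by rewrite /pw [leRHS]exprS ler_peMr ?sqr_ge0// exprn_ege1.
lra.
Qed.

Lemma measurable_pw r (Y : T -> R) : measurable_fun setT Y ->
  measurable_fun setT (fun w => pw r (Y w)).
Proof. by move=> mY; rewrite /pw; do 2 apply: measurable_funX. Qed.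

Lemma probability_integral_cst (a : R) : \int[P]_w a%:E = a%:E.
Proof. by rewrite integral_cst// [X in _ * X]probability_setT mule1. Qed.

Lemma integrable_of_pw r (Y : T -> R) : measurable_fun setT Y ->
  \int[P]_w (pw r (Y w))%:E < +oo -> P.-integrable setT (EFin \o Y).
Proof.
move=> mY iY; apply: (@le_integrable _ _ _ P setT _ _ (fun w => (1 + pw r (Y w))%:E)) => //.
- exact/measurable_EFinP.
- by move=> w _; rewrite /= lee_fin [leRHS]ger0_norm ?addr_ge0 ?pw_ge0// pw_dominates.
- rewrite (_ : (fun _ => _) = (fun w => 1%:E + (pw r (Y w))%:E)); last first.
    by apply/funext => w; rewrite EFinD.
  apply: integrableD => //=.
    apply/integrableP; split => //; under eq_integral do rewrite /= normr1.
    by rewrite probability_integral_cst ltry.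
  apply/integrableP; split; first exact/measurable_EFinP/measurable_pw.
  by under eq_integral do rewrite /= ger0_norm ?pw_ge0//.
Qed.

Lemma integral_pw_step (r : nat) (C : R) (Y : T -> R) (S p : R) :
  (0 <= C)%R -> (0 < p)%R ->
  (forall y, pw r (S + y) <= (1 + C * p) * pw r S + (2 * r.+1%:R) * (S ^+ 2) ^+ r * S * y +
     C * (p ^- r) * pw r y)%R ->
  measurable_fun setT Y ->
  \int[P]_w (pw r (Y w))%:E < +oo -> \int[P]_w (Y w)%:E = 0 ->
  \int[P]_w (pw r (S + Y w))%:E <=
    ((1 + C * p) * pw r S)%:E + (C * p ^- r)%:E * \int[P]_w (pw r (Y w))%:E.
Proof.
move=> C0 p0 H mY iY EY.
set a := ((1 + C * p) * pw r S)%R; set b := (2 * r.+1%:R * (S ^+ 2) ^+ r * S)%R.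
set c := (C * p ^- r)%R.
have mZ : measurable_fun setT (fun w => pw r (Y w)) by exact: measurable_pw.
have IY := integrable_of_pw mY iY.
have IZ : P.-integrable setT (fun w => (pw r (Y w))%:E).
  apply/integrableP; split; first exact/measurable_EFinP.
  by under eq_integral do rewrite /= ger0_norm ?pw_ge0//.
have Ia : P.-integrable setT (fun w : T => a%:E).
  apply/integrableP; split => //; under eq_integral do rewrite /=.
  by rewrite probability_integral_cst ltry.
apply: (@le_trans _ _ (\int[P]_w (a%:E + (b%:E * (Y w)%:E + c%:E * (pw r (Y w))%:E)))).
  apply: ge0_le_integral => //.
  - by move=> w _; rewrite lee_fin pw_ge0.
  - apply/measurable_EFinP; apply: measurable_pw; exact: measurable_funD.
  - apply: emeasurable_funD => //; apply: emeasurable_funD.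
      by apply: emeasurable_funM => //; exact/measurable_EFinP.
    by apply: emeasurable_funM => //; exact/measurable_EFinP.
  - by move=> w _; rewrite -!EFinM -!EFinD lee_fin addrA; exact: H.
rewrite integralD//; last first.
  by apply: integrableD => //; exact: integrableZl.
rewrite probability_integral_cst leeD2l//.
rewrite integralD//; try exact: integrableZl.
rewrite [X in X + _]integralZl// EY mule0 add0e.
by rewrite integralZl.
Qed.

End StepIntegral.

Section Martingale.
Context {d} {T : measurableType d} {R : realType} (P : probability T R).
Local Open Scope ereal_scope.

(* A sum whose increments Y_l are centred once the past is frozen. *)
Lemma martingale_moment (r : nat) : exists2 C : R, (0 <= C)%R &
  forall (N : nat) (y : nat -> T -> T -> R) (p : nat -> R) (B W : R),
  (0 <= B)%R -> (forall k, (k < N)%N -> 0 < p k <= 1)%R -> (\sum_(k < N) p k <= W)%R ->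
  (forall k, (k < N)%N -> measurable_fun setT (fun z : T * T => y k z.1 z.2)) ->
  (forall k, (k < N)%N -> measurable_fun setT (fun w => y k w w)) ->
  (forall k w, (k < N)%N -> \int[P]_v (pw r (y k w v))%:E < +oo) ->
  (forall k w, (k < N)%N -> \int[P]_v (y k w v)%:E = 0) ->
  (forall k, (k < N)%N -> \int[P]_w \int[P]_v (pw r (y k w v))%:E <= (p k ^+ r.+1 * B)%:E) ->
  (forall k, (k < N)%N ->
     \int[P]_w (pw r (\sum_(l < k.+1) y l w w))%:E =
     \int[P]_w \int[P]_v (pw r (\sum_(l < k) y l w w + y k w v))%:E) ->
  \int[P]_w (pw r (\sum_(l < N) y l w w))%:E <= (expR (C * W) * B)%:E.
Proof.
have [C C0 HC] := pw_taylor R r; exists C => // N y p B W B0 p01 sp my mdy fy cy by_ dec.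
pose Q k := (\prod_(l < k) (1 + C * p l))%R.
have Q0 k : (k <= N)%N -> (1 <= Q k)%R.
  move=> kN; rewrite /Q; elim: k kN => [|k IH] kN; first by rewrite big_ord0.
  have /andP[pk _] := p01 _ kN.
  rewrite big_ord_recr/= mulr_ege1//; first by rewrite IH// ltnW.
  by rewrite lerDl mulr_ge0// ltW.
(* The recursion $a_{k+1}\le(1+Cp_k)a_k+Cp_kB$ with $a_0=0$ is solved exactly by $(Q_k-1)B$. *)
have main k : (k <= N)%N ->
    \int[P]_w (pw r (\sum_(l < k) y l w w))%:E <= ((Q k - 1) * B)%:E.
  elim: k => [|k IH] kN.
    under eq_integral do rewrite big_ord0 /pw expr0n expr0n/=.
    by rewrite integral0 /Q big_ord0 subrr mul0r.
  have /andP[pk p1] := p01 _ kN.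
  have mS : measurable_fun setT (fun w => \sum_(l < k) y l w w)%R.
    by apply: measurable_sum => l; apply: mdy; apply: ltn_trans kN.
  have mF : measurable_fun setT (fun z : T * T => (pw r (y k z.1 z.2))%:E).
    by apply/measurable_EFinP/measurable_pw; exact: my.
  have mG : measurable_fun setT (fun w => \int[P]_v (pw r (y k w v))%:E).
    by apply: (measurable_fun_fubini_tonelli_F (m2 := P) (fun z => (pw r (y k z.1 z.2))%:E)) => // x; rewrite lee_fin pw_ge0.
  have mF2 : measurable_fun setT (fun z : T * T => (pw r (\sum_(l < k) y l z.1 z.1 + y k z.1 z.2))%:E).
    apply/measurable_EFinP/measurable_pw; apply: measurable_funD; last exact: my.
    exact: (measurableT_comp mS).
  have mG2 : measurable_fun setT (fun w => \int[P]_v (pw r (\sum_(l < k) y l w w + y k w v))%:E).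
    by apply: (measurable_fun_fubini_tonelli_F (m2 := P) (fun z => (pw r (\sum_(l < k) y l z.1 z.1 + y k z.1 z.2))%:E)) => // x; rewrite lee_fin pw_ge0.
  rewrite dec//.
  apply: (@le_trans _ _ (\int[P]_w (((1 + C * p k) )%:E * (pw r (\sum_(l < k) y l w w))%:E +
      (C * p k ^- r)%:E * \int[P]_v (pw r (y k w v))%:E))).
    apply: ge0_le_integral => //.
    - by move=> w _; apply: integral_ge0 => v _; rewrite lee_fin pw_ge0.
    - apply: emeasurable_funD; apply: emeasurable_funM => //.
      by apply/measurable_EFinP/measurable_pw.
    - move=> w _; rewrite -EFinM; apply: integral_pw_step => //.
      + by move=> z; exact: HC.
      + exact: (measurableT_comp (my _ kN) (pair1_measurable w)).
      + exact: fy.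
      + exact: cy.
  rewrite ge0_integralD//; first last.
  - by apply: emeasurable_funM.
  - move=> w _; rewrite mule_ge0//.
      by rewrite lee_fin mulr_ge0// invr_ge0 exprn_ge0// ltW.
    by apply: integral_ge0 => v _; rewrite lee_fin pw_ge0.
  - by apply: emeasurable_funM => //; apply/measurable_EFinP/measurable_pw.
  - by move=> w _; rewrite mule_ge0// lee_fin ?pw_ge0// addr_ge0// mulr_ge0// ltW.
  rewrite ge0_integralZl//; first last.
  - by rewrite lee_fin addr_ge0// mulr_ge0// ltW.
  - by move=> w _; rewrite lee_fin pw_ge0.
  - by apply/measurable_EFinP/measurable_pw.
  rewrite ge0_integralZl//; first last.
  - by rewrite lee_fin mulr_ge0// invr_ge0 exprn_ge0// ltW.
  - by move=> w _; apply: integral_ge0 => v _; rewrite lee_fin pw_ge0.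
  apply: (@le_trans _ _ ((1 + C * p k)%:E * ((Q k - 1) * B)%:E + (C * p k ^- r)%:E * (p k ^+ r.+1 * B)%:E)).
    apply: leeD; apply: lee_wpmul2l.
    - by rewrite lee_fin addr_ge0// mulr_ge0// ltW.
    - exact/IH/ltnW.
    - by rewrite lee_fin mulr_ge0// invr_ge0 exprn_ge0// ltW.
    - exact: by_.
  rewrite -!EFinM -EFinD lee_fin /Q big_ord_recr/= -/(Q k).
  have -> : (C * p k ^- r * (p k ^+ r.+1 * B) = C * p k * B)%R.
    by rewrite exprSr -!mulrA mulKf// expf_neq0// gt_eqF.
  by lra.
apply: (le_trans (main _ (leqnn N))); rewrite lee_fin ler_wpM2r//.
apply: (@le_trans _ _ (Q N)); first by rewrite gerBl.
apply: (@le_trans _ _ (\prod_(l < N) expR (C * p l))%R).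
  apply: ler_prod => l _; have /andP[pl _] := p01 _ (ltn_ord l).
  by rewrite addr_ge0 ?mulr_ge0 ?(ltW pl)//= expR_ge1Dx.
rewrite -expR_sum ler_expR -mulr_sumr ler_wpM2l//.
Qed.

End Martingale.

Section PwIntegral.
Context {d} {T : measurableType d} {R : realType} (P : probability T R).
Variable r : nat.
Local Open Scope ereal_scope.

Lemma pwD (x y : R) : (pw r (x + y) <= 4 ^+ r.+1 * (pw r x + pw r y))%R.
Proof.
have x2 := sqr_ge0 x; have y2 := sqr_ge0 y.
have h : ((x + y) ^+ 2 <= 4 * Num.max (x ^+ 2) (y ^+ 2))%R.
  have a1 : (x ^+ 2 <= Num.max (x ^+ 2) (y ^+ 2))%R by rewrite le_max lexx.
  have a2 : (y ^+ 2 <= Num.max (x ^+ 2) (y ^+ 2))%R by rewrite le_max lexx orbT.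
  have := sqr_ge0 (x - y); nra.
apply: (@le_trans _ _ ((4 * Num.max (x ^+ 2) (y ^+ 2)) ^+ r.+1)%R).
  by apply: lerXn2r => //; rewrite nnegrE ?sqr_ge0// mulr_ge0// le_max x2.
rewrite exprMn ler_wpM2l ?exprn_ge0//.
by case: (leP (x ^+ 2)%R (y ^+ 2)%R) => _; rewrite ?lerDl ?lerDr pw_ge0.
Qed.

Lemma integral_pwD (X Y : T -> R) : measurable_fun setT X -> measurable_fun setT Y ->
  \int[P]_w (pw r (X w + Y w))%:E <=
  (4 ^+ r.+1)%:E * (\int[P]_w (pw r (X w))%:E + \int[P]_w (pw r (Y w))%:E).
Proof.
move=> mX mY.
have mpX : measurable_fun setT (fun w => (pw r (X w))%:E).
  by apply/measurable_EFinP/measurable_pw.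
have mpY : measurable_fun setT (fun w => (pw r (Y w))%:E).
  by apply/measurable_EFinP/measurable_pw.
rewrite -ge0_integralD//; try by move=> w _; rewrite lee_fin pw_ge0.
rewrite -ge0_integralZl//; first last.
- by move=> w _; rewrite -EFinD lee_fin addr_ge0 ?pw_ge0.
- exact: emeasurable_funD.
apply: ge0_le_integral => //.
- by move=> w _; rewrite lee_fin pw_ge0.
- by apply/measurable_EFinP/measurable_pw; exact: measurable_funD.
- by apply: emeasurable_funM => //; exact: emeasurable_funD.
- by move=> w _; rewrite -EFinD -EFinM lee_fin pwD.
Qed.

Lemma integral_pwM (a : R) (X : T -> R) : measurable_fun setT X ->
  \int[P]_w (pw r (a * X w))%:E = (pw r a)%:E * \int[P]_w (pw r (X w))%:E.
Proof.
move=> mX; rewrite -ge0_integralZl//.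
- by apply: eq_integral => w _; rewrite pwM EFinM.
- by apply/measurable_EFinP/measurable_pw.
- by move=> w _; rewrite lee_fin pw_ge0.
- by rewrite lee_fin pw_ge0.
Qed.

End PwIntegral.

Lemma sum_sym_split {R : comRingType} (N : nat) (f : nat -> nat -> R) :
  (forall i j, f i j = f j i) ->
  \sum_(i < N) \sum_(j < N) f i j = \sum_(i < N) (f i i + 2 * \sum_(j < i) f i j).
Proof.
move=> sf; elim: N => [|N IH]; first by rewrite !big_ord0.
rewrite big_ord_recr/= [in RHS]big_ord_recr/= -IH.
under eq_bigr do rewrite big_ord_recr/=.
rewrite big_split/= big_ord_recr/= -!addrA; congr (_ + _).
rewrite [RHS]addrC mulr2n mulrDl mul1r -addrA; congr (_ + _).
by apply: eq_bigr => i _; rewrite sf.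
Qed.

Section Forms.
Context {d} {T : measurableType d} {R : realType} (P : probability T R).
Local Open Scope ereal_scope.

Section Row.
Variables (N : nat) (h : nat -> T -> R) (s : nat -> R) (r : nat) (M v : R).
Hypothesis mh : forall k, measurable_fun setT (h k).
Hypothesis ind : mutually_independent P [set: 'I_N]%SET (fun i : 'I_N => h i).
Hypothesis h0 : forall k, (k < N)%N -> \int[P]_w (h k w)%:E = 0.
Hypothesis h2 : forall k, (k < N)%N -> \int[P]_w ((h k w) ^+ 2)%:E = (s k)%:E.
Hypothesis M1 : (1 <= M)%R.
Hypothesis v0 : (0 < v)%R.
Hypothesis hr : forall k, (k < N)%N -> \int[P]_w (pw r (h k w))%:E <= (M * v ^+ r.+1)%:E.

Let past k := [set i : 'I_N | (i < k)%N]%SET.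
Let now k := [set i : 'I_N | i == k :> nat]%SET.

Lemma row_decoupling k (F : subT (fun i : 'I_N => h i) (past k) * subT (fun i : 'I_N => h i) (now k) -> \bar R) :
  measurable_fun setT F -> (forall x, 0 <= F x) ->
  \int[P]_w F (w, w) = \int[P]_w \int[P]_u F (w, u).
Proof.
move=> mF F0; apply: (family_decoupling (fun i : 'I_N => mh i) ind) => //.
by move=> i; rewrite !inE => ik; rewrite ltn_eqF.
Qed.

Lemma measurable_past k l : (l < k)%N -> (l < N)%N ->
  measurable_fun setT (h l : subT (fun i : 'I_N => h i) (past k) -> R).
Proof.
move=> lk lN; apply: (measurable_subT (X := fun i : 'I_N => h i) (k := Ordinal lN)).
by rewrite inE.
Qed.

Lemma measurable_now k : (k < N)%N ->
  measurable_fun setT (h k : subT (fun i : 'I_N => h i) (now k) -> R).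
Proof.
move=> lN; apply: (measurable_subT (X := fun i : 'I_N => h i) (k := Ordinal lN)).
by rewrite inE.
Qed.

End Row.
End Forms.

Section RowForms.
Context {d} {T : measurableType d} {R : realType} (P : probability T R).
Local Open Scope ereal_scope.

Definition centred_row (N : nat) (h : nat -> T -> R) (s : nat -> R) (r : nat) (M v : R) :=
  [/\ forall k, measurable_fun setT (h k),
      mutually_independent P [set: 'I_N]%SET (fun i : 'I_N => h i),
      forall k, (k < N)%N -> \int[P]_w (h k w)%:E = 0,
      forall k, (k < N)%N -> \int[P]_w ((h k w) ^+ 2)%:E = (s k)%:E &
      forall k, (k < N)%N -> [/\ \int[P]_w (pw r (h k w))%:E <= (M * v ^+ r.+1)%:E,
        \int[P]_w (pw r (h k w ^+ 2))%:E <= (M * (v ^+ 2) ^+ r.+1)%:E &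
        (pw r (s k) <= M * (v ^+ 2) ^+ r.+1)%R]].

(** The part of [a] in the total [F], averaged with [1 / N]: the martingale bound asks for positive
    weights, and [a] may vanish. *)
Definition share (N : nat) (a F : R) : R := ((a / F + N%:R^-1) / 2)%R.

Lemma share_bounds N a F : (0 < N)%N -> (0 < F)%R -> (0 <= a <= F)%R ->
  [/\ (0 < share N a F <= 1)%R & (a <= share N a F * (2 * F))%R].
Proof.
move=> N0 F0 /andP[a0 aF]; rewrite /share.
have i0 : (0 < N%:R^-1 :> R)%R by rewrite invr_gt0 ltr0n.
have i1 : (N%:R^-1 <= 1 :> R)%R by rewrite invf_le1 ?ltr0n// ler1n.
have a1 : (0 <= a / F <= 1)%R by rewrite divr_ge0 ?(ltW F0)//= ler_pdivrMr// mul1r.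
split; first by apply/andP; split; lra.
have -> : ((a / F + N%:R^-1) / 2 * (2 * F) = a + N%:R^-1 * F)%R.
  by field; rewrite (gt_eqF F0) pnatr_eq0 -lt0n N0.
by rewrite lerDl mulr_ge0// ltW.
Qed.

Lemma share_sum N (a : nat -> R) F : (0 < N)%N -> (0 < F)%R -> (\sum_(k < N) a k <= F)%R ->
  (\sum_(k < N) share N (a k) F <= 1)%R.
Proof.
move=> N0 F0 aF; rewrite /share -mulr_suml big_split/= -mulr_suml.
rewrite sumr_const card_ord -[X in (_ + X)%R]mulr_natl divff ?pnatr_eq0 -?lt0n//.
have : (\sum_(k < N) a k / F <= 1)%R by rewrite -mulr_suml ler_pdivrMr// mul1r.
rewrite -mulr_suml; lra.
Qed.

(** A martingale whose increment [a k * h k] gets the [share] of [a k ^+ 2]. The case of vanishing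
    coefficients is treated apart because the weights divide by their sum of squares. *)
Lemma linear_form_moment (r : nat) : exists2 C : R, (1 <= C)%R &
  forall N h s M v (a : nat -> R), centred_row N h s r M v -> (0 <= M)%R -> (0 <= v)%R ->
  \int[P]_w (pw r (\sum_(k < N) a k * h k w)%R)%:E <=
    (C * M * (v * \sum_(k < N) (a k) ^+ 2) ^+ r.+1)%:E.
Proof.
have [C C0 HC] := martingale_moment P r.
exists (1 + expR C * 2 ^+ r.+1)%R.
  by rewrite lerDl mulr_ge0 ?expR_ge0// exprn_ge0.
move=> N h s M v a [mh ind h0 h2 hr] M0 v0.
set F := (\sum_(k < N) (a k) ^+ 2)%R.
have F0 : (0 <= F)%R by apply: sumr_ge0 => k _; exact: sqr_ge0.
have rhs0 : (0 <= M * (v * F) ^+ r.+1)%R by rewrite mulr_ge0// exprn_ge0// mulr_ge0.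
have [Fz|Fn] := eqVneq F 0%R.
  have az (k : 'I_N) : a k = 0%R.
    apply/eqP; rewrite -sqrf_eq0; apply/eqP.
    by apply: (psumr_eq0P _ Fz) => // i _; exact: sqr_ge0.
  under eq_integral.
    move=> w _; rewrite big1; last by move=> k _; rewrite az mul0r.
    rewrite /pw expr0n expr0n/=; over.
  by rewrite integral0 lee_fin -mulrA mulr_ge0// addr_ge0// mulr_ge0 ?expR_ge0// exprn_ge0.
have {Fn}Fp : (0 < F)%R by rewrite lt_def Fn.
have N0 : (0 < N)%N by case: (posnP N) => // N00; move: Fp; rewrite /F N00 big_ord0 ltxx.
have ak k : (k < N)%N -> (0 <= a k ^+ 2 <= F)%R.
  move=> kN; rewrite sqr_ge0/= /F (bigD1 (Ordinal kN))//= lerDl.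
  by apply: sumr_ge0 => i _; exact: sqr_ge0.
apply: (le_trans (HC N (fun k _ u => a k * h k u)%R (fun k => share N (a k ^+ 2) F)
  ((2 * F) ^+ r.+1 * (M * v ^+ r.+1))%R 1%R _ _ _ _ _ _ _ _ _)).
- by rewrite mulr_ge0 ?exprn_ge0// mulr_ge0 ?exprn_ge0// ltW.
- by move=> k kN; have [] := share_bounds N0 Fp (ak _ kN).
- exact: (share_sum (a := fun k => a k ^+ 2)%R).
- by move=> k kN; apply: measurable_funM => //; exact: (measurableT_comp (mh k)).
- by move=> k kN; apply: measurable_funM.
- move=> k w kN; rewrite integral_pwM//; apply: lte_mul_pinfty => //.
    by rewrite lee_fin pw_ge0.
  by have [+ _ _] := hr _ kN => /le_lt_trans; apply; rewrite ltry.
- move=> k w kN; under eq_integral do rewrite EFinM.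
  rewrite integralZl ?h0 ?mule0//.
  apply: (integrable_of_pw (r := r)) => //.
  by have [+ _ _] := hr _ kN => /le_lt_trans; apply; rewrite ltry.
- move=> k kN; under eq_integral do rewrite integral_pwM//.
  rewrite integral_cst// [X in _ * X]probability_setT mule1.
  apply: (@le_trans _ _ ((pw r (a k))%:E * (M * v ^+ r.+1)%:E)).
    by apply: lee_wpmul2l; [rewrite lee_fin pw_ge0|have [] := hr _ kN].
  rewrite -EFinM lee_fin mulrA ler_wpM2r ?mulr_ge0 ?exprn_ge0// -exprMn.
  have [/andP[w0 _] wb] := share_bounds N0 Fp (ak _ kN).
  apply: lerXn2r => //; rewrite nnegrE; first exact: sqr_ge0.
  by rewrite mulr_ge0 ?(ltW w0)// mulr_ge0// ltW.
- move=> k kN; rewrite [LHS](_ : _ = \int[P]_w (pw r (\sum_(l < k) a l * h l w + a k * h k w)%R)%:E); last first.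
    by apply: eq_integral => w _; rewrite big_ord_recr.
  apply: (@row_decoupling _ _ _ P N h mh ind k (fun z => (pw r (\sum_(l < k) a l * h l z.1 + a k * h k z.2)%R)%:E)).
    apply/measurable_EFinP/measurable_pw; apply: measurable_funD.
      apply: measurable_sum => l; apply: measurable_funM => //.
      have lN := ltn_trans (ltn_ord l) kN.
      exact: (measurableT_comp (measurable_past (h := h) (ltn_ord l) lN) measurable_fst).
    apply: measurable_funM => //.
    exact: (measurableT_comp (measurable_now (h := h) kN) measurable_snd).
  by move=> x; rewrite lee_fin pw_ge0.
rewrite lee_fin mulr1 !exprMn.
set A := (_ ^+ r.+1)%R; set Fr := (F ^+ r.+1)%R; set vr := (v ^+ r.+1)%R.
rewrite (_ : _ * (_ * _) = expR C * A * M * (vr * Fr))%R; last by ring.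
rewrite ler_wpM2r//; first by rewrite mulr_ge0 ?exprn_ge0// ltW.
by rewrite ler_wpM2r// lerDr.
Qed.

End RowForms.

Section QuadraticForms.
Context {d} {T : measurableType d} {R : realType} (P : probability T R).
Local Open Scope ereal_scope.

Lemma row_sq_integrable N h s r M v k : centred_row P N h s r M v -> (k < N)%N ->
  P.-integrable setT (fun w => (h k w ^+ 2)%:E).
Proof.
move=> [mh ind h0 h2 hr] kN; apply/integrableP; split.
  by apply/measurable_EFinP/measurable_funX.
under eq_integral do rewrite /= ger0_norm ?sqr_ge0//.
by rewrite h2// ltry.
Qed.

Lemma row_prod_integrable N h s r M v k l : centred_row P N h s r M v ->
  (k < N)%N -> (l < N)%N -> P.-integrable setT (fun w => (h k w * h l w)%:E).
Proof.
move=> H kN lN; have [mh _ _ _ _] := H.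
apply: (@le_integrable _ _ _ P setT _ _ (fun w => (h k w ^+ 2)%:E + (h l w ^+ 2)%:E)) => //.
- by apply/measurable_EFinP/measurable_funM.
- move=> w _; rewrite -EFinD /= lee_fin [leRHS]ger0_norm ?addr_ge0 ?sqr_ge0// normrM.
  rewrite -(real_normK (num_real (h k w))) -(real_normK (num_real (h l w))).
  by have := sqr_ge0 (`|h k w| - `|h l w|)%R; have := sqr_ge0 (`|h k w| + `|h l w|)%R; nra.
- by apply: integrableD => //; apply: row_sq_integrable H _.
Qed.

Lemma row_lin_integrable N h s r M v k : centred_row P N h s r M v -> (k < N)%N ->
  P.-integrable setT (fun w => (h k w)%:E).
Proof.
move=> [mh ind h0 h2 hr] kN; apply: (integrable_of_pw (r := r)) => //.
by have [+ _ _] := hr _ kN => /le_lt_trans; apply; rewrite ltry.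
Qed.

Lemma integral_sum_EFin (n : nat) (f : nat -> T -> R) :
  (forall k, (k < n)%N -> P.-integrable setT (fun w => (f k w)%:E)) ->
  P.-integrable setT (fun w => (\sum_(k < n) f k w)%:E) /\
  \int[P]_w (\sum_(k < n) f k w)%:E = \sum_(k < n) \int[P]_w (f k w)%:E.
Proof.
elim: n => [_|n IH H].
  split; last by under eq_integral do rewrite big_ord0; rewrite integral0 big_ord0.
  by under eq_fun do rewrite big_ord0; exact: integrable0.
have [I1 I2] := IH (fun k kn => H k (ltnW kn)).
have Hn := H n (ltnSn n).
have e : (fun w => (\sum_(k < n.+1) f k w)%:E) =
    (fun w => (\sum_(k < n) f k w)%:E + (f n w)%:E).
  by apply/funext => w; rewrite big_ord_recr/= EFinD.
rewrite e; split; first exact: integrableD.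
by rewrite integralD// I2 big_ord_recr.
Qed.

(** Decoupling applies to nonnegative integrands, so the mean of the product is recovered from that
    of [(h l + h k) ^+ 2]. *)
Lemma row_uncorrelated N h s r M v k l : centred_row P N h s r M v ->
  (l < k)%N -> (k < N)%N -> \int[P]_w (h k w * h l w)%:E = 0.
Proof.
move=> H lk kN; have lN := ltn_trans lk kN.
have [mh ind h0 h2 _] := H.
have D : \int[P]_w ((h l w + h k w) ^+ 2)%:E =
         \int[P]_w \int[P]_u ((h l w + h k u) ^+ 2)%:E.
  apply: (@row_decoupling _ _ _ P N h mh ind k (fun z => ((h l z.1 + h k z.2) ^+ 2)%:E)).
    apply/measurable_EFinP/measurable_funX; apply: measurable_funD.
      exact: (measurableT_comp (measurable_past (h := h) lk lN) measurable_fst).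
    exact: (measurableT_comp (measurable_now (h := h) kN) measurable_snd).
  by move=> x; rewrite lee_fin sqr_ge0.
have Ik2 := row_sq_integrable H kN; have Il2 := row_sq_integrable H lN.
have Ik := row_lin_integrable H kN; have Ikl := row_prod_integrable H kN lN.
have Ic c : P.-integrable setT (fun w : T => c%:E).
  by apply/integrableP; split => //; under eq_integral do rewrite /=;
    rewrite probability_integral_cst ltry.
move: D.
have -> : (fun w => ((h l w + h k w) ^+ 2)%:E) =
    (fun w => (h l w ^+ 2)%:E + (2%:E * (h k w * h l w)%:E + (h k w ^+ 2)%:E)).
  by apply/funext => w; rewrite -EFinM -!EFinD; congr (_%:E); ring.
rewrite integralD//; last by apply: integrableD => //; exact: integrableZl.
rewrite integralD//; last exact: integrableZl.
rewrite integralZl// !h2//.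
have -> : \int[P]_w \int[P]_u ((h l w + h k u) ^+ 2)%:E = \int[P]_w ((h l w ^+ 2)%:E + (s k)%:E).
  apply: eq_integral => w _.
  have -> : (fun u => ((h l w + h k u) ^+ 2)%:E) =
    (fun u => (h l w ^+ 2)%:E + ((2 * h l w)%:E * (h k u)%:E + (h k u ^+ 2)%:E)).
    by apply/funext => u; rewrite -EFinM -!EFinD; congr (_%:E); ring.
  rewrite integralD//; last by apply: integrableD => //; exact: integrableZl.
  rewrite integralD//; last exact: integrableZl.
  by rewrite integralZl// h0// mule0 add0e probability_integral_cst h2.
rewrite integralD// h2// probability_integral_cst.
have /integrableP[_ ] := Ikl.
have /(integral_fune_fin_num measurableT) := Ikl.
move: (\int[P]_w _) => [x| |]//= _ _ [] e; congr (_%:E); lra.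
Qed.

Lemma quadratic_form_mean N h s r M v (A : nat -> nat -> R) :
  centred_row P N h s r M v -> (forall i j, A i j = A j i) ->
  P.-integrable setT (fun w => (\sum_(k < N) \sum_(l < N) A k l * (h k w * h l w))%:E) /\
  \int[P]_w (\sum_(k < N) \sum_(l < N) A k l * (h k w * h l w))%:E =
    (\sum_(k < N) A k k * s k)%:E.
Proof.
move=> H sA; have [mh ind h0 h2 _] := H.
have I1 k l : (k < N)%N -> (l < N)%N -> P.-integrable setT (fun w => (A k l * (h k w * h l w))%:E).
  move=> kN lN; under eq_fun do rewrite EFinM.
  by apply: integrableZl => //; apply: row_prod_integrable H _ _.
have I2 k (kN : (k < N)%N) := integral_sum_EFin (fun l lN => I1 k l kN lN).
have [I3 ->] := integral_sum_EFin (fun k kN => (I2 k kN).1).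
split; first exact: I3.
rewrite -sumEFin; apply: eq_bigr => k _.
rewrite (I2 _ (ltn_ord k)).2 (bigD1 k)//= [X in _ + X]big1 ?adde0.
  under eq_integral do rewrite EFinM -expr2.
  by rewrite integralZl ?h2 ?EFinM//; apply: row_sq_integrable H _.
move=> l lk; under eq_integral do rewrite EFinM.
rewrite integralZl//; last by apply: row_prod_integrable H _ _.
have : (l != k :> nat) by apply: contra lk => /eqP e; apply/eqP/val_inj.
rewrite neq_ltn => /orP[lt|lt].
  by rewrite (row_uncorrelated H)// mule0.
under eq_integral do rewrite mulrC.
by rewrite (row_uncorrelated H)// mule0.
Qed.

End QuadraticForms.

Section QuadraticMoment.
Context {d} {T : measurableType d} {R : realType} (P : probability T R).
Local Open Scope ereal_scope.

(** Grouping the terms by their larger index turns the centred form into a martingale: step [k]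
    contributes [A k k * (h k ^+ 2 - s k)] plus [2 * h k] times a linear form in the earlier
    variables. Its weight is the share of row [k] in the squared Frobenius norm. *)
Lemma quadratic_form_moment (r : nat) : exists2 C : R, (0 <= C)%R &
  forall N h s M v (A : nat -> nat -> R), centred_row P N h s r M v -> (1 <= M)%R -> (0 <= v)%R ->
  (forall i j, A i j = A j i) ->
  \int[P]_w (pw r (\sum_(k < N) \sum_(l < N) A k l * (h k w * h l w) - \sum_(k < N) A k k * s k)%R)%:E <=
    (C * M ^+ 2 * (v ^+ 2 * \sum_(k < N) \sum_(l < N) (A k l) ^+ 2) ^+ r.+1)%:E.
Proof.
have [C C0 HC] := martingale_moment P r.
have [L L1 HL] := linear_form_moment P r.
have L0 : (0 <= L)%R by lra.
pose q : R := (4 ^+ r.+1)%R.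
have q0 : (0 <= q)%R by rewrite exprn_ge0.
pose K := (q * (2 * q + 4 ^+ r.+1 * L))%R.
have K0 : (0 <= K)%R by rewrite mulr_ge0// addr_ge0// mulr_ge0.
exists (expR C * (2 ^+ r.+1 * K))%R; first by rewrite mulr_ge0 ?expR_ge0// mulr_ge0// exprn_ge0.
move=> N h s M v A H M1 v0 sA; have [mh ind h0 h2 hr] := H.
have M0 : (0 <= M)%R by lra.
have MM : (M <= M ^+ 2)%R by rewrite expr2 ler_peMr.
pose rho k := (\sum_(l < N) (A k l) ^+ 2)%R.
have rho0 k : (0 <= rho k)%R by apply: sumr_ge0 => l _; exact: sqr_ge0.
set F := (\sum_(k < N) \sum_(l < N) (A k l) ^+ 2)%R.
have F0 : (0 <= F)%R by apply: sumr_ge0 => k _; exact: rho0.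
have [Fz|Fn] := eqVneq F 0%R.
  have rz (k : 'I_N) : rho k = 0%R by apply: (psumr_eq0P _ Fz) => // i _; exact: rho0.
  have az (k l : 'I_N) : A k l = 0%R.
    apply/eqP; rewrite -sqrf_eq0; apply/eqP.
    by apply: (psumr_eq0P _ (rz k)) => // i _; exact: sqr_ge0.
  under eq_integral.
    move=> w _; rewrite big1; last by move=> k _; rewrite big1// => l _; rewrite az mul0r.
    rewrite big1; last by move=> k _; rewrite az mul0r.
    rewrite subrr /pw expr0n expr0n/=; over.
  rewrite integral0 lee_fin; apply: mulr_ge0; last by apply: exprn_ge0; exact: mulr_ge0 (sqr_ge0 v) F0.
  apply: mulr_ge0; last exact: sqr_ge0.
  by rewrite mulr_ge0 ?expR_ge0// mulr_ge0// exprn_ge0.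
have {Fn}Fp : (0 < F)%R by rewrite lt_def Fn.
have N0 : (0 < N)%N by case: (posnP N) => // N00; move: Fp; rewrite /F N00 big_ord0 ltxx.
have rk k : (k < N)%N -> (0 <= rho k <= F)%R.
  move=> kN; rewrite rho0/= /F (bigD1 (Ordinal kN))//= lerDl.
  by apply: sumr_ge0 => i _; exact: rho0.
pose ell k w := (\sum_(l < k) A k l * h l w)%R.
pose y k w u := (A k k * (h k u ^+ 2 - s k) + (2 * ell k w) * h k u)%R.
have mell k : measurable_fun setT (ell k).
  by apply: measurable_sum => l; apply: measurable_funM.
have eqS w : (\sum_(k < N) \sum_(l < N) A k l * (h k w * h l w) - \sum_(k < N) A k k * s k =
    \sum_(k < N) y k w w)%R.
  rewrite (sum_sym_split _ (f := fun k l => A k l * (h k w * h l w)))%R; last first.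
    by move=> i j; rewrite sA (mulrC (h i w)).
  rewrite -sumrB; apply: eq_bigr => k _; rewrite /y /ell.
  have -> : (\sum_(j < k) A k j * (h k w * h j w) = h k w * \sum_(j < k) A k j * h j w)%R.
    by rewrite mulr_sumr; apply: eq_bigr => j _; ring.
  by ring.
under eq_integral do rewrite eqS.
have fin k : (k < N)%N -> \int[P]_u (pw r (h k u))%:E < +oo.
  by move=> kN; have [+ _ _] := hr _ kN => /le_lt_trans; apply; rewrite ltry.
have sqb k : (k < N)%N ->
   \int[P]_u (pw r (h k u ^+ 2 - s k)%R)%:E <= (q * (2 * (M * (v ^+ 2) ^+ r.+1)))%:E.
  move=> kN; have [_ b1 b2] := hr _ kN.
  apply: (le_trans (integral_pwD P r _ _)) => //; first exact: measurable_funX.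
  rewrite EFinM; apply: lee_wpmul2l; first by rewrite lee_fin.
  rewrite mulr2n mulrDl mul1r EFinD; apply: leeD => //.
  by rewrite probability_integral_cst lee_fin /pw sqrrN.
have ybound k w : (k < N)%N -> \int[P]_u (pw r (y k w u))%:E <=
   (q * (pw r (A k k) * (q * (2 * (M * (v ^+ 2) ^+ r.+1)))))%:E +
   (q * 4 ^+ r.+1 * (M * v ^+ r.+1))%:E * (pw r (ell k w))%:E.
  move=> kN; have [b1 _ _] := hr _ kN.
  apply: (le_trans (integral_pwD P r _ _)).
  - by apply: measurable_funM => //; apply: measurable_funB => //; exact: measurable_funX.
  - exact: measurable_funM.
  rewrite ge0_muleDr//; try by apply: integral_ge0 => u _; rewrite lee_fin pw_ge0.
  apply: leeD.
    rewrite integral_pwM//; last by apply: measurable_funB => //; exact: measurable_funX.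
    rewrite !EFinM; apply: lee_wpmul2l; first by rewrite lee_fin.
    apply: lee_wpmul2l; first by rewrite lee_fin pw_ge0.
    by rewrite -!EFinM; exact: sqb.
  rewrite integral_pwM//.
  apply: (@le_trans _ _ (q%:E * ((pw r (2 * ell k w))%:E * (M * v ^+ r.+1)%:E))).
    by do 2 (apply: lee_wpmul2l; first by rewrite lee_fin ?pw_ge0).
  rewrite -!EFinM lee_fin pwM.
  have -> : pw r (2 : R) = (4 ^+ r.+1)%R by rewrite /pw; congr (_ ^+ _)%R; ring.
  by rewrite le_eqVlt; apply/orP; left; apply/eqP; ring.
apply: (le_trans (HC N y (fun k => share N (rho k) F)
  ((2 * F) ^+ r.+1 * (K * M ^+ 2 * (v ^+ 2) ^+ r.+1))%R 1%R _ _ _ _ _ _ _ _ _)).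
- apply: mulr_ge0; first by rewrite exprn_ge0// mulr_ge0// ltW.
  apply: mulr_ge0; last by apply: exprn_ge0; exact: sqr_ge0.
  by apply: mulr_ge0 => //; exact: sqr_ge0.
- by move=> k kN; have [] := share_bounds N0 Fp (rk _ kN).
- exact: share_sum.
- move=> k kN; rewrite /y; apply: measurable_funD.
    apply: measurable_funM => //; apply: measurable_funB => //.
    by apply: measurable_funX; exact: (measurableT_comp (mh k)).
  apply: measurable_funM; last exact: (measurableT_comp (mh k)).
  by apply: measurable_funM => //; exact: (measurableT_comp (mell k)).
- move=> k kN; rewrite /y; apply: measurable_funD.
    by apply: measurable_funM => //; apply: measurable_funB => //; exact: measurable_funX.
  by apply: measurable_funM => //; exact: measurable_funM.
- move=> k w kN; apply: (le_lt_trans (ybound k w kN)).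
  by rewrite -EFinM -EFinD ltry.
- move=> k w kN; rewrite /y.
  have Ik2 := row_sq_integrable H kN; have Ik := row_lin_integrable H kN.
  have -> : (fun u => (A k k * (h k u ^+ 2 - s k) + 2 * ell k w * h k u)%:E) =
    (fun u => (A k k)%:E * (h k u ^+ 2)%:E + (2 * ell k w)%:E * (h k u)%:E + (- (A k k * s k))%:E).
    by apply/funext => u; rewrite -!EFinM -!EFinD; congr (_%:E); ring.
  have Ic : P.-integrable setT (fun w : T => (- (A k k * s k))%:E).
    apply/integrableP; split => //.
    by under eq_integral do rewrite /=; rewrite probability_integral_cst ltry.
  rewrite integralD//; last by apply: integrableD => //; exact: integrableZl.
  rewrite integralD//; try exact: integrableZl.
  rewrite !integralZl// h0// mule0 adde0 h2// probability_integral_cst.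
  by rewrite -EFinM -EFinD subrr.
- move=> k kN.
  apply: (@le_trans _ _ (\int[P]_w ((q * (pw r (A k k) * (q * (2 * (M * (v ^+ 2) ^+ r.+1)))))%:E +
      (q * 4 ^+ r.+1 * (M * v ^+ r.+1))%:E * (pw r (ell k w))%:E))).
    apply: ge0_le_integral => //.
    + by move=> w _; apply: integral_ge0 => u _; rewrite lee_fin pw_ge0.
    + apply: (measurable_fun_fubini_tonelli_F (m2 := P) (fun z => (pw r (y k z.1 z.2))%:E)) => [|x].
        apply/measurable_EFinP/measurable_pw; apply: measurable_funD.
          apply: measurable_funM => //; apply: measurable_funB => //.
          by apply: measurable_funX; exact: (measurableT_comp (mh k)).
        apply: measurable_funM; last exact: (measurableT_comp (mh k)).
        by apply: measurable_funM => //; exact: (measurableT_comp (mell k)).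
      by rewrite lee_fin pw_ge0.
    + apply: emeasurable_funD => //; apply: emeasurable_funM => //.
      by apply/measurable_EFinP/measurable_pw.
    + by move=> w _; exact: ybound.
  have c2 : (0 <= q * 4 ^+ r.+1 * (M * v ^+ r.+1))%R by rewrite !mulr_ge0 ?exprn_ge0.
  have c1 : (0 <= q * (pw r (A k k) * (q * (2 * (M * (v ^+ 2) ^+ r.+1)))))%R.
    by rewrite mulr_ge0// mulr_ge0 ?pw_ge0// !mulr_ge0// exprn_ge0// sqr_ge0.
  rewrite ge0_integralD//; first last.
  + by apply: emeasurable_funM => //; apply/measurable_EFinP/measurable_pw.
  + by move=> w _; rewrite mule_ge0// lee_fin ?pw_ge0.
  rewrite probability_integral_cst ge0_integralZl//; first last.
  + by move=> w _; rewrite lee_fin pw_ge0.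
  + by apply/measurable_EFinP/measurable_pw.
  (* The form in the earlier variables is a full linear form whose coefficients from [k] on are set
     to zero. *)
  have lb : \int[P]_w (pw r (ell k w))%:E <= (L * M * (v * rho k) ^+ r.+1)%:E.
    have := HL N h s M v (fun l => if (l < k)%N then A k l else 0%R) H M0 v0.
    have e w : ell k w = (\sum_(l < N) (if (l < k)%N then A k l else 0) * h l w)%R.
      rewrite /ell (big_ord_widen N (fun l => A k l * h l w)%R (ltnW kN)) big_mkcond/=.
      by apply: eq_bigr => l _; case: ifP => //; rewrite mul0r.
    under eq_integral do rewrite -e.
    move=> /le_trans; apply; rewrite lee_fin ler_wpM2l ?mulr_ge0//.
    apply: lerXn2r; rewrite ?nnegrE ?mulr_ge0//.
      by apply: sumr_ge0 => l _; exact: sqr_ge0.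
    rewrite ler_wpM2l//; apply: ler_sum => l _; case: ifP => // _.
    by rewrite expr0n sqr_ge0.
  apply: (@le_trans _ _ ((q * (pw r (A k k) * (q * (2 * (M * (v ^+ 2) ^+ r.+1)))))%:E +
      (q * 4 ^+ r.+1 * (M * v ^+ r.+1))%:E * (L * M * (v * rho k) ^+ r.+1)%:E)).
    by rewrite leeD2l//; apply: lee_wpmul2l; rewrite ?lee_fin.
  rewrite -EFinM -EFinD lee_fin.
  have [/andP[w0 _] wb] := share_bounds N0 Fp (rk _ kN).
  have b1 : (pw r (A k k) <= rho k ^+ r.+1)%R.
    apply: lerXn2r; rewrite ?nnegrE ?sqr_ge0//.
    rewrite /rho (bigD1 (Ordinal kN))//= lerDl.
    by apply: sumr_ge0 => i _; exact: sqr_ge0.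
  have b2 : (rho k ^+ r.+1 <= share N (rho k) F ^+ r.+1 * (2 * F) ^+ r.+1)%R.
    by rewrite -exprMn; apply: lerXn2r; rewrite ?nnegrE// mulr_ge0 ?(ltW w0)// mulr_ge0.
  rewrite [leRHS]mulrA; set V := ((v ^+ 2) ^+ r.+1)%R.
  have V0 : (0 <= V)%R by rewrite exprn_ge0// sqr_ge0.
  apply: (@le_trans _ _ (rho k ^+ r.+1 * (K * M ^+ 2 * V)))%R; last first.
    by apply: ler_wpM2r => //; rewrite mulr_ge0// mulr_ge0// sqr_ge0.
  have -> : (q * 4 ^+ r.+1 * (M * v ^+ r.+1) * (L * M * (v * rho k) ^+ r.+1) =
     rho k ^+ r.+1 * (q * (4 ^+ r.+1 * L) * M ^+ 2 * V))%R.
    by rewrite /V exprMn -exprM mulnC exprM; ring.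
  have -> : (rho k ^+ r.+1 * (K * M ^+ 2 * V) = rho k ^+ r.+1 * (2 * q * q * M ^+ 2 * V) +
     rho k ^+ r.+1 * (q * (4 ^+ r.+1 * L) * M ^+ 2 * V))%R by rewrite /K; ring.
  rewrite lerD2r.
  have -> : (q * (pw r (A k k) * (q * (2 * (M * V)))) = pw r (A k k) * (2 * q * q * M * V))%R by ring.
  apply: ler_pM => //; first exact: pw_ge0.
    by rewrite !mulr_ge0.
  by rewrite ler_wpM2r// ler_wpM2l// !mulr_ge0.
- move=> k kN.
  rewrite [LHS](_ : _ = \int[P]_w (pw r (\sum_(l < k) y l w w + y k w w)%R)%:E); last first.
    by apply: eq_integral => w _; rewrite big_ord_recr.
  apply: (@row_decoupling _ _ _ P N h mh ind k (fun z => (pw r (\sum_(l < k) y l z.1 z.1 + y k z.1 z.2)%R)%:E)); last first.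
    by move=> x; rewrite lee_fin pw_ge0.
  have mp l : (l < k)%N -> measurable_fun setT
     (fun z : subT (fun i : 'I_N => h i) [set i : 'I_N | (i < k)%N]%SET *
              subT (fun i : 'I_N => h i) [set i : 'I_N | i == k :> nat]%SET => h l z.1).
    move=> lk; have lN := ltn_trans lk kN.
    exact: (measurableT_comp (measurable_past (h := h) lk lN) measurable_fst).
  have mn : measurable_fun setT
     (fun z : subT (fun i : 'I_N => h i) [set i : 'I_N | (i < k)%N]%SET *
              subT (fun i : 'I_N => h i) [set i : 'I_N | i == k :> nat]%SET => h k z.2).
    exact: (measurableT_comp (measurable_now (h := h) kN) measurable_snd).
  have me l : (l <= k)%N -> measurable_fun setT
     (fun z : subT (fun i : 'I_N => h i) [set i : 'I_N | (i < k)%N]%SET *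
              subT (fun i : 'I_N => h i) [set i : 'I_N | i == k :> nat]%SET => ell l z.1).
    move=> lk; apply: measurable_sum => j; apply: measurable_funM => //.
    by apply: mp; exact: leq_trans (ltn_ord j) lk.
  apply/measurable_EFinP/measurable_pw; apply: measurable_funD.
    apply: measurable_sum => l; apply: measurable_funD.
      apply: measurable_funM => //; apply: measurable_funB => //.
      by apply: measurable_funX; exact: mp.
    apply: measurable_funM; last exact: mp.
    by apply: measurable_funM => //; apply: me; exact: ltnW.
  apply: measurable_funD.
    apply: measurable_funM => //; apply: measurable_funB => //.
    by apply: measurable_funX.
  apply: measurable_funM => //.
  by apply: measurable_funM => //; apply: me.
rewrite lee_fin mulr1 !exprMn le_eqVlt; apply/orP; left; apply/eqP.
by ring.
Qed.

End QuadraticMoment.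

(** * Inverses of principal submatrices *)

Section Forms.
Variables (R : realType) (N : nat).
Implicit Types (A B G : 'M[R]_N) (u v w : 'cV[R]_N).

Definition dot u v : R := (u^T *m v) 0 0.
Definition psd A := forall v, 0 <= dot v (A *m v).
Definition symm A := A^T = A.

Lemma dotE u v : dot u v = \sum_i u i 0 * v i 0.
Proof. by rewrite /dot mxE; apply: eq_bigr => i _; rewrite mxE. Qed.

Lemma dotC u v : dot u v = dot v u.
Proof. by rewrite !dotE; apply: eq_bigr => i _; rewrite mulrC. Qed.

Lemma dotDr u v w : dot u (v + w) = dot u v + dot u w.
Proof. by rewrite /dot mulmxDr mxE. Qed.

Lemma dotDl u v w : dot (v + w) u = dot v u + dot w u.
Proof. by rewrite dotC dotDr !(dotC u). Qed.

Lemma dotZr a u v : dot u (a *: v) = a * dot u v.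
Proof. by rewrite /dot -scalemxAr mxE. Qed.

Lemma dotZl a u v : dot (a *: u) v = a * dot u v.
Proof. by rewrite dotC dotZr dotC. Qed.

Lemma dotNr u v : dot u (- v) = - dot u v.
Proof. by rewrite -scaleN1r dotZr mulN1r. Qed.

Lemma dotBr u v w : dot u (v - w) = dot u v - dot u w.
Proof. by rewrite dotDr dotNr. Qed.

Lemma dotBl u v w : dot (v - w) u = dot v u - dot w u.
Proof. by rewrite dotC dotBr !(dotC u). Qed.

Lemma dot0r u : dot u 0 = 0.
Proof. by rewrite /dot mulmx0 mxE. Qed.

Lemma dot_mxl A u v : dot (A *m u) v = dot u (A^T *m v).
Proof. by rewrite /dot trmx_mul mulmxA. Qed.

Lemma dot_sym A u v : symm A -> dot (A *m u) v = dot u (A *m v).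
Proof. by move=> sA; rewrite dot_mxl sA. Qed.

Lemma dot_ge0 u : 0 <= dot u u.
Proof. by rewrite dotE sumr_ge0// => i _; rewrite -expr2 sqr_ge0. Qed.

Lemma dot_eq0 u : dot u u = 0 -> u = 0.
Proof.
rewrite dotE => /psumr_eq0P h; apply/matrixP => i j; rewrite ord1 mxE.
apply/eqP; rewrite -sqrf_eq0 expr2; apply/eqP; apply: h => // k _.
by rewrite -expr2 sqr_ge0.
Qed.

Lemma dot_delta A i j : dot (delta_mx i 0) (A *m delta_mx j 0) = A i j.
Proof.
rewrite dotE (bigD1 i)//= big1 ?addr0.
  rewrite [delta_mx i 0 _ _]mxE !eqxx mul1r mxE (bigD1 j)//= big1 ?addr0.
    by rewrite mxE !eqxx mulr1.
  by move=> k kj; rewrite mxE (negbTE kj) mulr0.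
by move=> k ki; rewrite mxE (negbTE ki) mul0r.
Qed.

Lemma dot_col v j : dot (delta_mx j 0) v = v j 0.
Proof.
rewrite dotE (bigD1 j)//= big1 ?addr0; first by rewrite mxE !eqxx mul1r.
by move=> k ki; rewrite mxE (negbTE ki) mul0r.
Qed.

Lemma symmE A i j : symm A -> A i j = A j i.
Proof. by move=> sA; rewrite -[in LHS]sA mxE. Qed.

Lemma outer_mul u v w : (u *m v^T) *m w = dot v w *: u.
Proof. by rewrite -mulmxA (mx11_scalar (v^T *m w)) mul_mx_scalar. Qed.

Lemma symm_outer v : symm (v *m v^T).
Proof. by rewrite /symm trmx_mul trmxK. Qed.

Lemma symmD A B : symm A -> symm B -> symm (A + B).
Proof. by rewrite /symm linearD/= => -> ->. Qed.

Lemma symmZ a A : symm A -> symm (a *: A).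
Proof. by rewrite /symm linearZ/= => ->. Qed.

Lemma symmB A B : symm A -> symm B -> symm (A - B).
Proof. by rewrite /symm linearB/= => -> ->. Qed.

Lemma psd_outer v : psd (v *m v^T).
Proof. by move=> w; rewrite outer_mul dotZr (dotC w) -expr2 sqr_ge0. Qed.

Lemma psdD A B : psd A -> psd B -> psd (A + B).
Proof. by move=> pA pB v; rewrite mulmxDl dotDr addr_ge0. Qed.

Lemma psdZ a A : 0 <= a -> psd A -> psd (a *: A).
Proof. by move=> a0 pA v; rewrite -scalemxAl dotZr mulr_ge0. Qed.

Lemma psd_CS A u v : symm A -> psd A ->
  (dot u (A *m v)) ^+ 2 <= dot u (A *m u) * dot v (A *m v).
Proof.
move=> sA pA.
set a := dot u (A *m u); set b := dot u (A *m v); set c := dot v (A *m v).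
have a0 : 0 <= a := pA u; have c0 : 0 <= c := pA v.
have key t : 0 <= a + 2 * t * b + t ^+ 2 * c.
  have := pA (u + t *: v); rewrite mulmxDr -scalemxAr !(dotDl, dotDr) !(dotZl, dotZr).
  have -> : dot v (A *m u) = b by rewrite -dot_sym// dotC.
  by rewrite -/a -/b -/c; lra.
have [c00|cn] := eqVneq c 0.
  have [->|bn] := eqVneq b 0; first by rewrite c00 mulr0 expr0n.
  (* For [c = 0] the polynomial in [t] is affine, and this [t] gives it the value -1. *)
  have := key (- (a + 1) / (2 * b)).
  have -> : a + 2 * (- (a + 1) / (2 * b)) * b + (- (a + 1) / (2 * b)) ^+ 2 * c = - 1.
    by rewrite c00; field.
  by lra.
have cp : 0 < c by rewrite lt_def cn.
have := key (- b / c).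
have -> : a + 2 * (- b / c) * b + (- b / c) ^+ 2 * c = (a * c - b ^+ 2) / c by field.
by rewrite pmulr_lge0 ?invr_gt0// subr_ge0.
Qed.

Lemma dot_CS u v : (dot u v) ^+ 2 <= dot u u * dot v v.
Proof.
have := @psd_CS 1%:M u v; rewrite !mul1mx; apply; first by rewrite /symm trmx1.
by move=> w; rewrite mul1mx dot_ge0.
Qed.

Definition le_norm A (b : R) := forall v, dot v (A *m v) <= b * dot v v.

(** This is $A^2\le bA$, obtained from Cauchy-Schwarz in the form of [A] between [v] and [A v],
    without diagonalising. *)
Lemma psd_sq A b v : symm A -> psd A -> le_norm A b ->
  dot (A *m v) (A *m v) <= b * dot v (A *m v).
Proof.
move=> sA pA lA.
have := psd_CS v (A *m v) sA pA.
rewrite -(dot_sym v (A *m v) sA).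
set q := dot (A *m v) (A *m v); set a := dot v (A *m v).
have := lA (A *m v); rewrite -/q => h1 h2.
have q0 : 0 <= q := dot_ge0 _; have a0 : 0 <= a := pA v.
have [->|qn] := eqVneq q 0.
  have [b0|b0] := leP 0 b; first exact: mulr_ge0.
  have a00 : a <= b * dot v v := lA v.
  have : a = 0 by apply/eqP; rewrite eq_le a0 andbT (le_trans a00)// nmulr_rle0// dot_ge0.
  by move=> ->; rewrite mulr0.
have qp : 0 < q by rewrite lt_def qn.
have : q ^+ 2 <= a * (b * q) by apply: (le_trans h2); rewrite ler_wpM2l.
by rewrite expr2 mulrA ler_pM2r// mulrC.
Qed.

Lemma psd_sq_norm A b v : 0 <= b -> symm A -> psd A -> le_norm A b ->
  dot (A *m v) (A *m v) <= b ^+ 2 * dot v v.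
Proof.
move=> b0 sA pA lA; apply: (le_trans (psd_sq v sA pA lA)).
by rewrite expr2 -mulrA ler_wpM2l.
Qed.

Lemma sq_entry A j : symm A -> \sum_k (A j k) ^+ 2 = dot (A *m delta_mx j 0) (A *m delta_mx j 0).
Proof.
move=> sA; rewrite dotE; apply: eq_bigr => k _.
by rewrite -colE mxE expr2 (symmE _ _ sA).
Qed.

Lemma sq_diag A j : symm A -> (A *m A) j j = \sum_k (A j k) ^+ 2.
Proof. by move=> sA; rewrite mxE; apply: eq_bigr => k _; rewrite expr2 (symmE k j sA). Qed.

Lemma diag_ge0 A j : psd A -> 0 <= A j j.
Proof. by move=> pA; have := pA (delta_mx j 0); rewrite dot_delta. Qed.

Lemma sum_sq_le A b : 0 <= b -> symm A -> psd A -> le_norm A b ->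
  \sum_j \sum_k (A j k) ^+ 2 <= N%:R * b ^+ 2.
Proof.
move=> b0 sA pA lA.
apply: (@le_trans _ _ (\sum_(j < N) b ^+ 2)); last by rewrite sumr_const card_ord mulr_natl.
apply: ler_sum => j _; rewrite sq_entry//.
apply: (le_trans (psd_sq_norm _ b0 sA pA lA)).
by rewrite dot_col mxE !eqxx mulr1.
Qed.

Lemma psd_mul_sq A : symm A -> psd (A *m A).
Proof. by move=> sA v; rewrite -mulmxA -dot_sym// dot_ge0. Qed.

Lemma symm_sq A : symm A -> symm (A *m A).
Proof. by move=> sA; rewrite /symm trmx_mul sA. Qed.

Lemma le_norm_sq A b : 0 <= b -> symm A -> psd A -> le_norm A b -> le_norm (A *m A) (b ^+ 2).
Proof. by move=> b0 sA pA lA v; rewrite -mulmxA -dot_sym// psd_sq_norm. Qed.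

End Forms.

Section PartialInverse.
Variables (R : realType) (N : nat).
Implicit Types (A B G D : 'M[R]_N) (u v w x y h : 'cV[R]_N) (I : {set 'I_N}).

Definition supp I v := forall i, i \notin I -> v i 0 = 0.
Definition pd I A := forall v, supp I v -> v != 0 -> 0 < dot v (A *m v).
(* [G] is the inverse of the principal submatrix of [A] on [I], padded by zeros. *)
Definition isinv I A G := [/\ symm G, forall i j, i \notin I -> G i j = 0 &
  forall i k, i \in I -> (A *m G) i k = (i == k)%:R].

Lemma isinv_supp I A G x : isinv I A G -> supp I (G *m x).
Proof. by move=> [_ G0 _] i iI; rewrite mxE big1// => j _; rewrite G0// mul0r. Qed.

Lemma isinv_mulA I A G x i : isinv I A G -> i \in I -> (A *m (G *m x)) i 0 = x i 0.
Proof.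
move=> [_ _ AG] iI; rewrite mulmxA mxE (bigD1 i)//= AG// eqxx mul1r big1 ?addr0// => k ki.
by rewrite AG// eq_sym (negbTE ki) mul0r.
Qed.

Lemma isinv_ext I A G x y : isinv I A G -> (forall i, i \in I -> x i 0 = y i 0) ->
  G *m x = G *m y.
Proof.
move=> [sG G0 _] xy; apply/matrixP => i j; rewrite ord1 !mxE; apply: eq_bigr => k _.
have [kI|kI] := boolP (k \in I); first by rewrite xy.
by rewrite (symmE i k sG) G0// !mul0r.
Qed.

Lemma isinv_left I A G v : symm A -> isinv I A G -> supp I v -> G *m (A *m v) = v.
Proof.
move=> sA [sG G0 AG] sv; apply/matrixP => i j; rewrite ord1 mulmxA mxE.
have e k : k \in I -> (G *m A) i k = (k == i)%:R.
  by move=> kI; rewrite -AG// -[in LHS]sG -[in LHS]sA -trmx_mul mxE.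
have [iI|iI] := boolP (i \in I).
  rewrite (bigD1 i)//= e// eqxx mul1r big1 ?addr0// => k ki.
  have [kI|kI] := boolP (k \in I); last by rewrite sv// mulr0.
  by rewrite e// (negbTE ki) mul0r.
rewrite sv// big1// => k _.
by rewrite mxE big1 ?mul0r// => l _; rewrite G0// mul0r.
Qed.

Lemma isinv_uniq I A G G' : symm A -> isinv I A G -> isinv I A G' -> G = G'.
Proof.
move=> sA iG iG'; apply/matrixP => i k.
have : G *m delta_mx k (0 : 'I_1) = G' *m delta_mx k 0.
  rewrite -[RHS](isinv_left sA iG); last exact: isinv_supp iG'.
  by apply: isinv_ext iG _ => j jI; rewrite (isinv_mulA _ iG').
by rewrite -!colE => /matrixP/(_ i 0); rewrite !mxE.
Qed.

Lemma isinv_form I A G y : isinv I A G ->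
  dot (G *m y) (A *m (G *m y)) = dot y (G *m y).
Proof.
move=> iG; rewrite [RHS]dotC !dotE; apply: eq_bigr => i _.
have [iI|iI] := boolP (i \in I); first by rewrite (isinv_mulA _ iG).
by rewrite (isinv_supp y iG iI) !mul0r.
Qed.

Lemma pd_psd I A G : isinv I A G -> pd I A -> psd G.
Proof.
move=> iG pA y; rewrite -(isinv_form y iG).
have [->|n0] := eqVneq (G *m y) 0; first by rewrite mulmx0 dot0r.
exact/ltW/pA/n0/isinv_supp/iG.
Qed.

(** On vectors supported in [I] the form of [A] at [v] is the form of [G] at [A v]; Cauchy-Schwarz
    in the form of [G] shows that it vanishes only for [v = 0]. *)
Lemma psd_pd I A G : symm A -> isinv I A G -> psd G -> pd I A.
Proof.
move=> sA iG pG v sv v0.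
have sG : symm G by case: iG.
have e : dot v (A *m v) = dot (A *m v) (G *m (A *m v)).
  by rewrite (isinv_left sA iG sv) dot_sym.
rewrite lt_def e pG andbT -e; apply: contra v0 => /eqP vAv.
have := psd_CS v (A *m v) sG pG; rewrite -e vAv mulr0 (isinv_left sA iG sv).
rewrite real_exprn_even_le0 ?num_real//= => /eqP vv.
by apply/eqP/dot_eq0.
Qed.

Lemma isinv_norm I A G c : isinv I A G -> 0 < c ->
  (forall v, supp I v -> c * dot v v <= dot v (A *m v)) -> le_norm G c^-1.
Proof.
move=> iG c0 H y.
have := H _ (isinv_supp y iG); rewrite (isinv_form y iG).
set x := G *m y; set t := dot y x => h1.
have x0 := dot_ge0 x; have y0 := dot_ge0 y.
have t0 : 0 <= t by apply: le_trans h1; rewrite mulr_ge0// ltW.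
have h2 : t ^+ 2 <= dot y y * dot x x := dot_CS y x.
have [->|tn] := eqVneq t 0; first by rewrite mulr_ge0// invr_ge0 ltW.
have tp : 0 < t by rewrite lt_def tn.
rewrite ler_pdivlMl// -(ler_pM2r tp).
apply: (@le_trans _ _ (c * (dot y y * dot x x))); first by rewrite -mulrA ler_wpM2l// ltW.
by rewrite mulrCA ler_wpM2l.
Qed.

(** The principal block bordered by an identity, so that inverting the block is inverting a full
    matrix of the same size. *)
Definition Am A I : 'M[R]_N := \matrix_(i, j)
  if (i \in I) && (j \in I) then A i j else (i == j)%:R.
(** Cramer's formula as a total function of the entries, zero when the determinant vanishes:
    measurability then needs no case distinction on invertibility. *)
Definition inv' A : 'M[R]_N := (\det A)^-1 *: \adj A.
Definition Gm A I : 'M[R]_N := \matrix_(i, j)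
  if (i \in I) && (j \in I) then inv' (Am A I) i j else 0.

Lemma inv'E A : A \in unitmx -> inv' A = invmx A.
Proof. by move=> uA; rewrite /invmx uA. Qed.

Lemma Am_unit_isinv A I : symm A -> Am A I \in unitmx -> isinv I A (Gm A I).
Proof.
move=> sA uA.
have sAm : (Am A I)^T = Am A I.
  apply/matrixP => i j; rewrite !mxE andbC; case: ifP => _; first exact: symmE.
  by rewrite eq_sym.
have sV : (invmx (Am A I))^T = invmx (Am A I) by rewrite trmx_inv sAm.
have GmE i k : Gm A I i k = if (i \in I) && (k \in I) then invmx (Am A I) i k else 0.
  by rewrite mxE inv'E.
split.
- apply/matrixP => i j; rewrite mxE !GmE andbC; case: ifP => // _.
  by rewrite -[in LHS]sV mxE.
- by move=> i j iI; rewrite GmE (negbTE iI).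
- move=> i k iI; have := congr1 (fun M : 'M[R]_N => M i k) (mulmxV uA); rewrite mxE [RHS]mxE.
  have [kI|kI] := boolP (k \in I).
    move=> <-; rewrite mxE; apply: eq_bigr => j _; rewrite GmE [Am _ _ _ _]mxE iI kI/= andbT.
    case: (boolP (j \in I)) => // jI; rewrite mulr0.
    by case: eqP jI => [<-|_ _]; rewrite ?iI// mul0r.
  move=> _; rewrite mxE big1; last by move=> j _; rewrite GmE (negbTE kI) andbF mulr0.
  by case: eqP kI => // <-; rewrite iI.
Qed.

(** A kernel vector of the bordered matrix vanishes off [I], where the rows are those of the
    identity; positivity on [I] then makes it zero. *)
Lemma pd_isinv A I : symm A -> pd I A -> isinv I A (Gm A I).
Proof.
move=> sA pA; apply: Am_unit_isinv => //.
rewrite -row_free_unit -kermx_eq0; apply/eqP/row_matrixP => r; rewrite row0.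
set z := row r _.
have zA : z *m Am A I = 0.
  by rewrite /z -row_mul mulmx_ker row0.
have sAm : (Am A I)^T = Am A I.
  apply/matrixP => i j; rewrite !mxE andbC; case: ifP => _; first exact: symmE.
  by rewrite eq_sym.
pose v := z^T.
have Av : Am A I *m v = 0 by rewrite /v -sAm -trmx_mul zA trmx0.
have sv : supp I v.
  move=> i iI; have := congr1 (fun M : 'cV[R]_N => M i 0) Av; rewrite mxE [RHS]mxE => <-.
  rewrite (bigD1 i)//= big1 ?addr0; first by rewrite [Am _ _ _ _]mxE (negbTE iI) eqxx mul1r.
  by move=> k ki; rewrite [Am _ _ _ _]mxE (negbTE iI) eq_sym (negbTE ki) mul0r.
suff : v = 0 by move=> /(congr1 trmx); rewrite trmxK trmx0.
apply/eqP/negPn/negP => /(pA _ sv).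
suff -> : dot v (A *m v) = dot v (Am A I *m v) by rewrite Av dot0r ltxx.
rewrite !dotE; apply: eq_bigr => i _.
have [iI|iI] := boolP (i \in I); last by rewrite sv// !mul0r.
congr (_ * _); rewrite mxE [RHS]mxE; apply: eq_bigr => k _; rewrite [Am _ _ _ _]mxE iI/=.
by case: (boolP (k \in I)) => // kI; rewrite sv// !mulr0.
Qed.

Lemma Gm_eq A I G : symm A -> isinv I A G -> Gm A I = G.
Proof.
move=> sA iG; have [sG G0 AG] := iG.
apply: (isinv_uniq sA _ iG); apply: Am_unit_isinv => //.
pose V : 'M[R]_N := \matrix_(i, j) if (i \in I) && (j \in I) then G i j else (i == j)%:R.
suff h : Am A I *m V = 1%:M by case/mulmx1_unit: h.
apply/matrixP => i k; rewrite mxE [RHS]mxE.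
have [iI|iI] := boolP (i \in I); last first.
  rewrite (bigD1 i)//= big1 ?addr0.
    by rewrite !mxE (negbTE iI)/= eqxx mul1r.
  by move=> j ji; rewrite mxE (negbTE iI) eq_sym (negbTE ji) mul0r.
have [kI|kI] := boolP (k \in I).
  rewrite -AG// mxE; apply: eq_bigr => j _; rewrite !mxE iI kI/= andbT.
  case: (boolP (j \in I)) => // jI; rewrite G0// mulr0.
  by case: eqP jI => [<-|_ _]; rewrite ?iI// mul0r.
rewrite (bigD1 k)//= big1 ?addr0.
  rewrite !mxE (negbTE kI) !andbF eqxx mulr1.
  by case: eqP kI => // <-; rewrite iI.
move=> j jk; rewrite !mxE (negbTE kI) andbF.
by rewrite (negbTE jk) mulr0.
Qed.

Lemma isinv_set0 A : isinv finset.set0 A 0.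
Proof.
split; first by rewrite /symm trmx0.
  by move=> i j _; rewrite mxE.
by move=> i k; rewrite inE.
Qed.

Section RowStep.
Variables (I : {set 'I_N}) (A G : 'M[R]_N) (j : 'I_N).
Hypotheses (sA : symm A) (iG : isinv I A G) (jI : j \notin I).
Let h := - col j A.
Let w : 'cV[R]_N := delta_mx j 0 + G *m h.
Let s := A j j - dot h (G *m h).

(** Block inversion with the Schur complement [s]. The vector [w] is the lift of the new basis
    vector for which [A w] equals [s] at [j] and vanishes on [I]. *)
Lemma row_step : s != 0 -> isinv (j |: I)%SET A (G + s^-1 *: (w *m w^T)).
Proof.
move=> s0; have [sG G0 AG] := iG.
have wj : w j 0 = 1 by rewrite !mxE !eqxx/= big1 ?addr0// => k _; rewrite G0// mul0r.
have Aw i : i \in I -> (A *m w) i 0 = 0.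
  move=> iI; rewrite mulmxDr mxE (isinv_mulA _ iG iI) -colE !mxE.
  by rewrite addrN.
have Awj : (A *m w) j 0 = s.
  rewrite mulmxDr mxE -colE mxE /s; congr (_ + _).
  rewrite mxE dotE -sumrN; apply: eq_bigr => k _.
  by rewrite !mxE (symmE j k sA); ring.
have AGj k : (A *m G) j k = - (G *m h) k 0.
  rewrite mxE [in RHS]mxE -sumrN; apply: eq_bigr => l _.
  by rewrite !mxE (symmE j l sA) (symmE l k sG); ring.
split.
- by apply: symmD => //; apply: symmZ; exact: symm_outer.
- move=> i k; rewrite finset.in_setU1 negb_or => /andP[ij iI].
  rewrite mxE G0// add0r mxE mxE big_ord1 [w i 0]mxE.
  by rewrite (isinv_supp h iG iI) mxE (negbTE ij)/= addr0 mul0r mulr0.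
- move=> i k; rewrite finset.in_setU1.
  have e : (A *m (G + s^-1 *: (w *m w^T))) i k = (A *m G) i k + s^-1 * ((A *m w) i 0 * w k 0).
    by rewrite mulmxDr mxE; congr (_ + _); rewrite -scalemxAr mxE mulmxA mxE big_ord1 [w^T _ _]mxE.
  rewrite e; have [-> _|ij /=] := eqVneq i j; last first.
    by move=> iI; rewrite Aw// mul0r mulr0 addr0 AG.
  by rewrite Awj AGj mulKf// [w k 0]mxE addrCA addNr addr0 mxE andbT eq_sym.
Qed.

(** The enlarged inverse is positive semidefinite, which suffices by [psd_pd]. *)
Lemma row_step_pd : pd I A -> 0 < s -> pd (j |: I)%SET A.
Proof.
move=> pA s0; apply: (psd_pd sA (row_step (lt0r_neq0 s0))).
apply: psdD; first exact: pd_psd iG pA.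
by apply: psdZ; [rewrite invr_ge0 ltW|exact: psd_outer].
Qed.

End RowStep.

Section LeaveOneOut.
Variables (J : {set 'I_N}) (A G : 'M[R]_N) (j : 'I_N).
Hypotheses (sA : symm A) (iG : isinv J A G) (jJ : j \in J) (g0 : 0 < G j j).
Let h := - col j A.
Let g := col j G.
Let B := G - (G j j)^-1 *: (g *m g^T).

Let gE i : g i 0 = G i j. Proof. by rewrite mxE. Qed.

(** This is [row_step] run backwards: subtracting the rank-one matrix built from column [j] of [G]
    clears row and column [j]. *)
Lemma leave_one_out : isinv (J :\ j)%SET A B.
Proof.
have [sG G0 AG] := iG.
have Bij i k : B i k = G i k - (G j j)^-1 * (G i j * G k j).
  by rewrite !mxE big_ord1 !mxE.
split.
- by apply: symmB => //; apply: symmZ; exact: symm_outer.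
- move=> i k; rewrite !inE negb_and negbK => /orP[/eqP ->|iJ].
    by rewrite Bij mulKf ?gt_eqF// (symmE k j sG) subrr.
  by rewrite Bij (G0 i k iJ) (G0 i j iJ) mul0r mulr0 subr0.
- move=> i k; rewrite !inE => /andP[ij iJ].
  have -> : (A *m B) i k = (A *m G) i k - (G j j)^-1 * ((A *m g) i 0 * G k j).
    rewrite mulmxBr mxE; congr (_ + _); rewrite mxE; congr (- _).
    by rewrite -scalemxAr mxE mulmxA mxE big_ord1 [g^T _ _]mxE gE.
  have -> : (A *m g) i 0 = 0.
    by rewrite /g colE mulmxA -colE mxE AG// (negbTE ij).
  by rewrite mul0r mulr0 subr0 AG.
Qed.

(* The diagonal entry of [h] cancels against [B j j = 0]. *)
Lemma leave_one_out_vec : B *m h = (G j j)^-1 *: g - delta_mx j 0.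
Proof.
have sB : symm B by case: leave_one_out.
have BA : B *m (A *m delta_mx j 0) = delta_mx j 0 - (G j j)^-1 *: g.
  rewrite /B mulmxBl (isinv_left sA iG); last first.
    by move=> i iJ; rewrite mxE andbT; case: eqP iJ => // ->; rewrite jJ.
  congr (_ - _); rewrite -scalemxAl outer_mul; congr (_ *: _).
  have -> : dot g (A *m delta_mx j 0) = 1; last by rewrite scale1r.
  have [sG G0 AG] := iG.
  rewrite -dot_sym// dotC dot_col /g colE mulmxA -colE mxE AG// eqxx//.
by rewrite /h colE mulmxN BA opprB.
Qed.

(** Schur's formula for a diagonal entry, $1/G_{jj}=A_{jj}-h^TBh$, where [B] does not involve row
    [j] of [A]. *)
Lemma leave_one_out_quad : dot h (B *m h) = A j j - (G j j)^-1.
Proof.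
rewrite leave_one_out_vec dotBr dotZr [X in _ - X]dotC dot_col.
have -> : dot h g = -1; last by rewrite [h j 0]mxE [col j A j 0]mxE mulrN1 opprK addrC.
have [sG G0 AG] := iG.
have : (A *m g) j 0 = 1 by rewrite /g colE mulmxA -colE mxE AG// eqxx.
rewrite mxE dotE /h => <-; rewrite -sumrN; apply: eq_bigr => k _.
by rewrite !mxE (symmE j k sA) mulNr.
Qed.

End LeaveOneOut.

End PartialInverse.

(** * Spectral theorem and trace inequalities *)

Section SpectralTheorem.
Variable R : realType.

(** A real symmetric matrix is hermitian over the complex numbers, where its spectral diagonal is
    real; being a root of the characteristic polynomial then descends to [R]. *)
Lemma symm_eigenvalue n (A : 'M[R]_n.+1) : symm A -> exists a, eigenvalue A a.
Proof.
move=> sA; pose f := real_complex R; pose C := map_mx f A.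
have Ch : C \is hermsymmx.
  apply/is_hermitianmxP; rewrite expr0 scale1r; apply/matrixP => i j; rewrite !mxE.
  rewrite (symmE i j sA); apply/esym/CrealP.
  by rewrite /f complex_real.
have := hermitian_spectral_diag_real Ch.
have /orthomx_spectralP := hermitian_normalmx Ch.
set P := spectralmx C; set D := spectral_diag C => CE /mxOverP Dr.
have Pu : P \in unitmx := spectral_unit C.
have /complex_realP [a aE] := Dr 0 0.
exists a; rewrite eigenvalue_root_char -(fmorph_root f) map_char_poly -eigenvalue_root_char -/C.
apply/eigenvalueP; exists (row 0 P).
  have fa : f a = D 0 0 := esym aE.
  rewrite [X in X *: _](_ : _ = D 0 0)//.
  rewrite -row_mul; have -> : P *m C = diag_mx D *m P.
    by rewrite [in LHS]CE -!mulmxA mulKVmx.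
  by rewrite row_mul row_diag_mx -scalemxAl -rowE.
apply: contraTneq Pu => P0; rewrite -row_free_unit; apply/negP => /row_freeP [B PB].
have := congr1 (row 0) PB; rewrite row_mul P0 mul0mx => /matrixP/(_ 0 0).
by rewrite !mxE eqxx => /eqP; rewrite eq_sym oner_eq0.
Qed.

(** The reflection along [v - e] exchanges the unit vectors [v] and [e]; when they coincide the
    identity does. *)
Lemma householder n (v : 'cV[R]_n.+1) : dot v v = 1 ->
  exists P : 'M[R]_n.+1, [/\ symm P, P *m P = 1%:M & P *m delta_mx 0 0 = v].
Proof.
move=> v1; pose e : 'cV[R]_n.+1 := delta_mx 0 0; pose w := v - e.
have [w0|w0] := eqVneq w 0.
  exists 1%:M; split; [by rewrite /symm trmx1|by rewrite mul1mx|].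
  by rewrite mul1mx; apply/esym/eqP; rewrite -subr_eq0 -/w w0.
have q0 : dot w w != 0 by apply: contra w0 => /eqP/dot_eq0->.
pose c := 2 / dot w w.
pose X := c *: (w *m w^T).
have XX : X *m X = X + X.
  rewrite /X -scalemxAl -scalemxAr mulmxA outer_mul -scalemxAl !scalerA -scalerDl.
  by congr (_ *: _); rewrite /c; field.
exists (1%:M - X); split.
- by apply: symmB; [rewrite /symm trmx1|apply: symmZ; exact: symm_outer].
- by rewrite mulmxBl mul1mx mulmxBr mulmx1 XX opprB addrK subrK.
rewrite mulmxBl mul1mx /X -scalemxAl outer_mul scalerA.
have ee : dot e e = 1 by rewrite dot_col mxE !eqxx.
have we : dot w e = dot v e - 1 by rewrite /w dotBl ee.
have ww : dot w w = 2 - 2 * dot v e.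
  by rewrite /w dotBl !dotBr v1 ee (dotC e v); ring.
have -> : c * dot w e = - 1.
  rewrite /c we ww; field.
  by move: q0; rewrite ww; apply: contra => /eqP h; apply/eqP; lra.
by rewrite scaleN1r opprK /w addrC subrK.
Qed.

(** Deflation: a reflection moves an eigenvector to the first basis vector, symmetry makes the
    conjugated matrix block diagonal, and the induction treats the smaller block. *)
Theorem spectral_theorem n (A : 'M[R]_n) : symm A ->
  exists Q : 'M[R]_n, exists dd : 'rV[R]_n,
    [/\ Q *m Q^T = 1%:M, Q^T *m Q = 1%:M & A = Q^T *m diag_mx dd *m Q].
Proof.
elim: n A => [|n IH] A sA.
  exists 1%:M, 0; split; try by rewrite trmx1 mulmx1.
  by apply/matrixP => -[].
have [a /eigenvalueP [z zA z0]] := symm_eigenvalue sA.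
pose u := z^T.
have Au : A *m u = a *: u by rewrite /u -[in LHS]sA -trmx_mul zA linearZ.
have u0 : u != 0 by apply: contra z0 => /eqP h; rewrite -[z]trmxK -/u h trmx0.
have qu : 0 < dot u u.
  by rewrite lt_def dot_ge0 andbT; apply: contra u0 => /eqP/dot_eq0->.
pose v := (Num.sqrt (dot u u))^-1 *: u.
have v1 : dot v v = 1.
  rewrite /v dotZl dotZr mulrA -expr2 exprVn sqr_sqrtr ?dot_ge0// mulVf//.
  by rewrite gt_eqF.
have Av : A *m v = a *: v by rewrite /v -scalemxAr Au !scalerA mulrC.
have [P [sP PP Pe]] := householder v1.
pose B := P *m A *m P.
have sB : symm B by rewrite /symm !trmx_mul sP sA mulmxA.
have Be : B *m delta_mx 0 0 = a *: delta_mx 0 (0 : 'I_1).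
  rewrite /B -mulmxA Pe -mulmxA Av -scalemxAr; congr (_ *: _).
  by rewrite -Pe mulmxA PP mul1mx.
have AB : A = P *m B *m P by rewrite /B !mulmxA PP mul1mx -mulmxA PP mulmx1.
clearbody B.
have B0 i : B i 0 = a * (i == 0)%:R.
  by have := congr1 (fun M : 'cV[R]_n.+1 => M i 0) Be; rewrite -colE mxE => ->; rewrite !mxE andbT.
pose B' : 'M[R]_n := drsubmx (B : 'M[R]_(1 + n)).
have sB' : symm B'.
  by apply/matrixP => i j; rewrite !mxE (symmE _ _ sB).
have BE : (B : 'M[R]_(1 + n)) = block_mx a%:M 0 0 B'.
  have rs (j : 'I_n) : (rshift 1 j == 0 :> 'I_n.+1) = false by [].
  rewrite -[B in LHS](@submxK _ 1 n 1 n) /B'; congr block_mx.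
  - apply/matrixP => i j; rewrite !ord1 !mxE lshift0 B0 eqxx mulr1 mulr1n//.
  - apply/matrixP => i j; rewrite ord1 !mxE (symmE _ _ sB) lshift0 B0.
    by rewrite rs mulr0.
  - by apply/matrixP => i j; rewrite ord1 !mxE lshift0 B0 rs mulr0.
have [Q' [d' [q1 q2 q3]]] := IH B' sB'.
pose Q0 : 'M[R]_(1 + n) := block_mx 1%:M 0 0 Q'.
have Q0T : Q0^T = block_mx 1%:M 0 0 Q'^T by rewrite /Q0 tr_block_mx !trmx0 trmx1.
exists (Q0 *m P), (row_mx a%:M d' : 'rV_(1 + n)).
have e1 : Q0 *m Q0^T = 1%:M.
  by rewrite Q0T mulmx_block !mulmx0 !mul0mx !mulmx1 !addr0 !add0r q1 -scalar_mx_block.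
have e2 : Q0^T *m Q0 = 1%:M.
  by rewrite Q0T mulmx_block !mulmx0 !mul0mx !mulmx1 !addr0 !add0r q2 -scalar_mx_block.
split.
- by rewrite trmx_mul sP mulmxA -(mulmxA Q0 P P) PP mulmx1.
- by rewrite trmx_mul sP mulmxA -(mulmxA P Q0^T Q0) e2 mulmx1.
have core : (B : 'M[R]_(1 + n)) = Q0^T *m diag_mx (row_mx a%:M d' : 'rV_(1 + n)) *m Q0.
  rewrite BE diag_mx_row Q0T !mulmx_block !(mulmx0, mul0mx, mulmx1, mul1mx, addr0, add0r) -q3.
  congr block_mx; apply/matrixP => i j; rewrite !ord1 !mxE.
  by rewrite !mulr1n.
by rewrite AB trmx_mul sP [in LHS]core -!mulmxA.
Qed.

End SpectralTheorem.

(** * Functional calculus, Klein's inequality and rank-one updates *)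

Section SpectralCalculus.
Variables (R : realType) (N : nat).
Implicit Types (A X Y : 'M[R]_N) (v w : 'cV[R]_N).

(** Functional calculus: the matrix whose eigenvectors are the rows of an orthogonal [Q], with
    eigenvalues [g]. *)
Definition fm (Q : 'M[R]_N) (g : 'I_N -> R) : 'M[R]_N := Q^T *m diag_mx (\row_k g k) *m Q.
Definition diagonalizes Q (dd : 'I_N -> R) A :=
  [/\ Q *m Q^T = 1%:M, Q^T *m Q = 1%:M & A = fm Q dd].

Lemma symm_diagonalizes A : symm A -> exists Q dd, diagonalizes Q dd A.
Proof.
move=> /spectral_theorem [Q [dd [q1 q2 q3]]]; exists Q, (dd 0); split => //.
by rewrite q3 /fm; congr (_ *m diag_mx _ *m _); apply/rowP => i; rewrite mxE.
Qed.

Section Basis.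
Variables (Q : 'M[R]_N).
Hypotheses (QQ : Q *m Q^T = 1%:M) (QtQ : Q^T *m Q = 1%:M).

Lemma fmM g h : fm Q g *m fm Q h = fm Q (fun k => g k * h k).
Proof.
rewrite /fm !mulmxA -(mulmxA _ Q Q^T) QQ mulmx1 -(mulmxA Q^T) mulmx_diag.
by congr (_ *m diag_mx _ *m _); apply/rowP => i; rewrite !mxE.
Qed.

Lemma fmD g h : fm Q g + fm Q h = fm Q (fun k => g k + h k).
Proof.
rewrite /fm -mulmxDl -mulmxDr -raddfD/=.
by congr (_ *m diag_mx _ *m _); apply/rowP => i; rewrite !mxE.
Qed.

Lemma fmZ a g : a *: fm Q g = fm Q (fun k => a * g k).
Proof.
rewrite /fm scalemxAl scalemxAr -linearZ/=.
by congr (_ *m diag_mx _ *m _); apply/rowP => i; rewrite !mxE.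
Qed.

Lemma fm_const c : fm Q (fun=> c) = c%:M.
Proof.
rewrite /fm; have -> : diag_mx (\row_k c) = c%:M :> 'M[R]_N.
  by apply/matrixP => i j; rewrite !mxE.
by rewrite mul_mx_scalar -scalemxAl QtQ scalemx1.
Qed.

Lemma fmX g p : (fm Q g) ^+ p = fm Q (fun k => g k ^+ p).
Proof.
elim: p => [|p IH]; first by rewrite expr0 fm_const.
rewrite exprS IH -mulmxE fmM; congr fm; apply/funext => k; by rewrite exprS.
Qed.

Lemma dot_fm g v w : dot v (fm Q g *m w) = \sum_k g k * ((Q *m v) k 0 * (Q *m w) k 0).
Proof.
rewrite /fm -!mulmxA -[X in X *m (_ *m _)]trmxK.
have -> : dot v (Q^T^T^T *m (diag_mx (\row_k g k) *m (Q *m w))) =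
   dot (Q *m v) (diag_mx (\row_k g k) *m (Q *m w)) by rewrite trmxK dot_mxl.
rewrite dotE; apply: eq_bigr => k _; rewrite mul_diag_mx !mxE; ring.
Qed.

Lemma dot_basis v : \sum_k ((Q *m v) k 0) ^+ 2 = dot v v.
Proof.
have <- : dot (Q *m v) (Q *m v) = dot v v by rewrite dot_mxl mulmxA QtQ mul1mx.
by rewrite dotE; apply: eq_bigr => k _; rewrite expr2.
Qed.

Lemma tr_fm g : \tr (fm Q g) = \sum_k g k.
Proof.
rewrite /fm mxtrace_mulC mulmxA QQ mul1mx; apply: eq_bigr => k _.
by rewrite !mxE eqxx mulr1n.
Qed.

Lemma fm_entry g j : (fm Q g) j j = \sum_k g k * (Q k j) ^+ 2.
Proof.
rewrite -dot_delta dot_fm; apply: eq_bigr => k _.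
by rewrite -colE mxE expr2.
Qed.

Lemma fm_eig g k : dot (Q^T *m delta_mx k 0) (fm Q g *m (Q^T *m delta_mx k 0)) = g k.
Proof.
rewrite dot_fm mulmxA QQ mul1mx (bigD1 k)//= big1 ?addr0.
  by rewrite mxE !eqxx !mulr1.
by move=> i ik; rewrite mxE (negbTE ik) mul0r mulr0.
Qed.

Lemma psd_fm g : psd (fm Q g) -> forall k, 0 <= g k.
Proof. by move=> pg k; rewrite -(fm_eig g k). Qed.

Lemma fm_le_norm g b : (forall k, g k <= b) -> le_norm (fm Q g) b.
Proof.
move=> gb v; rewrite dot_fm -dot_basis mulr_sumr; apply: ler_sum => k _.
by rewrite -expr2 ler_wpM2r// sqr_ge0.
Qed.

End Basis.

(** The graph of $t^{p+1}$ on $t\ge0$ lies above its tangent at [b]; the induction multiplies by [a]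
    and gains $(p+1)(a-b)^2b^p$. *)
Lemma power_tangent (p : nat) (a b : R) : 0 <= a -> 0 <= b ->
  b ^+ p.+1 + p.+1%:R * (a - b) * b ^+ p <= a ^+ p.+1.
Proof.
move=> a0 b0; elim: p => [|p IH]; first by rewrite !expr1 expr0; lra.
have := ler_wpM2l a0 IH; rewrite -exprS; apply: le_trans.
rewrite [b ^+ p.+2]exprS [b ^+ p.+1]exprS -[p.+2%:R]natr1.
have B0 : 0 <= b ^+ p by rewrite exprn_ge0.
have n0 : 0 <= p.+1%:R :> R by [].
have : 0 <= p.+1%:R * (a - b) ^+ 2 * b ^+ p by exact: mulr_ge0 (mulr_ge0 n0 (sqr_ge0 _)) B0.
set B := b ^+ p in B0 *; set n := p.+1%:R in n0 * => h.
suff -> : a * (b * B + n * (a - b) * B) =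
   (b * (b * B) + (n + 1) * (a - b) * (b * B)) + n * (a - b) ^+ 2 * B by rewrite lerDl.
by ring.
Qed.

(** In the two eigenbases all traces become sums weighted by the doubly stochastic matrix [W] of
    squared scalar products of eigenvectors, and [power_tangent] holds term by term. *)
Lemma klein X Y p : symm X -> symm Y -> psd X -> psd Y ->
  \tr (Y ^+ p.+1) + p.+1%:R * \tr ((X - Y) *m Y ^+ p) <= \tr (X ^+ p.+1).
Proof.
move=> sX sY pX pY.
have [U [a [u1 u2 XE]]] := symm_diagonalizes sX.
have [V [b [v1 v2 YE]]] := symm_diagonalizes sY.
rewrite XE in pX *; rewrite YE in pY *.
have a0 := psd_fm u1 pX; have b0 := psd_fm v1 pY.
rewrite mulmxBl linearB/= !(fmX v1 v2) (fmM v1) (fmX u1 u2) ![\tr (fm V _)](tr_fm v1) (tr_fm u1).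
pose W i j := (\sum_l U i l * V j l) ^+ 2.
have W0 i j : 0 <= W i j by exact: sqr_ge0.
have WE i j : (U *m V^T) i j = \sum_l U i l * V j l.
  by rewrite mxE; apply: eq_bigr => l _; rewrite mxE.
have Wr i : \sum_j W i j = 1.
  have : ((U *m V^T) *m (U *m V^T)^T) i i = 1.
    by rewrite trmx_mul trmxK -mulmxA (mulmxA V^T) v2 mul1mx u1 mxE eqxx.
  by rewrite mxE => <-; apply: eq_bigr => j _; rewrite [X in _ * X]mxE WE /W expr2.
have Wc j : \sum_i W i j = 1.
  have : ((U *m V^T)^T *m (U *m V^T)) j j = 1.
    by rewrite trmx_mul trmxK -mulmxA (mulmxA U^T) u2 mul1mx v1 mxE eqxx.
  by rewrite mxE => <-; apply: eq_bigr => i _; rewrite [X in X * _]mxE WE /W expr2.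
have trXY g : \tr (fm U a *m fm V g) = \sum_i \sum_j W i j * (a i * g j).
  have -> : \tr (fm U a *m fm V g) = \tr (V *m fm U a *m V^T *m diag_mx (\row_k g k)).
    by rewrite [fm V g]/fm !mulmxA [LHS]mxtrace_mulC !mulmxA.
  rewrite exchange_big/=; apply: eq_bigr => j _.
  rewrite mul_mx_diag [LHS]mxE [X in _ * X]mxE.
  have -> : (V *m fm U a *m V^T) j j = \sum_i a i * W i j.
    rewrite -dot_delta -(mulmxA (V *m fm U a)) -(mulmxA V) -[X in dot _ (X *m _)]trmxK -dot_mxl dot_fm.
    by apply: eq_bigr => i _; rewrite mulmxA -colE mxE WE /W expr2.
  by rewrite mulr_suml; apply: eq_bigr => i _; ring.
rewrite trXY.
have -> : \sum_k a k ^+ p.+1 = \sum_i \sum_j W i j * a i ^+ p.+1.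
  by apply: eq_bigr => i _; rewrite -mulr_suml Wr mul1r.
have sb g : \sum_k g k = \sum_i \sum_j W i j * g j.
  by rewrite exchange_big/=; apply: eq_bigr => j _; rewrite -mulr_suml Wc mul1r.
rewrite (sb (fun k => b k ^+ p.+1)) (sb (fun k => b k * b k ^+ p)) -sumrB mulr_sumr -big_split/=.
apply: ler_sum => i _; rewrite -sumrB mulr_sumr -big_split/=; apply: ler_sum => j _.
apply: le_trans (ler_wpM2l (W0 i j) (power_tangent p (a0 i) (b0 j))).
by rewrite le_eqVlt; apply/orP; left; apply/eqP; rewrite !exprS; ring.
Qed.

(** Chebyshev's sum inequality, by expanding the nonnegative double sum of
    $w_iw_j(f_i-f_j)(g_i-g_j)$. *)
Lemma chebyshev_sum (w f g : 'I_N -> R) : (forall k, 0 <= w k) ->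
  (forall i j, 0 <= (f i - f j) * (g i - g j)) ->
  (\sum_k f k * w k) * (\sum_k g k * w k) <= (\sum_k w k) * (\sum_k f k * g k * w k).
Proof.
move=> w0 fg.
have : 0 <= \sum_i \sum_j w i * w j * ((f i - f j) * (g i - g j)).
  by apply: sumr_ge0 => i _; apply: sumr_ge0 => j _; exact: mulr_ge0 (mulr_ge0 (w0 i) (w0 j)) (fg i j).
have -> : \sum_i \sum_j w i * w j * ((f i - f j) * (g i - g j)) =
  2 * ((\sum_k w k) * (\sum_k f k * g k * w k) - (\sum_k f k * w k) * (\sum_k g k * w k)).
  transitivity (\sum_i \sum_j (w j * (f i * g i * w i)) + \sum_i \sum_j (w i * (f j * g j * w j))
    - (\sum_i \sum_j (f i * w i * (g j * w j)) + \sum_i \sum_j (f j * w j * (g i * w i)))).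
    rewrite -!big_split/= -sumrB; apply: eq_bigr => i _; rewrite -!big_split/= -sumrB.
    by apply: eq_bigr => j _; ring.
  have -> : \sum_i \sum_j (w j * (f i * g i * w i)) = (\sum_k w k) * (\sum_k f k * g k * w k).
    by rewrite mulr_sumr; apply: eq_bigr => i _; rewrite mulr_suml.
  have -> : \sum_i \sum_j (w i * (f j * g j * w j)) = (\sum_k w k) * (\sum_k f k * g k * w k).
    by rewrite mulr_suml; apply: eq_bigr => i _; rewrite mulr_sumr.
  have -> : \sum_i \sum_j (f i * w i * (g j * w j)) = (\sum_k f k * w k) * (\sum_k g k * w k).
    by rewrite mulr_suml; apply: eq_bigr => i _; rewrite mulr_sumr.
  have -> : \sum_i \sum_j (f j * w j * (g i * w i)) = (\sum_k f k * w k) * (\sum_k g k * w k).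
    by rewrite mulr_sumr; apply: eq_bigr => i _; rewrite mulr_suml.
  by ring.
by rewrite pmulr_rge0// subr_ge0.
Qed.

(** Inside this form the rank-one part acts at most like the scalar [c1]. It does not commute with
    [A], so the induction carries an extra factor [A ^+ i]: each rank-one factor splits the form
    into a product of two, and Chebyshev's inequality merges the resulting forms in [A] again. *)
Lemma rank_one_power A w th c1 q : symm A -> psd A -> 0 <= th -> th * dot w w <= c1 ->
  dot w ((A + th *: (w *m w^T)) ^+ q *m w) <= dot w ((A + c1%:M) ^+ q *m w).
Proof.
move=> sA pA th0 thc.
have [Q [a [u1 u2 AE]]] := symm_diagonalizes sA.
have a0 : forall k, 0 <= a k by apply: (psd_fm u1); rewrite -AE.
set X := A + th *: _.
have ww0 := dot_ge0 w.
have c0 : 0 <= c1 by apply: le_trans thc; rewrite mulr_ge0.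
have AcE : A + c1%:M = fm Q (fun k => a k + c1) by rewrite AE -(fm_const u2) fmD.
suff H i : dot w (A ^+ i *m (X ^+ q *m w)) <= dot w (A ^+ i *m ((A + c1%:M) ^+ q *m w)).
  by have := H 0%N; rewrite expr0 !mul1mx.
elim: q i => [|q IH] i; first by rewrite !expr0.
have e1 : dot w (A ^+ i *m (X ^+ q.+1 *m w)) =
   dot w (A ^+ i.+1 *m (X ^+ q *m w)) + th * (dot w (X ^+ q *m w) * dot w (A ^+ i *m w)).
  rewrite exprS -mulmxE -mulmxA /X mulmxDl mulmxDr dotDr; congr (_ + _).
    by rewrite exprSr -mulmxE -mulmxA.
  by rewrite -scalemxAl outer_mul -!scalemxAr !dotZr.
rewrite e1.
have e2 : dot w (A ^+ i *m ((A + c1%:M) ^+ q.+1 *m w)) =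
  dot w (A ^+ i.+1 *m ((A + c1%:M) ^+ q *m w)) + c1 * dot w (A ^+ i *m ((A + c1%:M) ^+ q *m w)).
  rewrite exprS -mulmxE -mulmxA mulmxDl mulmxDr dotDr; congr (_ + _).
    by rewrite exprSr -mulmxE -mulmxA.
  by rewrite mul_scalar_mx -scalemxAr dotZr.
rewrite e2; apply: lerD; first exact: IH.
have Ai : A ^+ i = fm Q (fun k => a k ^+ i) by rewrite AE fmX.
have Bq : (A + c1%:M) ^+ q = fm Q (fun k => (a k + c1) ^+ q) by rewrite AcE fmX.
pose z k := ((Q *m w) k 0) ^+ 2.
have z0 k : 0 <= z k := sqr_ge0 _.
have zz : \sum_k z k = dot w w := dot_basis u2 w.
have d1 : dot w (A ^+ i *m w) = \sum_k a k ^+ i * z k by rewrite Ai dot_fm.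
have d2 : dot w ((A + c1%:M) ^+ q *m w) = \sum_k (a k + c1) ^+ q * z k by rewrite Bq dot_fm.
have d3 : dot w (A ^+ i *m ((A + c1%:M) ^+ q *m w)) = \sum_k a k ^+ i * (a k + c1) ^+ q * z k.
  by rewrite mulmxA Ai Bq (fmM u1) dot_fm.
have IH0 := IH 0%N; rewrite expr0 !mul1mx in IH0.
have dA0 : 0 <= dot w (A ^+ i *m w) by rewrite d1 sumr_ge0// => k _; rewrite mulr_ge0// exprn_ge0.
have ac0 k : 0 <= a k + c1 by rewrite addr_ge0.
apply: (@le_trans _ _ (th * (dot w ((A + c1%:M) ^+ q *m w) * dot w (A ^+ i *m w)))).
  by rewrite ler_wpM2l// ler_wpM2r.
apply: (@le_trans _ _ (th * dot w w * dot w (A ^+ i *m ((A + c1%:M) ^+ q *m w)))).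
  rewrite -mulrA ler_wpM2l// d1 d2 d3 -zz mulrC; apply: chebyshev_sum => // k l.
  have [kl|/ltW kl] := leP (a k) (a l).
    apply: mulr_le0; rewrite subr_le0; first by apply: lerXn2r; rewrite ?nnegrE.
    by apply: lerXn2r; rewrite ?nnegrE// lerD2r.
  apply: mulr_ge0; rewrite subr_ge0; first by apply: lerXn2r; rewrite ?nnegrE.
  by apply: lerXn2r; rewrite ?nnegrE// lerD2r.
rewrite ler_wpM2r// d3 sumr_ge0// => k _.
by rewrite mulr_ge0// mulr_ge0// exprn_ge0.
Qed.

Lemma psd_exp A p : symm A -> psd A -> psd (A ^+ p).
Proof.
move=> sA pA; have [Q [a [u1 u2 AE]]] := symm_diagonalizes sA.
have a0 : forall k, 0 <= a k by apply: (psd_fm u1); rewrite -AE.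
move=> v; rewrite AE fmX// dot_fm sumr_ge0// => k _.
by rewrite -expr2 mulr_ge0 ?sqr_ge0// exprn_ge0.
Qed.

Lemma symm_exp A p : symm A -> symm (A ^+ p).
Proof.
move=> sA; elim: p => [|p IH]; first by rewrite expr0 /symm trmx1.
by rewrite exprS /symm -mulmxE trmx_mul IH sA mulmxE -exprSr exprS.
Qed.

Lemma tr_exp_ge0 A p : symm A -> psd A -> 0 <= \tr (A ^+ p).
Proof. by move=> sA pA; apply: sumr_ge0 => k _; exact/diag_ge0/psd_exp. Qed.

Lemma norm_of_tr A p b : symm A -> psd A -> 0 <= b -> \tr (A ^+ p.+1) <= b ^+ p.+1 -> le_norm A b.
Proof.
move=> sA pA b0 trb; have [Q [a [u1 u2 AE]]] := symm_diagonalizes sA.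
have a0 : forall k, 0 <= a k by apply: (psd_fm u1); rewrite -AE.
rewrite AE; apply: fm_le_norm => // k.
rewrite leNgt; apply/negP => bk; move: trb; rewrite AE fmX// tr_fm//.
rewrite leNgt => /negP; apply.
rewrite (bigD1 k)//=; apply: ltr_wpDr; last by rewrite ltrXn2r// nnegrE.
by rewrite sumr_ge0// => i _; rewrite exprn_ge0.
Qed.

End SpectralCalculus.

(** * Leave-one-out equations for the resolvent *)

Section StaticEquations.
Variables (R : realType) (N : nat).
Implicit Types (B G H : 'M[R]_N) (D m z : 'I_N -> R) (J : {set 'I_N}) (S : 'I_N -> 'I_N -> R).

Definition AD D H : 'M[R]_N := \matrix_(i, j) ((i == j)%:R * D i - H i j).
Definition qform H j B := \sum_k \sum_l B k l * (H j k * H j l).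
Definition trS S j B : R := \sum_k B k k * S j k.
(** The form in [B] governs the Schur complement, hence $G_{jj}$; the form in $B^2$ governs the
    squared row norm $\sum_k G_{jk}^2$. *)
Definition conc S H D J j (del : R) := let B := Gm (AD D H) (J :\ j)%SET in
  [/\ `|H j j| <= del, `|qform H j B - trS S j B| <= del &
      `|qform H j (B *m B) - trS S j (B *m B)| <= del].

Lemma AD_symm D H : symm H -> symm (AD D H).
Proof.
move=> sH; apply/matrixP => i j; rewrite !mxE (symmE j i sH) eq_sym.
by case: eqP => [->|_] //; rewrite !mul0r.
Qed.

Lemma qform_dot D H B j : symm H -> (forall k, B j k = 0) -> (forall k, B k j = 0) ->
  qform H j B = dot (- col j (AD D H)) (B *m - col j (AD D H)).
Proof.
move=> sH B1 B2; rewrite dotE /qform; apply: eq_bigr => k _.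
have [->|kj] := eqVneq k j.
  rewrite [(B *m _) j 0]mxE !big1 ?mulr0// => l _; by rewrite B1 mul0r.
rewrite [(B *m _) k 0]mxE mulr_sumr; apply: eq_bigr => l _.
have [->|lj] := eqVneq l j; first by rewrite B2 !mul0r mulr0.
rewrite !mxE (negbTE kj) (negbTE lj) (symmE k j sH) (symmE l j sH) /= mulr0n; ring.
Qed.

Section Loop.
Variables (S : 'I_N -> 'I_N -> R) (H : 'M[R]_N) (D : 'I_N -> R) (J : {set 'I_N}) (G : 'M[R]_N).
Variables (K b del : R).
Hypotheses (sH : symm H) (iG : isinv J (AD D H) G) (pG : psd G).
Hypotheses (b0 : 0 < b) (nG : le_norm G b) (S0 : forall j k, 0 <= S j k <= K).
Let A := AD D H.
Let sA : symm A := AD_symm D sH.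
Let sG : symm G. Proof. by case: iG. Qed.
Let g j := G j j.
Let v j := \sum_k (G j k) ^+ 2.

Lemma diag_inv_gt0 j : j \in J -> 0 < g j.
Proof.
move=> jJ; rewrite lt_def diag_ge0// andbT; apply/eqP => gj.
have := psd_sq (delta_mx j 0) sG pG nG; rewrite dot_delta -/(g j) gj mulr0 => h.
have /dot_eq0 Gz : dot (G *m delta_mx j 0) (G *m delta_mx j 0) = 0.
  by apply/eqP; rewrite eq_le h dot_ge0.
have [_ _ AG] := iG; have := AG j j jJ.
have -> : (AD D H *m G) j j = (AD D H *m (G *m delta_mx j (0 : 'I_1))) j 0.
  by rewrite mulmxA -colE [RHS]mxE.
by rewrite Gz mulmx0 mxE eqxx => /eqP; rewrite eq_sym oner_eq0.
Qed.

Lemma row_sq_le j : v j <= b * g j.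
Proof. by rewrite /v sq_entry//; have := psd_sq (delta_mx j 0) sG pG nG; rewrite dot_delta. Qed.

Variable j : 'I_N.
Hypotheses (jJ : j \in J) (cj : conc S H D J j del).
Let B := Gm A (J :\ j)%SET.
Let gj0 : 0 < G j j. Proof. exact: diag_inv_gt0. Qed.

Let BE : B = G - (G j j)^-1 *: (col j G *m (col j G)^T).
Proof. exact: Gm_eq sA (leave_one_out iG gj0). Qed.
Let iB : isinv (J :\ j)%SET A B.
Proof. by rewrite BE; exact: leave_one_out iG gj0. Qed.
Let Bentry k l : B k l = G k l - (g j)^-1 * (G k j * G l j).
Proof. by rewrite BE !mxE big_ord1 !mxE. Qed.
Let sB : symm B. Proof. by case: iB. Qed.
Let Bj0 k : B j k = 0. Proof. by case: iB => _ B0 _; rewrite B0// !inE eqxx. Qed.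
Let B0j k : B k j = 0. Proof. by rewrite (symmE k j sB). Qed.
Let BBj0 k : (B *m B) j k = 0.
Proof. by rewrite mxE big1// => l _; rewrite Bj0 mul0r. Qed.
Let BB0j k : (B *m B) k j = 0.
Proof. by rewrite mxE big1// => l _; rewrite B0j mulr0. Qed.
Let K0 : 0 <= K. Proof. by have /andP[] := S0 j j; exact: le_trans. Qed.
Let vE : v j = \sum_k (G k j) ^+ 2.
Proof. by apply: eq_bigr => k _; rewrite (symmE j k sG). Qed.

(** Schur's formula with the form of row [j] replaced by its mean. Passing from the minor [B] to [G]
    in that mean costs [K * b], since $\sum_k G_{jk}^2\le bG_{jj}$. *)
Lemma resolvent_loop : `|(g j)^-1 - (D j - \sum_k S j k * g k)| <= 2 * del + K * b.
Proof.
have [c1 c2 _] := cj; rewrite -/A -/B in c2.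
have q : qform H j B = A j j - (g j)^-1.
  by rewrite (qform_dot D)// BE (leave_one_out_quad sA iG jJ gj0).
have Aj : A j j = D j - H j j by rewrite mxE eqxx mul1r.
have e : \sum_k S j k * g k - trS S j B = (g j)^-1 * \sum_k S j k * (G k j) ^+ 2.
  rewrite /trS -sumrB mulr_sumr; apply: eq_bigr => k _.
  by rewrite Bentry /g expr2; ring.
have e0 : 0 <= (g j)^-1 * \sum_k S j k * (G k j) ^+ 2.
  rewrite mulr_ge0 ?invr_ge0 ?(ltW gj0)// sumr_ge0// => k _.
  by rewrite mulr_ge0 ?sqr_ge0//; have /andP[] := S0 j k.
have e1 : (g j)^-1 * \sum_k S j k * (G k j) ^+ 2 <= K * b.
  rewrite mulrC ler_pdivrMr//; apply: (@le_trans _ _ (K * v j)).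
    rewrite vE mulr_sumr; apply: ler_sum => k _.
    by rewrite ler_wpM2r ?sqr_ge0//; have /andP[] := S0 j k.
  by rewrite -mulrA ler_wpM2l// row_sq_le.
move: c1 c2; rewrite q Aj !ler_norml => /andP[? ?] /andP[? ?].
by apply/andP; split; lra.
Qed.

(** From $Ge_j=G_{jj}(e_j+Bh)$ follows $v_j/G_{jj}^2=1+|Bh|^2$. Expanding the square of
    $B=G-G_{jj}^{-1}gg^T$ leaves a cross term of size $2b^2$ and a last term of size $b^2$. *)
Lemma resolvent_sq_loop :
  `|v j / (g j) ^+ 2 - (1 + \sum_k S j k * v k)| <= del + K * (3 * b ^+ 2).
Proof.
have [_ _ c3] := cj; rewrite -/A -/B in c3.
have q : qform H j (B *m B) = v j / (g j) ^+ 2 - 1.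
  rewrite (qform_dot D)// -mulmxA -dot_sym// BE (leave_one_out_vec sA iG jJ gj0).
  rewrite !(dotBl, dotBr) !(dotZl, dotZr) [dot (col j G) (delta_mx j 0)]dotC !dot_col.
  rewrite !mxE !eqxx /=.
  have -> : dot (col j G) (col j G) = v j.
    by rewrite dotE vE; apply: eq_bigr => k _; rewrite mxE expr2.
  by rewrite /g; field; rewrite gt_eqF.
pose u := G *m col j G.
have BBE k : (B *m B) k k = (G *m G) k k - 2 * (g j)^-1 * (u k 0 * G k j) + (g j)^-1 ^+ 2 * v j * (G k j) ^+ 2.
  rewrite mxE [(G *m G) k k]mxE.
  transitivity (\sum_l (G k l * G l k - 2 * (g j)^-1 * (G k l * G l j * G k j) + (g j)^-1 ^+ 2 * (G k j) ^+ 2 * (G l j) ^+ 2)).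
    apply: eq_bigr => l _; rewrite !Bentry (symmE l k sG); ring.
  rewrite big_split/= sumrB -!mulr_sumr -vE.
  congr (_ + _); last by ring.
  congr (_ - _ * _); rewrite /u mxE mulr_suml; apply: eq_bigr => l _.
  by rewrite mxE.
have GGE k : (G *m G) k k = v k by rewrite sq_diag.
have vb : v j / g j <= b by rewrite ler_pdivrMr// row_sq_le.
have v0 : 0 <= v j by apply: sumr_ge0 => k _; exact: sqr_ge0.
have uu : dot u u <= b ^+ 2 * v j.
  apply: (le_trans (psd_sq_norm _ (ltW b0) sG pG nG)).
  rewrite dotE vE; apply: ler_wpM2l; first exact: sqr_ge0.
  by apply: ler_sum => k _; rewrite mxE expr2.
have gi0 : 0 <= (g j)^-1 by rewrite invr_ge0 ltW.
have cross : \sum_k `|u k 0 * G k j| <= b * v j.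
  apply: (@le_trans _ _ (\sum_k ((u k 0) ^+ 2 / b + b * (G k j) ^+ 2) / 2)).
    apply: ler_sum => k _; rewrite normrM.
    have h : 0 <= (`|u k 0| - b * `|G k j|) ^+ 2 / b by rewrite divr_ge0 ?sqr_ge0// ltW.
    rewrite -(real_normK (num_real (u k 0))) -(real_normK (num_real (G k j))).
    have : (`|u k 0| - b * `|G k j|) ^+ 2 / b = `|u k 0| ^+ 2 / b - 2 * (`|u k 0| * `|G k j|) + b * `|G k j| ^+ 2.
      by field; rewrite gt_eqF.
    lra.
  rewrite -mulr_suml big_split/= -mulr_suml -mulr_sumr -vE.
  have -> : \sum_k (u k 0) ^+ 2 = dot u u by rewrite dotE; apply: eq_bigr => k _; rewrite expr2.
  have : dot u u / b <= b * v j by rewrite ler_pdivrMr// mulrAC -expr2.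
  lra.
have diff : `|trS S j (B *m B) - \sum_k S j k * v k| <= K * (3 * b ^+ 2).
  rewrite /trS -sumrB.
  apply: (@le_trans _ _ (\sum_k K * (2 * (g j)^-1 * `|u k 0 * G k j| + (g j)^-1 ^+ 2 * v j * (G k j) ^+ 2))).
    apply: (le_trans (ler_norm_sum _ _ _)); apply: ler_sum => k _.
    have /andP[s0 s1] := S0 j k.
    have -> : (B *m B) k k * S j k - S j k * v k =
      S j k * (- (2 * (g j)^-1 * (u k 0 * G k j)) + (g j)^-1 ^+ 2 * v j * (G k j) ^+ 2).
      by rewrite BBE GGE; ring.
    rewrite normrM ger0_norm//; apply: ler_pM => //.
    apply: (le_trans (ler_normD _ _)); rewrite normrN lerD//.
      by rewrite normrM ger0_norm// mulr_ge0.
    by rewrite ger0_norm//; apply: mulr_ge0; [apply: mulr_ge0 => //|]; exact: sqr_ge0.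
  rewrite -mulr_sumr big_split/= -!mulr_sumr -vE ler_wpM2l//.
  have h1 : 2 * (g j)^-1 * \sum_k `|u k 0 * G k j| <= 2 * b ^+ 2.
    apply: (@le_trans _ _ (2 * (g j)^-1 * (b * v j))); first by rewrite ler_wpM2l// mulr_ge0.
    have -> : 2 * (g j)^-1 * (b * v j) = 2 * b * (v j / g j) by ring.
    have -> : 2 * b ^+ 2 = 2 * b * b by ring.
    by rewrite ler_wpM2l// mulr_ge0// ltW.
  have h2 : (g j)^-1 ^+ 2 * v j * v j <= b ^+ 2.
    rewrite (_ : (g j)^-1 ^+ 2 * v j * v j = (v j / g j) ^+ 2); last by rewrite exprMn expr2; ring.
    by apply: lerXn2r; rewrite ?nnegrE ?(ltW b0)// divr_ge0// ltW.
  lra.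
move: c3 diff; rewrite q !ler_norml => /andP[? ?] /andP[? ?].
by apply/andP; split; lra.
Qed.

End Loop.

(** * Maximum principles for the two leave-one-out equations *)

Section Comparison.
Variables (S : 'I_N -> 'I_N -> R) (D : 'I_N -> R) (J : {set 'I_N}) (g v : 'I_N -> R) (e : R).
Hypotheses (S0 : forall j k, 0 <= S j k).
Hypotheses (g0 : forall j, j \in J -> 0 < g j) (v0 : forall j, j \in J -> 0 < v j).
Hypotheses (gJ : forall j, j \notin J -> g j = 0) (vJ : forall j, j \notin J -> v j = 0).
Hypothesis gloop : forall j, j \in J -> `|(g j)^-1 - (D j - \sum_k S j k * g k)| <= e.
Hypothesis vloop : forall j, j \in J -> `|v j / (g j) ^+ 2 - (1 + \sum_k S j k * v k)| <= e.
Hypothesis e1 : e < 1.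

Lemma max_ratio (f : 'I_N -> R) j0 : j0 \in J ->
  exists2 j, j \in J & forall k, k \in J -> f k <= f j.
Proof.
move=> jJ; case: (@Order.TotalTheory.arg_maxP _ _ _ j0 (fun i => i \in J) f jJ) => j jj h.
by exists j.
Qed.

(** Maximum principle with weights [v]. If [g] exceeded [m], then at the index where [(g - m) / v]
    is largest the supersolution bounds $(g-m)/(mg)$ by [th * \sum_k S j k * v k], whereas the
    equation of [v], whose source is at least $1-e>0$, makes this smaller than $(g-m)/g^2$. *)
Lemma loop_upper m : (forall j, j \in J -> 0 < m j) ->
  (forall j, j \in J -> (m j)^-1 + \sum_(k in J) S j k * m k <= D j - e) ->
  forall j, j \in J -> g j <= m j.
Proof.
move=> m0 Hm j0 j0J; rewrite leNgt; apply/negP => mg.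
have [j jJ jmax] := max_ratio (fun i => (g i - m i) / v i) j0J.
set th := (g j - m j) / v j in jmax.
have th0 : 0 < th by apply: lt_le_trans (jmax _ j0J); rewrite divr_gt0 ?v0// subr_gt0.
have gmj : g j - m j = th * v j by rewrite /th divfK// gt_eqF// v0.
have sumJ (f : 'I_N -> R) : (forall i, i \notin J -> f i = 0) -> \sum_k S j k * f k = \sum_(k in J) S j k * f k.
  move=> fJ; rewrite [RHS]big_mkcond; apply: eq_bigr => k _.
  by case: (boolP (k \in J)) => // kJ; rewrite fJ// mulr0.
have h1 : \sum_k S j k * g k - \sum_(k in J) S j k * m k <= th * \sum_k S j k * v k.
  rewrite (sumJ g)// (sumJ v)// -sumrB mulr_sumr; apply: ler_sum => k kJ.
  rewrite -mulrBr mulrCA ler_wpM2l// -ler_pdivrMr ?v0//; exact: jmax.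
have gj := g0 jJ; have mj := m0 _ jJ; have vj := v0 jJ.
have h2 : th * \sum_k S j k * v k < (g j - m j) / (g j) ^+ 2.
  rewrite gmj -mulrA ltr_pM2l//.
  have := vloop jJ; rewrite ler_norml => /andP[h2 _]; move: h2 e1.
  set X := v j / _; set Y := \sum_k _; lra.
have h3 : (m j)^-1 - (g j)^-1 <= \sum_k S j k * g k - \sum_(k in J) S j k * m k.
  have := Hm _ jJ; have := gloop jJ; rewrite ler_norml => /andP[? ?]; lra.
have h4 : (m j)^-1 - (g j)^-1 = (g j - m j) / (m j * g j) by field; rewrite !gt_eqF.
have : (g j - m j) / (m j * g j) < (g j - m j) / (g j) ^+ 2.
  by rewrite -h4; apply: le_lt_trans h2; apply: le_trans h1.
have gm : 0 < g j - m j by rewrite gmj mulr_gt0.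
rewrite ltr_pM2l// ltf_pV2 ?posrE ?mulr_gt0// expr2 ltr_pM2r//.
by lra.
Qed.

(** The same principle with weights [z], now that [g <= m]. The perturbed source [1 + e] against the
    source 1 of [z] bounds the ratio by [1 + e], hence the factor 2. *)
Lemma sq_loop_upper m z : (forall j, j \in J -> 0 < z j) ->
  (forall j, j \in J -> g j <= m j) ->
  (forall j, j \in J -> m j ^+ 2 * (1 + \sum_(k in J) S j k * z k) <= z j) ->
  forall j, j \in J -> v j <= 2 * z j.
Proof.
move=> z0 gm Hz j0 j0J.
have [j jJ jmax] := max_ratio (fun i => v i / z i) j0J.
rewrite -ler_pdivrMr ?z0//; apply: (le_trans (jmax _ j0J)).
set th := v j / z j in jmax *.
have th0 : 0 < th by rewrite divr_gt0 ?v0 ?z0.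
have vE : v j = th * z j by rewrite /th divfK// gt_eqF// z0.
have sumJ : \sum_k S j k * v k = \sum_(k in J) S j k * v k.
  rewrite [RHS]big_mkcond; apply: eq_bigr => k _.
  by case: (boolP (k \in J)) => // kJ; rewrite vJ// mulr0.
have h1 : \sum_k S j k * v k <= th * \sum_(k in J) S j k * z k.
  rewrite sumJ mulr_sumr; apply: ler_sum => k kJ.
  rewrite mulrCA ler_wpM2l// -ler_pdivrMr ?z0//; exact: jmax.
have gj := g0 jJ; have gmj := gm _ jJ; have mj : 0 < m j by exact: lt_le_trans gmj.
have h2 : v j <= (g j) ^+ 2 * (1 + e + \sum_k S j k * v k).
  rewrite mulrC -ler_pdivrMr ?exprn_gt0//.
  have := vloop jJ; rewrite ler_norml => /andP[_ +]; lra.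
have Sv0 : 0 <= \sum_k S j k * v k.
  by rewrite sumJ sumr_ge0// => k kJ; rewrite mulr_ge0// ltW// v0.
have h3 : (g j) ^+ 2 <= (m j) ^+ 2 by apply: lerXn2r => //; rewrite nnegrE ltW.
have e0 : 0 <= e by apply: le_trans (gloop jJ).
have h4 : v j <= (m j) ^+ 2 * (1 + e + th * \sum_(k in J) S j k * z k).
  apply: (le_trans h2); apply: ler_pM => //; first by rewrite sqr_ge0.
    lra.
  by rewrite lerD2l.
have h5 := Hz _ jJ.
have m2 : 0 < (m j) ^+ 2 by rewrite exprn_gt0.
move: h4 h5; set Y := \sum_(k in J) _ => h4 h5.
have : th * z j <= (m j) ^+ 2 * (1 + e) + th * (z j - (m j) ^+ 2).
  rewrite -vE; apply: (le_trans h4); rewrite [leLHS]mulrDr lerD2l.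
  rewrite mulrCA ler_pM2l//; lra.
rewrite mulrBr addrCA addrC -addrA -subr_ge0 => h6.
have : 0 <= (m j) ^+ 2 * (1 + e - th) by lra.
rewrite pmulr_rge0//; move: e1; lra.
Qed.

(** Maximum principle for the deficit [m - g]. The identity $1/g-1/m=(m-g)/(mg)$ together with
    [g <= M] is the origin of the product [m j * M j] in the condition on [z]. *)
Lemma loop_lower m M z e' : (forall j, j \in J -> 0 < m j) -> (forall j, j \in J -> 0 < z j) ->
  (forall j, j \in J -> g j <= M j) -> 0 <= e' ->
  (forall j, j \in J -> D j <= (m j)^-1 + \sum_(k in J) S j k * m k + e') ->
  (forall j, j \in J -> m j * M j * (1 + \sum_(k in J) S j k * z k) <= z j) ->
  forall j, j \in J -> m j - g j <= (e + e') * z j.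
Proof.
move=> m0 z0 gM e'0 HD Hz j0 j0J.
have [j jJ jmax] := max_ratio (fun i => (m i - g i) / z i) j0J.
rewrite -ler_pdivrMr ?z0//; apply: (le_trans (jmax _ j0J)).
set th := (m j - g j) / z j in jmax *.
have e0 : 0 <= e by apply: le_trans (gloop jJ).
have [th0|th0] := leP th 0; first by rewrite (le_trans th0)// addr_ge0.
have rE : m j - g j = th * z j by rewrite /th divfK// gt_eqF// z0.
have sumJ : \sum_k S j k * g k = \sum_(k in J) S j k * g k.
  rewrite [RHS]big_mkcond; apply: eq_bigr => k _.
  by case: (boolP (k \in J)) => // kJ; rewrite gJ// mulr0.
have h1 : \sum_(k in J) S j k * m k - \sum_k S j k * g k <= th * \sum_(k in J) S j k * z k.
  rewrite sumJ -sumrB mulr_sumr; apply: ler_sum => k kJ.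
  rewrite -mulrBr mulrCA ler_wpM2l// -ler_pdivrMr ?z0//; exact: jmax.
have gj := g0 jJ; have mj := m0 _ jJ; have zj := z0 _ jJ; have gMj := gM _ jJ.
have Mj : 0 < M j by exact: lt_le_trans gMj.
have h2 : (g j)^-1 - (m j)^-1 <= th * (\sum_(k in J) S j k * z k) + (e + e').
  have := HD _ jJ; have := gloop jJ; rewrite ler_norml => /andP[? ?]; lra.
set X := th * _ + _ in h2.
have h3 : (g j)^-1 - (m j)^-1 = (m j - g j) / (m j * g j) by field; rewrite !gt_eqF.
have X0 : 0 < X.
  apply: lt_le_trans h2; rewrite h3 divr_gt0 ?mulr_gt0//.
  by rewrite rE mulr_gt0.
have h4 : th * z j <= m j * M j * X.
  apply: (@le_trans _ _ (m j * g j * X)).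
    by rewrite -rE mulrC -ler_pdivrMr ?mulr_gt0// -h3.
  by rewrite ler_wpM2r ?(ltW X0)// ler_wpM2l// ltW.
have h5 := Hz _ jJ.
have mM : 0 < m j * M j by rewrite mulr_gt0.
set Q := m j * M j in h4 h5 mM.
set Y := \sum_(k in J) S j k * z k in X h2 h4 h5 X0 h1.
have h6 : th * z j <= th * (z j - Q) + Q * (e + e').
  apply: (le_trans h4); rewrite /X mulrDr lerD2r mulrCA ler_pM2l//; lra.
have : 0 <= Q * (e + e' - th) by lra.
by rewrite pmulr_rge0//; lra.
Qed.

End Comparison.
End StaticEquations.

(** * Monotonicity of the inverse in the diagonal *)

Section MonotoneInverse.
Variables (R : realType) (N : nat).
Implicit Types (G H A : 'M[R]_N) (D m z : 'I_N -> R) (J : {set 'I_N}).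

Definition dg (f : 'I_N -> R) : 'M[R]_N := \matrix_(i, j) ((i == j)%:R * f i).

Lemma dg_mulE f (v : 'cV[R]_N) i : (dg f *m v) i 0 = f i * v i 0.
Proof.
rewrite mxE (bigD1 i)//= big1 ?addr0; first by rewrite mxE eqxx mul1r.
by move=> k ki; rewrite mxE eq_sym (negbTE ki) mul0r mul0r.
Qed.

Lemma dg_form f (u v : 'cV[R]_N) : dot u (dg f *m v) = \sum_i f i * (u i 0 * v i 0).
Proof. by rewrite dotE; apply: eq_bigr => i _; rewrite dg_mulE; ring. Qed.

Lemma dg_symm f : symm (dg f).
Proof. by apply/matrixP => i j; rewrite !mxE eq_sym; case: eqP => [->|]//; rewrite !mul0r. Qed.

Lemma tr_dg f A : \tr (dg f *m A) = \sum_k f k * A k k.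
Proof.
apply: eq_bigr => k _; rewrite mxE (bigD1 k)//= big1 ?addr0; first by rewrite mxE eqxx mul1r.
by move=> i ik; rewrite mxE eq_sym (negbTE ik) !mul0r.
Qed.

Lemma AD_diff D D' H : AD D' H = AD D H + dg (fun i => D' i - D i).
Proof. by apply/matrixP => i j; rewrite !mxE; ring. Qed.

Lemma supp_sub J J' (v : 'cV[R]_N) : J \subset J' -> supp J v -> supp J' v.
Proof. by move=> /fintype.subsetP sJ sv i iJ; apply: sv; apply: contra iJ; exact: sJ. Qed.

Lemma pd_sub J J' A : J \subset J' -> pd J' A -> pd J A.
Proof. by move=> sJ pA v sv; apply: pA; exact: supp_sub sv. Qed.

Lemma AD_mono J D D' H : (forall i, i \in J -> D i <= D' i) -> pd J (AD D H) -> pd J (AD D' H).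
Proof.
move=> DD pA v sv v0; rewrite (AD_diff D) mulmxDl dotDr ltr_wpDr// ?pA//.
rewrite dg_form sumr_ge0// => i _.
have [iJ|iJ] := boolP (i \in J); last by rewrite sv// mul0r mulr0.
by rewrite mulr_ge0 ?subr_ge0 ?DD// -expr2 sqr_ge0.
Qed.

Section Tilde.
Variables (J : {set 'I_N}) (D D' : 'I_N -> R) (H : 'M[R]_N).
Hypotheses (sH : symm H) (DD : forall i, i \in J -> D i <= D' i) (pA : pd J (AD D H)).
Let G := Gm (AD D H) J.
Let Gt := Gm (AD D' H) J.
Let De := dg (fun i => D' i - D i).
Let iG : isinv J (AD D H) G. Proof. by apply: pd_isinv => //; exact: AD_symm. Qed.
Let pA' : pd J (AD D' H). Proof. exact: AD_mono DD pA. Qed.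
Let iGt : isinv J (AD D' H) Gt. Proof. by apply: pd_isinv => //; exact: AD_symm. Qed.
Let pG : psd G. Proof. exact: pd_psd iG pA. Qed.
Let pGt : psd Gt. Proof. exact: pd_psd iGt pA'. Qed.
Let sG : symm G. Proof. by case: iG. Qed.
Let sGt : symm Gt. Proof. by case: iGt. Qed.

Let form_ge0 (x : 'cV[R]_N) : supp J x -> 0 <= dot x (De *m x).
Proof.
move=> sx; rewrite dg_form sumr_ge0// => i _.
have [iJ|iJ] := boolP (i \in J); last by rewrite sx// mul0r mulr0.
by rewrite mulr_ge0 ?subr_ge0 ?DD// -expr2 sqr_ge0.
Qed.

Lemma inverse_diff : G - Gt = G *m De *m Gt.
Proof.
apply/matrixP => i k.
have : (G - Gt) *m delta_mx k (0 : 'I_1) = (G *m De *m Gt) *m delta_mx k 0.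
  rewrite mulmxBl -!mulmxA.
  rewrite -[X in _ - X](isinv_left (AD_symm D sH) iG (isinv_supp _ iGt)) -mulmxBr.
  apply: (isinv_ext iG) => l lJ.
  have := isinv_mulA (delta_mx k (0 : 'I_1)) iGt lJ.
  rewrite (AD_diff D) mulmxDl -/De mxE => e.
  by rewrite [LHS]mxE [X in _ + X]mxE -e addrC addKr.
by rewrite -!colE => /matrixP/(_ i 0); rewrite !mxE.
Qed.

(** The resolvent identity applied twice writes the difference as a sum of two positive terms. The
    first involves [Gt] alone, the matrix that the next row meets. *)
Let diff2 : G - Gt = Gt *m De *m Gt + Gt *m De *m G *m De *m Gt.
Proof.
have e : G - Gt = Gt *m De *m G.
  have := congr1 trmx inverse_diff; rewrite linearB/= !trmx_mul sG sGt (dg_symm _) => ->.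
  by rewrite mulmxA.
rewrite {1}e -[X in _ *m X = _](subrK Gt) mulmxDr addrC; congr (_ + _).
by rewrite inverse_diff !mulmxA.
Qed.

Lemma inverse_mono : psd (G - Gt).
Proof.
rewrite diff2; apply: psdD => v.
  rewrite -!mulmxA -dot_sym//; apply: form_ge0; exact: isinv_supp iGt.
rewrite -!mulmxA -dot_sym// -dot_sym; last exact: dg_symm.
exact: pG.
Qed.

Lemma tilde_norm b : le_norm G b -> le_norm Gt b.
Proof.
move=> nG v; apply: le_trans (nG v); have := inverse_mono v.
by rewrite mulmxBl dotBr subr_ge0.
Qed.

(** Klein's inequality keeps the first-order gain from raising the diagonal; the second term of
    [diff2] has nonnegative trace against a power of [Gt]. *)
Lemma tr_power_tilde q :
  \tr (Gt ^+ q.+1) + q.+1%:R * (\sum_k (D' k - D k) * (Gt ^+ q.+2) k k) <= \tr (G ^+ q.+1).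
Proof.
apply: le_trans (klein q sG sGt pG pGt); rewrite lerD2l ler_wpM2l//.
rewrite diff2 mulmxDl linearD/= -[leLHS]addr0; apply: lerD.
  have e : Gt *m (Gt ^+ q *m Gt) = Gt ^+ q.+2 by rewrite !mulmxE -exprSr -exprS.
  by rewrite -!mulmxA [leRHS]mxtrace_mulC -!mulmxA e tr_dg.
set E := _ *m G *m De *m Gt.
have E0 : psd E.
  move=> v; rewrite /E -!mulmxA -dot_sym// -dot_sym; last exact: dg_symm.
  exact: pG.
clearbody E.
have [Q [a [u1 u2 EE]]] := symm_diagonalizes (symm_exp q sGt).
have a0 : forall k, 0 <= a k by apply: (psd_fm u1); rewrite -EE; exact: psd_exp.
rewrite EE /fm mulmxA mxtrace_mulC !mulmxA; apply: sumr_ge0 => k _.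
rewrite mul_mx_diag mxE [X in _ * X]mxE mulr_ge0//.
rewrite -dot_delta -(mulmxA (Q *m E)) -(mulmxA Q) -[X in dot _ (X *m _)]trmxK -dot_mxl.
exact: E0.
Qed.

End Tilde.
End MonotoneInverse.

(** * Adding one row: positivity and growth of the trace *)

Section GrowthStep.
Variables (R : realType) (N : nat).
Variables (S : 'I_N -> 'I_N -> R) (H : 'M[R]_N) (D D' : 'I_N -> R) (J : {set 'I_N}).
Variables (m z : 'I_N -> R) (K b del e : R).
Hypotheses (sH : symm H) (DD : forall i, i \in J -> D i <= D' i) (pA : pd J (AD D H)).
Let A := AD D' H.
Let G := Gm (AD D H) J.
Let Gt := Gm A J.
Hypotheses (b0 : 0 < b) (nG : le_norm G b) (S0 : forall i k, 0 <= S i k <= K).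
Hypothesis concJ : forall i, i \in J -> conc S H D' J i del.
Hypotheses (e_1 : 2 * del + K * b <= e) (e_2 : del + K * (3 * b ^+ 2) <= e) (e1 : e < 1).
Hypotheses (m0 : forall i, 0 < m i) (z0 : forall i, 0 < z i).
Hypothesis HD' : forall i, i \in J -> (m i)^-1 + \sum_(k in J) S i k * m k <= D' i - e.
Hypothesis Hz : forall i, i \in J -> m i ^+ 2 * (1 + \sum_(k in J) S i k * z k) <= z i.

Let sA : symm A. Proof. exact: AD_symm. Qed.
Let pA' : pd J A. Proof. exact: AD_mono DD pA. Qed.
Let iGt : isinv J A Gt. Proof. exact: pd_isinv. Qed.
Let pGt : psd Gt. Proof. exact: pd_psd iGt pA'. Qed.
Let sGt : symm Gt. Proof. by case: iGt. Qed.
Let nGt : le_norm Gt b. Proof. exact: (tilde_norm sH DD pA nG). Qed.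
Let Gt0 i k : i \notin J -> Gt i k = 0. Proof. by case: iGt => _ + _; apply. Qed.
Let S00 i k : 0 <= S i k. Proof. by have /andP[] := S0 i k. Qed.

Lemma tilde_diag_gt0 i : i \in J -> 0 < Gt i i.
Proof. exact: (diag_inv_gt0 iGt pGt nGt). Qed.

Let v i := \sum_k (Gt i k) ^+ 2.

Lemma tilde_loop i : i \in J -> `|(Gt i i)^-1 - (D' i - \sum_k S i k * Gt k k)| <= e.
Proof.
by move=> iJ; apply: le_trans e_1; exact: (resolvent_loop sH iGt pGt nGt S0 iJ (concJ iJ)).
Qed.

Lemma tilde_sq_loop i : i \in J -> `|v i / (Gt i i) ^+ 2 - (1 + \sum_k S i k * v k)| <= e.
Proof.
move=> iJ; apply: le_trans e_2.
exact: (resolvent_sq_loop sH iGt pGt b0 nGt S0 iJ (concJ iJ)).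
Qed.

Let v_gt0 i : i \in J -> 0 < v i.
Proof.
move=> iJ; rewrite /v (bigD1 i)//= ltr_wpDr// ?sumr_ge0// => [k _|]; first exact: sqr_ge0.
by rewrite exprn_gt0// tilde_diag_gt0.
Qed.

Lemma tilde_upper i : i \in J -> Gt i i <= m i.
Proof.
apply: (loop_upper S00 tilde_diag_gt0 v_gt0 _ _ tilde_loop tilde_sq_loop e1) => //.
- by move=> k; exact: Gt0.
- by move=> k kJ; rewrite /v big1// => l _; rewrite Gt0// expr0n.
Qed.

Lemma tilde_sq_upper i : i \in J -> v i <= 2 * z i.
Proof.
apply: (sq_loop_upper S00 tilde_diag_gt0 v_gt0 _ tilde_loop tilde_sq_loop e1 (m := m)) => //.
- by move=> k kJ; rewrite /v big1// => l _; rewrite Gt0// expr0n.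
- exact: tilde_upper.
Qed.

Variables (j : 'I_N) (Cz : R).
Hypotheses (jJ : j \notin J) (concj : conc S H D' (j |: J)%SET j del).
Hypothesis HD'j : (m j)^-1 + \sum_(k in J) S j k * m k + 2 * del <= D' j.
Hypothesis HCz : \sum_(k in J) S j k * z k <= Cz.

Let h := - col j A.
Let w : 'cV[R]_N := delta_mx j 0 + Gt *m h.
Let s := A j j - dot h (Gt *m h).

Let BE : Gm (AD D' H) ((j |: J) :\ j)%SET = Gt.
Proof. by rewrite finset.setU1K. Qed.

Let Gtj k : Gt j k = 0. Proof. exact: Gt0. Qed.
Let Gtj' k : Gt k j = 0. Proof. by rewrite (symmE k j sGt). Qed.

Lemma step_schurE : s = D' j - H j j - qform H j Gt.
Proof.
have -> : D' j - H j j = A j j by rewrite mxE eqxx mul1r.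
by rewrite /s (qform_dot D').
Qed.

(** By [tilde_upper] the mean of the form is at most the revealed part of the supersolution, so at
    least $1/m_j$ of the diagonal entry at [j] is left. *)
Lemma step_schur : (m j)^-1 <= s.
Proof.
have [c1 c2 _] := concj; rewrite BE in c2; rewrite step_schurE.
have : trS S j Gt <= \sum_(k in J) S j k * m k.
  rewrite /trS [leRHS]big_mkcond; apply: ler_sum => k _.
  case: (boolP (k \in J)) => kJ; last by rewrite Gt0// mul0r.
  by rewrite mulrC ler_wpM2l// tilde_upper.
move: c1 c2 HD'j; rewrite !ler_norml => /andP[? ?] /andP[? ?] ? ?.
lra.
Qed.

Let s_gt0 : 0 < s. Proof. by apply: lt_le_trans step_schur; rewrite invr_gt0. Qed.

Lemma step_pd : pd (j |: J)%SET A.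
Proof. exact: row_step_pd iGt jJ pA' s_gt0. Qed.

Lemma step_inverse : Gm A (j |: J)%SET = Gt + s^-1 *: (w *m w^T).
Proof. exact: (Gm_eq sA (row_step sA iGt jJ (lt0r_neq0 s_gt0))). Qed.

Let Gthj : (Gt *m h) j 0 = 0. Proof. exact: (isinv_supp h iGt jJ). Qed.

Lemma step_vec_sq : dot w w = 1 + qform H j (Gt *m Gt).
Proof.
rewrite (qform_dot D')//; first last.
- by move=> k; rewrite mxE big1// => l _; rewrite Gtj' mulr0.
- by move=> k; rewrite mxE big1// => l _; rewrite Gtj mul0r.
rewrite -/A -/h -mulmxA -dot_sym// /w dotDl !dotDr (dotC (Gt *m h)) !dot_col Gthj.
by rewrite mxE !eqxx addr0 add0r.
Qed.

Lemma step_vec_le : dot w w <= 1 + del + 2 * Cz.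
Proof.
have [_ _ c3] := concj; rewrite BE in c3; rewrite step_vec_sq.
have : trS S j (Gt *m Gt) <= 2 * \sum_(k in J) S j k * z k.
  rewrite /trS mulr_sumr [leRHS]big_mkcond; apply: ler_sum => k _.
  rewrite sq_diag//; case: (boolP (k \in J)) => kJ.
    by rewrite mulrC mulrCA ler_wpM2l//; exact: tilde_sq_upper.
  by rewrite big1 ?mul0r// => l _; rewrite Gt0// expr0n.
move: c3 HCz; rewrite ler_norml => /andP[_ ?] ? ?; lra.
Qed.

(** Three moves: raising the diagonal ([tr_power_tilde]), adding the row (Klein's inequality from
    the new matrix back to [Gt]), and [rank_one_power], which replaces the new matrix by
    [Gt + C1%:M]. What remains is a form in the new row whose kernel is built from [Gt] alone, so
    that its mean can be taken. *)
Lemma step_potential q C1 : m j * (1 + del + 2 * Cz) <= C1 ->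
  \tr (Gm A (j |: J)%SET ^+ q.+1) <= \tr (G ^+ q.+1)
    - q.+1%:R * (\sum_k (D' k - D k) * (Gt ^+ q.+2) k k)
    + q.+1%:R * m j * (C1 ^+ q + qform H j (Gt *m (Gt + C1%:M) ^+ q *m Gt)).
Proof.
move=> HC1.
have si0 : 0 <= s^-1 by rewrite invr_ge0 ltW.
have simj : s^-1 <= m j by rewrite -[leRHS]invrK lef_pV2 ?posrE ?invr_gt0// step_schur.
have ww0 := dot_ge0 w.
have cC1 : s^-1 * dot w w <= C1.
  by apply: le_trans HC1; apply: ler_pM => //; exact: step_vec_le.
have C10 : 0 <= C1 by apply: le_trans cC1; rewrite mulr_ge0.
set X := Gm A (j |: J)%SET; have XE : X = Gt + s^-1 *: (w *m w^T) := step_inverse.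
have pX : psd X by rewrite XE; apply: psdD => //; apply: psdZ => //; exact: psd_outer.
have sX : symm X by rewrite XE; apply: symmD => //; apply: symmZ; exact: symm_outer.
have k1 := klein q sGt sX pGt pX.
have e1' : \tr ((Gt - X) *m X ^+ q) = - (s^-1 * dot w (X ^+ q *m w)).
  rewrite XE opprD addrA subrr add0r -XE mulNmx raddfN/= -scalemxAl mxtraceZ.
  by rewrite -mulmxA mxtrace_mulC -mulmxA trace_mx11.
have k2 : dot w (X ^+ q *m w) <= dot w ((Gt + C1%:M) ^+ q *m w).
  by rewrite XE; exact: rank_one_power.
have k3 := tr_power_tilde sH DD pA q; rewrite -/A -/Gt -/G in k3.
set P := (Gt + C1%:M) ^+ q in k2 *.
have Gtd : Gt *m delta_mx j (0 : 'I_1) = 0.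
  by apply/matrixP => k l; rewrite ord1 -colE [RHS]mxE [LHS]mxE Gtj'.
(* [Gt] kills the new basis vector, which is therefore an eigenvector of [Gt + C1%:M]; the cross
   terms of the form vanish. *)
have Pd : P *m delta_mx j (0 : 'I_1) = C1 ^+ q *: delta_mx j 0.
  rewrite /P; elim: (q) => [|k IH]; first by rewrite !expr0 mul1mx scale1r.
  rewrite exprSr -mulmxE -mulmxA mulmxDl Gtd add0r mul_scalar_mx -scalemxAr IH scalerA.
  by rewrite -exprS.
have sP : symm P.
  by apply: symm_exp; apply: symmD => //; rewrite /symm tr_scalar_mx.
have k4 : dot w (P *m w) = C1 ^+ q + qform H j (Gt *m P *m Gt).
  have Z1 k : (Gt *m P *m Gt) j k = 0.
    rewrite mxE big1// => l _; rewrite mxE big1 ?mul0r// => i _.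
    by rewrite Gtj mul0r.
  have Z2 k : (Gt *m P *m Gt) k j = 0.
    by rewrite mxE big1// => l _; rewrite Gtj' mulr0.
  rewrite (qform_dot D' sH Z1 Z2).
  rewrite -/A -/h /w mulmxDr Pd dotDl !dotDr !dotZr !dot_col.
  have -> : dot (Gt *m h) (delta_mx j 0) = 0 by rewrite dotC dot_col Gthj.
  have -> : (P *m (Gt *m h)) j 0 = 0.
    by rewrite -dot_col -dot_sym// Pd dotZl dot_col Gthj mulr0.
  by rewrite mxE !eqxx mulr1 mulr0 addr0 add0r -!mulmxA dot_sym.
have Pw0 : 0 <= dot w (P *m w).
  apply: le_trans k2; apply: psd_exp => //.
have k5 : s^-1 * dot w (X ^+ q *m w) <= m j * dot w (P *m w).
  by apply: ler_pM => //; exact: psd_exp.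
move: k1 k3; rewrite e1' -k4 mulrN -mulrA.
have := ler_wpM2l (ler0n R q.+1) k5.
move: (_ * (s^-1 * _)) (_ * (m j * _)) (_ * \sum_k _) (\tr (X ^+ _)) (\tr (Gt ^+ _)) (\tr (G ^+ _)).
by move=> x1 x2 x3 x4 x5 x6; lra.
Qed.

End GrowthStep.

(** * Concentration events *)

Lemma measurable_inv_fun {R : realType} : measurable_fun setT (fun x : R => x^-1).
Proof.
have -> : (fun x : R => x^-1) = (fun x => if x == 0 then 0 else x^-1).
  by apply/funext => x; case: eqP => // ->; rewrite invr0.
apply: measurable_fun_if => //.
- exact: measurable_fun_eqr.
- rewrite setTI.
  have -> : (fun x : R => x == 0) @^-1` [set false] = [set r : R | r != 0].
    apply/seteqP; split => x /=; first by move=> ->.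
    exact: negbTE.
  apply: open_continuous_measurable_fun => //; apply/in_setP => x /= x0.
  exact: inv_continuous.
Qed.

Section MatrixMeasurability.
Context {d} {U : measurableType d} {R : realType} (N : nat).

Definition mmx (A : U -> 'M[R]_N) := forall i j, measurable_fun setT (fun u => A u i j).

Lemma mmx_mul A B : mmx A -> mmx B -> mmx (fun u => A u *m B u).
Proof.
move=> mA mB i j; under eq_fun do rewrite mxE.
by apply: measurable_sum => k; apply: measurable_funM.
Qed.

Lemma mmx_add A B : mmx A -> mmx B -> mmx (fun u => A u + B u).
Proof. by move=> mA mB i j; under eq_fun do rewrite mxE; apply: measurable_funD. Qed.

Lemma mmx_cst B : mmx (fun=> B).
Proof. by move=> i j. Qed.

Lemma mmx_exp A q : mmx A -> mmx (fun u => A u ^+ q).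
Proof.
move=> mA; elim: q => [|q IH]; first by under eq_fun do rewrite expr0; exact: mmx_cst.
by under eq_fun do rewrite exprS -mulmxE; exact: mmx_mul.
Qed.

Lemma measurable_tr A : mmx A -> measurable_fun setT (fun u => \tr (A u)).
Proof. by move=> mA; apply: measurable_sum => k; exact: mA. Qed.

Lemma measurable_inv (f : U -> R) : measurable_fun setT f -> measurable_fun setT (fun u => (f u)^-1).
Proof. exact: (measurableT_comp measurable_inv_fun). Qed.

End MatrixMeasurability.

Lemma measurable_det {d} {U : measurableType d} {R : realType} (N : nat) (A : U -> 'M[R]_N) :
  mmx A -> measurable_fun setT (fun u => \det (A u)).
Proof.
move=> mA; apply: measurable_sum => s; apply: measurable_funM => //.
by apply: measurable_prod => i _; exact: mA.
Qed.

Section InverseMeasurability.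
Context {d} {U : measurableType d} {R : realType} (N : nat).
Implicit Types (A : U -> 'M[R]_N).

Lemma mmx_inv' A : mmx A -> mmx (fun u => inv' (A u)).
Proof.
move=> mA i j; under eq_fun do rewrite 2!mxE.
apply: measurable_funM; first exact/measurable_inv/measurable_det.
rewrite /cofactor; apply: measurable_funM => //; apply: measurable_det => k l.
by under eq_fun do rewrite 2!mxE; exact: mA.
Qed.

Lemma mmx_Gm A (J : {set 'I_N}) :
  (forall i k, i \in J -> k \in J -> measurable_fun setT (fun u => A u i k)) ->
  mmx (fun u => Gm (A u) J).
Proof.
move=> mA i j; have [h|h] := boolP ((i \in J) && (j \in J)); last first.
  by under eq_fun do rewrite mxE (negbTE h); exact: measurable_cst.
under eq_fun do rewrite mxE h.
apply: mmx_inv' => k l; have [/andP[kJ lJ]|h'] := boolP ((k \in J) && (l \in J)).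
  by under eq_fun do rewrite mxE kJ lJ; exact: mA.
by under eq_fun do rewrite mxE (negbTE h'); exact: measurable_cst.
Qed.

Lemma measurable_AD (H : U -> 'M[R]_N) (D : 'I_N -> R) i k :
  measurable_fun setT (fun u => H u i k) -> measurable_fun setT (fun u => AD D (H u) i k).
Proof. by move=> mH; under eq_fun do rewrite mxE; apply: measurable_funB. Qed.

End InverseMeasurability.

(** * Rows and minors of the noise matrix *)

Section Noise.
Context {d} {T : measurableType d} {R : realType} (P : probability T R).
Variable (N : nat).

Definition upper : {set 'I_N * 'I_N} := [set p : 'I_N * 'I_N | (p.1 <= p.2)%N]%SET.
Definition entry (H : T -> 'M[R]_N) (p : 'I_N * 'I_N) (w : T) : R := H w p.1 p.2.
(** Rows are continued by zero to all of [nat], the index type of the moment bounds. *)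
Definition hrow (H : T -> 'M[R]_N) (j : 'I_N) (k : nat) (w : T) : R :=
  if insub k is Some i then H w j i else 0.
Definition srow (S : 'I_N -> 'I_N -> R) (j : 'I_N) (k : nat) : R :=
  if insub k is Some i then S j i else 0.

Lemma hrowE H j (i : 'I_N) w : hrow H j i w = H w j i.
Proof. by rewrite /hrow valK. Qed.

Lemma srowE S j (i : 'I_N) : srow S j i = S j i.
Proof. by rewrite /srow valK. Qed.

Definition noise (H : T -> 'M[R]_N) (S : 'I_N -> 'I_N -> R) (r : nat) (M v : R) :=
  [/\ forall i j, measurable_fun setT (fun w => H w i j), forall w, symm (H w),
      mutually_independent P upper (entry H) &
      forall j, centred_row P N (hrow H j) (srow S j) r M v].

Variables (H : T -> 'M[R]_N).
Hypotheses (mH : forall i j, measurable_fun setT (fun w => H w i j)).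
Hypotheses (sH : forall w, symm (H w)) (indH : mutually_independent P upper (entry H)).

(** Independence concerns the entries on or above the diagonal; by symmetry every entry is read at
    its ordered pair. *)
Definition ordpair (i j : 'I_N) := if (i <= j)%N then (i, j) else (j, i).
Definition rowset j := [set p in upper | (p.1 == j) || (p.2 == j)]%SET.
Definition restset j := [set p in upper | (p.1 != j) && (p.2 != j)]%SET.

Lemma ordpair_upper i j : ordpair i j \in upper.
Proof. by rewrite /ordpair inE; case: (leqP i j) => //= /ltnW. Qed.

Lemma entry_ordpair i j w : entry H (ordpair i j) w = H w i j.
Proof. by rewrite /ordpair /entry; case: ifP => //= _; rewrite symmE. Qed.

Lemma measurable_entry p : measurable_fun setT (entry H p).
Proof. exact: mH. Qed.

Lemma measurable_rest j i k : i != j -> k != j ->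
  measurable_fun setT ((fun w => H w i k) : subT (entry H) (restset j) -> R).
Proof.
move=> ij kj; under eq_fun do rewrite -entry_ordpair.
apply: (measurable_subT (X := entry H) (k := ordpair i k)); rewrite inE ordpair_upper/=.
by rewrite /ordpair; case: ifP; rewrite /= ?ij ?kj.
Qed.

Lemma measurable_row j k : measurable_fun setT ((fun w => H w j k) : subT (entry H) (rowset j) -> R).
Proof.
under eq_fun do rewrite -entry_ordpair.
apply: (measurable_subT (X := entry H) (k := ordpair j k)); rewrite inE ordpair_upper/=.
by rewrite /ordpair; case: ifP; rewrite /= ?eqxx ?orbT.
Qed.

Lemma row_rest_decoupling j
    (F : subT (entry H) (restset j) * subT (entry H) (rowset j) -> \bar R) :
  measurable_fun setT F -> (forall x, (0 <= F x)%E) ->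
  (\int[P]_w F (w, w) = \int[P]_w \int[P]_u F (w, u))%E.
Proof.
move=> mF F0; apply: (family_decoupling measurable_entry indH) => //.
- by apply/fintype.subsetP => p; rewrite inE => /andP[].
- by apply/fintype.subsetP => p; rewrite inE => /andP[].
- by move=> p; rewrite !inE => /andP[_ /andP[/negbTE -> /negbTE ->]]; rewrite andbF.
Qed.

(** The map [ordpair j] is a bijection from the indices onto [rowset j], through which the
    independence of the upper entries is reindexed. *)
Lemma row_independent j :
  mutually_independent P [set: 'I_N]%SET (fun i : 'I_N => hrow H j i).
Proof.
move=> B mB.
pose C (p : 'I_N * 'I_N) := if p.1 == j then B p.2 else B p.1.
have CE k : C (ordpair j k) = B k.
  rewrite /C /ordpair; case: (leqP j k) => [_|jk] /=; first by rewrite eqxx.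
  by case: eqP => // kj; move: jk; rewrite kj ltnn.
have inj : injective (ordpair j).
  move=> k l; rewrite /ordpair.
  by case: (leqP j k) => jk; case: (leqP j l) => jl [] => // *; subst; apply: val_inj => //=;
    apply/eqP; rewrite eqn_leq; rewrite ?jk ?jl ?(ltnW jk) ?(ltnW jl).
have mem p : (p \in rowset j) = (p \in [set ordpair j k | k : 'I_N]%SET).
  apply/idP/imsetP => [|[k _ ->]]; last first.
    by rewrite inE ordpair_upper /ordpair; case: ifP => _ /=; rewrite ?eqxx ?orbT.
  case: p => a b; rewrite !inE /= => /andP[ab /orP[/eqP aj|/eqP bj]].
    by exists b => //; rewrite /ordpair -aj ab.
  exists a => //; rewrite /ordpair -bj; case: ifP => // ba.
  by have -> : a = b by apply/val_inj/eqP; rewrite /= eqn_leq ab ba.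
have sub : rowset j \subset upper by apply/fintype.subsetP => p; rewrite inE => /andP[].
have mC p : measurable (C p) by rewrite /C; case: ifP.
have h := rects_prob indH sub mC.
have -> : \bigcap_(k in [set k | k \in [set: 'I_N]%SET]) (hrow H j k @^-1` B k) =
  \bigcap_(p in [set p | p \in rowset j]) (entry H p @^-1` C p).
  apply/seteqP; split => w h' /=.
    move=> p /=; rewrite mem => /imsetP[k _ ->]; rewrite /preimage/= entry_ordpair CE.
    by have := h' k; rewrite /= inE /preimage/= hrowE; apply.
  move=> k _; rewrite /preimage/= hrowE -entry_ordpair -(CE k); apply: h'.
  by rewrite /= mem; apply/imsetP; exists k.
rewrite h.
rewrite (eq_bigl _ _ mem) big_imset/=; last by move=> ? ? _ _; exact: inj.
apply: eq_big => [k|k _]; first by rewrite !inE.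
have -> : entry H (ordpair j k) = hrow H j k.
  by apply/funext => w; rewrite entry_ordpair hrowE.
by rewrite CE.
Qed.

End Noise.

Section QuadraticTail.
Context {d} {T : measurableType d} {R : realType} (P : probability T R).

Lemma qform_sum N (H : T -> 'M[R]_N) j (B : 'M[R]_N) w :
  qform (H w) j B = \sum_(k < N) \sum_(l < N)
    (fun a b : nat => if (insub a, insub b) is (Some x, Some y) then B x y else 0) k l *
    (hrow H j k w * hrow H j l w).
Proof.
apply: eq_bigr => k _; apply: eq_bigr => l _.
by rewrite !valK !hrowE.
Qed.

Lemma measurable_qform N d' (U : measurableType d') (h : U -> 'I_N -> R) (B : U -> 'M[R]_N) :
  mmx B -> (forall k, measurable_fun setT (fun u => h u k)) ->
  measurable_fun setT (fun u => \sum_k \sum_l B u k l * (h u k * h u l)).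
Proof.
move=> mB mh; apply: measurable_sum => k; apply: measurable_sum => l.
by apply: measurable_funM => //; exact: measurable_funM.
Qed.

Definition bad_quad N (H : T -> 'M[R]_N) S (j : 'I_N) (B : T -> 'M[R]_N) (beta del : R) : set T :=
  [set w | (\sum_i \sum_k (B w i k) ^+ 2 <= beta) /\
    del < `|qform (H w) j (B w) - trS S j (B w)|].

(** The minor is frozen by decoupling and the moment bound applied to row [j]. The indicator of the
    Frobenius bound belongs to the integrand, so the bound after freezing is deterministic and
    Markov's inequality applies. *)
Lemma quadratic_tail (r : nat) : exists2 C : R, (0 <= C)%R &
  forall N (H : T -> 'M[R]_N) S M v (j : 'I_N) (B : T -> 'M[R]_N) (beta del : R),
  noise P H S r M v -> (1 <= M)%R -> (0 <= v)%R -> (0 <= beta)%R -> (0 < del)%R ->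
  (forall w, symm (B w)) ->
  @mmx _ (subT (entry H) (restset j)) R N B ->
  measurable (bad_quad H S j B beta del) /\
  (P (bad_quad H S j B beta del) <=
   (C * M ^+ 2 * (v ^+ 2 * beta) ^+ r.+1 / pw r del)%:E)%E.
Proof.
have [C C0 HC] := quadratic_form_moment P r; exists C => //.
move=> N H S M v j B beta del [mH sH indH row] M1 v0 be0 del0 sB mB.
pose F (z : subT (entry H) (restset j) * subT (entry H) (rowset j)) : R :=
  (if \sum_i \sum_k (B z.1 i k) ^+ 2 <= beta then 1 else 0) *
  pw r (\sum_k \sum_l B z.1 k l * (H z.2 j k * H z.2 j l) - trS S j (B z.1)).
have F0 z : 0 <= F z by rewrite /F mulr_ge0 ?pw_ge0//; case: ifP.
have mB1 : mmx (fun z : subT (entry H) (restset j) * subT (entry H) (rowset j) => B z.1).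
  by move=> i k; exact: (measurableT_comp (mB i k) measurable_fst).
have mF : measurable_fun setT F.
  apply: measurable_funM.
    apply: measurable_fun_ifT => //; apply: measurable_fun_ler => //.
    by apply: measurable_sum => i; apply: measurable_sum => k; apply: measurable_funX; exact: mB1.
  apply: measurable_pw; apply: measurable_funB; last first.
    by apply: measurable_sum => k; apply: measurable_funM => //; exact: mB1.
  have mh2 (k : 'I_N) : measurable_fun setT (fun z : subT (entry H) (restset j) * subT (entry H) (rowset j) => H z.2 j k).
    exact: (measurableT_comp (measurable_row sH (j := j) k) measurable_snd).
  exact: (measurable_qform mB1 mh2).
have mdiag : measurable_fun setT (fun w : T => F (w, w)).
  have mB' : @mmx _ T R N B.
    by move=> i k; apply: (measurable_of_subT (measurable_entry mH)); exact: mB.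
  apply: measurable_funM.
    apply: measurable_fun_ifT => //; apply: measurable_fun_ler => //.
    by apply: measurable_sum => i; apply: measurable_sum => k; apply: measurable_funX; exact: (mB' i k).
  apply: measurable_pw; apply: measurable_funB; last first.
    by apply: measurable_sum => k; apply: measurable_funM => //; exact: (mB' k k).
  exact: (measurable_qform (B := B) (h := fun w k => H w j k)).
set E := bad_quad _ _ _ _ _ _.
have EE : E = [set w | pw r del < F (w, w)].
  apply/seteqP; split => w; rewrite /E /bad_quad /F /=.
    move=> [h1 h2]; rewrite h1 mul1r -/(qform (H w) j (B w)).
    rewrite /pw -[X in _ < X ^+ _]real_normK ?num_real//.
    apply: ltrXn2r => //; rewrite ?nnegrE ?sqr_ge0//.
    by apply: ltrXn2r => //; rewrite ?nnegrE// ltW.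
  case: ifP => [h1|_]; last by rewrite mul0r ltNge pw_ge0.
  rewrite mul1r => h2; split => //.
  rewrite ltNge; apply/negP => h3; move: h2; rewrite ltNge => /negP; apply.
  rewrite /pw -[X in X ^+ _ <= _]real_normK ?num_real//.
  apply: lerXn2r => //; rewrite ?nnegrE ?sqr_ge0//.
  by apply: lerXn2r => //; rewrite ?nnegrE// ltW.
have mE : measurable E.
  have mlt : measurable_fun setT (fun w : T => pw r del < F (w, w)).
    by apply: measurable_fun_ltr => //; exact: measurable_cst.
  have := mlt measurableT [set true] I; rewrite setTI EE.
  by congr measurable; apply/seteqP; split.
split => //.
have pd0 : 0 < pw r del by rewrite /pw !exprn_gt0.
rewrite EFinM lee_pdivlMr// muleC.
have -> : ((pw r del)%:E * P E = \int[P]_w ((pw r del)%:E * (\1_E w)%:E))%E.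
  rewrite ge0_integralZl//; last 2 first.
  - exact/measurable_EFinP.
  - by rewrite lee_fin ltW.
  by rewrite integral_indic// setIT.
apply: (@le_trans _ _ (\int[P]_w (F (w, w))%:E)%E).
  apply: ge0_le_integral => //.
  - by move=> w _; rewrite mule_ge0// lee_fin ?(ltW pd0).
  - by apply: emeasurable_funM => //; exact/measurable_EFinP.
  - exact/measurable_EFinP.
  - move=> w _; rewrite -EFinM lee_fin indicE.
    case: (boolP (w \in E)) => [|_]; last by rewrite mulr0.
    by rewrite mulr1 inE EE => /ltW.
rewrite (row_rest_decoupling mH indH (F := fun z => (F z)%:E)); last 2 first.
- exact/measurable_EFinP.
- by move=> z; rewrite lee_fin.
apply: (@le_trans _ _ (\int[P]_w (C * M ^+ 2 * (v ^+ 2 * beta) ^+ r.+1)%:E)%E).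
  apply: ge0_le_integral => //.
  - by move=> w _; apply: integral_ge0 => u _; rewrite lee_fin.
  - apply: (family_fubini P (measurable_entry mH) (F := fun z => (F z)%:E)) => [|z].
      exact/measurable_EFinP.
    by rewrite lee_fin.
  - move=> w _; rewrite /F/=; case: ifP => [h|_]; last first.
      under eq_integral do rewrite mul0r.
      rewrite integral0 lee_fin; apply: mulr_ge0; first by apply: mulr_ge0; rewrite ?sqr_ge0.
      by rewrite exprn_ge0// mulr_ge0// sqr_ge0.
    under eq_integral do rewrite mul1r.
    pose A := fun a b : nat => if (insub a, insub b) is (Some x, Some y) then B w x y else 0.
    have := HC N (hrow H j) (srow S j) M v A (row j) M1 v0.
    have -> : (\sum_(k < N) \sum_(l < N) A k l ^+ 2 = \sum_i \sum_k (B w i k) ^+ 2).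
      by apply: eq_bigr => k _; apply: eq_bigr => l _; rewrite /A !valK.
    have -> : (\sum_(k < N) A k k * srow S j k = trS S j (B w)).
      by apply: eq_bigr => k _; rewrite /A !valK srowE.
    have sA a b : A a b = A b a.
      by rewrite /A; case: insub => [x|]; case: insub => [y|]//; rewrite symmE.
    move=> /(_ sA) h1.
    under eq_integral do rewrite -/(qform (H _) j (B w)) qform_sum.
    apply: (le_trans h1); rewrite lee_fin ler_wpM2l//.
      by rewrite mulr_ge0// sqr_ge0.
    apply: lerXn2r; rewrite ?nnegrE ?mulr_ge0 ?sqr_ge0//.
      by apply: sumr_ge0 => i _; apply: sumr_ge0 => k _; exact: sqr_ge0.
    by rewrite ler_wpM2l// sqr_ge0.
by rewrite probability_integral_cst.
Qed.

End QuadraticTail.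

Section PwMarkov.
Context {d} {T : measurableType d} {R : realType} (P : probability T R).

Lemma markov_ge0 (f : T -> R) (c del : R) : measurable_fun setT f -> (forall w, 0 <= f w) ->
  0 < del -> (\int[P]_w (f w)%:E <= c%:E)%E ->
  (P [set w | del < f w]%R <= (c / del)%:E)%E.
Proof.
move=> mf f0 del0 fc.
set E := [set w | _].
have mE : measurable E.
  have mle : measurable_fun setT (fun w : T => del < f w).
    by apply: measurable_fun_ltr => //; exact: measurable_cst.
  have := mle measurableT [set true] I; rewrite setTI.
  by congr measurable; apply/seteqP; split.
rewrite EFinM lee_pdivlMr// muleC; apply: le_trans fc.
have -> : (del%:E * P E = \int[P]_w (del%:E * (\1_E w)%:E))%E.
  rewrite ge0_integralZl//; last 2 first.
  - exact/measurable_EFinP.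
  - by rewrite lee_fin ltW.
  by rewrite integral_indic// setIT.
apply: ge0_le_integral => //.
- by move=> w _; rewrite mule_ge0// lee_fin ?(ltW del0).
- by apply: emeasurable_funM => //; exact/measurable_EFinP.
- exact/measurable_EFinP.
- move=> w _; rewrite -EFinM lee_fin indicE.
  case: (boolP (w \in E)) => [|_]; last by rewrite mulr0.
  by rewrite mulr1 inE /E/= => /ltW.
Qed.

Lemma pw_lt r (a b : R) : 0 <= a -> a < `|b| -> pw r a < pw r b.
Proof.
move=> a0 ab; rewrite /pw -[X in _ < X ^+ _]real_normK ?num_real//.
apply: ltrXn2r => //; rewrite ?nnegrE ?sqr_ge0//.
by apply: ltrXn2r => //; rewrite nnegrE.
Qed.

Lemma pw_markov r (f : T -> R) (c del : R) : measurable_fun setT f -> 0 < del ->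
  (\int[P]_w (pw r (f w))%:E <= c%:E)%E ->
  (P [set w | ~~ (`|f w| <= del)%R] <= (c / pw r del)%:E)%E.
Proof.
move=> mf del0 fc.
have mp : measurable_fun setT (fun w => pw r (f w)) by exact: measurable_pw.
apply: (@le_trans _ _ (P [set w | pw r del < pw r (f w)]%R)); last first.
  by apply: markov_ge0 => // [w|]; rewrite ?pw_ge0// /pw !exprn_gt0.
have ms (g h : T -> R) : measurable_fun setT g -> measurable_fun setT h ->
    measurable [set w | g w < h w]%R.
  move=> mg mh; have ml : measurable_fun setT (fun w : T => g w < h w) by exact: measurable_fun_ltr.
  have := ml measurableT [set true] I; rewrite setTI.
  by congr measurable; apply/seteqP; split.
apply: le_measure; rewrite ?inE.
- under eq_set do rewrite -ltNge.
  by apply: ms; [exact: measurable_cst|exact: measurableT_comp].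
- by apply: ms => //; exact: measurable_cst.
- by move=> w /=; rewrite -ltNge => h; exact: pw_lt (ltW del0) h.
Qed.
End PwMarkov.

Section BoolEvents.
Context {d} {T : measurableType d} {R : realType} (P : probability T R).

Lemma measurable_big_and (I : Type) (r : seq I) (Q : pred I) (F : I -> T -> bool) :
  (forall i, Q i -> measurable_fun setT (F i)) ->
  measurable_fun setT (fun u => \big[andb/true]_(i <- r | Q i) F i u).
Proof.
move=> mF; elim: r => [|a r ih].
  by under eq_fun do rewrite big_nil; exact: measurable_cst.
under eq_fun do rewrite big_cons; case: (boolP (Q a)) => Qa //.
by apply: measurable_and => //; exact: mF.
Qed.

Lemma measurable_bool_set (b : T -> bool) : measurable_fun setT b ->
  measurable [set w | b w] /\ measurable [set w | ~~ b w].
Proof.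
move=> mb; split.
  have := mb measurableT [set true] I; rewrite setTI.
  by congr measurable; apply/seteqP; split.
have := mb measurableT [set false] I; rewrite setTI.
by congr measurable; apply/seteqP; split => w; rewrite /preimage/=; case: (b w).
Qed.

Lemma not_and_le (a b : T -> bool) : measurable_fun setT a -> measurable_fun setT b ->
  (P [set w | ~~ (a w && b w)] <= P [set w | ~~ a w] + P [set w | ~~ b w])%E.
Proof.
move=> /measurable_bool_set[_ ma] /measurable_bool_set[_ mb].
have -> : [set w | ~~ (a w && b w)] = [set w | ~~ a w] `|` [set w | ~~ b w].
  apply/seteqP; split => w /=; rewrite negb_and; first by move/orP.
  by move=> h; apply/orP.
exact: measureU2.
Qed.

Lemma not_big_and_le (I : Type) (r : seq I) (Q : pred I) (F : I -> T -> bool) (c : R) :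
  (0 <= c)%R -> (forall i, Q i -> measurable_fun setT (F i)) ->
  (forall i, Q i -> (P [set w | ~~ F i w] <= c%:E)%E) ->
  (P [set w | ~~ \big[andb/true]_(i <- r | Q i) F i w] <= ((size r)%:R * c)%:E)%E.
Proof.
move=> c0 mF hF; elim: r => [|a r ih].
  under eq_set do rewrite big_nil /=.
  by rewrite mul0r (_ : [set _ | _] = set0) ?measure0//; apply/seteqP; split.
under eq_set do rewrite big_cons; case: (boolP (Q a)) => Qa.
  rewrite (_ : (size (a :: r))%:R * c = c + (size r)%:R * c)%R; last first.
    by rewrite /= -natr1 mulrDl mul1r addrC.
  rewrite EFinD; apply: (le_trans (not_and_le (mF a Qa) (measurable_big_and r mF))).
  by apply: leeD => //; exact: hF.
by apply: (le_trans ih); rewrite lee_fin ler_wpM2r// ler_nat.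
Qed.
End BoolEvents.

Section Concentration.
Context {R : realType}.

Definition frob N (B : 'M[R]_N) := \sum_i \sum_k B i k ^+ 2.
(* Concentration is only asked under a Frobenius bound on [B]: given [B], the
   failure probability is then controlled unconditionally. *)
Definition okq N (S : 'I_N -> 'I_N -> R) (h : 'M[R]_N) j (B : 'M[R]_N) (be del : R) : bool :=
  (be < frob B) || (`|qform h j B - trS S j B| <= del).
Definition ok N S (h : 'M[R]_N) D (I : {set 'I_N}) j (be del : R) : bool :=
  let B := Gm (AD D h) I in
  [&& `|h j j| <= del, okq S h j B be del & okq S h j (B *m B) be del].

Lemma ok_conc N S (h : 'M[R]_N) D J j be del : ok S h D (J :\ j)%SET j be del ->
  frob (Gm (AD D h) (J :\ j)%SET) <= be ->
  frob (Gm (AD D h) (J :\ j)%SET *m Gm (AD D h) (J :\ j)%SET) <= be ->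
  conc S h D J j del.
Proof.
rewrite /ok /okq /conc => /and3P[h1 h2 h3] f1 f2; move: h2 h3.
by rewrite !ltNge f1 f2.
Qed.

Lemma Gm_out N (A : 'M[R]_N) (I : {set 'I_N}) k l : ~~ ((k \in I) && (l \in I)) -> Gm A I k l = 0.
Proof. by move=> /negbTE h; rewrite mxE h. Qed.

Lemma Gm_sq_out N (A : 'M[R]_N) (I : {set 'I_N}) k l : ~~ ((k \in I) && (l \in I)) ->
  (Gm A I *m Gm A I) k l = 0.
Proof.
move=> h; rewrite mxE big1// => i _.
move: h; rewrite negb_and => /orP[h|h].
  by rewrite Gm_out ?mul0r// negb_and h.
by rewrite (@Gm_out _ _ _ i l) ?mulr0// negb_and h orbT.
Qed.

Context {d} {U : measurableType d}.

Lemma measurable_okq N S (h B : U -> 'M[R]_N) (I : {set 'I_N}) j be del : mmx B ->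
  (forall k l u, ~~ ((k \in I) && (l \in I)) -> B u k l = 0) ->
  (forall k, k \in I -> measurable_fun setT (fun u => h u j k)) ->
  measurable_fun setT (fun u => okq S (h u) j (B u) be del).
Proof.
move=> mB B0 mh; apply: measurable_or.
  apply: measurable_fun_ltr; first exact: measurable_cst.
  by apply: measurable_sum => i; apply: measurable_sum => k; apply: measurable_funX; exact: mB.
apply: measurable_fun_ler; last exact: measurable_cst.
apply: measurableT_comp => //; apply: measurable_funB; last first.
  by apply: measurable_sum => k; apply: measurable_funM => //; exact: mB.
apply: measurable_sum => k; apply: measurable_sum => l.
case: (boolP ((k \in I) && (l \in I))) => [/andP[kI lI]|kl].
  by apply: measurable_funM; [exact: mB|apply: measurable_funM; exact: mh].
by under eq_fun do rewrite B0// mul0r; exact: measurable_cst.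
Qed.

Lemma measurable_ok N S (h : U -> 'M[R]_N) D (I : {set 'I_N}) j be del :
  (forall i k, i \in (j |: I)%SET -> k \in (j |: I)%SET -> measurable_fun setT (fun u => h u i k)) ->
  measurable_fun setT (fun u => ok S (h u) D I j be del).
Proof.
move=> mh.
have jj : j \in (j |: I)%SET by rewrite finset.in_setU1 eqxx.
have sub i : i \in I -> i \in (j |: I)%SET by move=> iI; rewrite finset.in_setU1 iI orbT.
have mG : mmx (fun u => Gm (AD D (h u)) I).
  by apply: mmx_Gm => i k iI kI; apply: measurable_AD; apply: mh; exact: sub.
have mrow k : k \in I -> measurable_fun setT (fun u => h u j k).
  by move=> kI; apply: mh => //; exact: sub.
apply: measurable_and; last apply: measurable_and.
- apply: measurable_fun_ler; last exact: measurable_cst.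
  by apply: measurableT_comp => //; exact: mh.
- by apply: measurable_okq mrow => // k l u; exact: Gm_out.
- by apply: measurable_okq mrow => [|k l u]; [exact: mmx_mul|exact: Gm_sq_out].
Qed.

End Concentration.

Lemma Gm_symm {R : realType} N (A : 'M[R]_N) I : symm A -> symm (Gm A I).
Proof.
move=> sA.
have sm : symm (Am A I) by apply/matrixP => i k; rewrite mxE [LHS]mxE [RHS]mxE symmE// [in RHS]andbC eq_sym.
have si : symm (inv' (Am A I)) by rewrite /symm /inv' linearZ /= trmx_adj sm.
apply/matrixP => i k; rewrite mxE [LHS]mxE [RHS]mxE andbC; case: ifP => // _.
by rewrite symmE.
Qed.

Section OkTail.
Context {d} {T : measurableType d} {R : realType} (P : probability T R).

(** [Gm] is a total function of the entries indexed by [I], which avoids [j]: the minor is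
    measurable with respect to the entries off row [j], whether or not its block is invertible. *)
Lemma ok_tail (r : nat) : exists2 C : R, (0 <= C)%R &
  forall N (H : T -> 'M[R]_N) S M v (j : 'I_N) D (I : {set 'I_N}) (be del : R),
  noise P H S r M v -> (1 <= M)%R -> (0 <= v)%R -> (0 <= be)%R -> (0 < del)%R ->
  j \notin I ->
  (P [set w | ~~ ok S (H w) D I j be del] <=
   ((M * v ^+ r.+1 + C * M ^+ 2 * (v ^+ 2 * be) ^+ r.+1) / pw r del)%:E)%E.
Proof.
have [C C0 HC] := quadratic_tail P r; exists (C + C) => [|N H S M v j D I be del nH M1 v0 be0 del0 jI].
  exact: addr_ge0.
have [mH sH indH row] := nH.
have mG : @mmx _ (subT (entry H) (restset j)) R N (fun w => Gm (AD D (H w)) I).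
  apply: mmx_Gm => i k iI kI; apply: measurable_AD; apply: measurable_rest => //.
    by apply: contraNneq jI => <-.
  by apply: contraNneq jI => <-.
have sG w : symm (Gm (AD D (H w)) I) by exact: Gm_symm (AD_symm _ (sH w)).
have [m1 P1] := HC N H S M v j (fun w => Gm (AD D (H w)) I) be del nH M1 v0 be0 del0 sG mG.
have [m2 P2] := HC N H S M v j (fun w => Gm (AD D (H w)) I *m Gm (AD D (H w)) I)
  be del nH M1 v0 be0 del0 (fun w => symm_sq (sG w)) (mmx_mul mG mG).
have eqE (B : T -> 'M[R]_N) : bad_quad H S j B be del = [set w | ~~ okq S (H w) j (B w) be del].
  apply/seteqP; split => w; rewrite /bad_quad /okq /frob /= negb_or -!leNgt -!ltNge.
    by move=> [-> ->].
  by move=> /andP[-> ->].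
move: m1 P1 m2 P2; rewrite !eqE => m1 P1 m2 P2.
have P0 : (P [set w | ~~ (`|H w j j| <= del)%R] <= (M * v ^+ r.+1 / pw r del)%:E)%E.
  apply: pw_markov => //.
  have [_ _ _ _ /(_ j (ltn_ord j))[h _ _]] := row j.
  apply: le_trans h; rewrite le_eqVlt; apply/orP; left; apply/eqP.
  by apply: eq_integral => w _; rewrite hrowE.
apply: (@le_trans _ _ (P ([set w | ~~ (`|H w j j| <= del)%R] `|`
    ([set w | ~~ okq S (H w) j (Gm (AD D (H w)) I) be del] `|`
     [set w | ~~ okq S (H w) j (Gm (AD D (H w)) I *m Gm (AD D (H w)) I) be del])))%E).
  have m0 : measurable [set w | ~~ (`|H w j j| <= del)%R].
    apply: (measurable_bool_set _).2.
    by apply: measurable_fun_ler; [exact: measurableT_comp|exact: measurable_cst].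
  have mU := measurableU _ _ m1 m2.
  apply: le_measure; rewrite ?inE; last 2 first.
  - exact: measurableU.
  - move=> w /=; rewrite /ok !negb_and => /or3P[]; [by left|by right; left|by right; right].
  - apply: (measurable_bool_set _).2; apply: measurable_ok => i k _ _; exact: mH.
rewrite (_ : ((_ + _) / _)%R = (M * v ^+ r.+1 / pw r del +
  (C * M ^+ 2 * (v ^+ 2 * be) ^+ r.+1 / pw r del +
   C * M ^+ 2 * (v ^+ 2 * be) ^+ r.+1 / pw r del))%R); last by ring.
have m0 : measurable [set w | ~~ (`|H w j j| <= del)%R].
  apply: (measurable_bool_set _).2.
  by apply: measurable_fun_ler; [exact: measurableT_comp|exact: measurable_cst].
apply: (le_trans (measureU2 P m0 (measurableU _ _ m1 m2))).
rewrite EFinD; apply: leeD => //.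
apply: (le_trans (measureU2 P m1 m2)); rewrite EFinD; exact: leeD.
Qed.
End OkTail.

(** * Revealing the rows one at a time *)

Section SmallLemmas.
Context {R : realType}.

(** The convex function $(1+t)^q$ lies below its chord on $[0,1]$. *)
Lemma bernoulli_upper (t : R) q : 0 <= t <= 1 -> (1 + t) ^+ q <= 1 + (2 ^+ q - 1) * t.
Proof.
move=> /andP[t0 t1]; elim: q => [|q ih]; first by rewrite !expr0 subrr mul0r addr0.
have p1 : 1 <= 2 ^+ q :> R by rewrite exprn_ege1// ler1n.
rewrite exprS; apply: (le_trans (ler_wpM2l _ ih)); first lra.
rewrite exprS; set p := 2 ^+ q in p1 *.
have : 0 <= (p - 1) * (t * (1 - t)) by apply: mulr_ge0; [lra|apply: mulr_ge0; lra].
lra.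
Qed.

(** Once [C1 <= t * y], the factor [(y + C1) ^+ q] is at most [kap * y ^+ q] and the difference is
    nonpositive; smaller [y] contribute a bounded amount. This is where [kap] must exceed 1. *)
Lemma growth_scalar q (kap C1 : R) : 1 < kap -> 0 <= C1 -> exists2 C2, 0 <= C2 &
  forall y, 0 <= y -> y * ((y + C1) ^+ q * y) - kap * y ^+ q.+2 <= C2.
Proof.
move=> k1 C10.
have p1 : 1 <= 2 ^+ q :> R by rewrite exprn_ege1// ler1n.
pose t := Num.min 1 ((kap - 1) / 2 ^+ q).
have t0 : 0 < t by rewrite lt_min ltr01 divr_gt0 ?subr_gt0// (lt_le_trans ltr01 p1).
have tk : (1 + t) ^+ q <= kap.
  apply: (le_trans (bernoulli_upper _ _)).
    by rewrite (ltW t0)/= ge_min lexx.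
  have : t * 2 ^+ q <= kap - 1.
    by rewrite -ler_pdivlMr ?(lt_le_trans ltr01 p1)// ge_min lexx orbT.
  set p := 2 ^+ q in p1 *; nra.
pose Y := C1 / t.
have Y0 : 0 <= Y by rewrite divr_ge0// ltW.
exists (Y * ((Y + C1) ^+ q * Y)) => [|y y0].
  by rewrite mulr_ge0// mulr_ge0// exprn_ge0// addr_ge0.
have [yY|Yy] := leP y Y.
  apply: (@le_trans _ _ (y * ((y + C1) ^+ q * y))).
    by rewrite lerBlDr lerDl mulr_ge0 ?exprn_ge0//; lra.
  have h1 : (y + C1) ^+ q <= (Y + C1) ^+ q.
    by apply: lerXn2r; rewrite ?nnegrE ?addr_ge0// lerD2r.
  have h0 : 0 <= (y + C1) ^+ q by rewrite exprn_ge0// addr_ge0.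
  by apply: ler_pM => //; [rewrite mulr_ge0|apply: ler_pM].
have cy : C1 <= t * y by rewrite mulrC -ler_pdivrMr// ltW.
have h1 : (y + C1) ^+ q <= ((1 + t) * y) ^+ q.
  by apply: lerXn2r; rewrite ?nnegrE ?addr_ge0 ?mulr_ge0 ?addr_ge0 ?(ltW t0)//; lra.
have h2 : (y + C1) ^+ q <= kap * y ^+ q.
  apply: (le_trans h1); rewrite exprMn; apply: ler_wpM2r => //; exact: exprn_ge0.
apply: (@le_trans _ _ 0); last by rewrite mulr_ge0// mulr_ge0// exprn_ge0// addr_ge0.
rewrite subr_le0 2!exprS.
have -> : kap * (y * (y * y ^+ q)) = y * (kap * y ^+ q * y) by ring.
by apply: ler_wpM2l => //; apply: ler_wpM2r.
Qed.

Lemma fm_psd N (Q : 'M[R]_N) (g : 'I_N -> R) : (forall k, 0 <= g k) -> psd (fm Q g).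
Proof. by move=> g0 v; rewrite dot_fm sumr_ge0// => k _; rewrite mulr_ge0// -expr2 sqr_ge0. Qed.

(** In an eigenbasis of [G] a diagonal entry is an average over the spectrum, so the scalar
    inequality passes to it. *)
Lemma potential_poly N (G : 'M[R]_N) q (C1 kap C2 : R) : symm G -> psd G -> 0 <= C1 ->
  (forall y, 0 <= y -> y * ((y + C1) ^+ q * y) - kap * y ^+ q.+2 <= C2) ->
  [/\ symm (G *m (G + C1%:M) ^+ q *m G), psd (G *m (G + C1%:M) ^+ q *m G) &
   forall k, (G *m (G + C1%:M) ^+ q *m G) k k - kap * (G ^+ q.+2) k k <= C2].
Proof.
move=> sG pG C10 HC2.
have [Q [dd [QQ QQ' GE]]] := symm_diagonalizes sG.
have dd0 : forall k, 0 <= dd k by apply: (psd_fm QQ); rewrite -GE.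
have E : G *m (G + C1%:M) ^+ q *m G = fm Q (fun k => dd k * (dd k + C1) ^+ q * dd k).
  by rewrite {1 2 3}GE -(fm_const QQ') fmD fmX// fmM// fmM.
have cE k : \sum_l Q l k ^+ 2 = 1.
  have /matrixP/(_ k k) := QQ'; rewrite mxE [RHS]mxE eqxx mulr1n => h1; rewrite -[RHS]h1.
  by apply: eq_bigr => l _; rewrite !mxE expr2.
split.
- have s1 : symm ((G + C1%:M) ^+ q).
    by apply: symm_exp; apply: symmD => //; rewrite /symm tr_scalar_mx.
  by rewrite /symm !trmx_mul s1 sG mulmxA.
- rewrite E; apply: fm_psd => k; rewrite mulr_ge0// mulr_ge0// exprn_ge0// addr_ge0//.
- move=> k; rewrite E {1}GE fmX// !fm_entry mulr_sumr -sumrB.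
  rewrite -[leRHS]mulr1 -(cE k) mulr_sumr; apply: ler_sum => l _.
  rewrite mulrA -mulrBl; apply: ler_wpM2r; first exact: sqr_ge0.
  by rewrite -mulrA; exact: HC2.
Qed.

Lemma quad_dot N (B : 'M[R]_N) (h : 'I_N -> R) :
  \sum_k \sum_l B k l * (h k * h l) = dot (\col_k h k) (B *m \col_k h k).
Proof.
rewrite dotE; apply: eq_bigr => k _; rewrite !mxE mulr_sumr; apply: eq_bigr => l _.
by rewrite !mxE; ring.
Qed.

(** Deleting an index subtracts a positive rank-one matrix, so the norm bound survives; it gives a
    Frobenius bound at the price of a factor [N]. *)
Lemma sub_frob N (J : {set 'I_N}) (D : 'I_N -> R) (H : 'M[R]_N) j (b : R) :
  let A := AD D H in symm A -> pd J A -> 1 <= b -> le_norm (Gm A J) b ->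
  frob (Gm A (J :\ j)%SET) <= N%:R * b ^+ 4 /\
  frob (Gm A (J :\ j)%SET *m Gm A (J :\ j)%SET) <= N%:R * b ^+ 4.
Proof.
move=> A sA pA b1 nG.
have b0 : 0 <= b by lra.
have sub : (J :\ j)%SET \subset J by exact: finset.subsetDl.
have pA' := pd_sub sub pA.
have iB := pd_isinv sA pA'; have pB := pd_psd iB pA'.
have nB : le_norm (Gm A (J :\ j)%SET) b.
  have [jJ|jJ] := boolP (j \in J); last first.
    have -> // : (J :\ j)%SET = J.
    by apply/finset.setDidPl; rewrite disjoint_sym finset.disjoints1.
  have iG := pd_isinv sA pA; have pG := pd_psd iG pA.
  have g0 := diag_inv_gt0 iG pG nG jJ.
  rewrite (Gm_eq sA (leave_one_out iG g0)) => v.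
  rewrite mulmxBl -scalemxAl; apply: le_trans (nG v).
  rewrite dotDr dotNr dotZr gerDl oppr_le0 mulr_ge0 ?invr_ge0 ?(ltW g0)//.
  exact: psd_outer.
have sB : symm (Gm A (J :\ j)%SET) by exact: Gm_symm.
split.
  apply: (le_trans (sum_sq_le b0 sB pB nB)); rewrite ler_wpM2l ?ler0n//.
  by rewrite ler_weXn2l.
have -> : b ^+ 4 = (b ^+ 2) ^+ 2 by rewrite -exprM.
apply: sum_sq_le; [exact: sqr_ge0|exact: symm_sq|exact: psd_mul_sq|exact: le_norm_sq].
Qed.

Lemma pd_set0 N (A : 'M[R]_N) : pd finset.set0 A.
Proof.
move=> v sv /negP[]; apply/eqP/matrixP => i k; rewrite ord1 mxE; apply: sv.
by rewrite finset.in_set0.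
Qed.

End SmallLemmas.

(** * The growth on a good event *)

Section GrowthDeterministic.
Context {R : realType} (N : nat) (S : 'I_N -> 'I_N -> R) (m z : 'I_N -> R).
Context (x kap b del e K Cz C1 be : R) (q : nat).

Definition seg n : {set 'I_N} := [set i : 'I_N | (i < n)%N]%SET.
(* With this diagonal shift the last matrix of the growth has diagonal [x]. *)
Definition Dn n (i : 'I_N) := x - kap * \sum_(k < N | (n <= k)%N) S i k * m k.

Lemma seg0 : seg 0 = finset.set0.
Proof. by apply/finset.setP => i; rewrite !inE. Qed.

Lemma segS (n : 'I_N) : seg n.+1 = (n |: seg n)%SET.
Proof.
by apply/finset.setP => i; rewrite finset.in_setU1 !inE ltnS leq_eqVlt.
Qed.

Lemma notin_seg (n : 'I_N) : n \notin seg n.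
Proof. by rewrite inE ltnn. Qed.

Lemma segN : seg N = [set: 'I_N]%SET.
Proof. by apply/finset.setP => i; rewrite !inE ltn_ord. Qed.

Hypotheses (S0 : forall i k, 0 <= S i k <= K) (sS : forall i k, S i k = S k i).
Hypotheses (m0 : forall i, 0 < m i) (z0 : forall i, 0 < z i).
Hypotheses (kap1 : 1 <= kap).
Hypotheses (base : forall i, (m i)^-1 + kap * (\sum_k S i k * m k) + e <= x).
Hypotheses (zeq : forall i, m i ^+ 2 * (1 + \sum_k S i k * z k) <= z i).
Hypotheses (b1 : 1 <= b) (del0 : 0 < del) (e1 : 2 * del + K * b <= e)
  (e2 : del + K * (3 * b ^+ 2) <= e) (e3 : e < 1).
Hypotheses (HCz : forall i, \sum_k S i k * z k <= Cz)
  (HC1 : forall i, m i * (1 + del + 2 * Cz) <= C1).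
Hypotheses (beN : N%:R * b ^+ 4 <= be).

Lemma Dn_step (n : 'I_N) i : Dn n.+1 i - Dn n i = kap * (S i n * m n).
Proof.
rewrite /Dn (bigD1 (P := fun k : 'I_N => (n <= k)%N) n)//=.
have -> : \sum_(k < N | (n < k)%N) S i k * m k =
  \sum_(k < N | (n <= k)%N && (k != n)) S i k * m k.
  by apply: eq_bigl => k; rewrite ltn_neqAle eq_sym andbC.
ring.
Qed.

Lemma Dn_mono (n : 'I_N) i : Dn n i <= Dn n.+1 i.
Proof.
rewrite -subr_ge0 Dn_step mulr_ge0 ?(le_trans ler01 kap1)// mulr_ge0// ?(ltW (m0 _))//.
by case/andP: (S0 i n).
Qed.

Let Sm0 i k : 0 <= S i k * m k.
Proof. by case/andP: (S0 i k) => s0 _; rewrite mulr_ge0// ltW. Qed.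
Let Sz0 i k : 0 <= S i k * z k.
Proof. by case/andP: (S0 i k) => s0 _; rewrite mulr_ge0// ltW. Qed.

(** The sum is split at [n]: the hidden part is what [Dn] subtracts, and [kap >= 1] covers the
    revealed one. *)
Lemma Dn_lower n i : (m i)^-1 + \sum_(k in seg n) S i k * m k + e <= Dn n i.
Proof.
have := base i; rewrite /Dn (bigID (fun k : 'I_N => (n <= k)%N))/=.
set s1 := \sum_(k | _) _; set s2 := \sum_(k | _) _.
have -> : \sum_(k in seg n) S i k * m k = s2.
  by apply: eq_bigl => k; rewrite inE -ltnNge.
have s20 : 0 <= s2 by apply: sumr_ge0 => k _.
rewrite mulrDr; have : 0 <= (kap - 1) * s2 by by rewrite mulr_ge0// subr_ge0.
move: (m i)^-1 => u; lra.
Qed.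

Definition potential (h : 'M[R]_N) n := \tr (Gm (AD (Dn n) h) (seg n) ^+ q.+1).
(** Indices below [n] are tested against leave-one-out minors of [seg n]. Row [n] is included as the
    next one to enter: since [n] lies outside [seg n], its minor is all of [seg n]. *)
Definition oks (h : 'M[R]_N) (n : nat) : bool :=
  \big[andb/true]_(j < N | (j <= n)%N) ok S h (Dn n.+1) (seg n :\ j)%SET j be del.

Lemma oksP h n : oks h n ->
  forall j : 'I_N, (j <= n)%N -> ok S h (Dn n.+1) (seg n :\ j)%SET j be del.
Proof. by rewrite /oks big_andE => /forallP hh j jn; have := hh j; rewrite jn. Qed.

Section Step.
Variables (h : 'M[R]_N) (n : 'I_N).
Hypotheses (sh : symm h) (pA : pd (seg n) (AD (Dn n) h)).
Let Gt := Gm (AD (Dn n.+1) h) (seg n).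

Lemma Gt_facts : [/\ symm Gt, psd Gt & pd (seg n) (AD (Dn n.+1) h)].
Proof.
have pA' := AD_mono (fun i _ => Dn_mono n i) pA.
by split => //; [apply/Gm_symm/AD_symm|exact: pd_psd (pd_isinv (AD_symm _ sh) pA') pA'].
Qed.

Definition drift := potential h n
  - q.+1%:R * (\sum_k (Dn n.+1 k - Dn n k) * (Gt ^+ q.+2) k k).
Definition kern := Gt *m (Gt + C1%:M) ^+ q *m Gt.

(** Needed to integrate the one-step bound by decoupling, which is stated for nonnegative
    functions. *)
Lemma drift_ge0 : 0 <= drift.
Proof.
have [sG pG _] := Gt_facts.
rewrite /drift /potential subr_ge0.
apply: le_trans (tr_power_tilde sh (fun i _ => Dn_mono n i) pA q).
by rewrite lerDr; exact: tr_exp_ge0.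
Qed.

Hypotheses (tr_b : potential h n <= b ^+ q.+1).

Let b0 : 0 < b. Proof. exact: lt_le_trans b1. Qed.
Let nG : le_norm (Gm (AD (Dn n) h) (seg n)) b.
Proof.
apply: norm_of_tr tr_b; [exact/Gm_symm/AD_symm| |exact: ltW].
exact: pd_psd (pd_isinv (AD_symm _ sh) pA) pA.
Qed.

Hypothesis okn : oks h n.

Lemma oks_conc (j : 'I_N) : (j <= n)%N ->
  forall J : {set 'I_N}, (J :\ j = seg n :\ j)%SET -> conc S h (Dn n.+1) J j del.
Proof.
move=> jn J JE.
have [sG pG pA'] := Gt_facts.
have nGt := tilde_norm sh (fun i _ => Dn_mono n i) pA nG.
have [f1 f2] := sub_frob j (AD_symm _ sh) pA' b1 nGt.
apply: (@ok_conc _ _ _ _ _ _ _ be); rewrite JE.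
- exact: oksP.
- exact: le_trans f1 beN.
- exact: le_trans f2 beN.
Qed.

Let cJ i : i \in seg n -> conc S h (Dn n.+1) (seg n) i del.
Proof. by rewrite inE => /ltnW ni; exact: oks_conc. Qed.
Let cj : conc S h (Dn n.+1) (n |: seg n)%SET n del.
Proof.
apply: oks_conc => //; rewrite finset.setU1K ?notin_seg//.
by apply/esym/finset.setDidPl; rewrite disjoint_sym finset.disjoints1 notin_seg.
Qed.

Let mD i : i \in seg n -> (m i)^-1 + \sum_(k in seg n) S i k * m k <= Dn n.+1 i - e.
Proof. by move=> _; rewrite lerBrDr (le_trans (Dn_lower n i))// Dn_mono. Qed.
Let zD i : i \in seg n -> m i ^+ 2 * (1 + \sum_(k in seg n) S i k * z k) <= z i.
Proof.
move=> _; apply: le_trans (zeq i); rewrite ler_wpM2l ?sqr_ge0// lerD2l.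
by rewrite [leRHS](bigID (mem (seg n)))/= lerDl sumr_ge0.
Qed.
Let jD : (m n)^-1 + \sum_(k in seg n) S n k * m k + 2 * del <= Dn n.+1 n.
Proof.
have := Dn_lower n n; have := Dn_mono n n.
by move: e1; have := mulr_ge0 (le_trans (proj1 (andP (S0 n n))) (proj2 (andP (S0 n n)))) (ltW b0); lra.
Qed.
Let zC : \sum_(k in seg n) S n k * z k <= Cz.
Proof.
apply: le_trans (HCz n).
by rewrite [leRHS](bigID (mem (seg n)))/= lerDl sumr_ge0.
Qed.

Lemma growth_step : pd (seg n.+1) (AD (Dn n.+1) h) /\
  potential h n.+1 <= drift + q.+1%:R * m n * (C1 ^+ q + qform h n kern).
Proof.
split; rewrite ?/potential segS.
  exact: (step_pd sh (fun i _ => Dn_mono n i) pA b0 nG S0 cJ e1 e2 e3 m0 mD (notin_seg n) cj jD).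
exact: (step_potential sh (fun i _ => Dn_mono n i) pA b0 nG S0 cJ e1 e2 e3 m0 z0 mD zD
  (notin_seg n) cj jD zC q (HC1 n)).
Qed.

End Step.

Definition goods (h : 'M[R]_N) n : bool :=
  \big[andb/true]_(k < n) ((potential h k <= b ^+ q.+1) && oks h k).

Lemma goodsS h n : goods h n.+1 = goods h n && ((potential h n <= b ^+ q.+1) && oks h n).
Proof. by rewrite /goods big_ord_recr. Qed.

Lemma goods_pd h n : symm h -> (n <= N)%N -> goods h n -> pd (seg n) (AD (Dn n) h).
Proof.
move=> sh; elim: n => [_ _|n ih nN]; first by rewrite seg0; exact: pd_set0.
rewrite goodsS => /and3P[g1 g2 g3].
by have [] := growth_step (n := Ordinal nN) sh (ih (ltnW nN) g1) g2 g3.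
Qed.

End GrowthDeterministic.


Section GrowthMeasurable.
Context {d} {U : measurableType d} {R : realType} (N : nat).
Context (S : 'I_N -> 'I_N -> R) (m : 'I_N -> R) (x kap b del C1 be : R) (q : nat).
Variable h : U -> 'M[R]_N.

Lemma mmx_Gm_seg D n (I : {set 'I_N}) : I \subset seg N n ->
  (forall i k : 'I_N, (i < n)%N -> (k < n)%N -> measurable_fun setT (fun u => h u i k)) ->
  mmx (fun u => Gm (AD D (h u)) I).
Proof.
move=> /fintype.subsetP sub mh; apply: mmx_Gm => i k /sub + /sub; rewrite !inE => iI kI.
exact/measurable_AD/mh.
Qed.

Lemma measurable_potential n :
  (forall i k : 'I_N, (i < n)%N -> (k < n)%N -> measurable_fun setT (fun u => h u i k)) ->
  measurable_fun setT (fun u => potential S m x kap q (h u) n).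
Proof. by move=> mh; apply: measurable_tr; apply: mmx_exp; exact: mmx_Gm_seg mh. Qed.

Lemma measurable_oks n :
  (forall i k : 'I_N, (i < n.+1)%N -> (k < n.+1)%N -> measurable_fun setT (fun u => h u i k)) ->
  measurable_fun setT (fun u => oks S m x kap del be (h u) n).
Proof.
move=> mh; apply: measurable_big_and => j jn; apply: measurable_ok => i k.
have lt i' : i' \in (j |: seg N n :\ j)%SET -> (i' < n.+1)%N.
  rewrite finset.in_setU1 finset.in_setD1 inE => /orP[/eqP ->|/andP[_ /ltnW]]; by rewrite ltnS.
by move=> /lt iI /lt kI; exact: mh.
Qed.

Lemma measurable_goods n :
  (forall i k : 'I_N, (i < n)%N -> (k < n)%N -> measurable_fun setT (fun u => h u i k)) ->
  measurable_fun setT (fun u => goods S m x kap b del be q (h u) n).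
Proof.
move=> mh; apply: measurable_big_and => k _; apply: measurable_and.
  apply: measurable_fun_ler; last exact: measurable_cst.
  by apply: measurable_potential => i l /ltn_trans il /ltn_trans ll; apply: mh; [apply: il|apply: ll].
apply: measurable_oks => i l il ll; apply: mh; exact: leq_trans (ltn_ord k).
Qed.

Lemma mmx_kern (n : 'I_N) :
  (forall i k : 'I_N, (i < n)%N -> (k < n)%N -> measurable_fun setT (fun u => h u i k)) ->
  mmx (fun u => kern S m x kap C1 q (h u) n).
Proof.
move=> mh; have mG : mmx (fun u => Gm (AD (Dn S m x kap n.+1) (h u)) (seg N n)) by exact: mmx_Gm_seg mh.
apply: mmx_mul => //; apply: mmx_mul => //; apply: mmx_exp; apply: mmx_add => //; exact: mmx_cst.
Qed.

Lemma measurable_drift (n : 'I_N) :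
  (forall i k : 'I_N, (i < n)%N -> (k < n)%N -> measurable_fun setT (fun u => h u i k)) ->
  measurable_fun setT (fun u => drift S m x kap q (h u) n).
Proof.
move=> mh; have mG : mmx (fun u => Gm (AD (Dn S m x kap n.+1) (h u)) (seg N n)) by exact: mmx_Gm_seg mh.
apply: measurable_funB; first exact: measurable_potential.
apply: measurable_funM; first exact: measurable_cst.
apply: measurable_sum => k; apply: measurable_funM; first exact: measurable_cst.
exact: mmx_exp.
Qed.

End GrowthMeasurable.

(** * Mean growth of the potential and probability of failure *)

Section GrowthProbability.
Context {d} {T : measurableType d} {R : realType} (P : probability T R) (N : nat).
Context (H : T -> 'M[R]_N) (S : 'I_N -> 'I_N -> R) (m z : 'I_N -> R).
Context (x kap b del e K Cz C1 be M v mm C2 : R) (q r : nat).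
Hypotheses (nH : noise P H S r M v).
Hypotheses (S0 : forall i k, 0 <= S i k <= K) (sS : forall i k, S i k = S k i).
Hypotheses (m0 : forall i, 0 < m i) (z0 : forall i, 0 < z i).
Hypotheses (kap1 : 1 <= kap).
Hypotheses (base : forall i, (m i)^-1 + kap * (\sum_k S i k * m k) + e <= x).
Hypotheses (zeq : forall i, m i ^+ 2 * (1 + \sum_k S i k * z k) <= z i).
Hypotheses (b1 : 1 <= b) (del0 : 0 < del) (e1 : 2 * del + K * b <= e)
  (e2 : del + K * (3 * b ^+ 2) <= e) (e3 : e < 1).
Hypotheses (HCz : forall i, \sum_k S i k * z k <= Cz)
  (HC1 : forall i, m i * (1 + del + 2 * Cz) <= C1).
Hypotheses (beN : N%:R * b ^+ 4 <= be).
Hypotheses (C10 : 0 <= C1) (C20 : 0 <= C2)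
  (HC2 : forall y, 0 <= y -> y * ((y + C1) ^+ q * y) - kap * y ^+ q.+2 <= C2).
Hypotheses (mmm : forall i, m i <= mm).

Let mH : forall i j, measurable_fun setT (fun w => H w i j).
Proof. by case: nH. Qed.
Let sH : forall w, symm (H w).
Proof. by case: nH. Qed.
Let indH : mutually_independent P (upper N) (entry H).
Proof. by case: nH. Qed.

Let good w n := goods S m x kap b del be q (H w) n.
Let pot w n := potential S m x kap q (H w) n.
Let cst := q.+1%:R * mm * (C1 ^+ q + N%:R * K * C2).

Let good_pd w (n : nat) : (n <= N)%N -> good w n -> pd (seg N n) (AD (Dn S m x kap n) (H w)).
Proof.
exact: (goods_pd S0 m0 z0 kap1 base zeq b1 e1 e2 e3 HCz HC1 beN (sH w)).
Qed.

Let pot_ge0 w (n : nat) : (n <= N)%N -> good w n -> 0 <= pot w n.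
Proof.
move=> nN /(good_pd nN) p.
have sA : symm (AD (Dn S m x kap n) (H w)) by exact: AD_symm.
by apply: tr_exp_ge0; [exact: Gm_symm|exact: pd_psd (pd_isinv sA p) p].
Qed.

(** The potential of the stopped growth, zero after the first failure: its mean is bounded without
    any control on the bad event. *)
Let gpot w n : R := if good w n then pot w n else 0.

Let gpot_ge0 w (n : nat) : (n <= N)%N -> 0 <= gpot w n.
Proof. by move=> nN; rewrite /gpot; case: ifP => // /(pot_ge0 nN). Qed.

Let mgood n : measurable_fun setT (fun w => good w n).
Proof. exact: measurable_goods. Qed.

Let mpot n : measurable_fun setT (fun w => pot w n).
Proof. exact: measurable_potential. Qed.

Let mgpot n : measurable_fun setT (fun w => gpot w n).
Proof. by apply: measurable_fun_ifT => //; exact: measurable_cst. Qed.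

Section OneStep.
Variable n : 'I_N.

(** The bound of [growth_step] with the past in the first argument and row [n] in the second, as
    decoupling requires. *)
Let F (p : subT (entry H) (restset n) * subT (entry H) (rowset n)) : R :=
  if good p.1 n then drift S m x kap q (H p.1) n +
    q.+1%:R * m n * (C1 ^+ q +
      \sum_k \sum_l kern S m x kap C1 q (H p.1) n k l * (H p.2 n k * H p.2 n l))
  else 0.

Let a0 : 0 <= q.+1%:R * m n.
Proof. by rewrite mulr_ge0// ltW. Qed.

Let kern_facts w : good w n ->
  [/\ symm (kern S m x kap C1 q (H w) n), psd (kern S m x kap C1 q (H w) n) &
   forall k, kern S m x kap C1 q (H w) n k k -
     kap * (Gm (AD (Dn S m x kap n.+1) (H w)) (seg N n) ^+ q.+2) k k <= C2].
Proof.
move=> /(good_pd (ltnW (ltn_ord n))) p.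
have [s1 s2 _] := Gt_facts S0 m0 kap1 (sH w) p.
exact: potential_poly.
Qed.

Let F_ge0 p : 0 <= F p.
Proof.
rewrite /F; case: ifP => // g.
have [_ pk _] := kern_facts g.
apply: addr_ge0.
  exact: (drift_ge0 q S0 m0 kap1 (sH _) (good_pd (ltnW (ltn_ord n)) g)).
apply: mulr_ge0 => //; apply: addr_ge0; first exact: exprn_ge0.
by rewrite (quad_dot (kern S m x kap C1 q (H p.1) n) (fun k => H p.2 n k)).
Qed.

Let mrest : forall i k : 'I_N, (i < n)%N -> (k < n)%N ->
  measurable_fun setT (fun w : subT (entry H) (restset n) => H w i k).
Proof.
move=> i k ni nk; apply: measurable_rest => //; first by rewrite neq_ltn ni.
by rewrite neq_ltn nk.
Qed.

Let mF : measurable_fun setT F.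
Proof.
apply: measurable_fun_ifT; last exact: measurable_cst.
  exact: (measurableT_comp (measurable_goods S m x kap b del be q mrest) measurable_fst).
apply: measurable_funD.
  exact: (measurableT_comp (measurable_drift S m x kap q mrest) measurable_fst).
apply: measurable_funM; first exact: measurable_cst.
apply: measurable_funD; first exact: measurable_cst.
apply: measurable_qform => [i k|k].
  exact: (measurableT_comp (mmx_kern S m x kap C1 q mrest i k) measurable_fst).
exact: (measurableT_comp (measurable_row sH (j := n) k) measurable_snd).
Qed.

(** The mean of the form is the diagonal of the kernel weighted by $S_{nk}$, while the drift
    subtracts [kap] times the diagonal of [Gt ^+ q.+2] with the same weights. By [potential_poly]
    the difference is at most [C2] per entry, hence the term [N%:R * K * C2]. *)
Let inner w : good w n ->
  (\int[P]_u (F (w, u))%:E <= (pot w n + cst)%:E)%E.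
Proof.
move=> g; rewrite /F/= g.
have [sk pk kb] := kern_facts g.
set k0 := kern _ _ _ _ _ _ _ _ in sk pk kb *.
pose A := fun a b : nat => if (insub a, insub b) is (Some x, Some y) then k0 x y else 0.
have sA i j : A i j = A j i.
  by rewrite /A; case: insub => [?|]; case: insub => [?|]//; rewrite symmE.
have [_ _ _ row] := nH.
have [qi qm] := quadratic_form_mean (row n) sA.
have AE u : \sum_(k < N) \sum_(l < N) A k l * (hrow H n k u * hrow H n l u) =
    \sum_k \sum_l k0 k l * (H u n k * H u n l).
  by apply: eq_bigr => k _; apply: eq_bigr => l _; rewrite /A !valK !hrowE.
have DE : \sum_(k < N) A k k * srow S n k = \sum_k k0 k k * S n k.
  by apply: eq_bigr => k _; rewrite /A !valK srowE.
rewrite DE in qm.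
set c := drift _ _ _ _ _ _ _; set a := q.+1%:R * m n.
have a0' : 0 <= a by exact: a0.
have -> : (\int[P]_u (c + a * (C1 ^+ q + \sum_k \sum_l k0 k l * (H u n k * H u n l)))%:E =
    (c + a * (C1 ^+ q + \sum_k k0 k k * S n k))%:E)%E.
  transitivity (\int[P]_u ((c + a * C1 ^+ q)%:E + a%:E *
     (\sum_(k < N) \sum_(l < N) A k l * (hrow H n k u * hrow H n l u))%:E))%E.
    by apply: eq_integral => u _; rewrite AE -EFinM -EFinD mulrDr addrA.
  rewrite integralD//; last 2 first.
  - by apply: finite_measure_integrable_cst.
  - exact: integrableZl.
  rewrite integralZl// qm probability_integral_cst -EFinM -EFinD.
  by rewrite mulrDr addrA.
rewrite lee_fin /c /drift -/(pot w n).
have -> : q.+1%:R * (\sum_k (Dn S m x kap n.+1 k - Dn S m x kap n k) *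
   (Gm (AD (Dn S m x kap n.+1) (H w)) (seg N n) ^+ q.+2) k k) =
   a * \sum_k S n k * (kap * (Gm (AD (Dn S m x kap n.+1) (H w)) (seg N n) ^+ q.+2) k k).
  rewrite /a -mulrA; congr (_ * _); rewrite mulr_sumr; apply: eq_bigr => k _.
  by rewrite Dn_step (sS n k); ring.
have hk : \sum_k k0 k k * S n k - \sum_k S n k *
    (kap * (Gm (AD (Dn S m x kap n.+1) (H w)) (seg N n) ^+ q.+2) k k) <= N%:R * K * C2.
  rewrite -sumrB; apply: (@le_trans _ _ (\sum_(k < N) K * C2)); last first.
    by rewrite sumr_const card_ord -[leLHS]mulr_natl mulrA.
  apply: ler_sum => k _; rewrite mulrC -mulrBr.
  have /andP[s0 sK] := S0 n k.
  by apply: (le_trans (ler_wpM2l s0 (kb k))); exact: ler_wpM2r.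
move: hk; set s1 := \sum_k k0 k k * S n k; set s2 := \sum_k S n k * _ => hk.
have aq : a * (C1 ^+ q + N%:R * K * C2) <= cst.
  rewrite /cst; apply: ler_wpM2r; last by rewrite /a ler_wpM2l.
  have K0 : 0 <= K by have /andP[h1 h2] := S0 n n; exact: le_trans h2.
  by rewrite addr_ge0 ?exprn_ge0// mulr_ge0// mulr_ge0.
apply: (@le_trans _ _ (pot w n + a * (C1 ^+ q + N%:R * K * C2))); last by rewrite lerD2l.
have -> : pot w n - a * s2 + a * (C1 ^+ q + s1) = pot w n + a * (C1 ^+ q + (s1 - s2)) by ring.
by rewrite lerD2l ler_wpM2l// lerD2l.
Qed.

Lemma mean_potential_step :
  (\int[P]_w (gpot w n.+1)%:E <= (\int[P]_w (gpot w n)%:E) + cst%:E)%E.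
Proof.
have mdiag : measurable_fun setT (fun w : T => F (w, w)).
  apply: measurable_fun_ifT; [exact: mgood| |exact: measurable_cst].
  apply: measurable_funD; first by apply: measurable_drift.
  apply: measurable_funM; first exact: measurable_cst.
  apply: measurable_funD; first exact: measurable_cst.
  apply: (measurable_qform (B := fun w : T => kern S m x kap C1 q (H w) n)
    (h := fun w k => H w n k)) => //.
  exact: mmx_kern.
have cst0 : 0 <= cst.
  rewrite /cst mulr_ge0//.
    by rewrite mulr_ge0// (le_trans _ (mmm n))// ltW.
  have K0 : 0 <= K by have /andP[h1 h2] := S0 n n; exact: le_trans h2.
  by rewrite addr_ge0 ?exprn_ge0// mulr_ge0// mulr_ge0.
apply: (@le_trans _ _ (\int[P]_w (F (w, w))%:E)%E).
  apply: ge0_le_integral => //.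
  - by move=> w _; rewrite lee_fin gpot_ge0.
  - exact/measurable_EFinP.
  - exact/measurable_EFinP.
  - move=> w _; rewrite lee_fin /gpot.
    case: (boolP (good w n.+1)) => [|_]; last exact: F_ge0.
    rewrite /good goodsS => /and3P[g1 g2 g3].
    have [_] := growth_step S0 m0 z0 kap1 base zeq b1 e1 e2 e3 HCz HC1 beN (sH w)
      (good_pd (ltnW (ltn_ord n)) g1) g2 g3.
    by rewrite /F/= /good g1.
rewrite (row_rest_decoupling mH indH (F := fun p => (F p)%:E)); last 2 first.
- exact/measurable_EFinP.
- by move=> p; rewrite lee_fin.
apply: (@le_trans _ _ (\int[P]_w ((gpot w n)%:E + cst%:E))%E).
  apply: ge0_le_integral => //.
  - by move=> w _; apply: integral_ge0 => u _; rewrite lee_fin.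
  - apply: (family_fubini P (measurable_entry mH) (F := fun p => (F p)%:E)) => [|p].
      exact/measurable_EFinP.
    by rewrite lee_fin.
  - by apply: emeasurable_funD; [exact/measurable_EFinP|exact: measurable_cst].
  - move=> w _; rewrite /gpot; case: (boolP (good w n)) => g; first exact: inner.
    under eq_integral do rewrite /F/= (negbTE g).
    by rewrite integral0 add0e lee_fin.
rewrite ge0_integralD//; last 2 first.
- by move=> w _; rewrite lee_fin gpot_ge0// ltnW.
- exact/measurable_EFinP.
by rewrite probability_integral_cst.
Qed.
End OneStep.

Lemma mean_potential (n : nat) : (n <= N)%N ->
  (\int[P]_w (gpot w n)%:E <= (n%:R * cst)%:E)%E.
Proof.
elim: n => [_|n ih nN].
  rewrite mul0r; under eq_integral => w _.
    have -> : gpot w 0 = 0.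
      rewrite /gpot /pot /potential seg0 (Gm_eq _ (isinv_set0 _)); last exact: AD_symm.
      by rewrite expr0n/= mxtrace0; case: ifP.
    over.
  by rewrite integral0.
apply: (le_trans (mean_potential_step (Ordinal nN))).
rewrite -natr1 mulrDl mul1r EFinD leeD2r//; exact/ih/ltnW.
Qed.

(** A first failure is either an overshoot of the potential on the good past, handled by Markov's
    inequality, or the failure of one of at most [N] concentration conditions. *)
Lemma goods_tail (tail : R) : 0 <= tail ->
  (forall D (I : {set 'I_N}) j, j \notin I ->
    (P [set w | ~~ ok S (H w) D I j be del] <= tail%:E)%E) ->
  forall n, (n <= N)%N ->
  (P [set w | ~~ good w n] <= (n%:R * (N%:R * cst / b ^+ q.+1 + N%:R * tail))%:E)%E.
Proof.
move=> t0 Htail; elim=> [_|n ih nN].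
  rewrite mul0r (_ : [set w | _] = set0) ?measure0//.
  by apply/seteqP; split => w //=; rewrite /good /goods big_ord0.
(* [bb] fails exactly when the potential overshoots on the good past, where [gpot] equals it. *)
pose bb (w : T) := ~~ (good w n && ~~ (pot w n <= b ^+ q.+1)).
have mbb : measurable_fun setT bb.
  apply: measurable_neg; apply: measurable_and => //; apply: measurable_neg.
  by apply: measurable_fun_ler => //; exact: measurable_cst.
have mok : measurable_fun setT (fun w => oks S m x kap del be (H w) n).
  by apply: measurable_oks => i k _ _; exact: mH.
have sub : [set w | ~~ good w n.+1] = [set w | ~~ (good w n && (bb w &&
    oks S m x kap del be (H w) n))].
  apply/seteqP; split => w /=; rewrite /good goodsS /bb -/(good w n) -/(pot w n);
   by case: (good w n); case: (pot w n <= _); case: (oks _ _ _ _ _ _ _ _).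
rewrite sub; apply: (le_trans (not_and_le P (mgood n) (measurable_and mbb mok))).
rewrite -natr1 mulrDl mul1r EFinD; apply: leeD; first exact/ih/ltnW.
apply: (le_trans (not_and_le P mbb mok)); rewrite EFinD; apply: leeD.
  have b0 : 0 < b ^+ q.+1 by rewrite exprn_gt0// (lt_le_trans ltr01 b1).
  apply: (@le_trans _ _ (P [set w | b ^+ q.+1 < gpot w n]%R)).
    apply: le_measure; rewrite ?inE.
    - exact: (measurable_bool_set _).2.
    - have mlt : measurable_fun setT (fun w : T => b ^+ q.+1 < gpot w n).
        by apply: measurable_fun_ltr => //; exact: measurable_cst.
      exact: (measurable_bool_set mlt).1.
    - move=> w /=; rewrite /bb negbK => /andP[g]; rewrite -ltNge /gpot g//.
  apply: (@le_trans _ _ ((n%:R * cst / b ^+ q.+1)%:E)).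
    apply: markov_ge0 => //.
    - by move=> w; apply: gpot_ge0; exact: ltnW.
    - exact/mean_potential/ltnW.
  have cst0 : 0 <= n%:R * cst -> 0 <= (N%:R - n%:R) * cst.
    case: n nN {ih bb mbb mok sub} => [|n] nN.
      have /mean_potential h1 := nN.
      have : (0 <= ((1 : nat)%:R * cst)%:E)%E.
        by apply: le_trans h1; apply: integral_ge0 => w _; rewrite lee_fin gpot_ge0.
      by rewrite lee_fin mul1r => c0 _; rewrite subr0 mulr_ge0.
    by rewrite pmulr_rge0// => c0; rewrite mulr_ge0// subr_ge0 ler_nat ltnW.
  rewrite lee_fin ler_wpM2r ?invr_ge0 ?(ltW b0)//.
  rewrite -subr_ge0 -mulrBl cst0//.
  have /mean_potential h1 := ltnW nN.
  rewrite -lee_fin; apply: le_trans h1.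
  by apply: integral_ge0 => w _; rewrite lee_fin gpot_ge0// ltnW.
rewrite /oks.
have := @not_big_and_le _ T R P _ (index_enum 'I_N) (fun j : 'I_N => (j <= n)%N)
  (fun j w => ok S (H w) (Dn S m x kap n.+1) (seg N n :\ j)%SET j be del) tail t0.
have -> : size (index_enum 'I_N) = N by rewrite /index_enum unlock -enumT size_enum_ord.
apply.
- by move=> j jn; apply: measurable_ok => i k _ _; exact: mH.
- by move=> j jn; apply: Htail; rewrite finset.setD11.
Qed.

End GrowthProbability.

(** * Two-sided estimates and the spiked quadratic form *)

Section TwoSided.
Context {R : realType} (N : nat) (S : 'I_N -> 'I_N -> R) (m mu z : 'I_N -> R).
Context (x tau del e e' K be mm eta Cs sig U : R) (u : 'cV[R]_N) (h : 'M[R]_N).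
Let b := tau^-1.
Let D := Dn S m x 1.

(** The resolvent of the first [n] indices with the diagonal already raised for row [n]: it does not
    involve that row and is the minor in the next Schur complement. *)
Definition tres n : 'M[R]_N := Gm (AD (Dn S m x 1 n.+1) h) (seg N n).
Definition row_form (y : 'cV[R]_N) (n : 'I_N) := \sum_k y k 0 * h n k.
(* The centred part of [(u_n + y . H_n)^2]: the martingale increment of [u^T G u]. *)
Definition xi (y : 'cV[R]_N) (n : 'I_N) :=
  2 * u n 0 * row_form y n + (row_form y n ^+ 2 - \sum_k S n k * y k 0 ^+ 2).

Hypotheses (S0 : forall i k, 0 <= S i k <= K) (sS : forall i k, S i k = S k i).
Hypotheses (SC : forall i, \sum_k S i k <= Cs).
Hypotheses (m0 : forall i, 0 < m i) (mmm : forall i, m i <= mm) (z0 : forall i, 0 < z i).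
Hypotheses (sh : symm h) (tau0 : 0 < tau) (tau1 : tau <= 1).
Hypotheses (pdn : forall n, (n <= N)%N -> forall v, supp (seg N n) v ->
  tau * dot v v <= dot v (AD (Dn S m x 1 n) h *m v)).
Hypotheses (okn : forall n, (n <= N)%N -> oks S m x 1 del be h n).
Hypotheses (beN : N%:R * b ^+ 4 <= be).
Hypotheses (eqm : forall i, `|(m i)^-1 + \sum_k S i k * m k - x| <= e').
Hypotheses (mmu : forall i, m i <= mu i)
  (base : forall i, (mu i)^-1 + \sum_k S i k * mu k + e <= x)
  (zeq : forall i, m i * mu i * (1 + \sum_k S i k * z k) <= z i).
Hypotheses (del0 : 0 < del) (e1 : 2 * del + K * b <= e)
  (e2 : del + K * (3 * b ^+ 2) <= e) (e3 : e < 1).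
Hypotheses (eta1 : forall i, mu i - m i <= eta) (eta2 : forall i, (e + (e' + K * mm)) * z i <= eta).

Let b1 : 1 <= b. Proof. by rewrite /b invf_ge1. Qed.
Let b0 : 0 < b. Proof. by rewrite /b invr_gt0. Qed.
Let Sm0 i k : 0 <= S i k * m k.
Proof. by case/andP: (S0 i k) => s0 _; rewrite mulr_ge0// ltW. Qed.
Let S00 i k : 0 <= S i k.
Proof. by case/andP: (S0 i k). Qed.

Lemma Dn_le n n' i : (n <= n')%N -> D n i <= D n' i.
Proof.
move=> nn; rewrite /D /Dn !mul1r lerD2l lerN2 [leLHS]big_mkcond [leRHS]big_mkcond/=.
apply: ler_sum => k _; case: (leqP n' k) => [/(leq_trans nn) -> //|_].
by case: ifP.
Qed.

Let sA n : symm (AD (D n) h). Proof. exact: AD_symm. Qed.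

Let pd_n n : (n <= N)%N -> pd (seg N n) (AD (D n) h).
Proof.
move=> nN v sv v0; apply: lt_le_trans (pdn nN sv); rewrite mulr_gt0//.
by rewrite lt_def dot_ge0 andbT; apply: contra v0 => /eqP/dot_eq0 ->.
Qed.

Let norm_n n : (n <= N)%N -> le_norm (Gm (AD (D n) h) (seg N n)) b.
Proof. by move=> nN; apply: isinv_norm (pd_isinv (sA n) (pd_n nN)) tau0 (pdn nN). Qed.

Let pd_t n : (n <= N)%N -> pd (seg N n) (AD (D n.+1) h).
Proof. by move=> nN; apply: AD_mono (pd_n nN) => i _; exact: Dn_le. Qed.

Let iGt n : (n <= N)%N -> isinv (seg N n) (AD (D n.+1) h) (tres n).
Proof. by move=> /pd_t; exact: pd_isinv. Qed.

Let pGt n : (n <= N)%N -> psd (tres n).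
Proof. by move=> nN; exact: pd_psd (iGt nN) (pd_t nN). Qed.

Let nGt n : (n <= N)%N -> le_norm (tres n) b.
Proof.
move=> nN; apply: (tilde_norm sh _ (pd_n nN) (norm_n nN)) => i _; exact: Dn_le.
Qed.

Let sGt n : symm (tres n). Proof. exact/Gm_symm/sA. Qed.

Let concn n (j : 'I_N) (J : {set 'I_N}) : (n <= N)%N -> (j <= n)%N ->
  (J :\ j = seg N n :\ j)%SET -> conc S h (D n.+1) J j del.
Proof.
move=> nN jn JE.
have [f1 f2] := sub_frob j (sA _) (pd_t nN) b1 (nGt nN).
apply: (@ok_conc _ _ _ _ _ _ _ be); rewrite JE.
- exact: oksP (okn nN) _ jn.
- exact: le_trans f1 beN.
- exact: le_trans f2 beN.
Qed.

Let cJ n i : (n <= N)%N -> i \in seg N n -> conc S h (D n.+1) (seg N n) i del.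
Proof. by move=> nN; rewrite inE => /ltnW ni; exact: concn. Qed.

Let e'0 (i : 'I_N) : 0 <= e'. Proof. exact: le_trans (eqm i). Qed.
Let K0 (i : 'I_N) : 0 <= K. Proof. by case/andP: (S0 i i) => s0; exact: le_trans. Qed.
Let mm0 (i : 'I_N) : 0 < mm. Proof. exact: lt_le_trans (mmm i). Qed.

(** The upper bound compares with [mu], a supersolution with slack [e]; the lower bound compares
    with [m]. The extra error [K * mm] is the term of row [n], which lies neither in the block
    [seg n] nor in the sum subtracted in [Dn n.+1]. *)
Lemma tres_diag n j : (n <= N)%N -> j \in seg N n -> `|tres n j j - m j| <= eta.
Proof.
move=> nN jn.
have DD i : i \in seg N n -> D n.+1 i <= D n.+1 i by [].
have mu0 i : 0 < mu i by exact: lt_le_trans (mmu i).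
have muD i : i \in seg N n -> (mu i)^-1 + \sum_(k in seg N n) S i k * mu k <= D n.+1 i - e.
  move=> _; have := base i; rewrite /D /Dn mul1r (bigID (mem (seg N n)))/=.
  have : \sum_(k < N | (n.+1 <= k)%N) S i k * m k <= \sum_(k | k \notin seg N n) S i k * mu k.
    rewrite [leLHS]big_mkcond [leRHS]big_mkcond/=; apply: ler_sum => k _.
    rewrite inE -leqNgt; case: (leqP n.+1 k) => [/ltnW -> |_]; first exact: ler_wpM2l.
    by case: ifP => _ //; rewrite mulr_ge0// ltW.
  move: (mu i)^-1 => iu; set s1 := \sum_(k in _) _; set s2 := \sum_(k | _) _; set s3 := \sum_(k | _) _.
  lra.
have up i : i \in seg N n -> tres n i i <= mu i.
  have XX := (tilde_upper sh DD (pd_t nN) b0 (nGt nN) S0 (fun i => @cJ n i nN) e1 e2 e3 mu0 muD). exact: XX.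
have lp := tilde_loop sh DD (pd_t nN) (nGt nN) S0 (fun i => @cJ n i nN) e1.
have g0 i : i \in seg N n -> 0 < tres n i i by exact: (diag_inv_gt0 (iGt nN) (pGt nN) (nGt nN)).
have gz i : i \notin seg N n -> tres n i i = 0 by move=> ni; rewrite /tres Gm_out// negb_and ni.
have e''0 : 0 <= e' + K * mm.
  by rewrite addr_ge0 ?(e'0 j)// mulr_ge0// ?(K0 j)// ltW// (mm0 j).
have Dm i : i \in seg N n -> D n.+1 i <= (m i)^-1 + \sum_(k in seg N n) S i k * m k + (e' + K * mm).
  move=> _; have := eqm i; rewrite ler_norml => /andP[+ _].
  rewrite /D /Dn mul1r (bigID (mem (seg N n)))/=.
  have : \sum_(k | k \notin seg N n) S i k * m k <=
     \sum_(k < N | (n.+1 <= k)%N) S i k * m k + K * mm.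
    have [nN'|Nn] := ltnP n N; last first.
      rewrite big1 ?addr_ge0//.
      - by apply: sumr_ge0.
      - by rewrite mulr_ge0// ?(K0 j)// ltW// (mm0 j).
      - by move=> k; rewrite inE -leqNgt => /(leq_trans Nn); rewrite leqNgt ltn_ord.
    rewrite (bigD1 (Ordinal nN'))/=; last by rewrite inE ltnn.
    rewrite addrC; apply: lerD.
      rewrite [leLHS]big_mkcond [leRHS]big_mkcond/=; apply: ler_sum => k _.
      rewrite inE -leqNgt (leq_eqVlt n) eq_sym.
      by case: (ltnP n k) => nk; rewrite ?orbT ?orbF; case: ifP => // /andP[/eqP ee /eqP[]];
       apply: val_inj.
    by apply: ler_pM => //; [exact: ltW|case/andP: (S0 i (Ordinal nN'))].
  move: (m i)^-1 => im; set s1 := \sum_(k in _) _; set s2 := \sum_(k | _) _; set s3 := \sum_(k | _) _.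
  lra.
have zD i : i \in seg N n -> m i * mu i * (1 + \sum_(k in seg N n) S i k * z k) <= z i.
  move=> _; apply: le_trans (zeq i); rewrite ler_wpM2l ?mulr_ge0 ?(ltW (m0 _)) ?(ltW (mu0 _))// lerD2l.
  by rewrite [leRHS](bigID (mem (seg N n)))/= lerDl sumr_ge0// => k _; rewrite mulr_ge0// ltW.
have lo := loop_lower S00 g0 gz lp (fun i _ => m0 i) (fun i _ => z0 i) up e''0 Dm zD jn.
have := up j jn; have := eta1 j; have := eta2 j.
move: lo; rewrite ler_norml; set g := tres n j j; lra.
Qed.

Section Step.
Variable n : 'I_N.
Let nN : (n <= N)%N. Proof. exact: ltnW. Qed.
Let c := - col n (AD (D n.+1) h).
Let s := AD (D n.+1) h n n - dot c (tres n *m c).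
Let y := tres n *m u.
Let w := delta_mx n 0 + tres n *m c.

Let schurE : s = D n.+1 n - h n n - qform h n (tres n).
Proof.
have DD i : i \in seg N n -> D n.+1 i <= D n.+1 i by [].
exact: (step_schurE sh DD (pd_t nN) (notin_seg n)).
Qed.

Hypothesis sigE : e' + K * mm + 2 * del + Cs * eta <= sig.

Lemma schur_close : `|s - (m n)^-1| <= sig.
Proof.
have cj : conc S h (D n.+1) (n |: seg N n)%SET n del.
  apply: concn => //; rewrite finset.setU1K ?notin_seg//.
  by apply/esym/finset.setDidPl; rewrite disjoint_sym finset.disjoints1 notin_seg.
move: cj => []; rewrite finset.setU1K ?notin_seg// => h1 + _.
rewrite -/(tres n) => h2.
have h3 : `|trS S n (tres n) - \sum_(k in seg N n) S n k * m k| <= Cs * eta.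
  have -> : trS S n (tres n) = \sum_(k in seg N n) S n k * tres n k k.
    rewrite /trS [RHS]big_mkcond; apply: eq_bigr => k _; rewrite [X in _ = if X then _ else _]/=.
    by case: (boolP (k \in seg N n)) => kn; [rewrite mulrC|rewrite Gm_out ?mul0r// negb_and kn].
  rewrite -sumrB; apply: (le_trans (ler_norm_sum _ _ _)).
  have eta0 : 0 <= eta.
    by apply: le_trans (eta1 n); rewrite subr_ge0.
  apply: (@le_trans _ _ (\sum_k S n k * eta)); last by rewrite -mulr_suml ler_wpM2r.
  rewrite big_mkcond; apply: ler_sum => k _; case: ifP => kn; last by rewrite mulr_ge0.
  by rewrite -mulrBr normrM ger0_norm// ler_wpM2l// tres_diag.
have h4 : D n.+1 n = x - \sum_k S n k * m k + S n n * m n + \sum_(k in seg N n) S n k * m k.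
  rewrite /D /Dn mul1r [X in _ = x - X + _ + _](bigID (fun k => k \in seg N n))/= [X in _ = _ - (_ + X) + _ + _](bigD1 n)/= ?notin_seg//.
  have -> : \sum_(k | (k \notin seg N n) && (k != n)) S n k * m k =
    \sum_(k < N | (n.+1 <= k)%N) S n k * m k.
    by apply: eq_bigl => k; rewrite inE -leqNgt ltn_neqAle eq_sym andbC.
  ring.
have h5 : 0 <= S n n * m n <= K * mm.
  by rewrite mulr_ge0 ?(ltW (m0 _))//= ler_pM ?(ltW (m0 _))//; case/andP: (S0 n n).
have h6 := eqm n.
rewrite schurE h4.
move: h6 h1 h2 h3 h5 sigE; rewrite !ler_norml.
move: (m n)^-1 (qform h n (tres n)) (trS S n (tres n)) (h n n) (\sum_k S n k * m k)
  (S n n * m n) (\sum_(k in seg N n) S n k * m k) (K * mm) (Cs * eta) => a1 a2 a3 a4 a5 a6 a7 a8 a9.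
move=> /andP[? ?] /andP[? ?] /andP[? ?] /andP[? ?] /andP[? ?] ?.
by apply/andP; split; lra.
Qed.

Hypothesis sigm : sig * mm < 1.

Lemma schur_gt0 : 0 < s.
Proof.
have := schur_close; rewrite ler_norml => /andP[h1 _].
have h2 : mm^-1 <= (m n)^-1 by rewrite lef_pV2 ?posrE// (mm0 n).
have h3 : sig < mm^-1 by rewrite -[mm^-1]div1r ltr_pdivlMr// (mm0 n).
move: (m n)^-1 (mm^-1) h1 h2 h3 => p q; lra.
Qed.

Lemma form_step : let G1 := Gm (AD (D n.+1) h) (seg N n.+1) in
  dot u (G1 *m u) = dot u (tres n *m u) + s^-1 * (u n 0 + row_form y n) ^+ 2.
Proof.
have sn0 : s != 0 by rewrite gt_eqF// schur_gt0.
have iG1 := row_step (sA n.+1) (iGt nN) (notin_seg n) sn0.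
move=> G1; rewrite /G1 segS (Gm_eq (sA _) iG1) -/c -/w -/s; have [w0 w0E] : exists w0, w0 = w by exists w.
rewrite -w0E.
rewrite mulmxDl dotDr -scalemxAl dotZr; congr (_ + _ * _).
rewrite outer_mul dotZr.
have wu : dot w0 u = u n 0 + row_form y n.
  rewrite w0E /w dotDl dotC; congr (_ + _).
    rewrite dotE (bigD1 n)//= big1 ?addr0; first by rewrite mxE !eqxx mulr1.
    by move=> k kn; rewrite mxE (negbTE kn)/= mulr0.
  rewrite dot_sym// dotC /row_form dotE; apply: eq_bigr => k _.
  have [->|kn] := eqVneq k n.
    have -> : y n 0 = 0 by apply: (isinv_supp u (iGt nN)); exact: notin_seg.
    by rewrite !mul0r.
  by congr (_ * _); rewrite !mxE (negbTE kn) mul0r sub0r opprK symmE.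
by rewrite (dotC u) wu expr2.
Qed.

(** The effect of raising the diagonal, to second order. The first-order term is [m n] times the
    variance subtracted in [xi], so it cancels the mean of what row [n] adds; the remainder is of
    order $K^2$ and stays small after summation over the rows. *)
Lemma form_tilde : exists2 rho, 0 <= rho <= b ^+ 3 * (K * mm) ^+ 2 * dot u u &
  dot u (Gm (AD (D n) h) (seg N n) *m u) =
  dot u (tres n *m u) + m n * (\sum_k S n k * y k 0 ^+ 2) + rho.
Proof.
have DD i : i \in seg N n -> D n i <= D n.+1 i by move=> _; exact: Dn_le.
have dif := inverse_diff sh DD (pd_n nN).
set G := Gm (AD (D n) h) (seg N n) in dif *.
set De := dg _ in dif.
have sG : symm G by exact/Gm_symm/sA.
have pG : psd G by exact: pd_psd (pd_isinv (sA n) (pd_n nN)) (pd_n nN).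
have De_y k : (De *m y) k 0 = m n * S n k * y k 0.
  by rewrite dg_mulE /D Dn_step mul1r sS; ring.
exists (dot (De *m y) (G *m (De *m y))).
  rewrite pG/=; apply: (le_trans (norm_n nN _)).
  have h1 : dot (De *m y) (De *m y) <= (K * mm) ^+ 2 * dot y y.
    rewrite !dotE mulr_sumr; apply: ler_sum => k _; rewrite De_y -expr2 exprMn -expr2.
    apply: ler_wpM2r; first exact: sqr_ge0.
    have /andP[s0 sK] := S0 n k.
    apply: lerXn2r; rewrite ?nnegrE ?mulr_ge0 ?(ltW (m0 _)) ?(K0 n) ?(ltW (mm0 n))//.
    by rewrite mulrC; apply: ler_pM => //; exact: ltW.
  have h2 := psd_sq_norm u (ltW b0) (sGt n) (pGt nN) (nGt nN).
  rewrite -/y in h2.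
  apply: (@le_trans _ _ (b * ((K * mm) ^+ 2 * (b ^+ 2 * dot u u)))).
    apply: ler_wpM2l; first exact: ltW.
    by apply: (le_trans h1); apply: ler_wpM2l => //; exact: sqr_ge0.
  by rewrite le_eqVlt; apply/orP; left; apply/eqP; ring.
have Gu : G *m u = y + G *m (De *m y).
  by rewrite /y !mulmxA -[in RHS]dif -/(tres n) mulmxBl addrC subrK.
rewrite {1}Gu dotDr -addrA; congr (_ + _).
rewrite -dot_sym// Gu dotDl; congr (_ + _).
  rewrite dotE mulr_sumr; apply: eq_bigr => k _; rewrite De_y; ring.
by rewrite dotC.
Qed.
End Step.

Hypothesis sigE : e' + K * mm + 2 * del + Cs * eta <= sig.
Hypothesis sigm : sig * mm < 1.
Hypothesis UU : dot u u <= U.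

Lemma tres_vec (n : 'I_N) : \sum_k (tres n *m u) k 0 ^+ 2 <= b ^+ 2 * U.
Proof.
have nN := ltnW (ltn_ord n).
have h2 := psd_sq_norm u (ltW b0) (sGt n) (pGt nN) (nGt nN).
rewrite (_ : \sum_k _ = dot (tres n *m u) (tres n *m u)); last first.
  by rewrite dotE; apply: eq_bigr => k _; rewrite expr2.
by apply: (le_trans h2); apply: ler_wpM2l => //; exact: sqr_ge0.
Qed.

Hypothesis N0 : (0 < N)%N.

(** Telescoping over the rows. Replacing the inverse Schur complements by [m n] turns the increments
    into $m_nu_n^2$ plus the martingale term; the relative error is at most [mm * sig] on the sum of
    the contributions [Q n]. *)
Lemma form_limit :
  `|dot u (Gm (AD (D N) h) (seg N N) *m u) - \sum_k m k * u k 0 ^+ 2| <=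
  `|\sum_n m n * xi (tres n *m u) n| +
  mm * sig * (b * U + N%:R * (mm * K * (b ^+ 2 * U) + b ^+ 3 * (K * mm) ^+ 2 * U)) +
  N%:R * (b ^+ 3 * (K * mm) ^+ 2 * U).
Proof.
pose f n := dot u (Gm (AD (D n) h) (seg N n) *m u).
pose y (n : 'I_N) := tres n *m u.
pose Sy n := \sum_k S n k * y n k 0 ^+ 2.
have step (n : 'I_N) : exists p : R * R, let s := p.1 in let rho := p.2 in
    [/\ 0 < s, `|s - (m n)^-1| <= sig, 0 <= rho <= b ^+ 3 * (K * mm) ^+ 2 * U &
     f n.+1 - f n = s^-1 * (u n 0 + row_form (y n) n) ^+ 2 - m n * Sy n - rho].
  have [rho /andP[r0 r1] fE] := form_tilde n.
  exists (AD (D n.+1) h n n - dot (- col n (AD (D n.+1) h)) (tres n *m - col n (AD (D n.+1) h)), rho).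
  split => /=.
  - exact: schur_gt0.
  - exact: schur_close.
  - rewrite r0 (le_trans r1)// ler_wpM2l// mulr_ge0 ?sqr_ge0//.
    by rewrite exprn_ge0// ltW.
  - have /= := form_step n sigE sigm; rewrite /f fE => ->; rewrite -/(y n) -/(Sy n); ring.
have [p Hp] := choice step.
pose sv n := (p n).1; pose rho n := (p n).2.
have f0 : f 0 = 0.
  rewrite /f seg0 (Gm_eq (sA _) (isinv_set0 _)) mul0mx dotE big1// => i _.
  by rewrite mxE mulr0.
have tel : f N = \sum_(n < N) (f n.+1 - f n).
  by rewrite -(big_mkord xpredT (fun n => f n.+1 - f n)) telescope_sumr// f0 subr0.
set R0 := b ^+ 3 * (K * mm) ^+ 2 * U.
have cN (X : R) : N%:R * X = \sum_(n < N) X by rewrite sumr_const card_ord mulr_natl.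
have Sy0 n : 0 <= m n * Sy n <= mm * K * (b ^+ 2 * U).
  have s0 : 0 <= Sy n by apply: sumr_ge0 => k _; rewrite mulr_ge0// sqr_ge0.
  rewrite mulr_ge0 ?(ltW (m0 n))//= -mulrA; apply: ler_pM => //; first exact: ltW.
  have h2 := psd_sq_norm u (ltW b0) (sGt n) (pGt (ltnW (ltn_ord n))) (nGt (ltnW (ltn_ord n))).
  apply: (@le_trans _ _ (K * dot (y n) (y n))).
    rewrite dotE mulr_sumr; apply: ler_sum => k _; rewrite -expr2.
    by apply: ler_wpM2r; [exact: sqr_ge0|case/andP: (S0 n k)].
  apply: ler_wpM2l; first exact: K0 n.
  by apply: (le_trans h2); apply: ler_wpM2l => //; exact: sqr_ge0.
pose Q n := (sv n)^-1 * (u n 0 + row_form (y n) n) ^+ 2.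
have Q0 n : 0 <= Q n.
  by have [s0 _ _ _] := Hp n; rewrite /Q mulr_ge0 ?sqr_ge0// invr_ge0 ltW.
(* The same telescoping sum: the nonnegative contributions add up to the final form, at most
   [b * U], plus the amounts lost at each step. *)
have QS : \sum_n Q n <= b * U + N%:R * (mm * K * (b ^+ 2 * U) + R0).
  have -> : \sum_n Q n = f N + \sum_n (m n * Sy n + rho n).
    rewrite tel -big_split; apply: eq_bigr => n _ /=.
    by have [_ _ _ ->] := Hp n; rewrite /Q /rho/= /sv; ring.
  apply: lerD.
    apply: (le_trans (norm_n (leqnn N) u)); apply: ler_wpM2l => //; exact: ltW.
  rewrite cN.
  apply: ler_sum => n _; have [_ _ /andP[_ ?] _] := Hp n.
  by apply: lerD => //; case/andP: (Sy0 n).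
have dec : f N - \sum_k m k * u k 0 ^+ 2 = \sum_n m n * xi (y n) n
   + \sum_n (1 - m n * sv n) * Q n - \sum_n rho n.
  rewrite tel -!sumrB -big_split/= -sumrB; apply: eq_bigr => n _.
  have [s0 _ _ ->] := Hp n; rewrite /xi /Q -/(Sy n) /rho.
  have sE : sv n * (sv n)^-1 = 1 by rewrite divff// gt_eqF.
  have -> : (1 - m n * sv n) * ((sv n)^-1 * (u n 0 + row_form (y n) n) ^+ 2) =
    (sv n)^-1 * (u n 0 + row_form (y n) n) ^+ 2 - m n * (u n 0 + row_form (y n) n) ^+ 2.
    by rewrite mulrBl mul1r -mulrA [sv n * _]mulrA sE mul1r.
  rewrite -/(sv n); ring.
rewrite -/(f N) dec.
have mm0' : 0 <= mm * sig.
  have i : 'I_N := Ordinal N0.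
  by rewrite mulr_ge0// ?(ltW (mm0 i))//; have [_ h1 _ _] := Hp i; exact: le_trans h1.
apply: (le_trans (ler_normB _ _)); apply: lerD; last first.
  rewrite ger0_norm; last by apply: sumr_ge0 => n _; have [_ _ /andP[? _] _] := Hp n.
  rewrite cN.
  by apply: ler_sum => n _; have [_ _ /andP[_ ?] _] := Hp n.
apply: (le_trans (ler_normD _ _)); rewrite lerD2l.
apply: (@le_trans _ _ (mm * sig * \sum_n Q n)); last by rewrite ler_wpM2l.
apply: (le_trans (ler_norm_sum _ _ _)); rewrite mulr_sumr; apply: ler_sum => n _.
rewrite normrM (ger0_norm (Q0 n)); apply: ler_wpM2r => //.
have [s0 h1 _ _] := Hp n.
have -> : 1 - m n * sv n = m n * ((m n)^-1 - sv n) by rewrite mulrBr divff// gt_eqF.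
rewrite normrM ger0_norm ?(ltW (m0 n))// distrC; apply: ler_pM => //; exact: ltW.
Qed.

End TwoSided.

(** * Moments of the martingale part *)

Section XiMoment.
Context {d} {T : measurableType d} {R : realType} (P : probability T R).

Definition nfun N (f : 'I_N -> R) (k : nat) : R := if insub k is Some i then f i else 0.

Lemma nfunE N (f : 'I_N -> R) (i : 'I_N) : nfun f i = f i.
Proof. by rewrite /nfun valK. Qed.

Lemma linear_form_mean N (h : nat -> T -> R) (s : nat -> R) r M v (a : nat -> R) :
  centred_row P N h s r M v ->
  P.-integrable setT (fun w => (\sum_(k < N) a k * h k w)%:E) /\
  (\int[P]_w (\sum_(k < N) a k * h k w)%:E = 0)%E.
Proof.
move=> row; have ih k : (k < N)%N -> P.-integrable setT (fun w => (a k * h k w)%:E).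
  move=> kN; under eq_fun do rewrite EFinM; apply: integrableZl => //.
  exact: row_lin_integrable row kN.
have [h1 ->] := integral_sum_EFin ih; split => //.
apply: big1 => k _; under eq_integral do rewrite EFinM.
rewrite integralZl//; last exact: row_lin_integrable row (ltn_ord k).
by case: row => _ _ /(_ _ (ltn_ord k)) -> _ _; rewrite mule0.
Qed.

(** A linear plus a centred quadratic form in row [n]. As $u_n^2$ is of order [v], both have squares
    of order $v^2$ and share one bound. *)
Lemma xi_moment r : exists2 C : R, 0 <= C & forall N (H : T -> 'M[R]_N) S M v
    (y u : 'cV[R]_N) (n : 'I_N) (c mm U1 Y : R),
  noise P H S r M v -> 1 <= M -> 0 <= v -> 0 <= c <= mm -> u n 0 ^+ 2 <= U1 * v ->
  \sum_k y k 0 ^+ 2 <= Y -> 0 <= U1 ->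
  [/\ measurable_fun setT (fun w => c * xi S u (H w) y n),
     (\int[P]_w (c * xi S u (H w) y n)%:E = 0)%E &
     (\int[P]_w (pw r (c * xi S u (H w) y n))%:E <=
       (C * M ^+ 2 * (v ^+ 2 * (4 * mm ^+ 2 * U1 * Y + mm ^+ 2 * Y ^+ 2)) ^+ r.+1)%:E)%E].
Proof.
have [C1 C11 H1] := linear_form_moment P r.
have [C2 C20 H2] := quadratic_form_moment P r.
have C10 : 0 <= C1 by exact: le_trans C11.
exists (4 ^+ r.+1 * (C1 + C2)) => [|N H S M v y u n c mm U1 Y nH M1 v0 /andP[c0 cm] uU yY U10].
  by rewrite mulr_ge0 ?exprn_ge0 ?addr_ge0.
have M0 : 0 <= M by exact: le_trans M1.
have mm0 : 0 <= mm by exact: le_trans cm.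
have Y0 : 0 <= Y by apply: le_trans yY; apply: sumr_ge0 => k _; exact: sqr_ge0.
have [mH sH indH row] := nH.
pose a := nfun (fun k : 'I_N => c * (2 * u n 0) * y k 0).
pose A (k l : nat) := c * (nfun (fun k : 'I_N => y k 0) k * nfun (fun k : 'I_N => y k 0) l).
pose Lf w := \sum_(k < N) a k * hrow H n k w.
pose Qf w := \sum_(k < N) \sum_(l < N) A k l * (hrow H n k w * hrow H n l w).
pose mu := \sum_(k < N) A k k * srow S n k.
have sA i j : A i j = A j i by rewrite /A [X in c * X]mulrC.
have E w : c * xi S u (H w) y n = Lf w + (Qf w - mu).
  rewrite /xi mulrDr mulrBr; congr (_ + (_ - _)).
  - rewrite mulrA /row_form mulr_sumr; apply: eq_bigr => k _.
    by rewrite /a nfunE hrowE; ring.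
  - rewrite expr2 /row_form mulr_suml mulr_sumr; apply: eq_bigr => k _.
    rewrite mulr_sumr mulr_sumr; apply: eq_bigr => l _.
    by rewrite /A !nfunE !hrowE; ring.
  - rewrite mulr_sumr; apply: eq_bigr => k _; rewrite /A !nfunE srowE; ring.
have [iL mL] := linear_form_mean a (row n).
have [iQ mQ] := quadratic_form_mean (row n) sA.
have mLf : measurable_fun setT Lf by apply/measurable_EFinP; case/integrableP: iL.
have mQf : measurable_fun setT Qf by apply/measurable_EFinP; case/integrableP: iQ.
have mQm : measurable_fun setT (fun w => Qf w - mu).
  by apply: measurable_funB => //; exact: measurable_cst.
split.
- under eq_fun do rewrite E; exact: measurable_funD.
- under eq_integral do rewrite E EFinD.
  have iQm : P.-integrable setT (fun w => (Qf w - mu)%:E).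
    under eq_fun do rewrite EFinB.
    by apply: integrableB => //; exact: finite_measure_integrable_cst.
  rewrite integralD// mL add0e.
  under eq_integral do rewrite EFinB.
  rewrite integralB//; last exact: finite_measure_integrable_cst.
  by rewrite mQ probability_integral_cst -EFinB subrr.
- under eq_integral do rewrite E.
  apply: (le_trans (integral_pwD P r mLf mQm)).
  have h1 := H1 N _ _ M v a (row n) M0 v0.
  have h2 := H2 N _ _ M v A (row n) M1 v0 sA.
  have sa : \sum_(k < N) a k ^+ 2 <= v * (4 * mm ^+ 2 * U1 * Y).
    have -> : \sum_(k < N) a k ^+ 2 = 4 * (c ^+ 2 * u n 0 ^+ 2 * \sum_k y k 0 ^+ 2).
      by rewrite !mulr_sumr; apply: eq_bigr => k _; rewrite /a nfunE; ring.
    have -> : v * (4 * mm ^+ 2 * U1 * Y) = 4 * (mm ^+ 2 * (U1 * v) * Y) by ring.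
    rewrite ler_wpM2l//; apply: ler_pM => //.
    + by rewrite mulr_ge0 ?sqr_ge0.
    + by apply: sumr_ge0 => k _; exact: sqr_ge0.
    + by apply: ler_pM; rewrite ?sqr_ge0//; apply: lerXn2r.
  have sB : \sum_(k < N) \sum_(l < N) A k l ^+ 2 <= mm ^+ 2 * Y ^+ 2.
    have -> : \sum_(k < N) \sum_(l < N) A k l ^+ 2 = c ^+ 2 * (\sum_k y k 0 ^+ 2) ^+ 2.
      rewrite (expr2 (\sum_k _)) mulr_suml mulr_sumr; apply: eq_bigr => k _.
      rewrite mulr_sumr mulr_sumr; apply: eq_bigr => l _; rewrite /A !nfunE; ring.
    apply: ler_pM; rewrite ?sqr_ge0//; apply: lerXn2r; rewrite ?nnegrE//.
    by apply: sumr_ge0 => k _; exact: sqr_ge0.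
  set L1 := 4 * mm ^+ 2 * U1 * Y in sa *; set L2 := mm ^+ 2 * Y ^+ 2 in sB *.
  have L10 : 0 <= L1 by rewrite /L1 mulr_ge0// mulr_ge0// mulr_ge0// sqr_ge0.
  have L20 : 0 <= L2 by rewrite /L2 mulr_ge0 ?sqr_ge0.
  have v20 : 0 <= v ^+ 2 by exact: sqr_ge0.
  have b1 : (v * \sum_(k < N) a k ^+ 2) ^+ r.+1 <= (v ^+ 2 * (L1 + L2)) ^+ r.+1.
    apply: lerXn2r; rewrite ?nnegrE.
    + by rewrite mulr_ge0// sumr_ge0// => k _; exact: sqr_ge0.
    + by rewrite mulr_ge0 ?addr_ge0.
    + apply: (le_trans (ler_wpM2l v0 sa)); rewrite mulrA -expr2 ler_wpM2l// lerDl//.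
  have b2 : (v ^+ 2 * \sum_(k < N) \sum_(l < N) A k l ^+ 2) ^+ r.+1 <= (v ^+ 2 * (L1 + L2)) ^+ r.+1.
    apply: lerXn2r; rewrite ?nnegrE.
    + by rewrite mulr_ge0// sumr_ge0// => k _; rewrite sumr_ge0// => l _; exact: sqr_ge0.
    + by rewrite mulr_ge0 ?addr_ge0.
    + by rewrite ler_wpM2l// (le_trans sB)// lerDr.
  set X := (v ^+ 2 * (L1 + L2)) ^+ r.+1 in b1 b2 *.
  have X0 : 0 <= X by rewrite exprn_ge0// mulr_ge0// addr_ge0.
  have MM : M <= M ^+ 2 by rewrite -[leLHS]mulr1 expr2 ler_wpM2l.
  have f1 : C1 * M * (v * \sum_(k < N) a k ^+ 2) ^+ r.+1 <= C1 * M ^+ 2 * X.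
    apply: ler_pM => //; rewrite ?mulr_ge0//; last by rewrite ler_wpM2l.
    by rewrite exprn_ge0// mulr_ge0// sumr_ge0// => k _; exact: sqr_ge0.
  have f2 : C2 * M ^+ 2 * (v ^+ 2 * \sum_(k < N) \sum_(l < N) A k l ^+ 2) ^+ r.+1 <= C2 * M ^+ 2 * X.
    by apply: ler_wpM2l => //; rewrite mulr_ge0// sqr_ge0.
  have -> : 4 ^+ r.+1 * (C1 + C2) * M ^+ 2 * X = 4 ^+ r.+1 * (C1 * M ^+ 2 * X + C2 * M ^+ 2 * X) by ring.
  rewrite EFinM; apply: lee_wpmul2l; first by rewrite lee_fin exprn_ge0.
  rewrite EFinD; apply: leeD.
    by apply: (le_trans h1); rewrite lee_fin.
  by apply: (le_trans h2); rewrite lee_fin.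
Qed.

End XiMoment.

Section XiSum.
Context {d} {T : measurableType d} {R : realType} (P : probability T R).

(** The martingale bound with constant weights [v], at most 1 in total. The cutoff on [y] is a
    function of the past, so the increments stay centred while their moments become
    deterministically bounded. *)
Lemma xi_sum_moment r : exists2 C : R, 0 <= C & forall N (H : T -> 'M[R]_N) S M v
    (m : 'I_N -> R) x (u : 'cV[R]_N) (mm U1 Y : R),
  noise P H S r M v -> 1 <= M -> 0 < v <= 1 -> N%:R * v <= 1 ->
  (forall n, 0 <= m n <= mm) -> (forall n, u n 0 ^+ 2 <= U1 * v) ->
  0 <= Y -> 0 <= U1 ->
  let y w (n : 'I_N) := tres S m x (H w) n *m u in
  let cut w n := if \sum_k y w n k 0 ^+ 2 <= Y then m n * xi S u (H w) (y w n) n else 0 in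
  measurable_fun setT (fun w => \sum_n cut w n) /\
  (\int[P]_w (pw r (\sum_n cut w n))%:E <=
       (C * M ^+ 2 * (v * (4 * mm ^+ 2 * U1 * Y + mm ^+ 2 * Y ^+ 2)) ^+ r.+1)%:E)%E.
Proof.
have [C1 C10 H1] := xi_moment P r.
have [C2 C20 H2] := martingale_moment P r.
exists (expR C2 * C1) => [|N H S M v m x u mm U1 Y nH M1 /andP[v0 v1] Nv mmm uU Y0 U10 y cut].
  by rewrite mulr_ge0// expR_ge0.
have [mH sH indH row] := nH.
pose two (n : 'I_N) w v' := if \sum_k y w n k 0 ^+ 2 <= Y then m n * xi S u (H v') (y w n) n else 0.
pose yk (k : nat) w v' := if insub k is Some n then two n w v' else 0.
have ykE (n : 'I_N) : yk n = two n by rewrite /yk valK.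
have myU d' (U : measurableType d') (h : U -> 'M[R]_N) (n : 'I_N) (k : 'I_N) :
   (forall i k : 'I_N, (i < n)%N -> (k < n)%N -> measurable_fun setT (fun u => h u i k)) ->
   measurable_fun setT (fun w => (tres S m x (h w) n *m u) k 0).
  move=> mh; under eq_fun do rewrite mxE.
  apply: measurable_sum => l; apply: measurable_funM; last exact: measurable_cst.
  by apply: mmx_Gm_seg mh _ _; exact: fintype.subxx.
have mtwo d' (U : measurableType d') (h1 h2 : U -> 'M[R]_N) (n : 'I_N) :
   (forall i k : 'I_N, (i < n)%N -> (k < n)%N -> measurable_fun setT (fun u => h1 u i k)) ->
   (forall k : 'I_N, (k < n)%N -> measurable_fun setT (fun u => h2 u n k)) ->
   measurable_fun setT (fun w => if \sum_k (tres S m x (h1 w) n *m u) k 0 ^+ 2 <= Y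
      then m n * xi S u (h2 w) (tres S m x (h1 w) n *m u) n else 0).
  move=> mh1 mh2.
  have my k := myU _ _ h1 n k mh1.
  have mr : measurable_fun setT (fun w => row_form (h2 w) (tres S m x (h1 w) n *m u) n).
    apply: measurable_sum => k; have [kn|kn] := ltnP k n.
      by apply: measurable_funM => //; exact: mh2.
    have z w : (tres S m x (h1 w) n *m u) k 0 = 0.
      by rewrite mxE big1// => l _; rewrite /tres Gm_out ?mul0r// !inE ltnNge kn.
    by under eq_fun do rewrite z mul0r; exact: measurable_cst.
  apply: measurable_fun_ifT.
  - apply: measurable_fun_ler; last exact: measurable_cst.
    by apply: measurable_sum => k; exact: measurable_funX.
  - apply: measurable_funM; first exact: measurable_cst.
    apply: measurable_funD; first by apply: measurable_funM => //; exact: measurable_cst.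
    apply: measurable_funB; first exact: measurable_funX.
    by apply: measurable_sum => k; apply: measurable_funM; [exact: measurable_cst|exact: measurable_funX].
  - exact: measurable_cst.
have mcut n : measurable_fun setT (fun w => cut w n).
  by apply: (mtwo _ _ H H n) => *; exact: mH.
have L0 : 0 <= 4 * mm ^+ 2 * U1 * Y + mm ^+ 2 * Y ^+ 2.
  apply: addr_ge0; last by rewrite mulr_ge0 ?sqr_ge0.
  by rewrite mulr_ge0// mulr_ge0// mulr_ge0// sqr_ge0.
set L := 4 * mm ^+ 2 * U1 * Y + mm ^+ 2 * Y ^+ 2 in L0 *.
have M20 : 0 <= C1 * M ^+ 2 by rewrite mulr_ge0 ?sqr_ge0.
pose B := C1 * M ^+ 2 * (v * L) ^+ r.+1.
have B0 : 0 <= B by rewrite mulr_ge0// exprn_ge0// mulr_ge0// ltW.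
have inner (n : 'I_N) w : [/\ measurable_fun setT (fun v' => two n w v'),
    (\int[P]_v' (two n w v')%:E = 0)%E &
    (\int[P]_v' (pw r (two n w v'))%:E <= (v ^+ r.+1 * B)%:E)%E].
  have vB : v ^+ r.+1 * B = C1 * M ^+ 2 * (v ^+ 2 * L) ^+ r.+1.
    by rewrite /B mulrCA -exprMn; congr (_ * _ ^+ _); ring.
  rewrite /two; case: (leP (\sum_k y w n k 0 ^+ 2) Y) => [yY|_].
    by rewrite vB; exact: (H1 _ _ _ _ _ _ _ _ _ _ _ _ nH M1 (ltW v0) (mmm n) (uU n) yY U10).
  split; first exact: measurable_cst.
    by rewrite integral0.
  under eq_integral do rewrite /pw expr0n/= expr0n/=.
  by rewrite integral0 lee_fin mulr_ge0// exprn_ge0// ltW.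
split; first exact: measurable_sum.
have step := H2 N yk (fun=> v) B 1 B0.
have -> : (\int[P]_w (pw r (\sum_n cut w n))%:E =
    \int[P]_w (pw r (\sum_(l < N) yk l w w))%:E)%E.
  by apply: eq_integral => w _; congr (pw r _)%:E; apply: eq_bigr => l _; rewrite ykE.
rewrite (_ : (expR C2 * C1 * M ^+ 2 * (v * L) ^+ r.+1)%R = expR (C2 * 1) * B)%R; last first.
  by rewrite /B mulr1 !mulrA.
apply: step.
- by move=> k _; rewrite v0 v1.
- by rewrite sumr_const card_ord -[leLHS]mulr_natl.
- move=> k kN; rewrite (_ : k = Ordinal kN)// ykE.
  apply: (mtwo _ _ (fun z : T * T => H z.1) (fun z : T * T => H z.2)) => [i l _ _|l _].
    exact: (measurableT_comp (mH i l) measurable_fst).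
  exact: (measurableT_comp (mH _ l) measurable_snd).
- by move=> k kN; rewrite (_ : k = Ordinal kN)// ykE; exact: mcut.
- move=> k w kN; rewrite (_ : k = Ordinal kN)// ykE.
  by have [_ _ h] := inner (Ordinal kN) w; apply: le_lt_trans h _; rewrite ltry.
- move=> k w kN; rewrite (_ : k = Ordinal kN)// ykE.
  by have [_ h _] := inner (Ordinal kN) w.
- move=> k kN; rewrite (_ : k = Ordinal kN)// ykE; set n := Ordinal kN.
  apply: (@le_trans _ _ (\int[P]_w (v ^+ r.+1 * B)%:E)%E).
    apply: ge0_le_integral => //.
    + by move=> w _; apply: integral_ge0 => v' _; rewrite lee_fin pw_ge0.
    + apply: (measurable_fun_fubini_tonelli_F (m2 := P) (fun z : T * T => (pw r (two n z.1 z.2))%:E)).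
        apply/measurable_EFinP; apply: measurable_pw.
        apply: (mtwo _ _ (fun z : T * T => H z.1) (fun z : T * T => H z.2)) => [i l _ _|l _].
          exact: (measurableT_comp (mH i l) measurable_fst).
        exact: (measurableT_comp (mH _ l) measurable_snd).
      by move=> z; rewrite lee_fin pw_ge0.
    + by move=> w _; have [_ _ h] := inner n w.
  by rewrite probability_integral_cst.
- move=> k kN; rewrite (_ : k = Ordinal kN)//; set n := Ordinal kN.
  pose F (z : subT (entry H) (restset n) * subT (entry H) (rowset n)) : \bar R :=
    (pw r (\sum_(l < n) yk l z.1 z.1 + two n z.1 z.2))%:E.
  have mrest (i l : 'I_N) : (i < n)%N -> (l < n)%N ->
      measurable_fun setT (fun w : subT (entry H) (restset n) => H w i l).
    move=> ni nl; apply: measurable_rest => //; first by rewrite neq_ltn ni.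
    by rewrite neq_ltn nl.
  have mF : measurable_fun setT F.
    apply/measurable_EFinP; apply: measurable_pw; apply: measurable_funD.
      apply: measurable_sum => l.
      have lN : (l < N)%N by exact: ltn_trans (ltn_ord l) kN.
      rewrite (_ : (l : nat) = Ordinal lN)// ykE.
      have m1 : measurable_fun setT (fun w : subT (entry H) (restset n) => two (Ordinal lN) w w).
        apply: (mtwo _ (subT (entry H) (restset n)) H H (Ordinal lN)) => [i i' il i'l|i il].
          by apply: mrest; [exact: ltn_trans (ltn_ord l)|exact: ltn_trans (ltn_ord l)].
        by apply: mrest; [exact: (ltn_ord l)|exact: ltn_trans il (ltn_ord l)].
      exact: (measurableT_comp m1 measurable_fst).
    apply: (mtwo _ _ (fun z : subT (entry H) (restset n) * subT (entry H) (rowset n) => H z.1)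
      (fun z : subT (entry H) (restset n) * subT (entry H) (rowset n) => H z.2)) => [i l il ll|l _].
      exact: (measurableT_comp (mrest i l il ll) measurable_fst).
    exact: (measurableT_comp (measurable_row sH (j := n) l) measurable_snd).
  have F0 z : (0 <= F z)%E by rewrite lee_fin pw_ge0.
  transitivity (\int[P]_w F (w, w))%E.
    by apply: eq_integral => w _; rewrite big_ord_recr/= (ykE n).
  rewrite (row_rest_decoupling mH indH mF F0).
  by apply: eq_integral => w _; apply: eq_integral => v' _; rewrite (ykE n).
Qed.

End XiSum.

(** * The limit equation *)

Section LimitEquation.
Context {R : realType} (s : bool -> bool -> R).
Hypothesis s0 : forall a b, 0 < s a b.

Definition supersol (x : R) (M : bool -> R) :=
  (forall a, 0 < M a) /\ (forall a, (M a)^-1 + \sum_b s a b * M b <= x).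
Definition feasible : set R := [set x | exists M, supersol x M].
Definition edge : R := inf feasible.
Definition sol (x : R) (a : bool) : R := inf [set M a | M in [set M | supersol x M]].

Lemma supersol_gt0 x M : supersol x M -> 0 < x.
Proof.
move=> [M0 Mx]; apply: lt_le_trans (Mx true); apply: ltr_wpDr; last by rewrite invr_gt0.
by apply: sumr_ge0 => b _; rewrite mulr_ge0// ltW.
Qed.

Lemma supersol_ge x M a : supersol x M -> x^-1 <= M a.
Proof.
move=> sM; have x0 := supersol_gt0 sM; case: sM => M0 Mx.
rewrite -[leRHS]invrK lef_pV2 ?posrE ?invr_gt0//; apply: le_trans (Mx a); rewrite lerDl.
by apply: sumr_ge0 => b _; rewrite mulr_ge0// ltW.
Qed.

Lemma supersol_le x y M : x <= y -> supersol x M -> supersol y M.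
Proof. by move=> xy [M0 Mx]; split => // a; apply: le_trans xy. Qed.

(** Taking the minimum lowers the sum, and the inverse at [a] is that of whichever function is
    smaller there. *)
Lemma supersol_min x M M' : supersol x M -> supersol x M' ->
  supersol x (fun a => Num.min (M a) (M' a)).
Proof.
move=> [M0 Mx] [M0' Mx']; split => a; first by rewrite lt_min M0 M0'.
have h1 : \sum_b s a b * Num.min (M b) (M' b) <= \sum_b s a b * M b.
  by apply: ler_sum => b _; rewrite ler_wpM2l ?(ltW (s0 _ _))// ge_min lexx.
have h2 : \sum_b s a b * Num.min (M b) (M' b) <= \sum_b s a b * M' b.
  by apply: ler_sum => b _; rewrite ler_wpM2l ?(ltW (s0 _ _))// ge_min lexx orbT.
by rewrite {1}/Num.min; case: ifP => _; [apply: le_trans (Mx a)|apply: le_trans (Mx' a)];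
  rewrite lerD2l.
Qed.

Lemma feasible_has_inf : has_inf feasible.
Proof.
split; last by exists 0 => x [M /supersol_gt0 /ltW].
exists (1 + \sum_a \sum_b s a b); exists (fun=> 1); split => // a.
rewrite invr1 lerD2l; under eq_bigr do rewrite mulr1.
rewrite [leRHS](bigD1 a)//= lerDl sumr_ge0// => b _.
by apply: sumr_ge0 => c _; exact: ltW.
Qed.

Lemma edge_ge0 : 0 <= edge.
Proof.
apply: lb_le_inf; first by case: feasible_has_inf.
by move=> x [M /supersol_gt0 /ltW].
Qed.

Lemma feasible_gt x : edge < x -> exists M, supersol x M.
Proof.
move=> Lx; have [y [M sM] yx] := inf_adherent (eps := x - edge) ltac:(by rewrite subr_gt0) feasible_has_inf.
exists M; apply: supersol_le sM; rewrite ltW//.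
by move: yx; rewrite -/edge addrC subrK.
Qed.

Lemma edge_le x M : supersol x M -> edge <= x.
Proof. by move=> sM; apply: ge_inf; [case: feasible_has_inf|exists M]. Qed.

Lemma sol_le x M a : supersol x M -> sol x a <= M a.
Proof.
move=> sM; apply: ge_inf; last by exists M.
by exists x^-1 => _ [M' sM' <-]; exact: supersol_ge.
Qed.

Section AboveEdge.
Variable x : R.
Hypothesis Lx : edge < x.

Let hasinf a : has_inf [set M a | M in [set M | supersol x M]].
Proof.
have [M sM] := feasible_gt Lx; split; first by exists (M a); exists M.
by exists x^-1 => _ [M' sM' <-]; exact: supersol_ge.
Qed.

Lemma sol_near (e : R) : 0 < e -> exists2 M, supersol x M & forall a, M a <= sol x a + e.
Proof.
move=> e0.
have [_ [M sM <-] h1] := inf_adherent e0 (hasinf true).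
have [_ [M' sM' <-] h2] := inf_adherent e0 (hasinf false).
exists (fun a => Num.min (M a) (M' a)); first exact: supersol_min.
by case; rewrite ge_min (ltW h1, ltW h2) ?orbT.
Qed.

Lemma edge_x_gt0 : 0 < x. Proof. exact: le_lt_trans edge_ge0 Lx. Qed.

Lemma sol_gt0 a : 0 < sol x a.
Proof.
apply: (@lt_le_trans _ _ x^-1); first by rewrite invr_gt0 edge_x_gt0.
apply: lb_le_inf; first by case: (hasinf a).
by move=> _ [M' sM' <-]; exact: supersol_ge.
Qed.

Lemma sol_supersol : supersol x (sol x).
Proof.
split => [|a]; first exact: sol_gt0.
rewrite -lerBrDr; set t := x - _.
have h e : 0 < e -> 1 <= (sol x a + e) * t.
  move=> e0; have [M sM Me] := sol_near e0.
  have [M0 Mx] := sM.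
  have p0 : 0 < sol x a + e by rewrite addr_gt0// sol_gt0.
  rewrite -ler_pdivrMl// mulr1.
  apply: (@le_trans _ _ (M a)^-1); first by rewrite lef_pV2 ?posrE.
  rewrite /t lerBrDr; apply: le_trans (Mx a); rewrite lerD2l.
  by apply: ler_sum => b _; rewrite ler_wpM2l ?(ltW (s0 _ _))// sol_le.
have m0 := sol_gt0 a.
have t0 : 0 < t.
  have h1 := h 1 ltr01; rewrite -(pmulr_rgt0 t (_ : 0 < sol x a + 1)); first exact: lt_le_trans h1.
  by rewrite addr_gt0.
rewrite -[leLHS]mulr1 mulrC ler_pdivrMr// mulrC.
apply/ler_addgt0Pr => e e0.
have := h (e / t) (divr_gt0 e0 t0).
by rewrite mulrDl divfK// gt_eqF.
Qed.

(** One step $M'=1/(x-sM)$ of the fixed-point iteration started at [sol x] lies below it and is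
    again a supersolution, so minimality forces equality. *)
Lemma sol_eq a : (sol x a)^-1 + \sum_b s a b * sol x b = x.
Proof.
have [m0 mx] := sol_supersol.
apply/eqP; rewrite eq_le mx/=.
pose M' c := (x - \sum_b s c b * sol x b)^-1.
have t0 c : 0 < x - \sum_b s c b * sol x b.
  rewrite subr_gt0; apply: lt_le_trans (mx c); rewrite ltrDr invr_gt0//.
have M'le c : M' c <= sol x c.
  rewrite /M' -[leRHS]invrK lef_pV2 ?posrE ?invr_gt0// lerBrDr//; exact: mx.
have sM' : supersol x M'.
  split => c; first by rewrite /M' invr_gt0.
  have h : \sum_b s c b * M' b <= \sum_b s c b * sol x b.
    by apply: ler_sum => b _; rewrite ler_wpM2l ?(ltW (s0 _ _)).
  by rewrite {1}/M' invrK -[leRHS](subrK (\sum_b s c b * sol x b)) lerD2l.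
have := sol_le a sM'; rewrite /M' -[X in X <= _]invrK lef_pV2 ?posrE ?invr_gt0//.
by rewrite lerBlDr.
Qed.

End AboveEdge.

(** Minus the difference quotient of [sol]. It satisfies the linearised equation exactly, with
    [sol x a * sol x' a] in place of the square that the derivative would have. *)
Definition zeta (x x' : R) a := (sol x' a - sol x a) / (x - x').

Section Zeta.
Variables x' x : R.
Hypotheses (Lx' : edge < x') (xx : x' < x).
Let Lx : edge < x. Proof. exact: lt_trans xx. Qed.

Lemma sol_mono a : sol x a <= sol x' a.
Proof. by apply: sol_le; apply: supersol_le (sol_supersol Lx'); exact: ltW. Qed.

Lemma sol_diff a : sol x' a - sol x a =
  sol x a * sol x' a * ((x - x') + \sum_b s a b * (sol x' b - sol x b)).
Proof.
have h1 := sol_eq Lx a; have h2 := sol_eq Lx' a.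
have m0 := sol_gt0 Lx a; have m0' := sol_gt0 Lx' a.
have -> : \sum_b s a b * (sol x' b - sol x b) =
    \sum_b s a b * sol x' b - \sum_b s a b * sol x b.
  by rewrite -sumrB; apply: eq_bigr => b _; rewrite mulrBr.
have -> : x - x' = (sol x a)^-1 + \sum_b s a b * sol x b -
    ((sol x' a)^-1 + \sum_b s a b * sol x' b) by rewrite h1 h2.
set A := \sum_b _; set B := \sum_b _.
have -> : (sol x a)^-1 + A - ((sol x' a)^-1 + B) + (B - A) = (sol x a)^-1 - (sol x' a)^-1 by ring.
by field; rewrite !gt_eqF.
Qed.

Lemma zeta_eq a : zeta x x' a = sol x a * sol x' a * (1 + \sum_b s a b * zeta x x' b).
Proof.
rewrite /zeta sol_diff.
have e0 : x - x' != 0 by rewrite gt_eqF// subr_gt0.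
under [X in _ * (1 + X)]eq_bigr do rewrite mulrA.
by rewrite -mulr_suml -mulrA mulrDl divff.
Qed.

Lemma zeta_ge0 a : 0 <= zeta x x' a.
Proof. by rewrite /zeta divr_ge0// subr_ge0 ?sol_mono// ltW. Qed.

Lemma zeta_gt0 a : 0 < zeta x x' a.
Proof.
rewrite zeta_eq mulr_gt0//; first by rewrite mulr_gt0// sol_gt0.
by rewrite ltr_wpDr// sumr_ge0// => b _; rewrite mulr_ge0 ?zeta_ge0// ltW.
Qed.

Lemma sol_lt a : sol x a < sol x' a.
Proof.
have := zeta_gt0 a; rewrite /zeta pmulr_lgt0 ?invr_gt0 ?subr_gt0//.
Qed.

Lemma sol_zeta a : sol x' a = sol x a + (x - x') * zeta x x' a.
Proof.
by rewrite /zeta mulrCA divff; [rewrite mulr1 addrC subrK|rewrite gt_eqF// subr_gt0].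
Qed.
End Zeta.

(** Convexity of [sol] in [x]. The equation at [x0] has the larger coefficient [sol x0], so a
    maximal ratio above 1 would be strictly smaller than itself. *)
Lemma zeta_mono x0 x' x a : edge < x0 -> x0 < x' -> x' < x -> zeta x x' a <= zeta x x0 a.
Proof.
move=> L0 x0' xx.
have Lx' : edge < x' by exact: lt_trans x0'.
have Lx : edge < x by exact: lt_trans xx.
have x0x : x0 < x by exact: lt_trans xx.
have Z0 b := zeta_gt0 L0 x0x b; have z0 b := zeta_ge0 Lx' xx b.
pose r b := zeta x x' b / zeta x x0 b.
have [c rc] : exists c, forall b, r b <= r c.
  have [h|/ltW h] := leP (r true) (r false); first by exists false; case.
  by exists true; case.
suff rc1 : r c <= 1.
  by have := le_trans (rc a) rc1; rewrite /r ler_pdivrMr// mul1r.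
rewrite leNgt; apply/negP => r1.
have rE b : zeta x x' b <= r c * zeta x x0 b by rewrite -ler_pdivrMr//; exact: rc.
have rcE : zeta x x' c = r c * zeta x x0 c by rewrite /r divfK// gt_eqF.
have : zeta x x' c < r c * zeta x x0 c.
  rewrite [ltLHS](zeta_eq Lx' xx) [X in _ < _ * X](zeta_eq L0 x0x).
  have m0 := sol_gt0 Lx c.
  apply: (@le_lt_trans _ _ (sol x c * sol x' c * (r c * (1 + \sum_b s c b * zeta x x0 b)))).
    rewrite ler_wpM2l ?mulr_ge0 ?(ltW m0) ?(ltW (sol_gt0 Lx' c))// mulrDr mulr1.
    apply: lerD; first exact: ltW.
    rewrite mulr_sumr; apply: ler_sum => b _; rewrite [leRHS]mulrCA.
    by rewrite ler_wpM2l// ltW.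
  rewrite mulrCA ltr_pM2l; last by rewrite (lt_trans ltr01).
  rewrite ltr_pM2r ?ltr_pM2l//; first exact: sol_lt.
  by rewrite ltr_wpDr// sumr_ge0// => b _; rewrite mulr_ge0 ?ltW.
by rewrite -rcE ltxx.
Qed.

(* Otherwise [sol x' + e * zeta] is a supersolution below the edge. *)
Lemma zeta_unbounded (C : R) : exists x' x, [/\ edge < x', x' < x & exists a, C < zeta x x' a].
Proof.
apply: contrapT => hn.
have H x' x a : edge < x' -> x' < x -> zeta x x' a <= C.
  move=> Lx' xx; rewrite leNgt; apply/negP => h; apply: hn; exists x', x; split => //.
  by exists a.
pose x1 := edge + 1.
have L1 : edge < x1 by rewrite ltrDl.
pose mu := Num.min (sol x1 true) (sol x1 false).
have mu0 : 0 < mu by rewrite lt_min !sol_gt0.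
have mub x a : edge < x -> x <= x1 -> mu <= sol x a.
  move=> Lx; rewrite le_eqVlt => /orP[/eqP ->|xx1].
    by rewrite /mu; case: a; rewrite ge_min lexx ?orbT.
  by apply: le_trans (sol_mono Lx xx1 a); rewrite /mu; case: a; rewrite ge_min lexx ?orbT.
pose Sx := \sum_a \sum_b s a b.
have S0 : 0 <= Sx by apply: sumr_ge0 => a _; apply: sumr_ge0 => b _; exact: ltW.
pose C' := Num.max C 1.
have C'1 : 1 <= C' by rewrite le_max lexx orbT.
pose K := (1 + Sx * C') * (C' / mu).
have K0 : 0 < K.
  apply: mulr_gt0; last by rewrite divr_gt0// (lt_le_trans ltr01).
  by rewrite ltr_wpDr// mulr_ge0// (le_trans ler01).
pose e := Num.min (1 / 4) (8 * K)^-1.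
have e0 : 0 < e by rewrite lt_min; rewrite divr_gt0//= invr_gt0 mulr_gt0.
have e4 : e <= 1 / 4 by rewrite ge_min lexx.
have eK : e * K <= 1 / 8.
  have : e <= (8 * K)^-1 by rewrite ge_min lexx orbT.
  move=> h; apply: (le_trans (ler_wpM2r (ltW K0) h)).
  by rewrite invfM -mulrA mulVf ?mulr1 ?gt_eqF// div1r.
(* Both points are within [e] of the edge, so the ratio of [sol x] to [M] is close to 1, and
   [x' - e / 2] falls below the edge. *)
pose x' := edge + e / 4; pose x := edge + e / 2.
have Lx' : edge < x' by rewrite ltrDl divr_gt0.
have xx : x' < x by rewrite /x' /x ltrD2l; lra.
have Lx : edge < x by exact: lt_trans xx.
have z0 a := zeta_gt0 Lx' xx a.
have zC a : zeta x x' a <= C' by rewrite le_max H.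
pose M a := sol x' a + e * zeta x x' a.
have M0 a : 0 < M a by rewrite /M addr_gt0 ?sol_gt0// mulr_gt0.
have sM : supersol (x' - e / 2) M.
  split => // a.
  have m0 := sol_gt0 Lx' a; have m1 := sol_gt0 Lx a.
  have E1 := sol_eq Lx' a; have zE := zeta_eq Lx' xx a.
  have -> : \sum_b s a b * M b = \sum_b s a b * sol x' b + e * \sum_b s a b * zeta x x' b.
    by rewrite mulr_sumr -big_split; apply: eq_bigr => b _; rewrite /M /=; ring.
  set sz := \sum_b s a b * zeta x x' b in zE *.
  have sz0 : 0 <= sz by apply: sumr_ge0 => b _; rewrite mulr_ge0 ?ltW.
  have szC : sz <= Sx * C'.
    apply: (@le_trans _ _ ((\sum_b s a b) * C')).
      by rewrite mulr_suml; apply: ler_sum => b _; rewrite ler_wpM2l ?(ltW (s0 _ _)).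
    rewrite ler_wpM2r ?(le_trans ler01)// /Sx [leRHS](bigD1 a)//= lerDl sumr_ge0// => c _.
    by apply: sumr_ge0 => b _; exact: ltW.
  have key : (sol x' a)^-1 - (M a)^-1 = e * ((1 + sz) * (sol x a / M a)).
    transitivity (e * (zeta x x' a / (sol x' a * M a))).
      have -> : zeta x x' a = (M a - sol x' a) / e by rewrite /M addrAC subrr add0r mulrAC divff ?mul1r// gt_eqF.
      by field; rewrite !gt_eqF ?M0.
    by rewrite zE; field; rewrite !gt_eqF ?M0.
  have rat : 1 - (C' / mu) * (2 * e) <= sol x a / M a.
    rewrite ler_pdivlMr//.
    have Mle : M a - sol x a <= C' * (2 * e).
      have -> : M a - sol x a = zeta x x' a * (x - x' + e).
        by rewrite /M (sol_zeta xx a); ring.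
      have xe : 0 <= x - x' + e by rewrite /x /x'; lra.
      apply: (le_trans (ler_wpM2r xe (zC a))); rewrite ler_wpM2l ?(le_trans ler01)//.
      rewrite /x /x'; lra.
    have mM : mu <= M a.
      apply: (@le_trans _ _ (sol x' a)); last by rewrite /M lerDl mulr_ge0 ?ltW.
      by apply: mub => //; rewrite /x' /x1 lerD2l; lra.
    have : C' * (2 * e) <= C' / mu * (2 * e) * M a.
      have -> : C' * (2 * e) = C' / mu * (2 * e) * mu by field; rewrite gt_eqF.
      rewrite ler_wpM2l// mulr_ge0// ?mulr_ge0 ?(ltW e0)// ?invr_ge0 ?(ltW mu0)//.
      exact: le_trans C'1.
    lra.
  (* Adding [e * zeta] raises the sum by [e * sz] and lowers the inverse by nearly [e * (1 + sz)];
     half of the net gain [e] is enough. *)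
  have big : 1 / 2 + sz <= (1 + sz) * (sol x a / M a).
    apply: (@le_trans _ _ ((1 + sz) * (1 - C' / mu * (2 * e)))); last first.
      by rewrite ler_wpM2l// addr_ge0.
    have : (1 + sz) * (C' / mu * (2 * e)) <= 1 / 4.
      apply: (@le_trans _ _ ((1 + Sx * C') * (C' / mu * (2 * e)))).
        rewrite ler_wpM2r ?lerD2l// mulr_ge0 ?mulr_ge0 ?(le_trans ler01 C'1) ?invr_ge0 ?(ltW mu0)//.
        exact: ltW.
      have -> : (1 + Sx * C') * (C' / mu * (2 * e)) = 2 * (e * K) by rewrite /K; ring.
      lra.
    rewrite mulrBr mulr1; lra.
  have := ler_wpM2l (ltW e0) big; rewrite -key => hh.
  rewrite mulrDr in hh; move: E1 hh; set A := \sum_b _; move: (sol x' a)^-1 (M a)^-1 => p q; lra.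
have := edge_le sM; rewrite /x'; lra.
Qed.

(** The constant function [e] is a supersolution as soon as [x] exceeds [e^-1] plus [e] times the
    sum of all coefficients. *)
Lemma sol_decay (e : R) : 0 < e -> exists2 X, edge < X & forall x a, X <= x -> sol x a <= e.
Proof.
move=> e0.
pose Sx := \sum_a \sum_b s a b.
have S0 : 0 <= Sx by apply: sumr_ge0 => a _; apply: sumr_ge0 => b _; exact: ltW.
pose X := edge + e^-1 + Sx * e + 1.
have ei0 : 0 < e^-1 by rewrite invr_gt0.
have Se : 0 <= Sx * e by rewrite mulr_ge0// ltW.
exists X => [|x a Xx]; first by rewrite /X; lra.
apply: (sol_le (M := fun=> e)); split => // c.
apply: le_trans Xx; rewrite -mulr_suml.
have : (\sum_b s c b) * e <= Sx * e.
  rewrite ler_wpM2r ?(ltW e0)// /Sx [leRHS](bigD1 c)//= lerDl sumr_ge0// => b _.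
  by apply: sumr_ge0 => d _; exact: ltW.
have := edge_ge0; rewrite /X; lra.
Qed.

End LimitEquation.

(** * Eigenvalues of symmetric and spiked matrices *)

Section Eigenvalues.
Context {R : realType}.

Lemma char_poly_fm N (Q : 'M[R]_N) (dd : 'I_N -> R) : Q *m Q^T = 1%:M ->
  char_poly (fm Q dd) = \prod_(k < N) ('X - (dd k)%:P).
Proof.
move=> QQ; have QQ' := mulmx1C QQ.
pose Q' := map_mx polyC Q.
have E : char_poly_mx (fm Q dd) = Q'^T *m char_poly_mx (diag_mx (\row_k dd k)) *m Q'.
  rewrite /char_poly_mx /fm mulmxBr mulmxBl !map_mxM /Q' matrix.map_trmx; congr (_ - _).
  by rewrite scalar_mxC -mulmxA -map_mxM QQ' map_mx1 mulmx1.
have diagE : \det (char_poly_mx (diag_mx (\row_k dd k))) = \prod_(k < N) ('X - (dd k)%:P).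
  rewrite -/(char_poly _) char_poly_trig ?diag_mx_is_trig//.
  by apply: eq_bigr => k _; rewrite !mxE eqxx mulr1n.
rewrite /char_poly E !det_mulmx mulrAC -det_mulmx.
by rewrite /Q' matrix.map_trmx -map_mxM QQ' map_mx1 det1 mul1r.
Qed.

(** A split polynomial has unique roots up to order, so the diagonal of any diagonalisation is a
    permutation of [eigseq]. *)
Lemma eigseq_diag N (Q A : 'M[R]_N) (dd : 'I_N -> R) : diagonalizes Q dd A ->
  exists p : {perm 'I_N}, (forall i : 'I_N, eigval A i = dd (p i)) /\
    (forall i j : 'I_N, (i <= j)%N -> dd (p j) <= dd (p i)).
Proof.
move=> [QQ QQ' AE].
have cp : char_poly A = \prod_(x <- [tuple dd i | i < N]) ('X - x%:P).
  rewrite AE char_poly_fm// big_tuple; apply: eq_bigr => i _; by rewrite tnth_mktuple.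
have pe : perm_eq (eigseq A) [tuple dd i | i < N].
  rewrite /eigseq; case: pselect => [h|[]]; last by eexists; exact: cp.
  case: cid => t /= tE; rewrite perm_sort; apply: prod_XsubC_eq.
  by rewrite -tE cp.
have so : sorted (fun x y : R => y <= x) (eigseq A).
  by apply: sort_sorted => x y; exact: le_total.
have /tuple_permP[p pE] := pe.
exists p.
have nE (i : 'I_N) : eigval A i = dd (p i).
  by rewrite /eigval pE -tnth_nth !tnth_mktuple.
split => // i j ij; rewrite -!nE /eigval.
have sz : size (eigseq A) = N by rewrite (perm_size pe) size_tuple.
have tr : transitive (fun x y : R => y <= x) by move=> a b c ba cb; exact: le_trans ba.
have rf : reflexive (fun x y : R => y <= x) by move=> a /=.
by apply: (sorted_leq_nth tr rf 0 so); rewrite ?inE ?sz.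
Qed.

Section Spectral.
Variables (N : nat) (A : 'M[R]_N).
Hypothesis sA : symm A.


Lemma eigval_max_lt (x : R) : (0 < N)%N ->
  (forall v, v != 0 -> dot v (A *m v) < x * dot v v) -> eigval A 0 < x.
Proof.
move=> N0 h; have [Q [dd dg]] := symm_diagonalizes sA; have [QQ QQ' AE] := dg.
have [p [pE _]] := eigseq_diag dg.
have -> : eigval A 0 = dd (p (Ordinal N0)) by rewrite -pE.
set k := p _; pose v := Q^T *m delta_mx k (0 : 'I_1).
have Qv : Q *m v = delta_mx k 0 by rewrite /v mulmxA QQ mul1mx.
have vv : dot v v = 1.
  rewrite -(dot_basis QQ') Qv (bigD1 k)//= mxE !eqxx expr1n big1 ?addr0// => i ik.
  by rewrite mxE (negbTE ik) expr0n.
have v0 : v != 0.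
  by apply/eqP => vz; move: vv; rewrite vz dot0r => /esym/eqP; rewrite oner_eq0.
have := h v v0; rewrite vv mulr1 {1}AE dot_fm Qv (bigD1 k)//= mxE !eqxx !mulr1.
by rewrite big1 ?addr0// => i ik; rewrite mxE (negbTE ik) mul0r mulr0.
Qed.

Lemma eigval_max_ge (x : R) v : v != 0 -> x * dot v v <= dot v (A *m v) -> x <= eigval A 0.
Proof.
move=> v0 h; have [Q [dd dg]] := symm_diagonalizes sA; have [QQ QQ' AE] := dg.
have [p [pE pm]] := eigseq_diag dg.
have N0 : (0 < N)%N.
  rewrite lt0n; apply/eqP => N0; case/negP: v0; apply/eqP/matrixP => i.
  by have := ltn_ord i; rewrite {2}N0.
rewrite leNgt; apply/negP => hx; move: h; apply/negP; rewrite -ltNge.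
have dx k : dd k < x.
  rewrite -[k](permKV p); apply: le_lt_trans hx.
  rewrite (_ : eigval A 0 = dd (p (Ordinal N0))); last by rewrite -pE.
  exact: pm.
rewrite {1}AE dot_fm -(dot_basis QQ') mulr_sumr -subr_gt0 -sumrB.
have vv : 0 < \sum_k (Q *m v) k 0 ^+ 2.
  by rewrite (dot_basis QQ') lt_def dot_ge0 andbT; apply: contra v0 => /eqP/dot_eq0 ->.
have nn k : 0 <= x * (Q *m v) k 0 ^+ 2 - dd k * ((Q *m v) k 0 * (Q *m v) k 0).
  by rewrite -expr2 -mulrBl mulr_ge0 ?sqr_ge0// subr_ge0 ltW.
rewrite lt_def sumr_ge0// andbT; apply: contraTneq vv => /eqP; rewrite psumr_eq0// => /allP h.
rewrite -leNgt; apply: sumr_le0 => k _.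
have := h k (mem_index_enum k); rewrite /= -expr2 -mulrBl mulf_eq0 subr_eq0 (gt_eqF (dx k))/=.
by rewrite sqrf_eq0 => /eqP ->; rewrite expr0n.
Qed.

(** Courant-Fischer: the plane of the two top eigenvectors contains a nonzero vector orthogonal to
    [e]. *)
Lemma eigval_second_le (x : R) e : (1 < N)%N ->
  (forall v, dot v e = 0 -> dot v (A *m v) <= x * dot v v) -> eigval A 1 <= x.
Proof.
move=> N1 h; have [Q [dd dg]] := symm_diagonalizes sA; have [QQ QQ' AE] := dg.
have [p [pE pm]] := eigseq_diag dg.
pose i0 := Ordinal (ltnW N1); pose i1 := Ordinal N1.
have -> : eigval A 1 = dd (p i1) by rewrite -pE.
rewrite leNgt; apply/negP => hx.
pose k0 := p i0; pose k1 := p i1.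
have k01 : k1 != k0 by rewrite (inj_eq perm_inj).
have d0 : x < dd k0 by apply: lt_le_trans hx _; exact: pm.
pose a := (Q *m e) k1 0; pose b := - (Q *m e) k0 0.
(* If [e] is orthogonal to both eigenvectors every combination will do, and the first eigenvector is
   taken. *)
pose ab : R * R := if (a == 0) && (b == 0) then (1, 0) else (a, b).
have ab0 : 0 < ab.1 ^+ 2 + ab.2 ^+ 2.
  rewrite /ab; case: ifP => [_|/= nz]; first by rewrite expr1n expr0n addr0.
  rewrite lt_def addr_ge0 ?sqr_ge0// andbT paddr_eq0 ?sqr_ge0// !sqrf_eq0.
  by rewrite nz.
pose q : 'cV[R]_N := \col_k (if k == k0 then ab.1 else if k == k1 then ab.2 else 0).
pose v := Q^T *m q.
have Qv : Q *m v = q by rewrite /v mulmxA QQ mul1mx.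
have sum2 (F : 'I_N -> R) : (forall k, k != k0 -> k != k1 -> F k = 0) -> \sum_k F k = F k0 + F k1.
  move=> F0; rewrite (bigD1 k0)//= (bigD1 k1)//= big1 ?addr0// => k /andP[n0 n1]; exact: F0.
have q0 : q k0 0 = ab.1 by rewrite mxE eqxx.
have q1 : q k1 0 = ab.2 by rewrite mxE (negbTE k01) eqxx.
have qz k : k != k0 -> k != k1 -> q k 0 = 0 by move=> n0 n1; rewrite mxE (negbTE n0) (negbTE n1).
have ve : dot v e = 0.
  have -> : dot v e = \sum_k q k 0 * (Q *m e) k 0.
    by rewrite -dotE /v dot_mxl trmxK.
  rewrite sum2; last by move=> k n0 n1; rewrite qz// mul0r.
  rewrite q0 q1 /ab; case: ifP => [/andP[/eqP az /eqP bz]|_] /=.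
    move: bz; rewrite /b => /eqP; rewrite oppr_eq0 => /eqP ->.
    by rewrite mulr0 mul0r addr0.
  by rewrite /a /b mulNr mulrC subrr.
have := h v ve; rewrite {1}AE dot_fm -(dot_basis QQ') Qv.
rewrite sum2; last by move=> k n0 n1; rewrite qz// mul0r mulr0.
rewrite sum2; last by move=> k n0 n1; rewrite qz// expr0n.
rewrite q0 q1; apply/negP; rewrite -ltNge -!expr2 mulrDr -subr_gt0.
have -> : dd k0 * ab.1 ^+ 2 + dd k1 * ab.2 ^+ 2 - (x * ab.1 ^+ 2 + x * ab.2 ^+ 2) =
   (dd k0 - x) * ab.1 ^+ 2 + (dd k1 - x) * ab.2 ^+ 2 by ring.
pose mn := Num.min (dd k0 - x) (dd k1 - x).
have mn0 : 0 < mn by rewrite lt_min !subr_gt0 d0 hx.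
apply: (@lt_le_trans _ _ (mn * (ab.1 ^+ 2 + ab.2 ^+ 2))); first by rewrite mulr_gt0.
by rewrite mulrDr; apply: lerD; rewrite ler_wpM2r ?sqr_ge0// ge_min lexx ?orbT.
Qed.

(** The witness is a top eigenvector. Together with [eigval_second_le] this yields interlacing under
    a positive rank-one perturbation. *)
Lemma eigval_second_form : (1 < N)%N ->
  exists e, forall v, dot v e = 0 -> dot v (A *m v) <= eigval A 1 * dot v v.
Proof.
move=> N1; have [Q [dd dg]] := symm_diagonalizes sA; have [QQ QQ' AE] := dg.
have [p [pE pm]] := eigseq_diag dg.
pose i0 := Ordinal (ltnW N1); pose i1 := Ordinal N1.
have -> : eigval A 1 = dd (p i1) by rewrite -pE.
exists (Q^T *m delta_mx (p i0) 0) => v ve.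
have vz : (Q *m v) (p i0) 0 = 0.
  have := ve; rewrite dotC dot_mxl trmxK dotC dotE (bigD1 (p i0))//= [X in _ * X + _]mxE !eqxx mulr1.
  by rewrite big1 ?addr0// => k kn; rewrite [X in _ * X]mxE (negbTE kn) mulr0.
rewrite {1}AE dot_fm -(dot_basis QQ') mulr_sumr; apply: ler_sum => k _.
have [->|kn] := eqVneq k (p i0); first by rewrite vz mul0r mulr0 expr0n mulr0.
rewrite -expr2 ler_wpM2r ?sqr_ge0//.
rewrite -[k](permKV p); apply: pm; rewrite lt0n; apply: contraNneq kn => z.
by rewrite -[k](permKV p); apply/eqP; congr (p _); exact: val_inj.
Qed.

Lemma eigval_second_le_max : (1 < N)%N -> eigval A 1 <= eigval A 0.
Proof.
move=> N1; have [Q [dd dg]] := symm_diagonalizes sA.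
have [p [pE pm]] := eigseq_diag dg.
by have := pm (Ordinal (ltnW N1)) (Ordinal N1) isT; rewrite -!pE.
Qed.
End Spectral.

Section RankOne.
Variables (N : nat) (H : 'M[R]_N) (x lam : R) (u : 'cV[R]_N).
Hypothesis sH : symm H.
Let A := x%:M - H.
Hypothesis pA : forall v, v != 0 -> 0 < dot v (A *m v).
Variable G : 'M[R]_N.
Hypothesis AG : A *m G = 1%:M.
Let M := H + lam *: (u *m u^T).

Let sAA : symm A.
Proof. by rewrite /A /symm linearB /= tr_scalar_mx sH. Qed.

Lemma spiked_form v : dot v (M *m v) = dot v (H *m v) + lam * dot u v ^+ 2.
Proof.
rewrite /M mulmxDl dotDr -scalemxAl dotZr outer_mul dotZr (dotC v u).
by rewrite expr2.
Qed.

Let AGu : A *m (G *m u) = u. Proof. by rewrite mulmxA AG mul1mx. Qed.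

Let formA v : dot v (A *m v) = x * dot v v - dot v (H *m v).
Proof. by rewrite /A mulmxBl mul_scalar_mx dotDr dotNr dotZr. Qed.

(** Cauchy-Schwarz in the form of $A=x-H$: since $AGu=u$, one has $(u\cdot v)^2\le(u\cdot Gu)(v\cdot
    Av)$. *)
Lemma spiked_below : 0 <= lam -> lam * dot u (G *m u) < 1 ->
  forall v, v != 0 -> dot v (M *m v) < x * dot v v.
Proof.
move=> l0 l1 v v0; rewrite spiked_form -ltrBrDl -formA.
have pp : psd A.
  by move=> w; have [->|/pA/ltW//] := eqVneq w 0; rewrite mulmx0 dot0r.
have := psd_CS (G *m u) v sAA pp.
rewrite AGu (dotC (G *m u) (A *m v)) dot_sym// AGu (dotC v u) (dotC (G *m u) u) => cs.
have p0 := pA v0.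
apply: (@le_lt_trans _ _ (lam * dot u (G *m u) * dot v (A *m v))).
  by rewrite -mulrA ler_wpM2l.
by rewrite -[ltRHS]mul1r ltr_pM2r.
Qed.

(** The test vector is [G *m u], the equality case of the Cauchy-Schwarz inequality in
    [spiked_below]. *)
Lemma spiked_above : 1 <= lam * dot u (G *m u) -> 0 <= lam ->
  exists2 v, v != 0 & x * dot v v <= dot v (M *m v).
Proof.
move=> l1 l0; exists (G *m u).
  by apply: contraTneq l1 => ->; rewrite dot0r mulr0 -ltNge.
rewrite spiked_form -lerBlDl -formA AGu (dotC (G *m u) u).
set t := dot u _ in l1 *.
have t0 : 0 <= t by rewrite leNgt; apply: contraTN l1 => t0; rewrite -ltNge; apply: (@le_lt_trans _ _ 0) => //; rewrite mulr_ge0_le0// ltW.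
by rewrite expr2 mulrA -[leLHS]mul1r ler_wpM2r.
Qed.
End RankOne.
End Eigenvalues.

(** * The stochastic block model *)

Section BlockModel.
Context {R : realType} (gam a1 a2 : R).

Definition sig2 (a b : bool) : R :=
  if a && b then a1 else if ~~ a && ~~ b then a2 else 1.
Definition frac (b : bool) : R := if b then gam else 1 - gam.
Definition svar N (B : {set 'I_N}) (i j : 'I_N) : R := gsbm_var B a1 a2 i j / N%:R.
(** The limit of a row of variances summed over block [b]; the weight of the column block makes it
    nonsymmetric in general. *)
Definition sblock (a b : bool) : R := sig2 a b * frac b.

Lemma svarE N (B : {set 'I_N}) i j : svar B i j = sig2 (i \in B) (j \in B) / N%:R.
Proof. by []. Qed.

Lemma sum_bool (F : bool -> R) : \sum_b F b = F true + F false.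
Proof.
rewrite (bigD1 true)//= (bigD1 false)//= big1 ?addr0//.
by case.
Qed.

Hypotheses (g0 : 0 < gam < 1) (a10 : 0 < a1) (a20 : 0 < a2).

Lemma sig2_gt0 a b : 0 < sig2 a b.
Proof. by rewrite /sig2; case: a; case: b. Qed.

Lemma frac_gt0 b : 0 < frac b.
Proof. by case/andP: g0 => ? ?; rewrite /frac; case: b; rewrite ?subr_gt0. Qed.

Lemma sblock_gt0 a b : 0 < sblock a b.
Proof. by rewrite /sblock mulr_gt0 ?sig2_gt0 ?frac_gt0. Qed.

Definition smax : R := 1 + a1 + a2.

Lemma sig2_le a b : sig2 a b <= smax.
Proof. by rewrite /sig2 /smax; move: a10 a20; case: a; case: b => /= ? ?; lra. Qed.

Lemma smax_gt0 : 0 < smax.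
Proof. by rewrite /smax addr_gt0// addr_gt0. Qed.

Variable S : forall N, {set 'I_N}.
Hypothesis HS : forall N : nat, (#|S N| : int) = Num.floor (gam * N%:R).

Lemma card_block N : `|#|S N|%:R - gam * N%:R| <= 1 :> R.
Proof.
have /andP[h1 h2] := floor_itv (gam * N%:R); move: h1 h2; rewrite -HS => h1 h2.
rewrite ler_norml; move: h1 h2; rewrite intrD /= -[X in X%:~R]/(Posz _) -!pmulrn => h1 h2.
by apply/andP; split; lra.
Qed.

Lemma sum_block N (f : bool -> R) :
  `|\sum_(k < N) f (k \in S N) - N%:R * \sum_b frac b * f b| <= `|f true| + `|f false|.
Proof.
have -> : \sum_(k < N) f (k \in S N) = #|S N|%:R * f true + (N%:R - #|S N|%:R) * f false.
  rewrite (bigID (fun k => k \in S N))/=; congr (_ + _).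
    transitivity (\sum_(k in S N) f true); first by apply: eq_bigr => k ->.
    by rewrite sumr_const -[LHS]mulr_natl.
  transitivity (\sum_(k | k \notin S N) f false); first by apply: eq_bigr => k /negbTE ->.
  rewrite (sumr_const (predC (mem (S N)))) -[LHS]mulr_natl; congr (_ * _).
  rewrite -natrB; last by rewrite -[leqRHS]card_ord max_card.
  by rewrite -[X in (X - _)%N](card_ord N) -(cardC (mem (S N))) addKn.
rewrite sum_bool /frac.
have -> : #|S N|%:R * f true + (N%:R - #|S N|%:R) * f false -
  N%:R * (gam * f true + (1 - gam) * f false) =
  (#|S N|%:R - gam * N%:R) * (f true - f false) by ring.
rewrite normrM; apply: (@le_trans _ _ (1 * `|f true - f false|)).
  by rewrite ler_wpM2r// card_block.
by rewrite mul1r ler_normB.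
Qed.

Lemma sum_svar N (f : bool -> R) i : (0 < N)%N ->
  `|\sum_(k < N) svar (S N) i k * f (k \in S N) - \sum_b sblock (i \in S N) b * f b|
  <= smax * (`|f true| + `|f false|) / N%:R.
Proof.
move=> N0; have Nr : 0 < N%:R :> R by rewrite ltr0n.
have h := sum_block N (fun b => sig2 (i \in S N) b * f b).
have -> : \sum_(k < N) svar (S N) i k * f (k \in S N) =
  (\sum_(k < N) sig2 (i \in S N) (k \in S N) * f (k \in S N)) / N%:R.
  by rewrite mulr_suml; apply: eq_bigr => k _; rewrite svarE mulrAC.
have -> : \sum_b sblock (i \in S N) b * f b =
  N%:R * (\sum_b frac b * (sig2 (i \in S N) b * f b)) / N%:R.
  rewrite mulrAC divff ?mul1r ?gt_eqF//; apply: eq_bigr => b _; rewrite /sblock; ring.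
rewrite -mulrBl normrM (ger0_norm (_ : 0 <= N%:R^-1)) ?invr_ge0 ?(ltW Nr)//.
rewrite ler_wpM2r ?invr_ge0 ?(ltW Nr)//; apply: (le_trans h).
rewrite !normrM mulrDr; apply: lerD; rewrite ler_wpM2r//;
  by rewrite ger0_norm ?sig2_le// ltW// sig2_gt0.
Qed.

End BlockModel.

Section NoiseOfGsbm.
Context {d} {T : measurableType d} {R : realType} (P : probability T R).

Lemma pw_norm r (x : R) : pw r x = `|x| ^+ (2 * r.+1).
Proof. by rewrite /pw -[in LHS]real_normK ?num_real// -exprM. Qed.

(** Orders [2 * r.+1] and [4 * r.+1] of the moment hypothesis serve the entries and their squares;
    [M] dominates all constants at once. *)
Lemma noise_of_gsbm (S : forall N, {set 'I_N}) (a1 a2 : R) (H : forall N, T -> 'M[R]_N) (r : nat) :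
  0 < a1 -> 0 < a2 -> gsbm_noise P S a1 a2 H ->
  exists2 M : R, 1 <= M & forall N, (0 < N)%N ->
    noise P (H N) (svar a1 a2 (S N)) r M (N%:R)^-1.
Proof.
move=> a10 a20 [mH sH indH mom hi].
have [C1 HC1] := hi (2 * r.+1)%:R ltac:(by rewrite ltr0n).
have [C2 HC2] := hi (4 * r.+1)%:R ltac:(by rewrite ltr0n).
pose M := 1 + `|C1| + `|C2| + smax a1 a2 ^+ (2 * r.+1).
have sm0 := smax_gt0 a10 a20.
have sx0 : 0 <= smax a1 a2 ^+ (2 * r.+1) by rewrite exprn_ge0// ltW.
have M1 : 1 <= M.
  by rewrite /M; have := normr_ge0 C1; have := normr_ge0 C2; lra.
have MC1 : C1 <= M.
  by rewrite /M; have := ler_norm C1; have := normr_ge0 C2; lra.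
have MC2 : C2 <= M.
  by rewrite /M; have := ler_norm C2; have := normr_ge0 C1; lra.
have MS : smax a1 a2 ^+ (2 * r.+1) <= M.
  by rewrite /M; have := normr_ge0 C2; have := normr_ge0 C1; lra.
exists M => // N N0.
have Nr : 0 < N%:R :> R by rewrite ltr0n.
have sH' w : symm (H N w) by exact: sH.
have ind : mutually_independent P (upper N) (entry (H N)) by exact: indH.
have wlog_le (Q : 'I_N -> 'I_N -> Prop) : (forall i j : 'I_N, (i <= j)%N -> Q i j) ->
    (forall i j, Q i j -> Q j i) -> forall i j, Q i j.
  by move=> h1 h2 i j; case: (leqP i j) => [/h1//|/ltnW/h1/h2].
have var_sym i j : gsbm_var (S N) a1 a2 i j = gsbm_var (S N) a1 a2 j i.
  by rewrite /gsbm_var andbC [X in if X then a2 else _]andbC.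
have pN k : N%:R `^ (- ((2 * k)%:R / 2)) = (N%:R^-1) ^+ k :> R.
  rewrite natrM mulrAC divff ?mul1r// powRN powR_mulrn ?exprVn// ler0n.
have m1 i j : (\int[P]_w (H N w i j)%:E = 0)%E.
  move: i j; apply: wlog_le => [i j ij|i j h]; first by have [] := mom N i j ij.
  by rewrite -h; apply: eq_integral => w _; rewrite symmE.
have m2 i j : (\int[P]_w ((H N w i j) ^+ 2)%:E = (svar a1 a2 (S N) i j)%:E)%E.
  move: i j; apply: wlog_le => [i j ij|i j h]; first by have [] := mom N i j ij.
  rewrite /svar var_sym -/(svar a1 a2 (S N) i j) -h.
  by apply: eq_integral => w _; rewrite symmE.
have m3 k C i j : (forall i j : 'I_N, (i <= j)%N ->
   (\int[P]_w (`|H N w i j| `^ (2 * k)%:R)%:E <= (C * (N%:R `^ (- ((2 * k)%:R / 2))))%:E)%E) ->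
   (\int[P]_w (`|H N w i j| ^+ (2 * k))%:E <= (C * (N%:R^-1) ^+ k)%:E)%E.
  move=> hC; move: i j; apply: wlog_le => [i j ij|i j h].
    rewrite -pN; apply: le_trans (hC i j ij).
    rewrite le_eqVlt; apply/orP; left; apply/eqP; apply: eq_integral => w _.
    by rewrite powR_mulrn.
  apply: le_trans h; rewrite le_eqVlt; apply/orP; left; apply/eqP.
  by apply: eq_integral => w _; rewrite symmE.
split => // j; split.
- move=> k; rewrite /hrow; case: insub => [i|]; last exact: measurable_cst.
  exact: mH.
- by apply: row_independent => //; exact: mH.
- move=> k kN; rewrite (_ : k = Ordinal kN)//; under eq_integral do rewrite hrowE.
  exact: m1.
- move=> k kN; rewrite (_ : k = Ordinal kN)// srowE; under eq_integral do rewrite hrowE.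
  exact: m2.
- move=> k kN; rewrite (_ : k = Ordinal kN)// srowE; split.
  + under eq_integral do rewrite hrowE pw_norm.
    apply: (le_trans (m3 _ C1 j (Ordinal kN) (HC1 N))).
    by rewrite lee_fin ler_wpM2r// exprn_ge0// invr_ge0 ltW.
  + under eq_integral do rewrite hrowE pw_norm normrX -exprM.
    have e4 : (2 * (2 * r.+1) = 4 * r.+1)%N by rewrite mulnA.
    have := m3 (2 * r.+1)%N C2 j (Ordinal kN); rewrite e4 => /(_ (HC2 N)) h.
    apply: (le_trans h).
    by rewrite lee_fin -exprM ler_wpM2r// exprn_ge0// invr_ge0 ltW.
  + have s0 : 0 <= svar a1 a2 (S N) j (Ordinal kN).
      by rewrite svarE divr_ge0 ?(ltW (sig2_gt0 _ _ _ _))// ltW.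
    rewrite pw_norm ger0_norm// svarE exprMn -exprM; apply: ler_wpM2r.
      by rewrite exprn_ge0// invr_ge0 ltW.
    apply: le_trans MS; apply: lerXn2r; rewrite ?nnegrE ?(ltW sm0) ?(ltW (sig2_gt0 _ _ _ _))//.
    exact: sig2_le.
Qed.
End NoiseOfGsbm.

Section Eventually.
Context {R : realType}.

Lemma near_div_le (C e : R) : 0 < e -> \forall N \near \oo, C / N%:R <= e.
Proof.
move=> e0; near=> N.
have N0 : (0 < N)%N by near: N; exact: nbhs_infty_gt.
rewrite ler_pdivrMr ?ltr0n// mulrC -ler_pdivrMr//.
by near: N; exact: nbhs_infty_ger.
Unshelve. all: by end_near. Qed.

(** With $b=N^{1/16}$ the quotient is of order $N^{-7/8}$; comparing with $b^8$, the square root of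
    [N], avoids real powers. *)
Lemma near_inv_norm_le (C e : R) : 0 < e ->
  \forall N \near \oo, forall b : R, 1 <= b -> b ^+ 16 = N%:R -> C * b ^+ 2 / N%:R <= e.
Proof.
move=> e0; near=> N => b b1 bN.
have N0 : (0 < N)%N by near: N; exact: nbhs_infty_gt.
have b0 : 0 <= b by exact: le_trans b1.
have [C0|C0] := leP C 0.
  apply: le_trans (ltW e0); rewrite mulr_le0_ge0 ?invr_ge0//.
  by rewrite mulr_le0_ge0// exprn_ge0.
have h : C / e <= b ^+ 8.
  rewrite -(@ler_pXn2r _ 2)// ?nnegrE ?exprn_ge0 ?divr_ge0 ?(ltW C0) ?(ltW e0)//.
  rewrite -exprM bN; near: N; exact: nbhs_infty_ger.
have bb : N%:R = b ^+ 8 * b ^+ 8 by rewrite -bN -exprD.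
rewrite ler_pdivrMr ?ltr0n// bb [leRHS]mulrA.
apply: (@le_trans _ _ (C * b ^+ 8)).
  by rewrite ler_wpM2l ?(ltW C0)// ler_weXn2l.
rewrite ler_wpM2r ?exprn_ge0//.
by rewrite mulrC -ler_pdivrMr.
Unshelve. all: by end_near. Qed.

Lemma root16 (N : nat) : (0 < N)%N -> exists2 b : R, 1 <= b & b ^+ 16 = N%:R.
Proof.
move=> N0; have N1 : 1 <= N%:R :> R by rewrite ler1n.
have bE : (N%:R `^ (16%:R^-1)) ^+ 16 = N%:R :> R.
  by rewrite -powR_mulrn ?powR_ge0// -powRrM mulVf ?pnatr_eq0// powRr1// ler0n.
exists (N%:R `^ (16%:R^-1)) => //.
by rewrite -(@ler_pXn2r _ 16)// ?nnegrE ?powR_ge0// bE expr1n.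
Qed.
End Eventually.

(** * First pass: positivity at every stage *)

Section Runs.
Context {d} {T : measurableType d} {R : realType} (P : probability T R).
Context (gam a1 a2 : R) (S : forall N, {set 'I_N}) (H : forall N, T -> 'M[R]_N).
Hypotheses (g0 : 0 < gam < 1) (a10 : 0 < a1) (a20 : 0 < a2).
Hypothesis nH : gsbm_noise P S a1 a2 H.
Hypothesis HS : forall N : nat, (#|S N| : int) = Num.floor (gam * N%:R).
Let s := sblock gam a1 a2.
Let s0 : forall a b, 0 < s a b. Proof. exact: sblock_gt0. Qed.
Let sv N := svar a1 a2 (S N).
Let sm := smax a1 a2.
Let sm0 : 0 < sm. Proof. exact: smax_gt0. Qed.

Lemma near_sum_svar (f : bool -> R) (e : R) : 0 < e -> \forall N \near \oo, forall i : 'I_N,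
  `|\sum_(k < N) sv i k * f (k \in S N) - \sum_b s (i \in S N) b * f b| <= e.
Proof.
move=> e0; near=> N => i.
have N0 : (0 < N)%N by near: N; exact: nbhs_infty_gt.
apply: (le_trans (sum_svar a10 a20 HS f i N0)).
by near: N; exact: near_div_le.
Unshelve. all: by end_near. Qed.

Lemma sv_bounds N (i k : 'I_N) : (0 < N)%N -> 0 <= sv i k <= sm / N%:R.
Proof.
move=> N0; have Nr : 0 < N%:R :> R by rewrite ltr0n.
rewrite /sv svarE divr_ge0 ?(ltW (sig2_gt0 _ _ _ _)) ?(ltW Nr)//=.
by rewrite ler_wpM2r ?invr_ge0 ?(ltW Nr)// sig2_le.
Qed.

Lemma sv_sym N (i k : 'I_N) : sv i k = sv k i.
Proof. by rewrite /sv /svar /gsbm_var andbC [X in if X then a2 else _]andbC. Qed.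

(** The supersolution is [sol] at [y1], at distance [dl] below [X1]; of this gap [kap], the
    block-sum errors and [e] each use at most a quarter. By monotonicity it dominates [sol s X] for
    all [X >= X1], which serves the second pass. *)
Lemma growth_run X1 : edge s < X1 -> exists m1 : bool -> R, exists kap C : R,
  [/\ forall b, 0 < m1 b, 1 <= kap, forall X b, X1 <= X -> sol s X b <= m1 b, 0 <= C &
  \forall N \near \oo, exists g : T -> bool,
    [/\ measurable_fun setT g, (P [set w | ~~ g w] <= (C / N%:R ^+ 2)%:E)%E &
     forall w, g w -> forall n, (n <= N)%N ->
       pd (seg N n) (AD (Dn (@sv N) (fun i => m1 (i \in S N)) X1 kap n) (H N w))]].
Proof.
move=> LX.
have [M M1 noiseM] := noise_of_gsbm 7 a10 a20 nH.
pose dl := (X1 - edge s) / 3.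
have dl0 : 0 < dl by rewrite divr_gt0// subr_gt0.
pose y0 := edge s + dl; pose y1 := edge s + 2 * dl.
have Ly0 : edge s < y0 by rewrite ltrDl.
have y01 : y0 < y1 by rewrite /y0 /y1 ltrD2l; lra.
have Ly1 : edge s < y1 by exact: lt_trans y01.
have y1p : 0 < y1 by exact: edge_x_gt0 Ly1.
have X1E : X1 = y1 + dl by rewrite /y1 /dl; field.
(* The equation of [z1] contains [sol s y0], taken to the left of [y1] and hence larger than [m1];
   the excess absorbs the errors of the block sums. *)
pose m1 := sol s y1; pose z1 := zeta s y1 y0.
have m10 b : 0 < m1 b by exact: sol_gt0.
have z10 b : 0 < z1 b by exact: zeta_gt0.
pose kap := 1 + dl / (4 * y1).
have kap1 : 1 < kap by rewrite /kap ltrDl divr_gt0// mulr_gt0.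
pose e := Num.min (dl / 4) (1 / 2).
have e0 : 0 < e by rewrite lt_min divr_gt0//=.
have e_dl : e <= dl / 4 by rewrite ge_min lexx.
have e3 : e < 1 by rewrite (@le_lt_trans _ _ (1 / 2))// ?ge_min ?lexx ?orbT//; lra.
pose del := e / 4.
have del0 : 0 < del by rewrite divr_gt0.
pose Cz := \sum_a \sum_b s a b * z1 b + 1.
pose mm := m1 true + m1 false.
have mmm b : m1 b <= mm by rewrite /mm; case: b; rewrite ?lerDl ?lerDr ltW.
have sz0 a : 0 <= \sum_b s a b * z1 b by apply: sumr_ge0 => b _; rewrite mulr_ge0 ?ltW.
have Cz1 a : \sum_b s a b * z1 b + 1 <= Cz.
  by rewrite /Cz lerD2r [leRHS](bigD1 a)//= lerDl sumr_ge0.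
have Cz0 : 0 <= Cz by apply: le_trans (Cz1 true); rewrite addr_ge0.
pose C1 := mm * (1 + del + 2 * Cz).
have mm0 : 0 < mm by rewrite /mm addr_gt0.
have C10 : 0 <= C1 by rewrite /C1 mulr_ge0 ?(ltW mm0)//; lra.
(* The potential is the trace of the 64th power. *)
have [C2 C20 HC2] := growth_scalar 63 kap1 C10.
have [Ct Ct0 HCt] := ok_tail P 7.
pose Ctail := (M + Ct * M ^+ 2) / pw 7 del.
have Ctail0 : 0 <= Ctail.
  rewrite /Ctail divr_ge0 ?pw_ge0// addr_ge0 ?(le_trans ler01 M1)//.
  by rewrite mulr_ge0 ?sqr_ge0.
pose cst0 := 64%:R * mm * (C1 ^+ 63 + sm * C2).
have cst00 : 0 <= cst0.
  rewrite /cst0 mulr_ge0 ?mulr_ge0 ?(ltW mm0)// addr_ge0 ?exprn_ge0// mulr_ge0//.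
  exact: ltW.
exists m1, kap, (cst0 + Ctail); split => //.
- exact: ltW.
- move=> X b XX; apply: (sol_mono s0 Ly1); apply: lt_le_trans XX.
  by rewrite X1E ltrDl.
- exact: addr_ge0.
pose slack := Num.min (m1 true * (sol s y0 true - m1 true)) (m1 false * (sol s y0 false - m1 false)).
have slack0 : 0 < slack by rewrite lt_min !mulr_gt0// subr_gt0 sol_lt.
have e1' : 0 < dl / (4 * kap) by rewrite divr_gt0// mulr_gt0// (lt_trans ltr01).
have ez' : 0 < Num.min 1 (slack / mm ^+ 2).
  by rewrite lt_min ltr01 divr_gt0// exprn_gt0.
near=> N.
have N0 : (0 < N)%N by near: N; exact: nbhs_infty_gt.
have Nr : 0 < N%:R :> R by rewrite ltr0n.
have h1 : forall i : 'I_N, `|\sum_(k < N) sv i k * m1 (k \in S N) - \sum_b s (i \in S N) b * m1 b|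
   <= dl / (4 * kap) by near: N; exact: near_sum_svar.
have h2 : forall i : 'I_N, `|\sum_(k < N) sv i k * z1 (k \in S N) - \sum_b s (i \in S N) b * z1 b|
   <= Num.min 1 (slack / mm ^+ 2) by near: N; exact: near_sum_svar.
have h3 : forall b : R, 1 <= b -> b ^+ 16 = N%:R -> (3 * sm) * b ^+ 2 / N%:R <= e / 2.
  by near: N; apply: near_inv_norm_le; rewrite divr_gt0.
have [b b1 bN] := root16 N0 : exists2 b : R, 1 <= b & b ^+ 16 = N%:R.
have b0 : 0 < b by exact: lt_le_trans b1.
pose m i := m1 (i \in S N); pose z i := z1 (i \in S N).
pose K := sm / N%:R.
have nN := noiseM N N0.
have S0 : forall i k : 'I_N, 0 <= sv i k <= K by move=> i k; exact: sv_bounds.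
have base : forall i : 'I_N, (m i)^-1 + kap * (\sum_(k < N) sv i k * m k) + e <= X1.
  move=> i; have := h1 i; rewrite ler_norml => /andP[_ hi].
  have eq1 := sol_eq s0 Ly1 (i \in S N); rewrite -/(m1 _) -/(m i) in eq1.
  have i0 : 0 < (m i)^-1 by rewrite invr_gt0 /m.
  have k0 : 0 < kap by exact: lt_trans kap1.
  have : kap * (\sum_(k < N) sv i k * m k) <= kap * (\sum_b s (i \in S N) b * m1 b) + dl / 4.
    have -> : dl / 4 = kap * (dl / (4 * kap)) by field; rewrite gt_eqF.
    by rewrite -mulrDr ler_wpM2l ?(ltW k0)// addrC -lerBlDr.
  set A := \sum_b _ in eq1 *.
  have A1 : A <= y1 by rewrite -eq1 lerDr ltW.
  have : kap * A <= A + dl / 4.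
    rewrite /kap mulrDl mul1r lerD2l.
    have -> : dl / (4 * y1) * A = dl / 4 * (A / y1) by field; rewrite gt_eqF.
    have d40 : 0 < dl / 4 by rewrite divr_gt0.
    rewrite ler_piMr ?(ltW d40)//.
    by rewrite ler_pdivrMr// mul1r.
  rewrite X1E; move: eq1 e_dl dl0; move: (m i)^-1 (kap * A) => p q; lra.
have zeq : forall i : 'I_N, m i ^+ 2 * (1 + \sum_(k < N) sv i k * z k) <= z i.
  move=> i; have := h2 i; rewrite ler_norml => /andP[_ hi].
  rewrite {2}/z /z1 (zeta_eq s0 Ly0 y01) -/(z1 _).
  have hs : \sum_(k < N) sv i k * z k <= \sum_b s (i \in S N) b * z1 b + slack / mm ^+ 2.
    rewrite addrC -lerBlDr (le_trans hi)// ge_min lexx orbT//.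
  set A := \sum_b s _ b * z1 b in hs *.
  have A0 : 0 <= A by exact: sz0.
  rewrite -/(m1 _) -/(m i).
  apply: (@le_trans _ _ (m i ^+ 2 * (1 + A) + slack)).
    apply: (@le_trans _ _ (m i ^+ 2 * (1 + A + slack / mm ^+ 2))).
      by rewrite ler_wpM2l ?sqr_ge0// -addrA lerD2l.
    rewrite mulrDr lerD2l (_ : m i ^+ 2 * (slack / mm ^+ 2) = slack * (m i ^+ 2 / mm ^+ 2)); last by ring.
    rewrite ler_piMr ?(ltW slack0)//.
    rewrite ler_pdivrMr ?mul1r ?exprn_gt0//.
    by apply: lerXn2r; rewrite ?nnegrE ?(ltW mm0) ?/m ?(ltW (m10 _)).
  have -> : m i * sol s y0 (i \in S N) * (1 + A) =
    m i ^+ 2 * (1 + A) + m i * (sol s y0 (i \in S N) - m i) * (1 + A) by ring.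
  rewrite lerD2l.
  have sl : slack <= m i * (sol s y0 (i \in S N) - m i).
    by rewrite /slack /m; case: (i \in S N); rewrite ge_min lexx ?orbT.
  by apply: (le_trans sl); rewrite ler_peMr ?lerDl// (le_trans (ltW slack0)).
have K0 : 0 <= K by rewrite divr_ge0 ?(ltW sm0) ?(ltW Nr).
have Kb2 : K * (3 * b ^+ 2) <= e / 2.
  by have := h3 b b1 bN; rewrite (_ : K * (3 * b ^+ 2) = 3 * sm * b ^+ 2 / N%:R)// /K; ring.
have Kb : K * b <= e / 2.
  apply: le_trans Kb2; rewrite ler_wpM2l//.
  have : b * 1 <= b * b by rewrite ler_wpM2l// ltW.
  rewrite expr2; have : 0 <= b * b by rewrite mulr_ge0 ?(ltW b0)//.
  lra.
have c1 : 2 * del + K * b <= e by rewrite /del; lra.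
have c2 : del + K * (3 * b ^+ 2) <= e by rewrite /del; lra.
have hCz : forall i : 'I_N, \sum_(k < N) sv i k * z k <= Cz.
  move=> i; have := h2 i; rewrite ler_norml => /andP[_ hi].
  apply: le_trans (Cz1 (i \in S N)); rewrite addrC -lerBlDr (le_trans hi)// ge_min lexx//.
have hC1 : forall i : 'I_N, m i * (1 + del + 2 * Cz) <= C1.
  by move=> i; rewrite /C1 ler_wpM2r ?mmm//; lra.
have v0 : 0 <= (N%:R^-1 : R) by rewrite invr_ge0 ltW.
have be0 : 0 <= N%:R * b ^+ 4 by rewrite mulr_ge0 ?(ltW Nr)// exprn_ge0// ltW.
have tailE : (M * (N%:R^-1) ^+ 8 + Ct * M ^+ 2 * ((N%:R^-1) ^+ 2 * (N%:R * b ^+ 4)) ^+ 8) / pw 7 del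
   <= Ctail * (N%:R^-1) ^+ 6.
  have -> : ((N%:R^-1) ^+ 2 * (N%:R * b ^+ 4)) ^+ 8 = (N%:R^-1) ^+ 6 :> R.
    have -> : (N%:R^-1) ^+ 2 * (N%:R * b ^+ 4) = N%:R^-1 * b ^+ 4 by field; rewrite gt_eqF.
    rewrite exprMn -exprM.
    have -> : b ^+ (4 * 8) = N%:R ^+ 2 by rewrite -bN -exprM.
    by field; rewrite gt_eqF.
  have n86 : (N%:R^-1) ^+ 8 <= (N%:R^-1) ^+ 6 :> R.
    rewrite ler_wiXn2l// invf_le1// ler1n//.
  rewrite /Ctail [leRHS]mulrAC ler_wpM2r ?invr_ge0 ?pw_ge0// [leRHS]mulrDl lerD2r.
  by rewrite ler_wpM2l// (le_trans ler01).
have tail0 : 0 <= Ctail * (N%:R^-1) ^+ 6 by rewrite mulr_ge0// exprn_ge0.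
have hm0 (i : 'I_N) : 0 < m i by exact: m10.
have hz0 (i : 'I_N) : 0 < z i by exact: z10.
have hmm (i : 'I_N) : m i <= mm by exact: mmm.
have tl := goods_tail (q := 63) nN S0 (@sv_sym N) hm0 hz0 (ltW kap1) base zeq b1 c1 c2 e3 hCz hC1
  (lexx _) C10 C20 HC2 hmm tail0.
exists (fun w => goods (@sv N) m X1 kap b del (N%:R * b ^+ 4) 63 (H N w) N).
have [mH sH _ _] := nN.
split.
- by apply: measurable_goods => i k _ _; exact: mH.
- apply: (le_trans (tl _ N (leqnn N))) => [D I j jI|].
    apply: (le_trans (HCt N (H N) (@sv N) M N%:R^-1 j D I _ del nN M1 v0 be0 del0 jI)).
    by rewrite lee_fin.
  rewrite lee_fin -/cst0 /K.
  have -> : 63.+1%:R * mm * (C1 ^+ 63 + N%:R * (sm / N%:R) * C2) = cst0.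
    by rewrite /cst0 mulrCA divff ?gt_eqF// mulr1.
  (* Markov's inequality costs $N^{-3}$ per row and the concentration conditions $N^{-5}$, so the
     [N] rows together cost $O(N^{-2})$. *)
  have -> : b ^+ 63.+1 = N%:R ^+ 4 by rewrite -bN -exprM.
  have -> : N%:R * (N%:R * cst0 / N%:R ^+ 4 + N%:R * (Ctail * N%:R^-1 ^+ 6)) =
     (cst0 + Ctail * (N%:R^-1) ^+ 2) / N%:R ^+ 2 by field; rewrite gt_eqF.
  rewrite ler_wpM2r ?invr_ge0 ?exprn_ge0 ?(ltW Nr)// lerD2l ler_piMr//.
  by rewrite exprn_ile1// invf_le1// ler1n.
- move=> w gw n nleN.
  have gn : goods (@sv N) m X1 kap b del (N%:R * b ^+ 4) 63 (H N w) n.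
    move: gw; rewrite /goods !big_andE => /forallP gw; apply/forallP => k.
    exact: (gw (Ordinal (leq_trans (ltn_ord k) nleN))).
  exact: (goods_pd S0 hm0 hz0 (ltW kap1) base zeq b1 c1 c2 e3 hCz hC1 (lexx _) (sH w) nleN gn).
Unshelve. all: by end_near. Qed.

End Runs.

Section Arithmetic.
Context {R : realType}.
Implicit Types t k x y A q p e : R.

Lemma ar_base x t : 0 < t -> x - t + t / 4 + t / 2 <= x. Proof. lra. Qed.
Lemma ar_err A q r er : er <= r -> q <= A + er -> 1 + q <= 1 + A + r. Proof. lra. Qed.
Lemma ar_zeq A u v : 0 <= v - u -> 0 <= A -> u * (1 + A) + (v - u) <= v * (1 + A).
Proof. nra. Qed.
Lemma ar_del t k : 0 < t -> k <= t / 4 -> 2 * (t / 8) + k <= t / 2. Proof. lra. Qed.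
Lemma ar_del' t k : 0 < t -> k <= t / 4 -> t / 8 + k <= t / 2. Proof. lra. Qed.
Lemma ar_half t : t <= 1 / 4 -> t / 2 < 1. Proof. lra. Qed.
Lemma ar_eta_ge0 t k : 0 < t -> 0 <= k -> 0 <= t / 2 + (t / 8 + k). Proof. lra. Qed.
Lemma ar_eta t k : 0 < t -> k <= t / 8 -> t / 2 + (t / 8 + k) <= t. Proof. lra. Qed.
Lemma ar_sig t k y : 0 < t -> k <= t / 8 -> t / 8 + k + 2 * (t / 8) + y <= t + y.
Proof. lra. Qed.
Lemma ar_shift p q x y : p <= q -> x - y <= x - p - (y - q). Proof. lra. Qed.
Lemma ar_quarter e q : 0 < e -> q <= e / 4 -> q <= e. Proof. lra. Qed.
Lemma ar_final e p q : 0 < e -> p <= e / 4 -> q <= e / 4 + e / 4 + e / 4 -> q + p <= e.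
Proof. lra. Qed.
Lemma ar_tail p q : 0 <= p -> p <= 1 -> 0 <= q -> q <= 1 -> (1 + p) * q <= 2.
Proof. nra. Qed.
End Arithmetic.

(** * Second pass: the resolvent at a fixed point above the edge *)

Section ResolventRun.
Context {d} {T : measurableType d} {R : realType} (P : probability T R).
Context (gam a1 a2 t1 t2 : R) (S : forall N, {set 'I_N}) (H : forall N, T -> 'M[R]_N).
Hypotheses (g0 : 0 < gam < 1) (a10 : 0 < a1) (a20 : 0 < a2).
Hypothesis nH : gsbm_noise P S a1 a2 H.
Hypothesis HS : forall N : nat, (#|S N| : int) = Num.floor (gam * N%:R).
Let s := sblock gam a1 a2.
Let s0 : forall a b, 0 < s a b. Proof. exact: sblock_gt0. Qed.
Let sv N := svar a1 a2 (S N).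
Let sm := smax a1 a2.
Let sm0 : 0 < sm. Proof. exact: smax_gt0. Qed.
Let tt (b : bool) := if b then t1 else t2.

Definition spike_limit (x : R) : R := \sum_b frac gam b * (tt b ^+ 2 * sol s x b).

Lemma spike_sq N (k : 'I_N) : spike (S N) t1 t2 k 0 ^+ 2 = tt (k \in S N) ^+ 2 / N%:R.
Proof. by rewrite mxE exprMn exprVn sqr_sqrtr// ler0n. Qed.

(** The first pass at [X1 < x] leaves a margin [tau] independent of [N]: intermediate resolvents are
    bounded by [tau^-1], and all errors can be made small. *)
Lemma resolvent_run x eta0 : edge s < x -> 0 < eta0 -> exists2 C : R, 0 <= C &
  \forall N \near \oo, exists g : T -> bool,
    [/\ measurable_fun setT g, (P [set w | ~~ g w] <= (C / N%:R ^+ 2)%:E)%E &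
     forall w, g w -> let A := AD (fun=> x) (H N w) in let G := Gm A [set: 'I_N]%SET in
       [/\ pd [set: 'I_N]%SET A, forall j, `|G j j - sol s x (j \in S N)| <= eta0 &
        `|dot (spike (S N) t1 t2) (G *m spike (S N) t1 t2) - spike_limit x| <= eta0]].
Proof.
move=> Lx eta00.
have [M M1 noiseM] := noise_of_gsbm 7 a10 a20 nH.
pose dl := (x - edge s) / 5.
have dl0 : 0 < dl by rewrite divr_gt0// subr_gt0.
have xE : x = edge s + 5 * dl by rewrite /dl; field.
clearbody dl.
pose X1 := edge s + 3 * dl; pose x0 := edge s + 4 * dl.
have X1x : X1 <= x by rewrite /X1; lra.
have LX1 : edge s < X1 by rewrite /X1; lra.
have Lx0 : edge s < x0 by rewrite /x0; lra.
have x0x : x0 < x by rewrite /x0; lra.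
have [m1 [kap [Cg [m10 kap1 m1b Cg0 run1]]]] := growth_run g0 a10 a20 nH HS LX1.
pose m b := sol s x b; pose z := zeta s x x0.
have m0 b : 0 < m b by exact: sol_gt0.
have z0 b : 0 < z b by exact: zeta_gt0.
pose mm := m true + m false; pose Z := z true + z false.
have mmm b : m b <= mm by rewrite /mm; case: b; rewrite ?lerDl ?lerDr ltW.
have zZ b : z b <= Z by rewrite /Z; case: b; rewrite ?lerDl ?lerDr ltW.
have mm0 : 0 < mm by rewrite addr_gt0.
have Z0 : 0 < Z by rewrite addr_gt0.
(* From the first pass to the second every intermediate diagonal rises by at least [x - X1], because
   [kap * m1] dominates [sol s x]. The cap at 1 ensures [tau^-1 >= 1]. *)
pose tau := Num.min 1 (2 * dl).
have tau0 : 0 < tau by rewrite lt_min ltr01 mulr_gt0.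
have tau1 : tau <= 1 by rewrite ge_min lexx.
have taux : tau <= x - X1.
  have : tau <= 2 * dl by rewrite ge_min lexx orbT.
  by rewrite /X1; lra.
pose b := tau^-1.
have b0 : 0 < b by rewrite invr_gt0.
pose U := t1 ^+ 2 + t2 ^+ 2.
have U0 : 0 <= U by rewrite addr_ge0// sqr_ge0.
have ttU c : tt c ^+ 2 <= U by rewrite /U /tt; case: c; rewrite ?lerDl ?lerDr sqr_ge0.
pose B0 := b * U + (mm * sm * (b ^+ 2 * U) + b ^+ 3 * (sm * mm) ^+ 2 * U).
have B00 : 0 <= B0.
  rewrite /B0; apply: addr_ge0; first by rewrite mulr_ge0// ltW.
  have b2 := sqr_ge0 b; have b3 : 0 <= b ^+ 3 by rewrite exprn_ge0// ltW.
  apply: addr_ge0; last by rewrite mulr_ge0// mulr_ge0// sqr_ge0.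
  by apply: mulr_ge0; [rewrite mulr_ge0 ?(ltW mm0) ?(ltW sm0)|exact: mulr_ge0].
(* [W] collects the factors by which [t] is multiplied in the final errors. *)
pose W := 1 + Z + (1 + sm * Z) * mm * (1 + B0).
have smZ : 0 < sm * Z by rewrite mulr_gt0.
have W1 : 1 <= W.
  rewrite /W -addrA lerDl addr_ge0 ?(ltW Z0)// mulr_ge0 ?mulr_ge0 ?(ltW mm0)//; lra.
have W0 : 0 < W by exact: lt_le_trans W1.
pose t := Num.min (dl / 2) (Num.min eta0 1 / (4 * W)).
have t0 : 0 < t by rewrite lt_min !divr_gt0 ?lt_min ?eta00 ?mulr_gt0//=.
have tdl : t < dl by rewrite (@le_lt_trans _ _ (dl / 2))// ?ge_min ?lexx//; lra.
have tW : t * W <= eta0 / 4 /\ t * W <= 1 / 4.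
  have h : t * W <= Num.min eta0 1 / 4.
    have : t <= Num.min eta0 1 / (4 * W) by rewrite ge_min lexx orbT.
    move=> h; apply: (le_trans (ler_wpM2r (ltW W0) h)).
    by rewrite invfM mulrA divfK ?gt_eqF.
  have : Num.min eta0 1 <= eta0 by rewrite ge_min lexx.
  have : Num.min eta0 1 <= 1 by rewrite ge_min lexx orbT.
  by split; lra.
have [tWe tW1] := tW.
have tt1 : t <= 1 / 4.
  by apply: le_trans tW1; rewrite ler_peMr// ltW.
have tZ : t * Z <= eta0 / 4.
  apply: le_trans tWe; rewrite ler_wpM2l ?(ltW t0)// /W.
  have : 0 <= (1 + sm * Z) * mm * (1 + B0).
    by apply: mulr_ge0; [apply: mulr_ge0; rewrite ?(ltW mm0)//; lra|lra].
  lra.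
pose sig := t * (1 + sm * Z).
have sigW : sig * mm * (1 + B0) <= t * W.
  rewrite /sig -!mulrA ler_wpM2l ?(ltW t0)// /W !mulrA lerDr.
  by rewrite addr_ge0 ?ltW.
have sig0 : 0 <= sig by rewrite /sig mulr_ge0 ?(ltW t0)//; lra.
have sigmm0 : 0 <= sig * mm by rewrite mulr_ge0// ltW.
have sigm : sig * mm < 1.
  have : sig * mm * 1 <= sig * mm * (1 + B0) by rewrite ler_wpM2l// lerDl.
  lra.
have sigB : mm * sig * B0 <= eta0 / 4.
  have : sig * mm * B0 <= sig * mm * (1 + B0) by rewrite ler_wpM2l// lerDr.
  rewrite [mm * sig]mulrC; lra.
clearbody W t.
(* The comparison function [mu] is [sol] at [x2]: the shift [t] provides its slack as a
   supersolution, and [mu - m] is at most [t * Z] by convexity. *)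
pose x2 := x - t.
have x02 : x0 < x2 by rewrite /x2 /x0; lra.
have x2x : x2 < x by rewrite /x2; lra.
have Lx2 : edge s < x2 by exact: lt_trans x02.
pose mu c := sol s x2 c.
have mu0 c : 0 < mu c by exact: sol_gt0.
have mmu c : m c <= mu c by exact: sol_mono.
pose e := t / 2; pose del := t / 8; pose e' := t / 8; pose eta := t * Z.
have del0 : 0 < del by rewrite divr_gt0.
(* The equation of [z] holds with [sol s x0] where the condition to be checked has the smaller [mu];
   this relative excess absorbs the block-sum errors. *)
pose rat c := (sol s x0 c - mu c) / mu c.
have rat0 c : 0 < rat c by rewrite /rat divr_gt0// subr_gt0 sol_lt.
pose er := Num.min (rat true) (rat false).
have er0 : 0 < er by rewrite lt_min !rat0.
have err c : er <= rat c by rewrite /er; case: c; rewrite ge_min lexx ?orbT.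
have [Ct Ct0 HCt] := ok_tail P 7.
have [Cx Cx0 HCx] := xi_sum_moment P 7.
pose Ctail := (M + Ct * M ^+ 2 * (b ^+ 4) ^+ 8) / pw 7 del.
have M0 : 0 <= M by exact: le_trans M1.
have b40 : 0 <= (b ^+ 4) ^+ 8 by rewrite -exprM exprn_ge0// ltW.
have Ctail0 : 0 <= Ctail.
  rewrite /Ctail divr_ge0 ?pw_ge0// addr_ge0// mulr_ge0// mulr_ge0 ?sqr_ge0//.
pose Y := b ^+ 2 * U.
have Y0 : 0 <= Y by rewrite mulr_ge0 ?sqr_ge0.
pose L := 4 * mm ^+ 2 * U * Y + mm ^+ 2 * Y ^+ 2.
have L0 : 0 <= L.
  apply: addr_ge0; last by rewrite mulr_ge0 ?sqr_ge0.
  by rewrite mulr_ge0// mulr_ge0// mulr_ge0// sqr_ge0.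
have eta4 : 0 < eta0 / 4 by rewrite divr_gt0.
pose Cxi := Cx * M ^+ 2 * L ^+ 8 / pw 7 (eta0 / 4).
have Cxi0 : 0 <= Cxi.
  by rewrite /Cxi divr_ge0 ?pw_ge0// mulr_ge0 ?exprn_ge0// mulr_ge0 ?sqr_ge0.
exists (Cg + 2 * Ctail + Cxi); first by rewrite addr_ge0// addr_ge0// mulr_ge0.
have t80 : 0 < t / 8 by rewrite divr_gt0.
have t40 : 0 < t / 4 by rewrite divr_gt0.
near=> N.
have N0 : (0 < N)%N by near: N; exact: nbhs_infty_gt.
have Nr : 0 < N%:R :> R by rewrite ltr0n.
have Nr1 : 1 <= N%:R :> R by rewrite ler1n.
have n0 : N%:R != 0 :> R by rewrite gt_eqF.
have [g1 [mg1 Pg1 Hg1]] : exists g : T -> bool,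
    [/\ measurable_fun setT g, (P [set w | ~~ g w] <= (Cg / N%:R ^+ 2)%:E)%E &
     forall w, g w -> forall n, (n <= N)%N ->
       pd (seg N n) (AD (Dn (@sv N) (fun i => m1 (i \in S N)) X1 kap n) (H N w))] by near: N.
have h1 : forall i : 'I_N, `|\sum_(k < N) sv i k * m (k \in S N) - \sum_b s (i \in S N) b * m b|
   <= t / 8 by near: N; exact: near_sum_svar.
have h2 : forall i : 'I_N, `|\sum_(k < N) sv i k * mu (k \in S N) - \sum_b s (i \in S N) b * mu b|
   <= t / 4 by near: N; exact: near_sum_svar.
have h3 : forall i : 'I_N, `|\sum_(k < N) sv i k * z (k \in S N) - \sum_b s (i \in S N) b * z b|
   <= er by near: N; exact: near_sum_svar.
have h4 : sm * b / N%:R <= t / 4 by near: N; exact: near_div_le.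
have h5 : 3 * sm * b ^+ 2 / N%:R <= t / 4 by near: N; exact: near_div_le.
have h6 : sm * mm / N%:R <= t / 8 by near: N; exact: near_div_le.
have h7 : b ^+ 3 * (sm * mm) ^+ 2 * U / N%:R <= eta0 / 4 by near: N; exact: near_div_le.
have h8 : (`|tt true ^+ 2 * m true| + `|tt false ^+ 2 * m false|) / N%:R <= eta0 / 4.
  by near: N; exact: near_div_le.
pose K := sm / N%:R.
have nN := noiseM N N0.
have [mH sH _ _] := nN.
pose u := spike (S N) t1 t2.
pose mi (i : 'I_N) := m (i \in S N); pose mui (i : 'I_N) := mu (i \in S N).
pose zi (i : 'I_N) := z (i \in S N).
have S0 : forall i k : 'I_N, 0 <= sv i k <= K by move=> i k; exact: sv_bounds.
have K0 : 0 <= K by rewrite divr_ge0 ?(ltW sm0) ?(ltW Nr).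
have SC : forall i : 'I_N, \sum_(k < N) sv i k <= sm.
  move=> i; apply: (@le_trans _ _ (\sum_(k < N) K)).
    by apply: ler_sum => k _; case/andP: (S0 i k).
  by rewrite sumr_const card_ord -[leLHS]mulr_natl /K mulrCA divff// mulr1.
have eqm : forall i : 'I_N, `|(mi i)^-1 + \sum_(k < N) sv i k * mi k - x| <= e'.
  move=> i; have eq1 := sol_eq s0 Lx (i \in S N).
  have -> : (mi i)^-1 + \sum_(k < N) sv i k * mi k - x =
    \sum_(k < N) sv i k * m (k \in S N) - \sum_b s (i \in S N) b * m b.
    by rewrite -[in LHS]eq1 -/(m _) -/(mi i) opprD addrACA subrr add0r.
  exact: h1.
have base : forall i : 'I_N, (mui i)^-1 + \sum_(k < N) sv i k * mui k + e <= x.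
  move=> i.
  have eq1 : (mui i)^-1 + \sum_b s (i \in S N) b * mu b = x2 by exact: sol_eq.
  have hB : \sum_(k < N) sv i k * mui k <= \sum_b s (i \in S N) b * mu b + t / 4.
    by rewrite -lerBlDl (le_trans (ler_norm _))//; exact: h2.
  apply: (@le_trans _ _ ((mui i)^-1 + (\sum_b s (i \in S N) b * mu b + t / 4) + e)).
    by rewrite lerD2r lerD2l.
  by rewrite addrA eq1; exact: ar_base.
have zeq : forall i : 'I_N, mi i * mui i * (1 + \sum_(k < N) sv i k * zi k) <= zi i.
  move=> i.
  have hi : \sum_(k < N) sv i k * zi k <= \sum_b s (i \in S N) b * z b + er.
    by rewrite -lerBlDl (le_trans (ler_norm _))//; exact: h3.
  rewrite {2}/zi /z (zeta_eq s0 Lx0 x0x) -/z.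
  set A := \sum_b s _ b * _ in hi *.
  have A0 : 0 <= A by apply: sumr_ge0 => c _; rewrite mulr_ge0 ?ltW.
  rewrite -/(m _) -/(mi i) -!mulrA ler_wpM2l ?(ltW (m0 _))//.
  apply: (@le_trans _ _ (mui i * (1 + A + rat (i \in S N)))).
    rewrite ler_wpM2l ?(ltW (mu0 _))//; have := err (i \in S N).
    by move=> he; exact: ar_err he hi.
  have -> : mui i * (1 + A + rat (i \in S N)) = mui i * (1 + A) + (sol s x0 (i \in S N) - mui i).
    by rewrite /rat /mui; field; rewrite gt_eqF//; exact: mu0.
  have p0 : 0 <= sol s x0 (i \in S N) - mui i by rewrite subr_ge0 ltW// sol_lt.
  exact: ar_zeq.
have c1 : 2 * del + K / tau <= e.
  have : K / tau <= t / 4 by apply: le_trans h4; rewrite /K mulrAC.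
  exact: ar_del.
have c2 : del + K * (3 * tau^-1 ^+ 2) <= e.
  have : K * (3 * tau^-1 ^+ 2) <= t / 4 by apply: le_trans h5; rewrite -/b /K le_eqVlt; apply/orP; left; apply/eqP; ring.
  exact: ar_del'.
have c3 : e < 1 by exact: ar_half.
have Kmm : K * mm <= t / 8 by apply: le_trans h6; rewrite /K mulrAC.
have ceta1 : forall i : 'I_N, mui i - mi i <= eta.
  move=> i; rewrite /mui /mu (sol_zeta s x2x) -/(m _) -/(mi i) addrAC subrr add0r.
  have -> : x - x2 = t by rewrite /x2; ring.
  rewrite ler_wpM2l ?(ltW t0)//; apply: le_trans (zZ (i \in S N)).
  exact: zeta_mono.
have ceta2 : forall i : 'I_N, (e + (e' + K * mm)) * zi i <= eta.
  move=> i; apply: ler_pM; rewrite ?(ltW (z0 _))//.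
  - have : 0 <= K * mm by rewrite mulr_ge0// ltW.
    exact: ar_eta_ge0.
  - exact: ar_eta.
  - exact: zZ.
have csig : e' + K * mm + 2 * del + sm * eta <= sig.
  have -> : sig = t + sm * eta by rewrite /sig /eta; ring.
  exact: ar_sig.
have UU : dot u u <= U.
  rewrite dotE (eq_bigr (fun k : 'I_N => tt (k \in S N) ^+ 2 / N%:R)); last first.
    by move=> k _; rewrite -expr2 spike_sq.
  apply: (@le_trans _ _ (\sum_(k < N) U / N%:R)).
    by apply: ler_sum => k _; rewrite ler_wpM2r ?invr_ge0 ?(ltW Nr).
  by rewrite sumr_const card_ord -[leLHS]mulr_natl mulrCA divff// mulr1.
have hmi : forall i : 'I_N, 0 < mi i by move=> ?; exact: m0.
have hzi : forall i : 'I_N, 0 < zi i by move=> ?; exact: z0.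
have hmm : forall i : 'I_N, mi i <= mm by move=> ?; exact: mmm.
have hmu : forall i : 'I_N, mi i <= mui i by move=> ?; exact: mmu.
pose be := N%:R * b ^+ 4.
have be0 : 0 <= be by rewrite mulr_ge0 ?(ltW Nr)// exprn_ge0// ltW.
have v0 : 0 < (N%:R^-1 : R) by rewrite invr_gt0.
have v1 : (N%:R^-1 : R) <= 1 by rewrite invf_le1.
have uU : forall n : 'I_N, u n 0 ^+ 2 <= U * N%:R^-1.
  by move=> n; rewrite spike_sq ler_wpM2r ?(ltW v0).
have mi2 : forall n : 'I_N, 0 <= mi n <= mm by move=> n; rewrite hmm ltW.
have [] := HCx N (H N) (@sv N) M N%:R^-1 mi x u mm U Y nN M1 _ _ mi2 uU Y0 U0.
- by rewrite v0 v1.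
- by rewrite divff.
move=> mcut Pcut.
set cut := fun w => \sum_(n < N) _ in mcut Pcut.
pose okb w := \big[andb/true]_(n < N.+1) oks (@sv N) mi x 1 del be (H N w) n.
have mok (n : 'I_N.+1) : measurable_fun setT (fun w => oks (@sv N) mi x 1 del be (H N w) n).
  by apply: measurable_oks => *; exact: mH.
have mokb : measurable_fun setT okb by apply: measurable_big_and => n _; exact: mok.
have mcutb : measurable_fun setT (fun w => `|cut w| <= eta0 / 4).
  by apply: measurable_fun_ler; [exact: measurableT_comp|exact: measurable_cst].
exists (fun w => g1 w && (okb w && (`|cut w| <= eta0 / 4))).
split.
- by apply: measurable_and => //; exact: measurable_and.
- apply: (le_trans (not_and_le P mg1 (measurable_and mokb mcutb))).
  rewrite -addrA mulrDl EFinD; apply: leeD => //.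
  apply: (le_trans (not_and_le P mokb mcutb)); rewrite mulrDl EFinD; apply: leeD.
    have tailE : (M * N%:R^-1 ^+ 8 + Ct * M ^+ 2 * (N%:R^-1 ^+ 2 * be) ^+ 8) / pw 7 del =
        Ctail * N%:R^-1 ^+ 8.
      rewrite /Ctail /be.
      have -> : N%:R^-1 ^+ 2 * (N%:R * b ^+ 4) = N%:R^-1 * b ^+ 4 by field.
      by rewrite exprMn; ring.
    have tail0 : 0 <= Ctail * N%:R^-1 ^+ 8 by rewrite mulr_ge0// exprn_ge0// ltW.
    have okt (n : 'I_N.+1) : (P [set w | ~~ oks (@sv N) mi x 1 del be (H N w) n] <=
        (N%:R * (Ctail * N%:R^-1 ^+ 8))%:E)%E.
      have := @not_big_and_le _ T R P _ (index_enum 'I_N) (fun j : 'I_N => (j <= n)%N)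
        (fun j w => ok (@sv N) (H N w) (Dn (@sv N) mi x 1 n.+1) (seg N n :\ j)%SET j be del) _ tail0.
      have -> : size (index_enum 'I_N) = N by rewrite /index_enum unlock -enumT size_enum_ord.
      apply.
      - by move=> j jn; apply: measurable_ok => *; exact: mH.
      - move=> j jn; rewrite -tailE.
        apply: (HCt N (H N) (@sv N) M N%:R^-1 j _ _ be del nN M1 (ltW v0) be0 del0).
        by rewrite finset.setD11.
    have c0 : 0 <= N%:R * (Ctail * N%:R^-1 ^+ 8) by rewrite mulr_ge0 ?(ltW Nr).
    have := @not_big_and_le _ T R P _ (index_enum 'I_N.+1) xpredT
      (fun n w => oks (@sv N) mi x 1 del be (H N w) n) _ c0 (fun n _ => mok n) (fun n _ => okt n).
    have -> : size (index_enum 'I_N.+1) = N.+1 by rewrite /index_enum unlock -enumT size_enum_ord.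
    move=> hh; apply: (le_trans hh); rewrite lee_fin.
    have -> : N.+1%:R * (N%:R * (Ctail * N%:R^-1 ^+ 8)) = (1 + N%:R^-1) * N%:R^-1 ^+ 4 * Ctail / N%:R ^+ 2.
      by rewrite -natr1; field.
    rewrite ler_wpM2r ?invr_ge0 ?exprn_ge0 ?(ltW Nr)// ler_wpM2r//.
    by apply: ar_tail; [exact: ltW|exact: v1|rewrite exprn_ge0// ltW|rewrite exprn_ile1// ltW].
  apply: (le_trans (pw_markov mcut eta4 Pcut)); rewrite lee_fin.
  have -> : Cx * M ^+ 2 * (N%:R^-1 * L) ^+ 8 / pw 7 (eta0 / 4) = Cxi * N%:R^-1 ^+ 6 / N%:R ^+ 2.
    rewrite /Cxi exprMn; set p := pw 7 _.
    have p0 : p != 0 by rewrite gt_eqF// /p /pw !exprn_gt0.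
    by field; rewrite n0 p0.
  rewrite ler_wpM2r ?invr_ge0 ?exprn_ge0 ?(ltW Nr)// ler_piMr//.
  by rewrite exprn_ile1// ltW.
move=> w /and3P[gw okw cutw].
have sh : symm (H N w) by exact: sH.
have pdn : forall n, (n <= N)%N -> forall v, supp (seg N n) v ->
    tau * dot v v <= dot v (AD (Dn (@sv N) mi x 1 n) (H N w) *m v).
  move=> n nleN v sv'; have pdw := Hg1 w gw n nleN.
  rewrite (AD_diff (Dn (@sv N) (fun i => m1 (i \in S N)) X1 kap n)) mulmxDl dotDr.
  have h0 : 0 <= dot v (AD (Dn (@sv N) (fun i => m1 (i \in S N)) X1 kap n) (H N w) *m v).
    by have [->|vn] := eqVneq v 0; [rewrite mulmx0 dot0r|exact/ltW/pdw].
  apply: ler_wpDl => //.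
  rewrite dg_form dotE mulr_sumr; apply: ler_sum => i _; rewrite -expr2.
  apply: ler_wpM2r; first exact: sqr_ge0.
  apply: (le_trans taux); rewrite /Dn mul1r.
  have : \sum_(k < N | (n <= k)%N) sv i k * mi k <= kap * \sum_(k < N | (n <= k)%N) sv i k * m1 (k \in S N).
    rewrite mulr_sumr; apply: ler_sum => k _; rewrite mulrCA.
    have /andP[sk _] := S0 i k; apply: ler_wpM2l => //.
    have mm1 : mi k <= m1 (k \in S N) by exact: m1b.
    by apply: (le_trans mm1); rewrite ler_peMl// ltW.
  exact: ar_shift.
have okn : forall n, (n <= N)%N -> oks (@sv N) mi x 1 del be (H N w) n.
  move=> n nleN; move: okw; rewrite /okb big_andE => /forallP okw.
  by have := okw (Ordinal (nleN : (n < N.+1)%N)).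
have DE : Dn (@sv N) mi x 1 N = fun=> x.
  apply/funext => i; rewrite /Dn big_pred0 ?mulr0 ?subr0// => k.
  by rewrite leqNgt ltn_ord.
have DE1 : Dn (@sv N) mi x 1 N.+1 = fun=> x.
  apply/funext => i; rewrite /Dn big_pred0 ?mulr0 ?subr0// => k.
  by rewrite leqNgt ltnW// ltnS ltn_ord.
split.
- move=> v svv vn; have := pdn N (leqnn N) v; rewrite DE segN => /(_ svv).
  apply: lt_le_trans; rewrite mulr_gt0//.
  by rewrite lt_def dot_ge0 andbT; apply: contra vn => /eqP/dot_eq0 ->.
- move=> j.
  have := tres_diag S0 hmi hmm hzi sh tau0 tau1 pdn okn (lexx _) eqm hmu base zeq c1 c2 c3
    ceta1 ceta2 (n := N) (j := j) (leqnn N).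
  rewrite /tres DE1 segN inE => /(_ isT) hj; apply: (le_trans hj).
  exact: ar_quarter.
have fl := form_limit S0 (@sv_sym _ a1 a2 S N) SC hmi hmm hzi sh tau0 tau1 pdn okn (lexx _) eqm hmu base zeq
  c1 c2 c3 ceta1 ceta2 csig sigm UU N0.
rewrite DE segN in fl.
(* On this event the cutoff is inactive, by [tres_vec]. *)
have cutE : \sum_(n < N) mi n * xi (@sv N) u (H N w) (tres (@sv N) mi x (H N w) n *m u) n = cut w.
  apply: eq_bigr => n _.
  by rewrite (tres_vec S0 hmi sh tau0 pdn UU n).
rewrite cutE in fl.
have lim1 : `|\sum_(k < N) mi k * u k 0 ^+ 2 - spike_limit x| <= eta0 / 4.
  have := sum_block HS N (fun c => tt c ^+ 2 * m c).
  have -> : \sum_(k < N) mi k * u k 0 ^+ 2 = (\sum_(k < N) tt (k \in S N) ^+ 2 * m (k \in S N)) / N%:R.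
    by rewrite mulr_suml; apply: eq_bigr => k _; rewrite spike_sq /mi; ring.
  rewrite -/(spike_limit x) => hb.
  rewrite -(ler_pM2r Nr) -[X in _ * X <= _](ger0_norm (ltW Nr)) -normrM mulrBl divfK//.
  rewrite [spike_limit x * _]mulrC; apply: (le_trans hb).
  by rewrite -ler_pdivrMr.
have e1 : N%:R * (mm * K * (b ^+ 2 * U) + b ^+ 3 * (K * mm) ^+ 2 * U) <=
    mm * sm * (b ^+ 2 * U) + b ^+ 3 * (sm * mm) ^+ 2 * U.
  have -> : N%:R * (mm * K * (b ^+ 2 * U) + b ^+ 3 * (K * mm) ^+ 2 * U) =
    mm * sm * (b ^+ 2 * U) + b ^+ 3 * (sm * mm) ^+ 2 * U * N%:R^-1 by rewrite /K; field.
  rewrite lerD2l; apply: ler_piMr; last exact: v1.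
  by apply: mulr_ge0 => //; apply: mulr_ge0; [rewrite exprn_ge0// ltW|exact: sqr_ge0].
have e2 : N%:R * (b ^+ 3 * (K * mm) ^+ 2 * U) <= eta0 / 4.
  apply: le_trans h7; rewrite le_eqVlt; apply/orP; left; apply/eqP; rewrite /K; field.
  exact: n0.
have e3 : mm * sig * (b * U + N%:R * (mm * K * (b ^+ 2 * U) + b ^+ 3 * (K * mm) ^+ 2 * U)) <= eta0 / 4.
  apply: le_trans sigB; rewrite ler_wpM2l ?[mm * sig]mulrC// /B0 lerD2l//.
apply: (le_trans (ler_distD (\sum_(k < N) mi k * u k 0 ^+ 2) _ _)).
exact: (ar_final eta00 lim1 (le_trans fl (lerD (lerD cutw e3) e2))).
Unshelve. all: by end_near. Qed.

End ResolventRun.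

(** * Almost sure limits of the two top eigenvalues *)

Section BorelCantelli.
Context {d} {T : measurableType d} {R : realType} (P : probability T R).

(** Borel-Cantelli; the exceptional sets are taken empty for the finitely many [N] before the
    hypothesis holds. *)
Lemma ae_eventually (E : nat -> T -> Prop) (C : R) : 0 <= C ->
  (\forall N \near \oo, exists g : T -> bool,
    [/\ measurable_fun setT g, (P [set w | ~~ g w] <= (C / N%:R ^+ 2)%:E)%E &
     forall w, g w -> E N w]) ->
  {ae P, forall w, \forall N \near \oo, E N w}.
Proof.
move=> C0 [N0 _ HN].
(* For $N\ge1$ one has $(N+1)(N+2)\le6N^2$, which dominates the bound by a telescoping series. *)
have /choice[A HA] N : exists A : set T, [/\ measurable A,
    (P A <= (6 * C * (N.+1%:R^-1 - N.+2%:R^-1))%:E)%E & (N0.+1 <= N)%N -> ~` A `<=` E N].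
  have dif : 0 <= 6 * C * (N.+1%:R^-1 - N.+2%:R^-1).
    by rewrite mulr_ge0 ?mulr_ge0// subr_ge0 lef_pV2 ?posrE ?ltr0n// ler_nat.
  have [NN|NN] := leqP N0.+1 N; last first.
    by exists set0; split => //; rewrite ?measure0 ?lee_fin// leqNgt NN.
  have [g [mg Pg gE]] := HN N (ltnW NN).
  exists [set w | ~~ g w]; split.
  - exact: (measurable_bool_set mg).2.
  - apply: (le_trans Pg); rewrite lee_fin.
    have N1 : 1 <= N%:R :> R by rewrite ler1n (leq_trans _ NN).
    have N0' : 0 < N%:R :> R by exact: lt_le_trans N1.
    have -> : N.+2%:R = N%:R + 1 + 1 :> R by rewrite !natr1.
    have -> : N.+1%:R = N%:R + 1 :> R by rewrite natr1.
    set n := N%:R in N1 N0' *.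
    have n1 : n + 1 != 0 by rewrite gt_eqF// addr_gt0.
    have n2 : n + 1 + 1 != 0 by rewrite gt_eqF// !addr_gt0.
    have -> : 6 * C * ((n + 1)^-1 - (n + 1 + 1)^-1) = C * (6 / ((n + 1) * (n + 1 + 1))).
      by field; rewrite n1 n2.
    rewrite ler_wpM2l// -[leLHS]mul1r ler_pdivrMr ?exprn_gt0// mulrAC ler_pdivlMr.
      by rewrite mul1r; nra.
    by rewrite mulr_gt0 ?addr_gt0.
  - by move=> _ w /= /negP; rewrite negbK; exact: gE.
have mA N : measurable (A N) by case: (HA N).
have fin : (\sum_(n <oo) P (A n) < +oo)%E.
  apply: (@le_lt_trans _ _ (6 * C)%:E); last exact: ltry.
  apply: lime_le; first exact: is_cvg_nneseries.
  apply: nearW => n.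
  apply: (@le_trans _ _ (\sum_(0 <= i < n) (6 * C * (i.+1%:R^-1 - i.+2%:R^-1))%:E)%E).
    by apply: lee_sum => i _; case: (HA i).
  rewrite sumEFin lee_fin -mulr_sumr ler_piMr ?mulr_ge0//.
  under eq_bigr do rewrite -opprB.
  rewrite sumrN (telescope_sumr (fun i => i.+1%:R^-1 : R))// opprB invr1.
  by rewrite lerBlDr lerDl invr_ge0.
have null := lim_sup_set_cvg0 mA fin.
exists (lim_sup_set A); split.
- by apply: bigcap_measurable => // k _; apply: bigcup_measurable.
- exact: null.
- move=> w /= hw; apply: contrapT => nw; apply: hw.
  have [k nk] : exists k, forall j, (k <= j)%N -> ~ A j w.
    apply: contrapT => nk; apply: nw => n _.
    apply: contrapT => na; apply: nk; exists n => j nj Aj; apply: na.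
    by exists j.
  exists (maxn k N0.+1) => // j /=; rewrite geq_max => /andP[kj Nj].
  by have [_ _ h] := HA j; apply: h => //; exact: nk.
Qed.
End BorelCantelli.

(** * A trace bound under a small second eigenvalue *)

Section TraceGap.
Context {R : realType} (N : nat) (H : 'M[R]_N).
Hypothesis sH : symm H.

Lemma Gm_scalar x Q (dd : 'I_N -> R) : diagonalizes Q dd H -> (forall k, dd k < x) ->
  Gm (AD (fun=> x) H) [set: 'I_N]%SET = fm Q (fun k => (x - dd k)^-1).
Proof.
move=> [QQ QQ' HE] dx.
have AE : AD (fun=> x) H = fm Q (fun k => x - dd k).
  have -> : fm Q (fun k => x - dd k) = fm Q (fun=> x) + (-1) *: fm Q dd.
    by rewrite fmZ fmD; congr (fm Q _); apply/funext => k; rewrite mulN1r.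
  rewrite fm_const// -HE scaleN1r; apply/matrixP => i j; rewrite !mxE.
  by congr (_ - _); rewrite mulr_natl.
apply: Gm_eq; first exact: AD_symm.
have GA : fm Q (fun k => x - dd k) *m fm Q (fun k => (x - dd k)^-1) = 1%:M.
  rewrite fmM// -(fm_const QQ' 1); congr (fm Q _); apply/funext => k.
  by rewrite divff// gt_eqF// subr_gt0.
split => [|i j|i k _].
- by rewrite /symm /fm !trmx_mul trmxK tr_diag_mx mulmxA.
- by rewrite finset.inE.
- by rewrite AE GA mxE.
Qed.

(** Every eigenvalue but the top one is at most [x0] and gives the factor $(x-x_1)/(x_1-x_0)^2$. The
    top one is only known to be below [x2], but its eigenvector is normalised, so it costs at most
    $(x_1-x_2)^{-1}$ in all, whatever the size of [J]. *)
Lemma trace_gap x0 x2 x1 x (J : {set 'I_N}) : (1 < N)%N -> x0 < x1 -> x2 < x1 -> x1 < x ->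
  eigval H 1 <= x0 -> (forall v, v != 0 -> dot v (H *m v) < x2 * dot v v) ->
  \sum_(j in J) (Gm (AD (fun=> x1) H) [set: 'I_N]%SET j j - Gm (AD (fun=> x) H) [set: 'I_N]%SET j j)
   <= (x - x1) * (#|J|%:R / (x1 - x0) ^+ 2) + (x1 - x2)^-1.
Proof.
move=> N1 x01 x21 x1x e0 h.
have [Q [dd dg]] := symm_diagonalizes sH; have [QQ QQ' HE] := dg.
have [p [pE pm]] := eigseq_diag dg.
pose i0 := Ordinal (ltnW N1); pose i1 := Ordinal N1.
have d2 k : dd k < x2.
  rewrite -[k](permKV p); apply: (@le_lt_trans _ _ (dd (p i0))); first exact: pm.
  by rewrite -pE; apply: eigval_max_lt => //; exact: ltnW.
have d0 k : k != p i0 -> dd k <= x0.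
  move=> kn; apply: le_trans e0; rewrite (_ : eigval H 1 = dd (p i1)); last by rewrite -pE.
  rewrite -[k](permKV p); apply: pm; rewrite lt0n; apply: contraNneq kn => z.
  by rewrite -[k](permKV p); apply/eqP; congr (p _); exact: val_inj.
rewrite (Gm_scalar dg) => [|k]; last exact: lt_trans (d2 k) _.
rewrite (Gm_scalar dg) => [|k]; last exact: lt_trans (lt_trans (d2 k) x21) x1x.
have cQ j : \sum_k Q k j ^+ 2 = 1.
  have /matrixP/(_ j j) := QQ'; rewrite mxE [RHS]mxE eqxx mulr1n => h1; rewrite -[RHS]h1.
  by apply: eq_bigr => l _; rewrite !mxE expr2.
have rQ k : \sum_j Q k j ^+ 2 = 1.
  have /matrixP/(_ k k) := QQ; rewrite mxE [RHS]mxE eqxx mulr1n => h1; rewrite -[RHS]h1.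
  by apply: eq_bigr => l _; rewrite !mxE expr2.
pose f k := (x1 - dd k)^-1 - (x - dd k)^-1.
have fE k : f k = (x - x1) * ((x1 - dd k)^-1 * (x - dd k)^-1).
  rewrite /f; field; rewrite !gt_eqF// subr_gt0 (lt_trans (d2 k))//.
  exact: lt_trans x1x.
have p1 k : 0 < x1 - dd k by rewrite subr_gt0 (lt_trans (d2 k)).
have p2 k : 0 < x - dd k by rewrite subr_gt0 (lt_trans (d2 k))// (lt_trans x21).
have xx0 : 0 < x - x1 by rewrite subr_gt0.
have f0 : f (p i0) <= (x1 - x2)^-1.
  apply: (@le_trans _ _ (x1 - dd (p i0))^-1); first by rewrite gerBl invr_ge0 ltW.
  by rewrite lef_pV2 ?posrE ?p1 ?subr_gt0// lerD2l lerN2 ltW.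
have f1 k : k != p i0 -> f k <= (x - x1) / (x1 - x0) ^+ 2.
  move=> /d0 dk; rewrite fE ler_wpM2l ?(ltW xx0)// expr2 invfM.
  apply: ler_pM; rewrite ?invr_ge0 ?(ltW (p1 k)) ?(ltW (p2 k))// lef_pV2 ?posrE ?p1 ?p2 ?subr_gt0//.
    by rewrite lerD2l lerN2.
  by apply: lerD; [exact: ltW|rewrite lerN2].
have fge0 k : 0 <= f k.
  by rewrite fE mulr_ge0 ?(ltW xx0)// mulr_ge0// invr_ge0 ltW.
apply: (@le_trans _ _ (\sum_(j in J) ((x1 - x2)^-1 * Q (p i0) j ^+ 2 + (x - x1) / (x1 - x0) ^+ 2))).
  apply: ler_sum => j _; rewrite !fm_entry -sumrB (bigD1 (p i0))//= -mulrBl.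
  apply: lerD; first by rewrite ler_wpM2r ?sqr_ge0.
  rewrite -[leRHS]mulr1 -(cQ j) mulr_sumr [leRHS](bigD1 (p i0))//=.
  apply: ler_wpDl.
    by rewrite mulr_ge0 ?sqr_ge0// divr_ge0 ?sqr_ge0// ltW.
  by apply: ler_sum => k kn; rewrite -mulrBl ler_wpM2r ?sqr_ge0//; exact: f1.
rewrite big_split/= addrC sumr_const -[X in X + _ <= _]mulr_natl; apply: lerD.
  by rewrite mulrCA.
rewrite -mulr_sumr ler_piMr ?invr_ge0 ?subr_ge0 ?(ltW x21)//.
by rewrite -(rQ (p i0)) [leRHS](bigID (mem J))/= lerDl sumr_ge0// => k _; exact: sqr_ge0.
Qed.
End TraceGap.

Section EigenvalueLimits.
Context {d} {T : measurableType d} {R : realType} (P : probability T R).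
Context (gam a1 a2 t1 t2 : R) (S : forall N, {set 'I_N}) (H : forall N, T -> 'M[R]_N).
Hypotheses (g0 : 0 < gam < 1) (a10 : 0 < a1) (a20 : 0 < a2).
Hypothesis nH : gsbm_noise P S a1 a2 H.
Hypothesis HS : forall N : nat, (#|S N| : int) = Num.floor (gam * N%:R).
Let s := sblock gam a1 a2.
Let s0 : forall a b, 0 < s a b. Proof. exact: sblock_gt0. Qed.
Let L := edge s.
Let F := spike_limit gam a1 a2 t1 t2.
Variable lam : R.
Hypothesis lam0 : 0 <= lam.
Let M N w := gsbm_matrix (S N) t1 t2 lam (H N w).

Let sH N w : symm (H N w). Proof. by case: nH => _ sH _ _ _; exact: sH. Qed.
Let sM N w : symm (M N w).
Proof. by rewrite /M /gsbm_matrix; apply: symmD => //; apply: symmZ; exact: symm_outer. Qed.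

Lemma resolvent_ae x eta : L < x -> 0 < eta -> {ae P, forall w, \forall N \near \oo,
  let A := AD (fun=> x) (H N w) in let G := Gm A [set: 'I_N]%SET in
       [/\ pd [set: 'I_N]%SET A, forall j, `|G j j - sol s x (j \in S N)| <= eta &
        `|dot (spike (S N) t1 t2) (G *m spike (S N) t1 t2) - F x| <= eta]}.
Proof.
move=> Lx eta0; have [C C0 h] := resolvent_run t1 t2 g0 a10 a20 nH HS Lx eta0.
exact: (ae_eventually C0 h).
Qed.

Let AD_form N (h : 'M[R]_N) x : AD (fun=> x) h = x%:M - h.
Proof. by apply/matrixP => i j; rewrite !mxE; congr (_ - _); rewrite mulr_natl. Qed.

Let pd_lt N (h : 'M[R]_N) x : pd [set: 'I_N]%SET (AD (fun=> x) h) ->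
  forall v, v != 0 -> dot v (h *m v) < x * dot v v.
Proof.
move=> p v v0; have := p v; rewrite AD_form mulmxBl mul_scalar_mx dotDr dotNr dotZr subr_gt0.
by apply => // i; rewrite inE.
Qed.

Let inv_full N (h : 'M[R]_N) x : symm h -> pd [set: 'I_N]%SET (AD (fun=> x) h) ->
  (x%:M - h) *m Gm (AD (fun=> x) h) [set: 'I_N]%SET = 1%:M.
Proof.
move=> sh p; have [_ _ h1] := pd_isinv (AD_symm _ sh) p.
by rewrite -AD_form; apply/matrixP => i j; rewrite h1 ?inE// mxE.
Qed.

Lemma top_upper x : L < x -> lam * F x < 1 ->
  {ae P, forall w, \forall N \near \oo, eigval (M N w) 0 < x}.
Proof.
move=> Lx l1.
pose eta := (1 - lam * F x) / (2 * (lam + 1)).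
have l10 : 0 < 2 * (lam + 1) by rewrite mulr_gt0// ltr_wpDl.
have eta0 : 0 < eta by rewrite divr_gt0// subr_gt0.
have leta : lam * eta < 1 - lam * F x.
  rewrite /eta mulrA ltr_pdivrMr//; move: l1 lam0; set q := lam * F x => *; nra.
apply: filterS (resolvent_ae Lx eta0) => w hw; near=> N.
have N0 : (0 < N)%N by near: N; exact: nbhs_infty_gt.
have [p _ hF] : let A := AD (fun=> x) (H N w) in let G := Gm A [set: 'I_N]%SET in
       [/\ pd [set: 'I_N]%SET A, forall j, `|G j j - sol s x (j \in S N)| <= eta &
        `|dot (spike (S N) t1 t2) (G *m spike (S N) t1 t2) - F x| <= eta].
  by near: N.
apply: eigval_max_lt => // v v0.
apply: (spiked_below (sH N w) _ (inv_full (sH N w) p) lam0) => // [v' v'0|].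
  by rewrite -AD_form; apply: p => // i; rewrite inE.
move: hF; set q := dot _ _; rewrite ler_norml => /andP[_ hF].
apply: (@le_lt_trans _ _ (lam * (F x + eta))); first by rewrite ler_wpM2l//; lra.
rewrite mulrDr; lra.
Unshelve. all: by end_near. Qed.

Lemma top_lower x : L < x -> 1 < lam * F x ->
  {ae P, forall w, \forall N \near \oo, x <= eigval (M N w) 0}.
Proof.
move=> Lx l1.
pose eta := (lam * F x - 1) / (lam + 1).
have l10 : 0 < lam + 1 by rewrite ltr_wpDl.
have eta0 : 0 < eta by rewrite divr_gt0// subr_gt0.
have leta : lam * eta <= lam * F x - 1.
  rewrite /eta mulrA ler_pdivrMr//; move: l1 lam0; set q := lam * F x => *; nra.
apply: filterS (resolvent_ae Lx eta0) => w hw; near=> N.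
have [p _ hF] : let A := AD (fun=> x) (H N w) in let G := Gm A [set: 'I_N]%SET in
       [/\ pd [set: 'I_N]%SET A, forall j, `|G j j - sol s x (j \in S N)| <= eta &
        `|dot (spike (S N) t1 t2) (G *m spike (S N) t1 t2) - F x| <= eta].
  by near: N.
have hl : 1 <= lam * dot (spike (S N) t1 t2) (Gm (AD (fun=> x) (H N w)) [set: 'I_N]%SET *m spike (S N) t1 t2).
  move: hF; set q := dot _ _; rewrite ler_norml => /andP[hF _].
  apply: (@le_trans _ _ (lam * (F x - eta))); last by rewrite ler_wpM2l//; lra.
  rewrite mulrBr; lra.
have [v v0 hv] := spiked_above (inv_full (sH N w) p) hl lam0.
exact: (eigval_max_ge (sM N w) v0 hv).
Unshelve. all: by end_near. Qed.

(** On vectors orthogonal to the spike the forms of [M] and [H] coincide. *)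
Lemma second_upper x : L < x -> {ae P, forall w, \forall N \near \oo, eigval (M N w) 1 <= x}.
Proof.
move=> Lx; apply: filterS (resolvent_ae Lx ltr01) => w hw; near=> N.
have N1 : (1 < N)%N by near: N; exact: nbhs_infty_gt.
have [p _ _] : let A := AD (fun=> x) (H N w) in let G := Gm A [set: 'I_N]%SET in
       [/\ pd [set: 'I_N]%SET A, forall j, `|G j j - sol s x (j \in S N)| <= 1 &
        `|dot (spike (S N) t1 t2) (G *m spike (S N) t1 t2) - F x| <= 1].
  by near: N.
apply: (eigval_second_le (sM N w) (e := spike (S N) t1 t2) N1) => v ve.
rewrite /M /gsbm_matrix spiked_form (dotC (spike (S N) t1 t2)) ve expr0n mulr0 addr0.
have [->|v0] := eqVneq v 0; first by rewrite mulmx0 !dot0r mulr0.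
exact/ltW/pd_lt.
Unshelve. all: by end_near. Qed.

Lemma near_card_block (a : bool) (c : R) :
  \forall N \near \oo, c <= #|[set j : 'I_N | (j \in S N) == a]%SET|%:R.
Proof.
have f0 := frac_gt0 g0 a.
near=> N.
have hc : (c + 1) / frac gam a <= N%:R by near: N; exact: nbhs_infty_ger.
have := sum_block HS N (fun b => (b == a)%:R).
have -> : \sum_(k < N) ((k \in S N) == a)%:R = #|[set j : 'I_N | (j \in S N) == a]%SET|%:R :> R.
  rewrite -natr_sum -sum1dep_card; congr (_%:R).
  by rewrite [RHS]big_mkcond; apply: eq_bigr => k _; case: eqP.
have -> : \sum_b frac gam b * (b == a)%:R = frac gam a.
  by rewrite sum_bool; case: (a); rewrite /= ?mulr1 ?mulr0 ?addr0 ?add0r.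
have -> : `|(true == a)%:R| + `|(false == a)%:R| = 1 :> R.
  by case: (a); rewrite /= ?normr1 ?normr0 ?addr0 ?add0r.
rewrite ler_norml => /andP[h _].
by move: hc; rewrite ler_pdivrMr//; lra.
Unshelve. all: by end_near. Qed.

(** The contradiction is drawn on the single block [a] that [zeta_unbounded] provides; its size
    grows with [N], so the one eigenvalue that may exceed [x0] becomes negligible. *)
Lemma second_lower x0 : x0 < L -> {ae P, forall w, \forall N \near \oo, x0 <= eigval (M N w) 1}.
Proof.
move=> x0L.
(* The surplus 1 yields [x - x1] per index of the block: a quarter pays for the errors [2 * eta],
   another quarter for the top eigenvalue once the block has [c] indices. *)
have [x1 [x [Lx1 x1x [a ha]]]] := zeta_unbounded s0 (((L - x0) ^+ 2)^-1 + 1).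
have Lx : L < x by exact: lt_trans x1x.
pose x2 := (L + x1) / 2.
have Lx2 : L < x2 by rewrite /x2; move: Lx1; rewrite -/L; lra.
have x21 : x2 < x1 by rewrite /x2; move: Lx1; rewrite -/L; lra.
pose eta := (x - x1) / 8.
have xx0 : 0 < x - x1 by rewrite subr_gt0.
have eta0 : 0 < eta by rewrite divr_gt0.
pose c := 4 / ((x - x1) * (x1 - x2)).
have := resolvent_ae Lx eta0; have := resolvent_ae Lx1 eta0; have := resolvent_ae Lx2 ltr01.
move=> h2 h1 h; apply: filterS3 h2 h1 h => w h2 h1 h; near=> N.
have N1 : (1 < N)%N by near: N; exact: nbhs_infty_gt.
have [p _ _] : let A := AD (fun=> x2) (H N w) in let G := Gm A [set: 'I_N]%SET in
       [/\ pd [set: 'I_N]%SET A, forall j, `|G j j - sol s x2 (j \in S N)| <= 1 &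
        `|dot (spike (S N) t1 t2) (G *m spike (S N) t1 t2) - F x2| <= 1].
  by near: N.
have [_ q1 _] : let A := AD (fun=> x1) (H N w) in let G := Gm A [set: 'I_N]%SET in
       [/\ pd [set: 'I_N]%SET A, forall j, `|G j j - sol s x1 (j \in S N)| <= eta &
        `|dot (spike (S N) t1 t2) (G *m spike (S N) t1 t2) - F x1| <= eta].
  by near: N.
have [_ q _] : let A := AD (fun=> x) (H N w) in let G := Gm A [set: 'I_N]%SET in
       [/\ pd [set: 'I_N]%SET A, forall j, `|G j j - sol s x (j \in S N)| <= eta &
        `|dot (spike (S N) t1 t2) (G *m spike (S N) t1 t2) - F x| <= eta].
  by near: N.
have hc : c <= #|[set j : 'I_N | (j \in S N) == a]%SET|%:R by near: N; exact: near_card_block.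
have [e he] := eigval_second_form (sM N w) N1.
apply: (@le_trans _ _ (eigval (H N w) 1)); last first.
  apply: (eigval_second_le (sH N w) (e := e) N1) => v ve; apply: le_trans (he v ve).
  by rewrite /M /gsbm_matrix spiked_form lerDl mulr_ge0// sqr_ge0.
rewrite leNgt; apply/negP => /ltW bad.
have x01 : x0 < x1 by exact: lt_trans Lx1.
have := trace_gap (sH N w) [set j : 'I_N | (j \in S N) == a]%SET N1 x01 x21 x1x bad (pd_lt p).
apply/negP; rewrite -ltNge.
set n := #|_|%:R in hc *.
have c0 : 0 < c by rewrite divr_gt0// mulr_gt0// subr_gt0.
have n0 : 0 < n by exact: lt_le_trans hc.
have lowj : n * ((x - x1) * zeta s x x1 a - 2 * eta) <= \sum_(j in [set j : 'I_N | (j \in S N) == a]%SET)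
   (Gm (AD (fun=> x1) (H N w)) [set: 'I_N]%SET j j - Gm (AD (fun=> x) (H N w)) [set: 'I_N]%SET j j).
  rewrite /n mulr_natl -sumr_const; apply: ler_sum => j; rewrite inE => /eqP ja.
  have := q1 j; have := q j; rewrite ja !ler_norml => /andP[_ u1] /andP[u2 _].
  have := sol_zeta s x1x a; move: u1 u2; lra.
apply: lt_le_trans lowj.
have zl : (x1 - x0) ^- 2 + 1 < zeta s x x1 a.
  apply: le_lt_trans ha; rewrite lerD2r lef_pV2 ?posrE ?exprn_gt0 ?subr_gt0//.
  by apply: lerXn2r; rewrite ?nnegrE ?subr_ge0 ?(ltW x0L) ?(ltW x01)// lerD2r ltW.
have i0 : 0 < (x1 - x2)^-1 by rewrite invr_gt0 subr_gt0.
have k1 : (x1 - x2)^-1 <= n * ((x - x1) / 4).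
  apply: (@le_trans _ _ (c * ((x - x1) / 4))); last first.
    by rewrite ler_wpM2r// divr_ge0// ltW.
  rewrite /c le_eqVlt; apply/orP; left; apply/eqP; field.
  by rewrite !gt_eqF// subr_gt0.
apply: (@le_lt_trans _ _ (n * ((x - x1) * ((x1 - x0) ^- 2) + (x - x1) / 4))).
  by rewrite mulrDr [X in X + _ <= _](_ : _ = n * ((x - x1) * (x1 - x0) ^- 2)) ?lerD2l//; ring.
rewrite ltr_pM2l//.
have := ltr_pM2l xx0 ((x1 - x0) ^- 2 + 1) (zeta s x x1 a); rewrite zl => /esym.
by rewrite mulrDr mulr1 /eta; lra.
Unshelve. all: by end_near. Qed.

End EigenvalueLimits.

(** * The critical strength and the outlier *)

Section Threshold.
Context {R : realType} (gam a1 a2 t1 t2 : R).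
Hypotheses (g0 : 0 < gam < 1) (a10 : 0 < a1) (a20 : 0 < a2)
  (t12 : gam * t1 ^+ 2 + (1 - gam) * t2 ^+ 2 = 1).
Let s := sblock gam a1 a2.
Let s0 : forall a b, 0 < s a b. Proof. exact: sblock_gt0. Qed.
Let L := edge s.
Let F := spike_limit gam a1 a2 t1 t2.

Lemma spike_limitE x : F x = gam * t1 ^+ 2 * sol s x true + (1 - gam) * t2 ^+ 2 * sol s x false.
Proof. by rewrite /F /spike_limit sum_bool /frac /= !mulrA. Qed.

Lemma spike_limit_lt x' x : L < x' -> x' < x -> F x < F x'.
Proof.
move=> Lx' xx; rewrite !spike_limitE -subr_gt0.
have h1 := sol_lt s0 Lx' xx true; have h2 := sol_lt s0 Lx' xx false.
have := t12; set p := gam * t1 ^+ 2; set q := (1 - gam) * t2 ^+ 2 => pq.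
have p0 : 0 <= p by rewrite mulr_ge0 ?sqr_ge0//; case/andP: g0 => /ltW.
have q0 : 0 <= q by rewrite mulr_ge0 ?sqr_ge0// subr_ge0; case/andP: g0 => _ /ltW.
pose mn := Num.min (sol s x' true - sol s x true) (sol s x' false - sol s x false).
have mn0 : 0 < mn by rewrite lt_min !subr_gt0 h1 h2.
apply: (lt_le_trans mn0); rewrite -[leLHS]mul1r -pq mulrDl.
rewrite (_ : _ - _ = p * (sol s x' true - sol s x true) + q * (sol s x' false - sol s x false)).
  by apply: lerD; rewrite ler_wpM2l// ge_min lexx ?orbT.
by ring.
Qed.

Lemma spike_limit_le x (e : R) : (forall b, sol s x b <= e) -> F x <= e.
Proof.
move=> h; rewrite spike_limitE; case/andP: g0 => /ltW ga /ltW gb.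
have p0 : 0 <= gam * t1 ^+ 2 by rewrite mulr_ge0 ?sqr_ge0.
have q0 : 0 <= (1 - gam) * t2 ^+ 2 by rewrite mulr_ge0 ?sqr_ge0// subr_ge0.
apply: (@le_trans _ _ ((gam * t1 ^+ 2 + (1 - gam) * t2 ^+ 2) * e)); last by rewrite t12 mul1r.
by rewrite [leRHS]mulrDl; apply: lerD; rewrite ler_wpM2l.
Qed.

Lemma spike_limit_gt0 x : L < x -> 0 < F x.
Proof.
move=> Lx; have x1 : x < x + 1 by rewrite ltrDl.
apply: le_lt_trans (spike_limit_lt Lx x1); rewrite spike_limitE.
case/andP: g0 => /ltW ga /ltW gb.
have h b : 0 <= sol s (x + 1) b by rewrite ltW// sol_gt0// (lt_trans Lx).
by apply: addr_ge0; rewrite mulr_ge0// mulr_ge0 ?sqr_ge0// subr_ge0.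
Qed.

(** This is $1/\sup_{x>L}F(x)$, written so that no limit of [F] at the edge has to be taken. *)
Definition critical : R := inf [set l | 0 <= l /\ exists2 x, L < x & 1 < l * F x].
(** As [F] decreases, this is an interval starting at the edge; its supremum is the limit of the top
    eigenvalue in the supercritical case. *)
Definition outlier_set lam : set R := [set x | L < x /\ 1 <= lam * F x].
Definition spectral_gap lam : R := sup (outlier_set lam) - L.

Lemma critical_has_inf : has_inf [set l : R | 0 <= l /\ exists2 x, L < x & 1 < l * F x].
Proof.
split; last by exists 0 => l [].
have L1 : L < L + 1 by rewrite ltrDl.
have F0 := spike_limit_gt0 L1.
exists (2 / F (L + 1)); split; first by rewrite divr_ge0// ltW.
by exists (L + 1) => //; rewrite divfK ?gt_eqF// ltrDl.
Qed.

(** The definition of [critical] only gives [lam * F x' <= 1]; strictness comes from a point [x']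
    between the edge and [x], where [F] is larger. *)
Lemma subcritical lam x : 0 <= lam -> lam < critical -> L < x -> lam * F x < 1.
Proof.
move=> l0 lc Lx.
pose x' := (L + x) / 2.
have Lx' : L < x' by rewrite /x'; lra.
have xx : x' < x by rewrite /x'; lra.
have [->|ln] := eqVneq lam 0; first by rewrite mul0r.
have lp : 0 < lam by rewrite lt_def ln.
apply: (@lt_le_trans _ _ (lam * F x')); first by rewrite ltr_pM2l// spike_limit_lt.
rewrite leNgt; apply/negP => h; move: lc; apply/negP; rewrite -leNgt.
by apply: ge_inf; [case: critical_has_inf|split => //; exists x'].
Qed.

Lemma supercritical lam : 0 <= lam -> critical < lam -> exists2 x, L < x & 1 < lam * F x.
Proof.
move=> l0 lc.
have lc0 : 0 < lam - critical by rewrite subr_gt0.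
have [l [lp [x Lx h]]] := inf_adherent lc0 critical_has_inf.
rewrite -/critical addrC subrK => ll; exists x => //.
by apply: (lt_trans h); rewrite ltr_pM2r// spike_limit_gt0.
Qed.

Lemma outlier_has_sup lam : 0 <= lam -> critical < lam -> has_sup (outlier_set lam).
Proof.
move=> l0 lc; split; first by have [x Lx h] := supercritical l0 lc; exists x; split => //; exact: ltW.
(* Once [sol] is below this level, [lam * F x] is at most [lam / (2 * (lam + 1))], which is less
   than 1. *)
have e0 : 0 < (2 * (lam + 1))^-1 by rewrite invr_gt0 mulr_gt0// ltr_wpDl.
have [X LX hX] := sol_decay s0 e0.
exists X => x [Lx h]; rewrite leNgt; apply/negP => /ltW Xx.
have := spike_limit_le (fun b => hX x b Xx) => h1.
have : lam * F x <= lam / (2 * (lam + 1)) by rewrite ler_wpM2l.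
move=> h2; have := le_trans h h2; rewrite ler_pdivlMr ?mulr_gt0 ?ltr_wpDl// mul1r; lra.
Qed.

Lemma outlier_gt lam : 0 <= lam -> critical < lam -> L < sup (outlier_set lam).
Proof.
move=> l0 lc; have [x Lx h] := supercritical l0 lc.
apply: (lt_le_trans Lx); apply: ub_le_sup; last by split => //; exact: ltW.
by case: (outlier_has_sup l0 lc).
Qed.

Lemma above_outlier lam x : 0 <= lam -> critical < lam -> sup (outlier_set lam) < x ->
  lam * F x < 1.
Proof.
move=> l0 lc sx; rewrite ltNge; apply/negP => h; have := sx; apply/negP; rewrite -leNgt.
apply: ub_le_sup; first by case: (outlier_has_sup l0 lc).
by split => //; exact: lt_trans (outlier_gt l0 lc) sx.
Qed.

Lemma below_outlier lam x : 0 <= lam -> critical < lam -> L < x -> x < sup (outlier_set lam) ->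
  1 < lam * F x.
Proof.
move=> l0 lc Lx xs.
have e0 : 0 < sup (outlier_set lam) - x by rewrite subr_gt0.
have [y [Ly h]] := sup_adherent e0 (outlier_has_sup l0 lc).
rewrite opprB addrC subrK => xy.
apply: (le_lt_trans h); rewrite ltr_pM2l ?spike_limit_lt//.
rewrite lt_def l0 andbT; apply: contraTneq h => ->.
by rewrite mul0r -ltNge.
Qed.
End Threshold.

(** The margins [n.+1%:R^-1] make the hypotheses countable, so that almost sure statements for each
    margin hold simultaneously. *)
Lemma gap_cvg {R : realType} (p q : nat -> R) (X Y : R) :
  (forall n : nat, \forall N \near \oo, p N < X + n.+1%:R^-1) ->
  (forall n : nat, \forall N \near \oo, X - n.+1%:R^-1 <= p N) ->
  (forall n : nat, \forall N \near \oo, q N <= Y + n.+1%:R^-1) ->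
  (forall n : nat, \forall N \near \oo, Y - n.+1%:R^-1 <= q N) ->
  (fun N => p N - q N) @ \oo --> X - Y.
Proof.
move=> h1 h2 h3 h4.
have key (f : nat -> R) (Z : R) : (forall n : nat, \forall N \near \oo, f N <= Z + n.+1%:R^-1) ->
    (forall n : nat, \forall N \near \oo, Z - n.+1%:R^-1 <= f N) -> f @ \oo --> Z.
  move=> u l; apply/cvgrPdist_le => e e0.
  have [n hn] : exists n : nat, n.+1%:R^-1 <= e.
    exists (Num.truncn e^-1); rewrite -[leRHS]invrK lef_pV2 ?posrE ?invr_gt0//.
    by rewrite ltW// truncnS_gt.
  near=> N.
  have a : f N <= Z + n.+1%:R^-1 by near: N; exact: u.
  have b : Z - n.+1%:R^-1 <= f N by near: N; exact: l.
  by rewrite ler_norml; move: hn a b; set i := n.+1%:R^-1 => *; apply/andP; split; lra.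
apply: cvgB; apply: key => // n.
by have := h1 n; apply: filterS => N /ltW.
Unshelve. all: by end_near. Qed.

Lemma ae_and d (T : measurableType d) (R : realType) (P : probability T R) (A B : T -> Prop) :
  {ae P, forall w, A w} -> {ae P, forall w, B w} -> {ae P, forall w, A w /\ B w}.
Proof. by move=> a b; apply: filterS2 a b. Qed.

Theorem theorem1 (R : realType) (gam a1 a2 t1 t2 : R) :
  0 < gam < 1 -> 0 < a1 -> 0 < a2 ->
  gam * t1 ^+ 2 + (1 - gam) * t2 ^+ 2 = 1 ->
  exists lamc : R,
    (forall lam : R, 0 <= lam -> lam < lamc ->
      forall (d : measure_display) (T : measurableType d) (P : probability T R)
             (S : forall N, {set 'I_N}) (H : forall N, T -> 'M[R]_N),
        gsbm_noise P S a1 a2 H ->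
        (forall N : nat, (#|S N| : int) = Num.floor (gam * N%:R)) ->
        {ae P, forall w,
          (fun N : nat => top_gap (gsbm_matrix (S N) t1 t2 lam (H N w)))
            @ \oo --> (0 : R)}) /\
    (exists g : R -> R, forall lam : R, 0 <= lam -> lamc < lam ->
      0 < g lam /\
      forall (d : measure_display) (T : measurableType d) (P : probability T R)
             (S : forall N, {set 'I_N}) (H : forall N, T -> 'M[R]_N),
        gsbm_noise P S a1 a2 H ->
        (forall N : nat, (#|S N| : int) = Num.floor (gam * N%:R)) ->
        {ae P, forall w,
          (fun N : nat => top_gap (gsbm_matrix (S N) t1 t2 lam (H N w)))
            @ \oo --> g lam}).
Proof.
move=> g0 a10 a20 t12.
pose L := edge (sblock gam a1 a2).
have pos (n : nat) : 0 < n.+1%:R^-1 :> R by rewrite invr_gt0 ltr0n.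
have Lup n : L < L + n.+1%:R^-1 by rewrite ltrDl.
have Llo n : L - n.+1%:R^-1 < L by rewrite gtrBl.
exists (critical gam a1 a2 t1 t2); split.
  move=> lam l0 lc d T P S H nH HS.
  have u1 := ae_foralln (fun n => top_upper g0 a10 a20 nH HS l0 (Lup n)
    (subcritical g0 a10 a20 t12 l0 lc (Lup n))).
  have u2 := ae_foralln (fun n => second_upper t1 t2 g0 a10 a20 nH HS lam (Lup n)).
  have u3 := ae_foralln (fun n => second_lower t1 t2 g0 a10 a20 nH HS l0 (Llo n)).
  apply: filterS3 u1 u2 u3 => w w1 w2 w3.
  (* Only the lower bound on the top eigenvalue is left, and it is inherited from the second one. *)
  rewrite -(subrr L); apply: gap_cvg => // n.
  near=> N.
  have N1 : (1 < N)%N by near: N; exact: nbhs_infty_gt.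
  apply: (@le_trans _ _ (eigval (gsbm_matrix (S N) t1 t2 lam (H N w)) 1)).
    by near: N; exact: w3.
  apply: eigval_second_le_max => //.
  apply: symmD; first by case: nH => _ sH _ _ _; exact: sH.
  by apply: symmZ; exact: symm_outer.
exists (spectral_gap gam a1 a2 t1 t2) => lam l0 lc.
pose X := sup (outlier_set gam a1 a2 t1 t2 lam).
have LX : L < X by exact: outlier_gt.
split; first by rewrite /spectral_gap subr_gt0.
move=> d T P S H nH HS.
have Xup n : X < X + n.+1%:R^-1 by rewrite ltrDl.
(* [X - n.+1%:R^-1] may fall below the edge, where [below_outlier] does not apply; the midpoint of
   [L] and [X] keeps [y n] above it. *)
pose y n := Num.max (X - n.+1%:R^-1) ((L + X) / 2).
have Ly n : L < y n by rewrite lt_max; apply/orP; right; lra.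
have yX n : y n < X by rewrite gt_max gtrBl pos/=; lra.
have u1 := ae_foralln (fun n => top_upper g0 a10 a20 nH HS l0 (lt_trans LX (Xup n))
    (above_outlier g0 a10 a20 t12 l0 lc (Xup n))).
have u0 := ae_foralln (fun n => top_lower g0 a10 a20 nH HS l0 (Ly n)
    (below_outlier g0 a10 a20 t12 l0 lc (Ly n) (yX n))).
have u2 := ae_foralln (fun n => second_upper t1 t2 g0 a10 a20 nH HS lam (Lup n)).
have u3 := ae_foralln (fun n => second_lower t1 t2 g0 a10 a20 nH HS l0 (Llo n)).
have u01 := ae_and u0 u1.
apply: filterS3 u01 u2 u3 => w [w0 w1] w2 w3.
apply: gap_cvg => // n.
apply: filterS (w0 n) => N; apply: le_trans.
by rewrite le_max lexx.
Unshelve. all: by end_near. Qed.
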